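(* Let $(\mu,\mathrm j)\in\mathsf{CE}$ satisfy $\mathcal E(\mu(0))<\infty$ and $\mathcal L(\mu,\mathrm j)<\infty$. Then $[0,T]\ni t\mapsto \mathcal E(\mu(t))$ is absolutely continuous and for all $0\le s\le t\le T$ $$\mathcal E(\mu(t))-\mathcal E(\mu(s))=\int_s^t\Big[\sum_{v\in V}\sum_{e\in E(v)} G^e_v(\tau)\,\bar\jmath^e_v(\tau)+\sum_{e\in E}\int_0^{\ell^e}\partial_x\Big(\log\frac{d\rho^e(\tau)}{d\pi^e}\Big)(x)\,dj^e(\tau)(x)\Big]d\tau ,$$ where $G^e_v=0$ if $\log\frac{\gamma_v}{\omega_v}=-\infty=\big(\log\frac{d\rho^e}{d\pi^e}\big)\big|_v$, and $G^e_v=\log\frac{\gamma_v}{\omega_v}-\big(\log\frac{d\rho^e}{d\pi^e}\big)\big|_v\in[-\infty,+\infty]$ otherwise.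
   Context: Graph. $(V,E)$ is a finite connected graph: $V$ is a finite node set, $E\subset V\times V$, $vv\notin E$, and $vw\in E$ implies $wv\notin E$. For $e=vw\in E$, $v$ is the tail, $w$ the head, $V(e)=\{v,w\}$; $E(v)$ is the set of edges containing $v$. Edge lengths $\ell^e>0$ are given, $L=\bigsqcup_{e\in E}[0,\ell^e]$, $M=(V,E,L)$. A function (measure) on $L$ is a family $(\varphi^e)_{e\in E}$ of functions (measures) on the intervals $[0,\ell^e]$; $\varphi\in C^1(L)$ means $\varphi^e\in C^1([0,\ell^e])$ for all $e$ (no continuity across nodes). For $e=vw$ put $\varphi^e|_v=\varphi^e(0)$, $\varphi^e|_w=\varphi^e(\ell^e)$. $\mathcal P(M)$ is the set of $\mu=(\gamma,\rho)$ with $\gamma=(\gamma_v)_{v\in V}$ a nonnegative measure on $V$, $\rho$ a nonnegative measure on $L$ and $\sum_v\gamma_v+\sum_e\rho^e([0,\ell^e])=1$. A measure and its Lebesgue density are denoted by the same symbol. Data. $(\omega,\pi)\in\mathcal P(M)$ with $\omega_v>0$ and $\pi^e(dx)=e^{-P^e(x)}dx$, $P^e$ Lipschitz; constants $d^e>0$ ($e\in E$) and $\kappa^e_v>0$ ($e\in E$, $v\in V(e)$); $T>0$. Continuity equation. $\mathsf{CE}$ is the set of pairs $(\mu,\mathrm j)$ with $\mu=(\gamma,\rho):[0,T]\to\mathcal P(M)$ narrowly continuous and $\mathrm j=(\bar\jmath,j)$ a measurable family of reals $\bar\jmath^e_v(t)$ ($e\in E,v\in V(e)$) and finite signed measures $j^e(t)$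 on $[0,\ell^e]$ with $\int_0^T\big(\sum_{e}\sum_{v\in V(e)}|\bar\jmath^e_v|+\sum_e|j^e|([0,\ell^e])\big)dt<\infty$, such that for all $\phi:V\to\mathbb R$, $\varphi\in C^1(L)$ and a.e. $t$ $$\frac{d}{dt}\Big[\sum_{v}\phi_v\gamma_v(t)+\sum_e\int_0^{\ell^e}\varphi^e d\rho^e(t)\Big]=\sum_{v}\sum_{e\in E(v)}(\phi_v-\varphi^e|_v)\bar\jmath^e_v(t)+\sum_e\int_0^{\ell^e}\partial_x\varphi^e\,dj^e(t).$$ Functionals. $\eta(r)=r\log r-r+1$; $\mathcal H(\mu|\nu)=\int\eta(\frac{d\mu}{d\nu})d\nu$ if $\mu\ll\nu$, $+\infty$ otherwise; $\mathcal E(\mu)=\sum_e\mathcal H(\rho^e|\pi^e)+\sum_v\mathcal H(\gamma_v|\omega_v)$. $\mathsf C(r)=2r\log\frac{r+\sqrt{r^2+4}}2-2\sqrt{r^2+4}+4$, $\mathsf C(r|s)=s\,\mathsf C(r/s)$ for $s>0$, $\mathsf C(0|0)=0$, $\mathsf C(r|0)=+\infty$ for $r\ne0$. $$\mathcal R(\mu,\mathrm j)=\sum_e\sum_{v\in V(e)}\mathsf C\big(\bar\jmath^e_v\,\big|\,\kappa^e_v\sqrt{\gamma_v\,\rho^e|_v}\big)+\sum_e\frac1{2d^e}\int_0^{\ell^e}\Big|\frac{dj^e}{d\rho^e}\Big|^2d\rho^e$$ ($+\infty$ if $j^e\not\ll\rho^e$ for some $e$), $$\mathcal I(\mu)=\sum_e\sum_{v\in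 V(e)}2\kappa^e_v\sqrt{\omega_v\pi^e|_v}\,\Big|\sqrt{\tfrac{\rho^e}{\pi^e}}\Big|_v-\sqrt{\tfrac{\gamma_v}{\omega_v}}\Big|^2+\sum_e2d^e\int_0^{\ell^e}\Big|\partial_x\sqrt{\tfrac{\rho^e}{\pi^e}}\Big|^2d\pi^e$$ ($+\infty$ if $\rho^e\not\ll\pi^e$ or $\sqrt{\rho^e/\pi^e}\notin H^1(0,\ell^e)$ for some $e$; otherwise boundary values are those of the continuous representative). $\mathcal D(\mu,\mathrm j)=\int_0^T[\mathcal R(\mu,\mathrm j)+\mathcal I(\mu)]dt$ and $\mathcal L(\mu,\mathrm j)=\mathcal E(\mu(T))-\mathcal E(\mu(0))+\mathcal D(\mu,\mathrm j)$. Conventions on extended reals: $\log 0=-\infty$; $0\cdot(\pm\infty)=0$, $a\cdot(+\infty)=\pm\infty$ according to the sign of $a\neq 0$; $\pm\infty+a=\pm\infty$ for finite $a$.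
   Formalization: In the definition of CE, the pairing of μ(t) with each test pair (φ,ϕ) is also required to be absolutely continuous on [0,T]; with only the a.e. derivative identity, a Cantor-type curve with zero flux would violate the claim. *)

(* Defs.v *)
From HB Require Import structures.
From mathcomp Require Import all_boot all_order all_algebra.
From mathcomp Require Import all_classical all_reals all_analysis.
From mathcomp Require Import measurable_realfun.

Set Implicit Arguments.
Unset Strict Implicit.
Unset Printing Implicit Defensive.

Import Order.TTheory GRing.Theory Num.Theory.
Import numFieldNormedType.Exports.

Local Open Scope ring_scope.
Local Open Scope classical_set_scope.
Local Open Scope charge_scope.

Section Analysis.
Context {R : realType}.
Local Notation leb := (@lebesgue_measure R).

Definition absolutely_continuous_on (a b : R) (f : R -> R) : Prop :=
  forall eps : R, 0 < eps -> exists2 delta : R, 0 < delta &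
    forall (n : nat) (lo hi : 'I_n -> R),
      (forall i, a <= lo i /\ lo i <= hi i /\ hi i <= b) ->
      trivIset [set: 'I_n] (fun i => [set` `]lo i, hi i[]) ->
      \sum_i (hi i - lo i) < delta ->
      \sum_i `|f (hi i) - f (lo i)| < eps.

(* [f] is C^1 on the closed interval [0, l] with derivative [f'], one-sided at
   the end points: the increment tends to [0] within [0, l]. *)
Definition is_C1 (l : R) (f f' : R -> R) : Prop :=
  (forall x, 0 <= x <= l ->
     (f y - f x) / (y - x) @[y --> within `[0, l] x^'] --> f' x) /\
  {within `[0, l], continuous f'}.

Definition test_function (Omega : set R) (phi : R -> R) : Prop :=
  (forall (n : nat) (x : R), derivable phi^`(n) x 1) /\
  exists2 K : set R, compact K /\ K `<=` Omega &
    forall x, ~ K x -> phi x = 0.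

Definition is_weak_derivative (Omega : set R) (f g : R -> R) : Prop :=
  [/\ locally_integrable Omega f,
      locally_integrable Omega g &
      forall phi, test_function Omega phi ->
        \int[leb]_(x in Omega) (f x * (phi^`())%classic x) =
        - \int[leb]_(x in Omega) (g x * phi x)].

(* Unique up to Lebesgue-null sets in [Omega] when it exists; set to zero
   outside [Omega]. *)
Definition weak_derivative (Omega : set R) (f : R -> R) : R -> R :=
  (get [set g | is_weak_derivative Omega f g]) \_ Omega.

Definition square_integrable (D : set R) (f : R -> R) : Prop :=
  measurable_fun D f /\ leb.-integrable D (fun x => (f x ^+ 2)%:E).

Definition in_H1 (l : R) (f : R -> R) : Prop :=
  square_integrable `]0, l[ f /\
  exists2 g, is_weak_derivative `]0, l[ f g & square_integrable `]0, l[ g.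

(* For [0 < l], unique on [0, l] when it exists. *)
Definition continuous_representative (U : ptopologicalType) (l : R)
    (f : R -> U) : R -> U :=
  get [set u | {within `[0, l], continuous u} /\ ae_eq leb `[0, l] u f].

Definition density
    (nu : {charge set (measurableTypeR R) -> \bar R})
    (mu : {sigma_finite_measure set (measurableTypeR R) -> \bar R}) : R -> R :=
  fun x => fine (('d nu '/d mu) x).

Definition mdensity
    (nu : {finite_measure set (measurableTypeR R) -> \bar R})
    (mu : {sigma_finite_measure set (measurableTypeR R) -> \bar R}) : R -> R :=
  density (charge_of_finite_measure nu) mu.

Section signed.
Variable nu : {charge set (measurableTypeR R) -> \bar R}.

Let hahnP := cid (Hahn_decomposition nu).
Let hahnN := cid (projT2 hahnP).

Definition charge_tv : set R -> \bar R := charge_variation (projT2 hahnN).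

Definition charge_integral (D : set R) (f : R -> R) : \bar R :=
  (\int[jordan_pos (projT2 hahnN)]_(x in D) (f x)%:E
   - \int[jordan_neg (projT2 hahnN)]_(x in D) (f x)%:E)%E.

End signed.

Definition eta (r : R) : R := r * ln r - r + 1.

Definition cosh_cost (r : R) : R :=
  2 * r * ln ((r + Num.sqrt (r ^+ 2 + 4)) / 2)
  - 2 * Num.sqrt (r ^+ 2 + 4) + 4.

Definition cosh_persp (r s : R) : \bar R :=
  if 0 < s then (s * cosh_cost (r / s))%:E
  else if r == 0 then 0%E else +oo%E.

End Analysis.

Record metric_graph (R : realType) := MetricGraph {
  node : finType;
  edge_set : {set node * node};
  no_loop : forall v, (v, v) \notin edge_set;
  oriented : forall v w, (v, w) \in edge_set -> (w, v) \notin edge_set;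
  graph_connected : forall v w,
    connect (fun x y => ((x, y) \in edge_set) || ((y, x) \in edge_set)) v w;
  edge := {e : node * node | e \in edge_set};
  len : edge -> R;
  len_gt0 : forall e, 0 < len e }.

Section Graph.
Context {R : realType} {G : metric_graph R}.

Definition tail_node (e : edge G) : node G := (val e).1.
Definition head_node (e : edge G) : node G := (val e).2.

Definition ends (e : edge G) : {set node G} := [set tail_node e; head_node e].

Definition edges_at (v : node G) : {set edge G} := [set e | v \in ends e]%SET.

Definition edge_itv (e : edge G) : set R := `[0, len e].

(* The end of [0, len e] glued to [v], for [v] in [ends e]. *)
Definition end_point (e : edge G) (v : node G) : R :=
  if v == tail_node e then 0 else len e.

Definition trace (U : ptopologicalType) (e : edge G) (v : node G)
    (f : R -> U) : U :=
  continuous_representative (len e) f (end_point e v).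

End Graph.

Record prob (R : realType) (G : metric_graph R) := Prob {
  gam : node G -> R;
  rho : edge G -> {finite_measure set (measurableTypeR R) -> \bar R};
  gam_ge0 : forall v, 0 <= gam v;
  rho_supp : forall e, (rho e).-null_set (~` edge_itv e);
  prob_mass :
    (\sum_v (gam v)%:E + \sum_e rho e (edge_itv e) = 1)%E }.

Record flux (R : realType) (G : metric_graph R) := Flux {
  jbar : edge G -> node G -> R;  (* only used at [v] in [ends e] *)
  jint : edge G -> {charge set (measurableTypeR R) -> \bar R};
  jint_supp : forall e, (jint e).-null_set (~` edge_itv e) }.

Section ContinuityEquation.
Context {R : realType} {G : metric_graph R}.
Local Notation leb := (@lebesgue_measure R).

Definition pairing (phi : node G -> R) (f : edge G -> R -> R)
    (mu : prob G) : R :=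
  \sum_v phi v * gam mu v
  + \sum_e \int[rho mu e]_(x in edge_itv e) f e x.

Definition narrowly_continuous (T : R) (mu : R -> prob G) : Prop :=
  forall (phi : node G -> R) (f : edge G -> R -> R),
    (forall e, {within edge_itv e, continuous (f e)}) ->
    {within `[0, T], continuous (fun t => pairing phi f (mu t))}.

Definition flux_pairing (phi : node G -> R) (f f' : edge G -> R -> R)
    (j : flux G) : R :=
  \sum_v \sum_(e in edges_at v) (phi v - f e (end_point e v)) * jbar j e v
  + \sum_e fine (charge_integral (jint j e) (edge_itv e) (f' e)).

Definition measurable_flux (T : R) (j : R -> flux G) : Prop :=
  (forall e v, v \in ends e ->
     measurable_fun `[0, T] (fun t => jbar (j t) e v)) /\
  (forall e (A : set R), measurable A ->
     measurable_fun `[0, T] (fun t => jint (j t) e A)).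

Definition flux_mass (j : flux G) : \bar R :=
  (\sum_e \sum_(v in ends e) `|jbar j e v|%:E
   + \sum_e charge_tv (jint j e) (edge_itv e))%E.

(* The identity for the time derivative is the one of W^{1,1}(0, T): the
   pairing is absolutely continuous and its derivative is given almost
   everywhere. Without absolute continuity, singular (Cantor-like) curves would
   solve the equation with zero flux. *)
Definition CE (T : R) (mu : R -> prob G) (j : R -> flux G) : Prop :=
  [/\ narrowly_continuous T mu,
      measurable_flux T j,
      (\int[leb]_(t in `[0%R, T]) flux_mass (j t) < +oo)%E &
      forall (phi : node G -> R) (f f' : edge G -> R -> R),
        (forall e, is_C1 (len e) (f e) (f' e)) ->
        absolutely_continuous_on 0 T (fun t => pairing phi f (mu t)) /\
        {ae leb, forall t, t \in `]0, T[ ->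
           is_derive t 1 (fun t => pairing phi f (mu t))
             (flux_pairing phi f f' (j t))}].

End ContinuityEquation.

Section Functionals.
Context {R : realType} {G : metric_graph R}.
Variable ref : prob G.  (* the reference measure (omega, pi) *)
Variables (d : edge G -> R) (kappa : edge G -> node G -> R).
Local Notation leb := (@lebesgue_measure R).
Local Notation omega := (gam ref).
Local Notation pi := (rho ref).

Definition node_relent (g w : R) : \bar R :=
  if (g == 0) || (w != 0) then (w * eta (g / w))%:E else +oo%E.

Definition edge_relent (mu nu : {finite_measure set (measurableTypeR R) -> \bar R}) :
    \bar R :=
  if `[< mu `<< nu >] then (\int[nu]_x (eta (mdensity mu nu x))%:E)%E
  else +oo%E.

Definition energy (mu : prob G) : \bar R :=
  (\sum_e edge_relent (rho mu e) (pi e)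
   + \sum_v node_relent (gam mu v) (omega v))%E.

Definition leb_density (mu : prob G) (e : edge G) : R -> R :=
  mdensity (rho mu e) leb.

Definition rel_density (mu : prob G) (e : edge G) : R -> R :=
  mdensity (rho mu e) (pi e).

Definition sqrt_density (mu : prob G) (e : edge G) : R -> R :=
  fun x => Num.sqrt (rel_density mu e x).

Definition rate (mu : prob G) (j : flux G) : \bar R :=
  if `[< forall e, jint j e `<< rho mu e >] then
    (\sum_e \sum_(v in ends e)
       cosh_persp (jbar j e v)
         (kappa e v * Num.sqrt (gam mu v * trace e v (leb_density mu e)))%R
     + \sum_e ((2 * d e)^-1)%:E
         * \int[rho mu e]_(x in edge_itv e)
             (`|density (jint j e) (rho mu e) x| ^+ 2)%:E)%E
  else +oo%E.

Definition slope (mu : prob G) : \bar R :=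
  if `[< forall e, rho mu e `<< pi e /\ in_H1 (len e) (sqrt_density mu e) >] then
    (\sum_e \sum_(v in ends e)
       (2 * kappa e v
          * Num.sqrt (omega v * trace e v (leb_density ref e))
          * `|trace e v (sqrt_density mu e)
               - Num.sqrt (gam mu v / omega v)| ^+ 2)%:E
     + \sum_e (2 * d e)%:E
         * \int[pi e]_(x in edge_itv e)
             (`|weak_derivative `]0%R, len e[ (sqrt_density mu e) x| ^+ 2)%:E)%E
  else +oo%E.

Definition dissipation (T : R) (mu : R -> prob G) (j : R -> flux G) : \bar R :=
  (\int[leb]_(t in `[0%R, T]) (rate (mu t) (j t) + slope (mu t)))%E.

Definition ed_functional (T : R) (mu : R -> prob G) (j : R -> flux G) : \bar R :=
  (energy (mu T) - energy (mu 0%R) + dissipation T mu j)%E.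

(* log (d rho^e / d pi^e), with values in [-oo, +oo]; [lne 0 = -oo]. *)
Definition log_density (mu : prob G) (e : edge G) : R -> \bar R :=
  fun x => lne (rel_density mu e x)%:E.

(* The weak derivative of log (d rho^e / d pi^e) lives on the open set where
   the logarithm is finite, i.e. where the continuous density is positive. The
   complement is negligible for rho^e, hence for any j^e << rho^e. *)
Definition dlog_density (mu : prob G) (e : edge G) : R -> R :=
  weak_derivative
    [set x | 0 < x < len e /\
       continuous_representative (len e) (log_density mu e) x != -oo%E]
    (fine \o log_density mu e).

Definition log_jump (mu : prob G) (e : edge G) (v : node G) : \bar R :=
  let a := lne (gam mu v / omega v)%:E in
  let b := trace e v (log_density mu e) in
  if (a == -oo%E) && (b == -oo%E) then 0%E else (a - b)%E.

Definition energy_production (mu : prob G) (j : flux G) : \bar R :=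
  (\sum_v \sum_(e in edges_at v) log_jump mu e v * (jbar j e v)%:E
   + \sum_e charge_integral (jint j e) (edge_itv e) (dlog_density mu e))%E.

End Functionals.

(* Main.v *)
From HB Require Import structures.
From mathcomp Require Import all_boot all_order all_algebra.
From mathcomp Require Import all_classical all_reals all_analysis.
From mathcomp Require Import measurable_realfun.
From mathcomp Require Import ring lra.
Require Import Defs.

Set Implicit Arguments.
Unset Strict Implicit.
Unset Printing Implicit Defensive.

Import Order.TTheory GRing.Theory Num.Theory.
Import numFieldNormedType.Exports.

Local Open Scope ring_scope.
Local Open Scope classical_set_scope.

(** Formally the time derivative of the energy along the continuity equation is
the flux paired with the logarithm of the relative density, because [ln] is
the derivative of [eta]; this pairing is [energy_production]. The logarithm is
however no test function: it is unbounded, it has a weak derivative only where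
the density is positive, and it depends on time.

Regularisation. [eta] is replaced by [reg_eta d], whose derivative [reg_log d]
is bounded by [- ln d] and tends to [ln] as [d] tends to 0, and the measure on
an edge by its masses against the hats of a C^1 partition of unity of dyadic
width [l / 2 ^+ N]. The energy [energy_disc d N] so obtained is a Lipschitz
function of finitely many pairings of [mu t] with C^1 functions. Hence it is
absolutely continuous in time ([energy_disc_ac]), and its derivative
[prod_disc d N] is the flux at time [t] tested against combinations of hats
whose coefficients are read off [mu t] ([energy_disc_derive]).

Limit at a fixed time. At a time of finite dissipation the relative density on
every edge is [q ^ 2] with [q] in H^1, the flux has a square-integrable density
with respect to the measure, and the flux through a node vanishes where the
mobility does ([good], [finite_good]). Then [prod_disc d N] converges to
[energy_production] as first [N] tends to infinity and then [d] to 0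
([prod_disc_cvg], [prod_reg_cvg], [energy_productionE]). On the edges this is
weak convergence in L^2 of [q] times the derivative of the hat combination,
which the slope controls ([pou_comb'_weak]); at the nodes the Fenchel-Young
inequality of the cosh pair bounds flux times jump of the logarithm by rate
plus slope ([node_bound]).

Integration in time. The productions are bounded by a multiple of the
dissipation plus an integrable function, so dominated convergence applies. The
dissipation itself may fail to be a measurable function of time: its integral
is the supremum of the integrals of the simple functions below it. This still
suffices: measurable functions below it are integrable ([lower_dominated]) and
measurable sets on which it is infinite are null
([lower_integral_pinfty_null]). For almost every time the structure [good] is
recovered from countably many functions that are measurable in time, dyadic
sums whose boundedness amounts to [q] being in H^1 ([fisher_rep]) and to the
flux having a square-integrable density ([charge_rep]); see [ae_good].

All times. So far the energy equals a constant plus the integrated production for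
almost every time. The integrated identity for the discrete energies holds at
every time, and these lie below the energy by Jensen's inequality
([energy_disc_le]); this gives one inequality everywhere. For the other one,
the relative entropy is the supremum of functionals that are continuous in
time ([dual_relent], [energy_le_indef]). *)

(** * Integrals of functions that need not be measurable *)

Section LowerIntegral.
Context d (T : measurableType d) (R : realType).
Variable mu : {measure set T -> \bar R}.
Local Open Scope ereal_scope.
Import HBNNSimple.

Lemma ge0_le_lower_integral (D : set T) (f g : T -> \bar R) :
  (forall x, D x -> 0 <= f x) -> (forall x, D x -> f x <= g x) ->
  \int[mu]_(x in D) f x <= \int[mu]_(x in D) g x.
Proof.
move=> f0 fg.
have g0 x : D x -> 0 <= g x by move=> Dx; rewrite (le_trans (f0 _ Dx)) ?fg.
rewrite !ge0_integralE//; apply: le_ereal_sup => _ [h /= hf <-].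
exists h => // x; apply: (le_trans (hf x)).
by rewrite !patchE; case: ifPn => // /set_mem/fg.
Qed.

(** Any simple function below [f] may be set to zero on [N] without changing its
integral, so null sets are negligible even for suprema over simple functions. *)
Lemma ge0_lower_integral_setD (D N : set T) (f : T -> \bar R) :
  measurable N -> mu N = 0 -> (forall x, D x -> 0 <= f x) ->
  \int[mu]_(x in D) f x = \int[mu]_(x in D `\` N) f x.
Proof.
move=> mN N0 f0.
have f0' x : (D `\` N) x -> 0 <= f x by move=> [/f0].
apply/eqP; rewrite eq_le; apply/andP; split; last first.
  rewrite integral_mkcond [leRHS]integral_mkcond.
  apply: ge0_le_lower_integral => x _; first exact: erestrict_ge0.
  rewrite !patchE; case: ifPn => [/set_mem[Dx _]|_]; first by rewrite mem_set.
  by case: ifPn => // /set_mem/f0.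
rewrite !ge0_integralE//; apply: ge_ereal_sup => _ [h /= hf <-].
have mNC : measurable (~` N) by exact: measurableC.
set k : {nnsfun T >-> R} := proj_nnsfun h mNC.
have kE x : k x = (h x * \1_(~` N) x)%R by [].
have -> : sintegral mu h = sintegral mu k.
  have H (l : {nnsfun T >-> R}) : sintegral mu l = \int[mu]_x (l x)%:E.
    by rewrite integral_nnsfun// patch_setT.
  rewrite !H; apply: ge0_ae_eq_integral => //.
  - exact/measurable_EFinP.
  - exact/measurable_EFinP.
  - by move=> x _; rewrite lee_fin.
  - by move=> x _; rewrite lee_fin.
  exists N; split => // x /= /not_implyP[_] hk; apply: contrapT => Nx; apply: hk.
  by change ((h x)%:E = (h x * \1_(~` N) x)%:E); rewrite indicE mem_set//= mulr1.
apply: ereal_sup_ubound; exists k => // x.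
have := hf x; rewrite !patchE kE indicE.
case: ifPn => [/set_mem Dx|Dx].
  case: (pselect (N x)) => Nx.
    by rewrite memNset//= mulr0 => _; case: ifPn => // /set_mem[].
  have -> : (x \in ~` N) = true by exact: mem_set.
  have -> : (x \in D `\` N) = true by exact: (mem_set (conj Dx Nx)).
  by rewrite mulr1.
have -> : (x \in D `\` N) = false.
  by apply/memNset => -[/mem_set Dx' _]; rewrite Dx' in Dx.
move=> hx.
apply: le_trans hx; rewrite lee_fin; case: (x \in _); rewrite ?mulr1 ?mulr0//.
Qed.

Lemma ae_eq_lower_integral (D : set T) (f g : T -> \bar R) :
  {ae mu, forall x, D x -> f x = g x} ->
  \int[mu]_(x in D) f x = \int[mu]_(x in D) g x.
Proof.
move=> [N [mN N0 fgN]].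
have E x : (D `\` N) x -> f x = g x.
  by move=> [Dx Nx]; apply: contrapT => h; apply: Nx; apply: fgN => /(_ Dx).
rewrite integralE [RHS]integralE; congr (_ - _);
  rewrite (ge0_lower_integral_setD mN N0)// [RHS](ge0_lower_integral_setD mN N0)//;
  by apply: eq_integral => x /set_mem/E fg; rewrite ?funeposE ?funenegE fg.
Qed.

Lemma ae_ge0_le_lower_integral (D : set T) (f g : T -> \bar R) :
  (forall x, D x -> 0 <= f x) -> (forall x, D x -> 0 <= g x) ->
  {ae mu, forall x, D x -> f x <= g x} ->
  \int[mu]_(x in D) f x <= \int[mu]_(x in D) g x.
Proof.
move=> f0 g0 [N [mN N0 fgN]].
rewrite (ge0_lower_integral_setD mN N0)// [leRHS](ge0_lower_integral_setD mN N0)//.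
apply: ge0_le_lower_integral => x [Dx Nx]; first exact: f0.
by apply: contrapT => h; apply: Nx; apply: fgN => /(_ Dx).
Qed.

(** Otherwise the functions [n * \1_S] lie below [B] and have unbounded
integrals. This excludes infinite values of [B] only on measurable sets. *)
Lemma lower_integral_pinfty_null (D S : set T) (B : T -> \bar R) :
  measurable S -> S `<=` D -> (forall x, D x -> 0 <= B x) ->
  \int[mu]_(x in D) B x < +oo -> (forall x, S x -> B x = +oo) -> mu S = 0.
Proof.
move=> mS SD B0 Bfin BS; apply/eqP; rewrite -measure_le0 leNgt; apply/negP => S0.
have : \int[mu]_(x in D) (+oo * (\1_S x)%:E) <= \int[mu]_(x in D) B x.
  apply: ge0_le_lower_integral => x Dx; rewrite indicE.
    by case: (x \in S); rewrite /= ?mule0// mule1.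
  by case: (boolP (x \in S)) => [/set_mem/BS ->|_]; rewrite /= ?mule0 ?B0// mule1.
have -> : \int[mu]_(x in D) (+oo * (\1_S x)%:E) = \int[mu]_x (+oo * (\1_S x)%:E).
  rewrite integral_mkcond; apply: eq_integral => x _; rewrite patchE.
  case: ifPn => // Dx; rewrite indicE memNset ?mule0// => /SD/mem_set.
  by rewrite (negbTE Dx).
rewrite ge0_integralZl//; last by apply/measurable_EFinP; exact: measurable_indic.
rewrite integral_indic// setIT gt0_mulye// => /le_lt_trans/(_ Bfin).
by rewrite ltxx.
Qed.

End LowerIntegral.

Section AlmostEverywhere.
Context d (T : measurableType d) (R : realType).
Variable mu : {measure set T -> \bar R}.

Lemma ae_imply (P Q : T -> Prop) : (forall x, P x -> Q x) ->
  {ae mu, forall x, P x} -> {ae mu, forall x, Q x}.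
Proof. by move=> PQ; apply: filterS. Qed.

Lemma ae_imply2 (P Q S : T -> Prop) : (forall x, P x -> Q x -> S x) ->
  {ae mu, forall x, P x} -> {ae mu, forall x, Q x} -> {ae mu, forall x, S x}.
Proof. by move=> PQS; apply: filterS2. Qed.

End AlmostEverywhere.

Local Close Scope ereal_scope.

(** * Real-valued integrals and square-integrable functions *)

Section RealIntegrals.
Context d (T : measurableType d) (R : realType).
Variable mu : {measure set T -> \bar R}.
Implicit Types (D : set T) (f g : T -> R).

Lemma EFin_Rint D f : measurable D -> mu.-integrable D (EFin \o f) ->
  (\int[mu]_(x in D) f x)%:E = (\int[mu]_(x in D) (f x)%:E)%E.
Proof. by move=> mD fi; rewrite /Rintegral fineK// integrable_fin_num. Qed.

Lemma dom_integrable D f g : measurable D -> measurable_fun D f ->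
  mu.-integrable D (EFin \o g) -> (forall x, D x -> `|f x| <= g x) ->
  mu.-integrable D (EFin \o f).
Proof.
move=> mD mf ig fg; apply: (le_integrable mD _ _ ig).
  exact/measurable_EFinP.
by move=> x Dx /=; rewrite lee_fin (le_trans (fg _ Dx))// ler_norm.
Qed.

Lemma Rintegral_dct D (f_ : nat -> T -> R) f g : measurable D ->
  (forall n, measurable_fun D (f_ n)) -> measurable_fun D f ->
  {ae mu, forall x, D x -> f_ n x @[n --> \oo] --> f x} ->
  mu.-integrable D (EFin \o g) ->
  {ae mu, forall x, D x -> forall n, `|f_ n x| <= g x} ->
  mu.-integrable D (EFin \o f) /\
  \int[mu]_(x in D) f_ n x @[n --> \oo] --> \int[mu]_(x in D) f x.
Proof.
move=> mD mf_ mf f_f ig f_g.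
have [] := @dominated_convergence _ _ _ mu D mD (fun n => EFin \o f_ n)
  (EFin \o f) (EFin \o g).
- by move=> n; exact/measurable_EFinP.
- exact/measurable_EFinP.
- apply: filterS f_f => x H Dx; apply: cvg_EFin; last exact: H.
  by near=> n.
- exact: ig.
- by apply: filterS f_g => x H n Dx /=; rewrite lee_fin H.
move=> fi _ c; split => //.
by have := fine_cvg; rewrite /Rintegral => H; apply: H; rewrite fineK// integrable_fin_num.
Unshelve. all: by end_near. Qed.

Lemma ae_eq_Rint D f g : measurable D ->
  {ae mu, forall x, D x -> f x = g x} ->
  \int[mu]_(x in D) f x = \int[mu]_(x in D) g x.
Proof.
move=> mD fg; rewrite /Rintegral; congr fine; apply: ae_eq_lower_integral.
by apply: filterS fg => x H /H ->.
Qed.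

Lemma le_Rint_norm D f g : measurable D -> measurable_fun D f ->
  mu.-integrable D (EFin \o g) -> (forall x, D x -> `|f x| <= g x) ->
  `|\int[mu]_(x in D) f x| <= \int[mu]_(x in D) g x.
Proof.
move=> mD mf ig fg; have fi := dom_integrable mD mf ig fg.
apply: (le_trans (le_normr_Rintegral mD fi)).
apply: le_Rintegral => //.
exact: integrable_norm.
Qed.

Lemma Rint_sum D (I : Type) (s : seq I) (F : I -> T -> R) : measurable D ->
  (forall i, mu.-integrable D (EFin \o F i)) ->
  mu.-integrable D (EFin \o (fun x => \sum_(i <- s) F i x)) /\
  \int[mu]_(x in D) (\sum_(i <- s) F i x) = \sum_(i <- s) \int[mu]_(x in D) F i x.
Proof.
move=> mD Fi; elim: s => [|a s [IH1 IH2]].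
  split.
    rewrite (_ : _ \o _ = cst 0%E); last by apply/funext => x /=; rewrite big_nil.
    exact: integrable0.
  rewrite big_nil.
  have -> : \int[mu]_(x in D) (\sum_(i <- [::]) F i x) = \int[mu]_(x in D) cst 0 x.
    by apply: eq_Rintegral => x _; rewrite big_nil.
  by rewrite /Rintegral integral0.
have E : (fun x => \sum_(i <- a :: s) F i x) = (fun x => F a x + \sum_(i <- s) F i x).
  by apply/funext => x; rewrite big_cons.
rewrite E big_cons -IH2 RintegralD//; split => //.
exact: (integrableD mD (Fi a) IH1).
Qed.

Lemma RintZ D (k : R) f : measurable D -> mu.-integrable D (EFin \o f) ->
  mu.-integrable D (EFin \o (fun x => k * f x)).
Proof. by move=> mD fi; exact: (integrableZl mD k fi). Qed.

Lemma RintD D f g : measurable D -> mu.-integrable D (EFin \o f) ->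
  mu.-integrable D (EFin \o g) -> mu.-integrable D (EFin \o (fun x => f x + g x)).
Proof. by move=> mD fi gi; exact: (integrableD mD fi gi). Qed.

Lemma RintB D f g : measurable D -> mu.-integrable D (EFin \o f) ->
  mu.-integrable D (EFin \o g) -> mu.-integrable D (EFin \o (fun x => f x - g x)).
Proof. by move=> mD fi gi; exact: (integrableB mD fi gi). Qed.

Lemma RintNorm D f : measurable D -> mu.-integrable D (EFin \o f) ->
  mu.-integrable D (EFin \o (fun x => `|f x|)).
Proof. by move=> mD fi; exact: (integrable_norm fi). Qed.

Lemma Rint_measurable D f : mu.-integrable D (EFin \o f) -> measurable_fun D f.
Proof. by move=> /integrableP[/measurable_EFinP]. Qed.

Definition L2 D f := measurable_fun D f /\ mu.-integrable D (fun x => (f x ^+ 2)%:E).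

Lemma L2_mul D f g : measurable D -> L2 D f -> L2 D g ->
  mu.-integrable D (EFin \o (fun x => f x * g x)).
Proof.
move=> mD [mf f2] [mg g2].
apply: (dom_integrable (g := fun x => f x ^+ 2 + g x ^+ 2)) => //.
- exact: measurable_funM.
- rewrite (_ : _ \o _ = ((fun x => (f x ^+ 2)%:E) \+ (fun x => (g x ^+ 2)%:E))%E)//.
  exact: integrableD.
move=> x Dx; rewrite normrM.
have := sqr_ge0 (`|f x| - `|g x|); have := real_normK (num_real (f x)).
have := real_normK (num_real (g x)); have := normr_ge0 (f x); have := normr_ge0 (g x).
nra.
Qed.

Lemma L2Z D (k : R) f : measurable D -> L2 D f -> L2 D (fun x => k * f x).
Proof.
move=> mD [mf f2]; split; first exact: measurable_funM.
rewrite (_ : (fun x => _) = (fun x => (k ^+ 2)%:E * (f x ^+ 2)%:E)%E); last first.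
  by apply/funext => x; rewrite -EFinM exprMn.
exact: integrableZl.
Qed.

Lemma L2D D f g : measurable D -> L2 D f -> L2 D g -> L2 D (fun x => f x + g x).
Proof.
move=> mD Lf Lg; have [mf f2] := Lf; have [mg g2] := Lg.
split; first exact: measurable_funD.
rewrite (_ : (fun x => _) = (((fun x => (f x ^+ 2)%:E) \+ (fun x => (g x ^+ 2)%:E))
   \+ (fun x => 2%:E * (f x * g x)%:E))%E); last first.
  by apply/funext => x /=; rewrite -EFinM -!EFinD; congr (_%:E); ring.
by apply: integrableD => //; [exact: integrableD|apply: integrableZl => //; exact: L2_mul].
Qed.

Lemma L2B D f g : measurable D -> L2 D f -> L2 D g -> L2 D (fun x => f x - g x).
Proof.
move=> mD Lf Lg; rewrite (_ : (fun x => _) = (fun x => f x + (-1) * g x)).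
  by apply: L2D => //; exact: L2Z.
by apply/funext => x; rewrite mulN1r.
Qed.

Lemma L2_dom D f g : measurable D -> measurable_fun D f -> L2 D g ->
  (forall x, D x -> `|f x| <= `|g x|) -> L2 D f.
Proof.
move=> mD mf [mg g2] fg; split => //.
apply: (dom_integrable (f := fun x => f x ^+ 2) (g := fun x => g x ^+ 2)) => //.
  exact: measurable_funX.
by move=> x Dx; rewrite normrX -[leRHS]real_normK ?num_real// lerXn2r ?nnegrE// fg.
Qed.

Lemma L2_cst D (k : R) : measurable D -> (mu D < +oo)%E -> L2 D (fun=> k).
Proof.
move=> mD Dfin; split => //; rewrite (_ : (fun x => _) = cst (k ^+ 2)%:E)//.
apply: measurable_bounded_integrable => //.
exact: bounded_cst.
Qed.

Lemma L2_bounded D f (K : R) : measurable D -> (mu D < +oo)%E -> measurable_fun D f ->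
  (forall x, D x -> `|f x| <= K) -> L2 D f.
Proof.
move=> mD Dfin mf fK; apply: (L2_dom (g := fun=> K)) => //; first exact: L2_cst.
by move=> x Dx; rewrite (le_trans (fK _ Dx))// ler_norm.
Qed.

Lemma bounded_integrable D f (K : R) : measurable D -> (mu D < +oo)%E ->
  measurable_fun D f -> (forall x, D x -> `|f x| <= K) -> mu.-integrable D (EFin \o f).
Proof.
move=> mD Dfin mf fK; have := L2_mul mD (L2_bounded mD Dfin mf fK) (L2_cst 1 mD Dfin).
by rewrite (_ : _ \o _ = EFin \o f)//; apply/funext => x /=; rewrite mulr1.
Qed.

Lemma L2_integrable D f : measurable D -> (mu D < +oo)%E -> L2 D f ->
  mu.-integrable D (EFin \o f).
Proof.
move=> mD Dfin Lf; have := L2_mul mD Lf (L2_cst 1 mD Dfin).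
by rewrite (_ : _ \o _ = EFin \o f)//; apply/funext => x /=; rewrite mulr1.
Qed.

Lemma L2_subset D E f : measurable D -> measurable E -> E `<=` D -> L2 D f -> L2 E f.
Proof.
move=> mD mE ED [mf f2]; split; first exact: measurable_funS mf.
exact: integrableS f2.
Qed.

Lemma L2_ae D f g : measurable D -> measurable_fun D g -> L2 D f ->
  {ae mu, forall x, D x -> f x = g x} -> L2 D g.
Proof.
move=> mD mg [mf f2] fg; split => //.
move/integrableP : f2 => [m2 lt]; apply/integrableP; split.
  by apply/measurable_EFinP; exact: measurable_funX.
apply: le_lt_trans lt; rewrite le_eqVlt; apply/orP; left; apply/eqP.
by apply: ae_eq_lower_integral; apply: filterS fg => x H /H ->.
Qed.

(** The quadratic form in [s], [t] obtained by integrating [(s f + t g) ^ 2] is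
nonnegative, in particular at [(- C, A)]; if [A = 0], large [s] forces [C = 0]. *)
Lemma cauchy_schwarz D f g : measurable D -> L2 D f -> L2 D g ->
  (\int[mu]_(x in D) (f x * g x)) ^+ 2 <=
  (\int[mu]_(x in D) (f x ^+ 2)) * (\int[mu]_(x in D) (g x ^+ 2)).
Proof.
move=> mD Lf Lg; have [_ f2] := Lf; have [_ g2] := Lg.
set A := \int[mu]_(x in D) (f x ^+ 2); set B := \int[mu]_(x in D) (g x ^+ 2).
set C := \int[mu]_(x in D) _.
have A0 : 0 <= A by apply: Rintegral_ge0 => x _; exact: sqr_ge0.
have B0 : 0 <= B by apply: Rintegral_ge0 => x _; exact: sqr_ge0.
have H (s t : R) : 0 <= s ^+ 2 * A + t ^+ 2 * B + 2 * s * t * C.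
  have -> : s ^+ 2 * A + t ^+ 2 * B + 2 * s * t * C =
      \int[mu]_(x in D) ((s * f x + t * g x) ^+ 2).
    have i1 := integrableZl mD (s ^+ 2) f2.
    have i2 := integrableZl mD (t ^+ 2) g2.
    have i3 := integrableZl mD (2 * s * t) (L2_mul mD Lf Lg).
    rewrite /A /B /C -!RintegralZl//; last exact: L2_mul.
    rewrite -RintegralD// -RintegralD//; last exact: (integrableD mD i1 i2).
    by apply: eq_Rintegral => x _; ring.
  by apply: Rintegral_ge0 => x _; exact: sqr_ge0.
have [A0'|] := eqVneq A 0.
  rewrite A0' mul0r; have [->|C0] := eqVneq C 0; first by rewrite expr0n.
  have := H (- (B + 1) / C) 1; rewrite A0'.
  have -> : 2 * (- (B + 1) / C) * 1 * C = - 2 * (B + 1) by field.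
  by nra.
move=> An0; have Ap : 0 < A by rewrite lt_neqAle eq_sym An0.
have := H (- C) A; have := Ap; nra.
Qed.

Lemma cauchy_schwarz1 D f : measurable D -> (mu D < +oo)%E -> L2 D f ->
  (\int[mu]_(x in D) f x) ^+ 2 <=
  fine (mu D) * (\int[mu]_(x in D) (f x ^+ 2)).
Proof.
move=> mD Dfin Lf; have := cauchy_schwarz mD (L2_cst 1 mD Dfin) Lf.
have -> : \int[mu]_(x in D) (1 * f x) = \int[mu]_(x in D) f x.
  by apply: eq_Rintegral => x _; rewrite mul1r.
suff -> : \int[mu]_(x in D) (1 ^+ 2 : R) = fine (mu D) by [].
by rewrite Rintegral_cst// expr1n mul1r.
Qed.

End RealIntegrals.

(** * Absolutely continuous functions *)

Section AbsolutelyContinuous.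
Context {R : realType}.
Local Notation leb := (@lebesgue_measure R).
Implicit Types (a b : R) (f F H : R -> R).

Lemma is_deriveP1 F (t l : R) :
  is_derive t 1 F l <->
  (forall e, 0 < e -> exists2 r, 0 < r & forall y, `|y - t| < r ->
     `|F y - F t - l * (y - t)| <= e * `|y - t|).
Proof.
split.
  move=> [dF Fl] e e0.
  have := dF; rewrite /derivable => /cvg_ex[l' cl'].
  have El : l' = l by rewrite -Fl; apply/esym/cvg_lim.
  rewrite El in cl'.
  have /cvgrPdist_le /(_ _ e0) := cl'.
  move=> -[r /= r0 H]; exists r => // y yt.
  have [->|ynt] := eqVneq y t; first by rewrite !subrr mulr0 subr0 normr0 mulr0.
  have h0 : y - t != 0 by rewrite subr_eq0.
  have := H (y - t); rewrite /ball_ /= sub0r normrN => /(_ yt h0).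
  rewrite [_ *: 1]mulr1 subrK => K.
  rewrite -ler_pdivrMr ?normr_gt0// -normfV -normrM.
  rewrite -normrN; apply: le_trans K; rewrite le_eqVlt; apply/orP; left; apply/eqP.
  by congr `|_|; rewrite /GRing.scale /=; field.
move=> H.
have c : h^-1 *: (F (h *: 1 + t) - F t) @[h --> 0^'] --> l.
  apply/cvgrPdist_le => e e0; have [r r0 K] := H _ e0.
  exists r => // h /=; rewrite sub0r normrN => hr h0.
  have := K (h + t); rewrite addrK => /(_ hr) K'.
  rewrite [_ *: 1]mulr1 -normrN.
  have -> : - (l - h^-1 *: (F (h + t) - F t)) = (F (h + t) - F t - l * h) / h.
    by rewrite /GRing.scale /=; field.
  by rewrite normrM normfV ler_pdivrMr ?normr_gt0.
split; first by apply/cvg_ex; exists l.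
exact: cvg_lim.
Qed.

Lemma ac_sub a b a' b' F : a <= a' -> b' <= b ->
  absolutely_continuous_on a b F -> absolutely_continuous_on a' b' F.
Proof.
move=> aa bb H e /H[dl dl0 K]; exists dl => // n lo hi lh tr s; apply: K => // i.
by have [h1 [h2 h3]] := lh i; split; [exact: le_trans h1|split => //; exact: le_trans bb].
Qed.

Lemma ac_lin a b F G (c : R) :
  absolutely_continuous_on a b F -> absolutely_continuous_on a b G ->
  absolutely_continuous_on a b (fun x => F x + c * G x).
Proof.
move=> HF HG e e0.
have [d1 d10 K1] := HF _ (divr_gt0 e0 (ltr0Sn R 1)).
have c0 : 0 < `|c| + 1 by have := normr_ge0 c; lra.
have [d2 d20 K2] := HG _ (divr_gt0 (divr_gt0 e0 (ltr0Sn R 1)) c0).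
exists (Num.min d1 d2); first by rewrite lt_min d10.
move=> n lo hi lh tr; rewrite lt_min => /andP[s1 s2].
have {}K1 := K1 _ _ _ lh tr s1; have {}K2 := K2 _ _ _ lh tr s2.
apply: (@le_lt_trans _ _ (\sum_i (`|F (hi i) - F (lo i)| + (`|c| + 1) * `|G (hi i) - G (lo i)|))).
  apply: ler_sum => i _.
  rewrite (_ : _ - _ = (F (hi i) - F (lo i)) + c * (G (hi i) - G (lo i))); last by ring.
  rewrite (le_trans (ler_normD _ _))// lerD2l normrM ler_wpM2r// lerDl ler01//.
rewrite big_split /= -mulr_sumr; rewrite ltr_pdivlMr// mulrC in K2; lra.
Qed.

Lemma ac_lip a b F (f : R -> R) (K : R) :
  (forall x y, a <= x <= b -> a <= y <= b ->
     `|f (F x) - f (F y)| <= K * `|F x - F y|) ->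
  absolutely_continuous_on a b F -> absolutely_continuous_on a b (f \o F).
Proof.
move=> lip HF e e0.
have K0 : 0 < `|K| + 1 by have := normr_ge0 K; lra.
have [d1 d10 K1] := HF _ (divr_gt0 e0 K0).
exists d1 => // n lo hi lh tr s; have {}K1 := K1 _ _ _ lh tr s.
apply: (@le_lt_trans _ _ ((`|K| + 1) * \sum_i `|F (hi i) - F (lo i)|)).
  rewrite mulr_sumr; apply: ler_sum => i _ /=; have [h1 [h2 h3]] := lh i.
  rewrite (le_trans (lip _ _ _ _))//; try by apply/andP; split; lra.
  by rewrite ler_wpM2r// (le_trans (ler_norm K))// lerDl ler01.
by rewrite mulrC -ltr_pdivlMr.
Qed.

Lemma ac_mul a b F G (K : R) :
  (forall x, a <= x <= b -> `|F x| <= K) -> (forall x, a <= x <= b -> `|G x| <= K) ->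
  absolutely_continuous_on a b F -> absolutely_continuous_on a b G ->
  absolutely_continuous_on a b (fun x => F x * G x).
Proof.
move=> FK GK HF HG e e0.
have K0 : 0 < 2 * (`|K| + 1) by have := normr_ge0 K; lra.
have [d1 d10 K1] := HF _ (divr_gt0 e0 K0).
have [d2 d20 K2] := HG _ (divr_gt0 e0 K0).
exists (Num.min d1 d2); first by rewrite lt_min d10.
move=> n lo hi lh tr; rewrite lt_min => /andP[s1 s2].
have {}K1 := K1 _ _ _ lh tr s1; have {}K2 := K2 _ _ _ lh tr s2.
apply: (@le_lt_trans _ _ (\sum_i (`|K| + 1) * (`|F (hi i) - F (lo i)| + `|G (hi i) - G (lo i)|))).
  apply: ler_sum => i _; have [h1 [h2 h3]] := lh i.
  rewrite (_ : _ - _ = (F (hi i) - F (lo i)) * G (hi i) + F (lo i) * (G (hi i) - G (lo i))); last by ring.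
  rewrite (le_trans (ler_normD _ _))// [leRHS]mulrDr lerD// normrM; last first.
    rewrite ler_wpM2r// (le_trans (FK _ _)) //; first by apply/andP; split; lra.
    by rewrite (le_trans (ler_norm K))// lerDl.
  rewrite mulrC ler_wpM2r// (le_trans (GK _ _)) //; first by apply/andP; split; lra.
  by rewrite (le_trans (ler_norm K))// lerDl.
rewrite -mulr_sumr big_split /=.
have : 0 < `|K| + 1 by have := normr_ge0 K; lra.
rewrite ltr_pdivlMr// in K1; rewrite ltr_pdivlMr// in K2.
lra.
Qed.

Lemma leb_oo (lo hi : R) : lo <= hi -> (leb `]lo, hi[ = (hi - lo)%:E)%E.
Proof.
move=> lh; rewrite lebesgue_measure_itv /= lte_fin; case: ltP => // hl.
by have -> : hi = lo; [apply/eqP; rewrite eq_le lh hl|rewrite subrr].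
Qed.

Lemma leb_cc (lo hi : R) : lo <= hi -> (leb `[lo, hi] = (hi - lo)%:E)%E.
Proof.
move=> lh; rewrite lebesgue_measure_itv /= lte_fin; case: ltP => // hl.
by have -> : hi = lo; [apply/eqP; rewrite eq_le lh hl|rewrite subrr].
Qed.

Lemma set_of_set (A : set R) : [set` A] = A.
Proof. by apply/seteqP; split=> x; rewrite /= inE. Qed.

Lemma leb_bigU (n : nat) (lo hi : 'I_n -> R) : (forall i, lo i <= hi i) ->
  trivIset [set: 'I_n] (fun i => `]lo i, hi i[%classic) ->
  (leb (\big[setU/set0]_(i < n) `]lo i, hi i[%classic) = (\sum_i (hi i - lo i))%:E)%E.
Proof.
move=> lh tr; rewrite measure_bigsetU_ord; try done.
by rewrite -sumEFin; apply: eq_bigr => i _; exact: leb_oo (lh i).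
Qed.

Lemma sum_disjoint_itv_le (n : nat) (lo hi : 'I_n -> R) (O : set R) :
  measurable O -> (forall i, lo i <= hi i) ->
  trivIset [set: 'I_n] (fun i => `]lo i, hi i[%classic) ->
  (forall i, `]lo i, hi i[%classic `<=` O) ->
  ((\sum_i (hi i - lo i))%:E <= leb O)%E.
Proof.
move=> mO lh tr sub.
have -> : (\sum_i (hi i - lo i))%:E = leb (\big[setU/set0]_(i < n) `]lo i, hi i[%classic).
  by rewrite leb_bigU.
apply: le_measure; rewrite ?inE//; first exact: bigsetU_measurable.
apply: (big_ind (fun X : set R => X `<=` O)); first exact: sub0set.
  by move=> A B AO BO x [/AO|/BO].
by move=> i _; exact: sub.
Qed.

(** This is absolute continuity of the integral with respect to the measure, applied
to the union of the intervals. *)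
Lemma ac_indef a b (g : R -> R) : leb.-integrable `[a, b] (EFin \o g) ->
  absolutely_continuous_on a b (fun x => \int[leb]_(t in `[a, x]) g t).
Proof.
move=> ig e e0.
pose gT := (g \_ `[a, b] : R -> R).
have igT : leb.-integrable setT (EFin \o gT).
  rewrite /gT -restrict_EFin.
  by apply: (iffLR (integrable_mkcond _ _)).
have [dl [dl0 H]] := integral_normr_continuous igT e0.
exists dl => // n lo hi lh tr s.
have {}tr : trivIset [set: 'I_n] (fun i => `]lo i, hi i[%classic).
  by move: tr; congr trivIset; apply/funext => i; rewrite set_of_set.
pose A := \big[setU/set0]_(i < n) `]lo i, hi i[%classic.
have mA : measurable A by exact: bigsetU_measurable.
have leA : (leb A = (\sum_i (hi i - lo i))%:E)%E.
  by apply: leb_bigU => // i; have [h1 [h2 h3]] := lh i.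
have leA' : (leb A < dl%:E)%E by rewrite leA lte_fin.
have := H A mA leA'; apply: le_lt_trans.
have -> : \int[leb]_(x in A) `|gT x| = \sum_i \int[leb]_(x in `]lo i, hi i[) `|gT x|.
  rewrite /Rintegral /A ge0_integral_bigsetU//; last 3 first.
  - exact: index_enum_uniq.
  - by move=> i k _ _; exact: tr.
  - apply/measurable_EFinP; apply: measurable_funTS.
    by apply: measurableT_comp => //; case/integrableP : igT => /measurable_EFinP.
  rewrite sum_fine// => i _; apply: integrable_fin_num => //.
  apply: integrableS (measurableT) _ _ _ => //.
  exact: (integrable_abse igT).
apply: ler_sum => i _; have [h1 [h2 h3]] := lh i.
have ig2 (x : R) : x <= b -> leb.-integrable `[a, x] (EFin \o g).
  move=> xb; apply: integrableS ig => //.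
  by apply: subset_itvl; rewrite bnd_simp.
rewrite Rintegral_itvB//; try exact: ig2; try by rewrite bnd_simp.
rewrite -Rintegral_itv_bndo_bndc; last first.
  apply: integrableS ig => //; move=> x /=; rewrite !in_itv /= => /andP[u v].
  by apply/andP; split; lra.
have -> : \int[leb]_(x in `]lo i, hi i[) g x = \int[leb]_(x in `]lo i, hi i[) gT x.
  apply: eq_Rintegral => x; rewrite inE /= in_itv /= => /andP[u v].
  by rewrite /gT patchE mem_set//= in_itv /=; apply/andP; split; lra.
apply: le_normr_Rintegral => //.
exact: integrableS igT.
Qed.

(** The set of those [x] up to which the increment of [H] is at most
[e1 (x - a)] plus the oscillation of [H] over disjoint intervals inside [V] is
shown to reach [b] by looking at its supremum; here [V] is an open
neighbourhood of small measure of the points where [H] is not known to have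
derivative 0. At any other point the derivative 0 advances the bound with slope
[e1]; at a point of [V] one more interval is collected, and absolute continuity
bounds the total oscillation over the collected intervals. *)
Lemma ac_derive0_const a b H : a <= b -> absolutely_continuous_on a b H ->
  {ae leb, forall t, t \in `]a, b[ -> is_derive t 1 H 0} -> H b = H a.
Proof.
move=> ab acH [N0 [mN0 N00 subN]].
suff Heps : forall e, 0 < e -> `|H b - H a| <= e.
  apply/eqP; rewrite -subr_eq0 -normr_le0; apply/ler_addgt0Pl => e e0.
  by rewrite addr0; exact: Heps.
move=> e e0.
pose e1 := e / 2 / (b - a + 1).
have ba1 : 0 < b - a + 1 by lra.
have e10 : 0 < e1 by rewrite !divr_gt0.
have [dl dl0 acd] := acH _ (divr_gt0 e0 (ltr0Sn R 1)).
(* The derivative is only known in the open interval, so the end points join the null set. *)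
pose N := N0 `|` ([set a] `|` [set b]).
have mN : measurable N by apply: measurableU => //; apply: measurableU.
have N_0 : leb N = 0%E.
  apply: null_set_setU => //; first exact: measurableU.
  apply: null_set_setU => //; exact: lebesgue_measure_set1.
have [V [oO NO leO]] : exists U : set R, [/\ open U, N `<=` U & (leb (U `\` N) < dl%:E)%E].
  by apply: lebesgue_regularity_outer => //; rewrite [X in (X < _)%E]N_0.
have mO : measurable V by exact: open_measurable.
have {}leO : (leb V < dl%:E)%E.
  apply: le_lt_trans leO; rewrite -[X in (_ <= X)%E]add0e -[X in (_ <= X + _)%E]N_0.
  apply: le_trans (measureU2 _ _ _) => //; last exact: measurableD.
  by apply: le_measure; rewrite ?inE//; [apply: measurableU => //; exact: measurableD|rewrite setUDr setDv setD0 //; exact: subsetUr].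
have gauge t : a <= t <= b -> exists2 r, 0 < r &
    (forall y, `|y - t| < r -> `|H y - H t| <= e1 * `|y - t|) \/
    (forall y, `|y - t| < r -> V y).
  move=> /andP[ta tb]; have [Nt|Nt] := pselect (N t).
    have /NO Ot := Nt; have := oO; rewrite openE => /(_ _ Ot) [r /= r0 rO].
    by exists r => //; right => y yt; apply: rO; rewrite /ball /= distrC.
  have [r r0 K] : exists2 r, 0 < r & forall y, `|y - t| < r -> `|H y - H t - 0 * (y - t)| <= e1 * `|y - t|.
    have /is_deriveP1 : is_derive t 1 H 0; last exact.
    apply: contrapT => nd; apply: (Nt); left; apply: subN => /= K; apply: nd; apply: K.
    rewrite inE /= in_itv /=; apply/andP; split; rewrite lt_neqAle ?ta ?tb andbT.
      by apply/eqP => at_; apply: Nt; right; left; rewrite at_.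
    by apply/eqP => at_; apply: Nt; right; right; rewrite at_.
  exists r => //; left => y /K; rewrite mul0r subr0 //.
pose good (s : seq (R * R)) x := [/\ pairwise (fun p q => p.2 <= q.1) s,
  forall p, p \in s -> [/\ a <= p.1, p.1 <= p.2, p.2 <= x & (`]p.1, p.2[ `<=` V)] &
  `|H x - H a| <= e1 * (x - a) + \sum_(p <- s) `|H p.2 - H p.1| ].
pose S := [set x | a <= x <= b /\ exists s, good s x].
have Sa : S a.
  split; first by rewrite lexx.
  by exists [::]; split => //; rewrite big_nil !subrr normr0 mulr0 addr0.
have Sb : ubound S b by move=> x [/andP[]].
have supS : has_sup S by split; [exists a|exists b].
pose c := sup S.
have ac : a <= c by apply: sup_upper_bound.
have cb : c <= b by apply: sup_le_ub => //; exists a.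
(* The bound passes from a point just left of [c] to any point just right of it. *)
have step (r x' y : R) : 0 < r -> S x' -> x' <= c -> c <= y -> c - r < x' -> y < c + r -> y <= b ->
    ((forall z, `|z - c| < r -> `|H z - H c| <= e1 * `|z - c|) \/
     (forall z, `|z - c| < r -> V z)) -> S y.
  move=> r0 [/andP[ax xb] [s [ps sO Hs]]] xc cy rx yr yb K.
  have ay : a <= y by lra.
  split; first by rewrite ay yb.
  case: K => K.
    exists s; split => //.
      by move=> p /sO[h1 h2 h3 h4]; split => //; lra.
    have K1 : `|H y - H c| <= e1 * (y - c).
      have := K y; rewrite ger0_norm ?subr_ge0//; apply; lra.
    have K2 : `|H x' - H c| <= e1 * (c - x').
      have := K x'; rewrite distrC ger0_norm ?subr_ge0//; apply; lra.
    have -> : H y - H a = (H y - H c) - (H x' - H c) + (H x' - H a) by ring.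
    rewrite (le_trans (ler_normD _ _))//.
    have := ler_normB (H y - H c) (H x' - H c); lra.
  exists (rcons s (x', y)); split.
  - rewrite pairwise_rcons ps andbT; apply/allP => p /sO[] //.
  - move=> p; rewrite mem_rcons inE => /orP[/eqP ->|/sO[h1 h2 h3 h4]] /=.
      split => //; first lra.
      move=> z /=; rewrite in_itv /= => /andP[z1 z2]; apply: K.
      by rewrite ltr_norml; apply/andP; split; lra.
    by split => //; lra.
  - rewrite -cats1 big_cat /= big_seq1 /=.
    have -> : H y - H a = (H x' - H a) + (H y - H x') by ring.
    rewrite (le_trans (ler_normD _ _))//.
    have : 0 <= e1 * (y - x') by apply: mulr_ge0; lra.
    lra.
have Sbb : S b.
  have [r r0 K] : exists2 r, 0 < r & (forall y, `|y - c| < r -> `|H y - H c| <= e1 * `|y - c|) \/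
    (forall y, `|y - c| < r -> V y) by apply: gauge; rewrite ac cb.
  have [x' Sx' cx'] := sup_adherent r0 supS.
  have x'c : x' <= c by exact: sup_upper_bound.
  have [cb'|bc] := ltP c b; last first.
    have E : c = b by apply/eqP; rewrite eq_le cb bc.
    rewrite -E; apply: (step r x' c) => //; lra.
  pose y := Num.min b (c + r / 2).
  have yb : y <= b by rewrite /y ge_min lexx.
  have yc : y <= c + r / 2 by rewrite /y ge_min lexx orbT.
  have cy : c < y by rewrite /y lt_min cb' ltrDl divr_gt0.
  have Sy : S y by apply: (step r x' y) => //; lra.
  have : y <= c by exact: sup_upper_bound.
  lra.
have [_ [s [ps sO Hs]]] := Sbb.
have := acd (size s) (fun i => (nth (0, 0) s i).1) (fun i => (nth (0, 0) s i).2).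
have sn (i : 'I_(size s)) : nth (0, 0) s i \in s by exact: mem_nth.
have ps' := elimT (pairwiseP (0, 0)) ps.
have tr : trivIset [set: 'I_(size s)]
   (fun i => [set` `](nth (0, 0) s i).1, (nth (0, 0) s i).2[]).
  move=> i k _ _ [z [/=]]; rewrite !inE /= !in_itv /= => /andP[z1 z2] /andP[z3 z4].
  apply/val_inj/eqP; rewrite eq_le /= !leNgt; apply/andP; split; apply/negP => ik.
    by have := ps' k i; rewrite !inE /= => /(_ (ltn_ord _) (ltn_ord _) ik); lra.
  by have := ps' i k; rewrite !inE /= => /(_ (ltn_ord _) (ltn_ord _) ik); lra.
move=> /(_ _ tr) acd'.
have {acd'} : \sum_(i < size s) `|H (nth (0, 0) s i).2 - H (nth (0, 0) s i).1| < e / 2.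
  apply: acd'.
    by move=> i; have [h1 h2 h3 _] := sO _ (sn i).
  rewrite -lte_fin; apply: le_lt_trans leO; apply: sum_disjoint_itv_le => //.
    by move=> i; have [h1 h2 h3 _] := sO _ (sn i).
    by move: tr; congr trivIset; apply/funext => i; rewrite set_of_set.
  by move=> i; have [h1 h2 h3 ] := sO _ (sn i).
rewrite (big_nth (0, 0)) big_mkord in Hs.
have : e1 * (b - a) <= e / 2.
  rewrite /e1 mulrAC ler_pdivrMr// ler_wpM2l//; [by rewrite divr_ge0// ltW|lra].
lra.
Qed.

End AbsolutelyContinuous.

(** * Indefinite integrals *)

Section IndefiniteIntegral.
Context {R : realType}.
Local Notation leb := (@lebesgue_measure R).
Implicit Types (a b : R) (q p : R -> R).

(** [q] is absolutely continuous with derivative [p] almost everywhere, encoded by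
the integral formula. *)
Definition indef a b q p := leb.-integrable `[a, b] (EFin \o p) /\
  forall x, a <= x <= b -> q x = q a + \int[leb]_(t in `[a, x]) p t.

Lemma itvcc_sub a b a' b' : a <= a' -> b' <= b -> `[a', b']%classic `<=` `[a, b]%classic.
Proof.
move=> aa bb x /=; rewrite !in_itv /= => /andP[u v]; apply/andP; split.
  exact: le_trans u.
exact: le_trans bb.
Qed.

Lemma integrable_cc_sub a b a' b' (f : R -> R) : a <= a' -> b' <= b ->
  leb.-integrable `[a, b] (EFin \o f) -> leb.-integrable `[a', b'] (EFin \o f).
Proof. by move=> aa bb; apply: integrableS => //; exact: itvcc_sub. Qed.

Lemma is_derive_local a b F G (t l : R) : (forall y, a < y < b -> F y = G y) ->
  a < t < b -> is_derive t 1 F l -> is_derive t 1 G l.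
Proof.
move=> FG /andP[at_ tb] /is_deriveP1 H; apply/is_deriveP1 => e e0.
have [r r0 K] := H _ e0.
exists (Num.min r (Num.min (t - a) (b - t))).
  by rewrite !lt_min r0 !subr_gt0 at_.
move=> y; rewrite !lt_min => /and3P[yr ya yb].
have yab : a < y < b.
  move: ya yb; rewrite !ltr_norml => /andP[u1 u2] /andP[u3 u4].
  by apply/andP; split; lra.
rewrite -!FG ?at_// ?yab//; exact: K.
Qed.

Lemma indef_derive a b q p : indef a b q p ->
  {ae leb, forall t, t \in `]a, b[ -> is_derive t 1 q (p t)}.
Proof.
move=> [ip qE].
pose pT := (p \_ `[a, b] : R -> R).
have ipT : leb.-integrable setT (EFin \o pT).
  rewrite /pT -restrict_EFin.
  by apply: (iffLR (integrable_mkcond _ _)).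
have ipy (y : R) : leb.-integrable [set` Interval (BLeft a) (BRight y)] (EFin \o pT).
  by apply: integrableS ipT.
have loc : locally_integrable [set: R] pT.
  by apply: open_integrable_locally => //; exact: openT.
have := FTC1 ipy loc; apply: ae_imply => t H.
rewrite inE /= in_itv /= => /andP[at_ tb].
have [|dG EG] := H.
  exact: at_.
have dG' : is_derive t 1 (fun x => \int[leb]_(t in [set` Interval (BLeft a) (BRight x)]) pT t) (p t).
  split => //; rewrite -derive1E EG /pT patchE mem_set//= in_itv /=.
  by rewrite !ltW.
have dG2 : is_derive t 1 (fun x => q a + \int[leb]_(t in [set` Interval (BLeft a) (BRight x)]) pT t) (p t).
  by have := is_deriveD (is_derive_cst (q a) t 1) dG'; rewrite add0r.
apply: (@is_derive_local a b _ _ _ _ _ _ dG2); last by rewrite at_.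
move=> y /andP[ay yb] /=; rewrite [RHS]qE ?ltW//; congr (q a + _).
apply: eq_Rintegral => x; rewrite inE /= in_itv /= => /andP[u v].
by rewrite /pT patchE mem_set//= in_itv /= u/=; lra.
Qed.

Lemma ac_congr a b F G : (forall x, a <= x <= b -> F x = G x) ->
  absolutely_continuous_on a b F -> absolutely_continuous_on a b G.
Proof.
move=> FG H e /H[dl dl0 K]; exists dl => // n lo hi lh tr /(K _ _ _ lh tr).
congr (_ < _); apply: eq_bigr => i _; have [h1 [h2 h3]] := lh i.
by rewrite !FG//; apply/andP; split => //; [exact: le_trans h3|exact: le_trans h2].
Qed.

Lemma ac_cst a b (c : R) : absolutely_continuous_on a b (fun=> c).
Proof.
move=> e e0; exists 1 => // n lo hi _ _ _; rewrite big1// => i _.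
by rewrite subrr normr0.
Qed.

Lemma indef_ac a b q p : indef a b q p -> absolutely_continuous_on a b q.
Proof.
move=> [ip qE]; have := ac_lin 1 (ac_cst a b (q a)) (ac_indef ip).
by apply: ac_congr => x xab; rewrite mul1r [RHS]qE.
Qed.

(** The difference of [F] and the indefinite integral of [g] is absolutely continuous
and has derivative 0 almost everywhere. *)
Lemma ac_ftc a b F g : a <= b -> absolutely_continuous_on a b F ->
  leb.-integrable `[a, b] (EFin \o g) ->
  {ae leb, forall t, t \in `]a, b[ -> is_derive t 1 F (g t)} ->
  F b - F a = \int[leb]_(t in `[a, b]) g t.
Proof.
move=> ab acF ig dF.
pose G x := \int[leb]_(t in `[a, x]) g t.
have iG : indef a b G g.
  split => // x xab; suff -> : G a = 0 by rewrite add0r.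
  by rewrite /G set_itv1 Rintegral_set1.
have : (fun x => F x + (-1) * G x) b = (fun x => F x + (-1) * G x) a.
  apply: (@ac_derive0_const _ a b (fun x => F x + (-1) * G x) ab); first by apply: ac_lin => //; exact: indef_ac iG.
  have := indef_derive iG; apply: (ae_imply2 _ dF) => t H1 H2 tab.
  have := is_deriveB (H1 tab) (H2 tab); rewrite subrr.
  by congr is_derive; apply/funext => x; rewrite /= mulN1r.
rewrite /= !mulN1r => E.
have E2 : F b - F a = G b - G a by lra.
by rewrite E2 /G set_itv1 Rintegral_set1 subr0.
Qed.

Lemma indefP a b F g : absolutely_continuous_on a b F ->
  leb.-integrable `[a, b] (EFin \o g) ->
  {ae leb, forall t, t \in `]a, b[ -> is_derive t 1 F (g t)} -> indef a b F g.
Proof.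
move=> acF ig dF; split => // x /andP[ax xb].
rewrite -(@ac_ftc a x F g) ?ax//.
- by rewrite addrC subrK.
- exact: ac_sub acF.
- exact: integrable_cc_sub ig.
apply: (ae_imply _ dF) => t H; rewrite inE /= in_itv /= => /andP[u v]; apply: H.
by rewrite inE /= in_itv /= u (lt_le_trans v xb).
Qed.

Lemma indef_sub a b q p a' b' : indef a b q p -> a <= a' -> a' <= b' -> b' <= b ->
  indef a' b' q p.
Proof.
move=> H aa ab bb; apply: indefP.
- exact: ac_sub aa bb (indef_ac H).
- exact: integrable_cc_sub (H.1).
apply: (ae_imply _ (indef_derive H)) => t K; rewrite inE /= in_itv /= => /andP[u v].
by apply: K; rewrite inE /= in_itv /= (le_lt_trans aa u) (lt_le_trans v bb).
Qed.

Lemma indef_incr a b q p x y : indef a b q p -> a <= x -> x <= y -> y <= b ->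
  q y - q x = \int[leb]_(t in `[x, y]) p t.
Proof.
move=> H ax xy yb; have [_ ->] := indef_sub H ax xy yb; last by rewrite xy lexx.
by rewrite addrC addKr.
Qed.

Lemma indef_continuous a b q p : a <= b -> indef a b q p ->
  {within `[a, b], continuous q}.
Proof.
move=> ab [ip qE].
have c : {within `[a, b], continuous (fun x => q a + \int[leb]_(t in `[a, x]) p t)}.
  have := parameterized_integral_continuous ab ip.
  move=> H x; apply: cvgD; [exact: cvg_cst|exact: H].
apply: subspace_eq_continuous c => x; rewrite inE => xab.
by rewrite [RHS]qE//; move: xab; rewrite /= in_itv.
Qed.

Lemma within_bounded a b q : a <= b -> {within `[a, b], continuous q} ->
  exists2 K : R, 0 <= K & forall x, a <= x <= b -> `|q x| <= K.
Proof.
move=> ab cq.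
have cn : {within `[a, b], continuous (fun x => `|q x|)}.
  by move=> x; apply: continuous_comp; [exact: cq|exact: norm_continuous].
have [c cab H] := EVT_max ab cn; exists `|q c|; first exact: normr_ge0.
by move=> x xab; apply: H; rewrite in_itv.
Qed.

Lemma within_integrable a b q : {within `[a, b], continuous q} ->
  leb.-integrable `[a, b] (EFin \o q).
Proof. by move=> c; apply: continuous_compact_integrable => //; exact: segment_compact. Qed.

Lemma within_measurable a b q : {within `[a, b], continuous q} ->
  measurable_fun `[a, b] q.
Proof. by move=> /within_integrable/integrableP[/measurable_EFinP]. Qed.

Lemma indef_mul a b q p q' p' : a <= b -> indef a b q p -> indef a b q' p' ->
  indef a b (fun x => q x * q' x) (fun x => p x * q' x + q x * p' x).
Proof.
move=> ab H H'.
have [K K0 qK] := within_bounded ab (indef_continuous ab H).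
have [K' K0' qK'] := within_bounded ab (indef_continuous ab H').
have [mp mp'] : measurable_fun `[a, b] p /\ measurable_fun `[a, b] p'.
  by split; [case: H|case: H'] => /integrableP[/measurable_EFinP].
have mq := within_measurable (indef_continuous ab H).
have mq' := within_measurable (indef_continuous ab H').
have itv x : `[a, b]%classic x -> a <= x <= b by rewrite /= in_itv.
apply: indefP.
- apply: (@ac_mul _ a b _ _ (Num.max K K')); [| |exact: indef_ac H|exact: indef_ac H'].
  + by move=> x /qK h; rewrite le_max h.
  + by move=> x /qK' h; rewrite le_max h orbT.
- have mI : measurable (`[a, b]%classic : set R) by exact: measurable_itv.
  have i1 := RintZ (mu := leb) K' mI (RintNorm (mu := leb) mI H.1).
  have i2 := RintZ (mu := leb) K mI (RintNorm (mu := leb) mI H'.1).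
  have := RintD (mu := leb) mI i1 i2.
  move=> ig; apply: (dom_integrable (mu := leb) mI _ ig).
    by apply: measurable_funD; apply: measurable_funM.
  move=> x /itv xab; rewrite (le_trans (ler_normD _ _))// !normrM.
  by rewrite lerD// ?ler_wpM2r// ?qK// mulrC ler_wpM2r ?qK'.
apply: (ae_imply2 _ (indef_derive H) (indef_derive H')) => t H1 H2 tab.
apply: is_derive_eq (is_deriveM (H1 tab) (H2 tab)) _.
by rewrite /GRing.scale /= addrC mulrC.
Qed.

Lemma is_derive_lip (Psi psi : R -> R) (A B K : R) :
  (forall y, A <= y <= B -> is_derive y 1 Psi (psi y)) ->
  (forall y, A <= y <= B -> `|psi y| <= K) ->
  forall x y, A <= x <= B -> A <= y <= B -> `|Psi x - Psi y| <= K * `|x - y|.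
Proof.
move=> dP bK x y.
wlog yx : x y / y <= x.
  move=> W xAB yAB; have [h|h] := leP y x; first exact: W.
  by rewrite distrC (distrC x) W// ltW.
move=> /andP[Ax xB] /andP[Ay yB].
have [| |c] := @MVT_segment _ Psi psi y x yx.
- move=> z; rewrite in_itv /= => /andP[u v]; apply: dP; apply/andP; split; lra.
- apply: derivable_within_continuous => z; rewrite in_itv /= => /andP[u v].
  by have [] : is_derive z 1 Psi (psi z) by apply: dP; apply/andP; split; lra.
rewrite in_itv /= => /andP[u v] ->; rewrite normrM ler_wpM2r// bK//.
by apply/andP; split; lra.
Qed.

Lemma indef_comp a b q p (Psi psi : R -> R) : a <= b -> indef a b q p ->
  (forall y : R, is_derive y 1 Psi (psi y)) -> continuous psi ->
  indef a b (Psi \o q) (fun x => psi (q x) * p x).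
Proof.
move=> ab H dP cpsi.
have cq := indef_continuous ab H.
have [K K0 qK] := within_bounded ab cq.
have KK : - K <= K by lra.
have [L L0 pL] := within_bounded KK (continuous_subspaceT cpsi).
have mp : measurable_fun `[a, b] p by case: H => /integrableP[/measurable_EFinP].
have mq := within_measurable cq.
apply: indefP.
- apply: (@ac_lip _ a b q Psi L); last exact: indef_ac H.
  move=> x y /qK; rewrite ler_norml => hx /qK; rewrite ler_norml => hy.
  exact: (@is_derive_lip Psi psi (- K) K L).
- have mI : measurable (`[a, b]%classic : set R) by exact: measurable_itv.
  have := RintZ (mu := leb) L mI (RintNorm (mu := leb) mI H.1).
  move=> ig; apply: (dom_integrable (mu := leb) mI _ ig).
    apply: measurable_funM => //.
    by apply: (measurableT_comp (f := psi)) => //; exact: continuous_measurable_fun.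
  move=> x /=; rewrite in_itv /= => /qK; rewrite ler_norml => hx.
  by rewrite normrM ler_wpM2r// pL.
apply: (ae_imply _ (indef_derive H)) => t H1 tab.
have := H1 tab; exact: is_derive1_comp.
Qed.

Lemma indef_C1 a b (f f' : R -> R) : a <= b -> (forall x : R, is_derive x 1 f (f' x)) ->
  continuous f' -> indef a b f f'.
Proof.
move=> ab df cf'.
have [L L0 pL] := within_bounded ab (continuous_subspaceT cf').
apply: indefP.
- apply: (@ac_congr _ _ (f \o id)) => //.
  apply: (@ac_lip _ a b id f L).
    by move=> x y xab yab; apply: (@is_derive_lip f f' a b L).
  move=> e e0; exists e => // n lo hi lh _ s; rewrite (eq_bigr (fun i => hi i - lo i))// => i _.
  by rewrite ger0_norm// subr_ge0; have [_ []] := lh i.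
- by apply: within_integrable; exact: continuous_subspaceT.
by apply: aeW => t _.
Qed.

End IndefiniteIntegral.

(** * Weak derivatives on an interval *)

Section Bumps.
Context {R : realType}.
Local Notation leb := (@lebesgue_measure R).

(** The family is closed under differentiation ([flat_derive]), so all derivatives
of [expR (- x^-1)], extended by 0, are obtained at once. *)
Definition flat (k : nat) (x : R) : R := if 0 < x then x^-1 ^+ k * expR (- x^-1) else 0.

Lemma flat_ge0 k x : 0 <= flat k x.
Proof.
rewrite /flat; case: ifPn => // x0.
by rewrite mulr_ge0// ?expR_ge0// exprn_ge0// invr_ge0 ltW.
Qed.

(** The quadratic bound is what makes every member differentiable at 0. *)
Lemma flat_le k x : flat k x <= k.+2`!%:R * x ^+ 2.
Proof.
rewrite /flat; case: ifPn => x0; last by rewrite mulr_ge0// sqr_ge0.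
set t := x^-1; have t0 : 0 < t by rewrite invr_gt0.
have := expR_ge1Dxn k.+1 (ltW t0).
set F := k.+2`!%:R; have F0 : 0 < F by rewrite ltr0n fact_gt0.
move=> H.
have {}H : t ^+ k.+2 <= F * expR t.
  have : t ^+ k.+2 / F <= expR t by lra.
  by rewrite ler_pdivrMr// mulrC.
have -> : x = t^-1 by rewrite invrK.
have -> : F * t^-1 ^+ 2 = F / t ^+ 2 by rewrite exprVn.
rewrite ler_pdivlMr ?exprn_gt0// expRN mulrAC ler_pdivrMr ?expR_gt0//.
by rewrite -exprD addn2.
Qed.

Lemma flat_derive (k : nat) (x : R) :
  is_derive x 1 (flat k) (flat k.+2 x - k%:R * flat k.+1 x).
Proof.
have [x0|x0|<-] := ltgtP 0 x.
- have d1 : is_derive x 1 (fun y => y^-1) (- x^-1 ^+ 2).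
    apply: is_derive_eq; first by apply: is_deriveV; rewrite gt_eqF.
    by rewrite /GRing.scale /= mulr1 exprVn.
  have d2 : is_derive x 1 (fun y => expR (- y^-1)) (expR (- x^-1) * x^-1 ^+ 2).
    apply: is_derive_eq.
    by rewrite opprK.
  have dX : is_derive x 1 (fun y => y^-1 ^+ k) (- (k%:R * x^-1 ^+ k.+1)).
    elim: k => [|k IH].
      rewrite mul0r oppr0; have := is_derive_cst (1 : R) x 1.
      by congr is_derive; apply/funext => y; rewrite expr0.
    have -> : (fun y : R => y^-1 ^+ k.+1) = (fun y => y^-1 * y^-1 ^+ k).
      by apply/funext => y; rewrite exprS.
    apply: (is_derive_eq (is_deriveM d1 IH)).
    by rewrite /GRing.scale /= !exprS -[k.+1%:R]natr1; ring.
  have d3 : is_derive x 1 (fun y => y^-1 ^+ k * expR (- y^-1))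
      (flat k.+2 x - k%:R * flat k.+1 x).
    apply: (is_derive_eq (is_deriveM dX d2)); rewrite /GRing.scale /= /flat x0.
    by rewrite !exprS; ring.
  apply: (@is_derive_local _ 0 (x + 1) _ _ _ _ _ _ d3); last by rewrite x0 ltrDl ltr01.
  by move=> y /andP[y0 _]; rewrite /flat y0.
- rewrite /flat !ltNge !ltW//= mulr0 subr0.
  apply: (@is_derive_local _ (x - 1) 0 (cst 0)); last by rewrite x0 andbT ltrBlDr ltrDl ltr01.
  by move=> y /andP[_ y0]; rewrite /flat ltNge ltW.
rewrite /flat ltxx mulr0 subr0; apply/is_deriveP1 => e e0.
have F0 : 0 < k.+2`!%:R :> R by rewrite ltr0n fact_gt0.
exists (e / k.+2`!%:R); first by rewrite divr_gt0.
move=> y; rewrite ltxx !subr0 mul0r subr0 => ye.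
rewrite ger0_norm; last exact: flat_ge0.
apply: (le_trans (flat_le _ _)); rewrite -real_normK ?num_real// expr2 mulrA.
by rewrite ler_wpM2r// mulrC -ler_pdivlMr// ltW.
Qed.

(** A syntactic class closed under derivation; membership yields derivatives of all
orders without handling iterated derivatives of products. *)
Inductive smooth : (R -> R) -> Prop :=
| smooth_flat k c d : smooth (fun x => flat k (c * x + d))
| smooth_mul f g : smooth f -> smooth g -> smooth (fun x => f x * g x)
| smooth_add f g : smooth f -> smooth g -> smooth (fun x => f x + g x)
| smooth_scale c f : smooth f -> smooth (fun x => c * f x).

Lemma smooth_derive f : smooth f ->
  exists2 f', smooth f' & forall x : R, is_derive x 1 f (f' x).
Proof.
elim => [k c d|{}f g sf [f' sf' df] sg [g' sg' dg]|{}f g sf [f' sf' df] sg [g' sg' dg]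
  |c {}f sf [f' sf' df]].
- exists (fun x => c * (flat k.+2 (c * x + d) + (- k%:R) * flat k.+1 (c * x + d))).
    by apply: smooth_scale; apply: smooth_add; [|apply: smooth_scale]; exact: smooth_flat.
  move=> x; have := flat_derive k (c * x + d) => df.
  have dl : is_derive x 1 (fun x => c * x + d) c.
    by apply: is_derive_eq; rewrite /GRing.scale /= ?mulr1 ?mulr0 ?addr0 ?add0r.
  have := is_derive1_comp (g := fun x => c * x + d) df dl; rewrite [(_ - _) * c]mulrC mulNr.
  by [].
- exists (fun x => f' x * g x + f x * g' x).
    by apply: smooth_add; exact: smooth_mul.
  move=> x; have dfx := df x; have dgx := dg x.
  by apply: is_derive_eq; rewrite /GRing.scale /= addrC [g x * _]mulrC.
- exists (fun x => f' x + g' x); first exact: smooth_add.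
  by move=> x; have dfx := df x; have dgx := dg x; apply: is_derive_eq.
- exists (fun x => c * f' x); first exact: smooth_scale.
  by move=> x; have dfx := df x; apply: is_derive_eq; rewrite /GRing.scale /= ?mulr0 ?addr0.
Qed.

Lemma derive1_is (f f' : R -> R) : (forall x : R, is_derive x 1 f (f' x)) ->
  (f^`())%classic = f'.
Proof. by move=> df; apply/funext => x; rewrite derive1E; have [_] := df x. Qed.

Lemma smooth_derive1n f n : smooth f -> smooth (f^`(n))%classic.
Proof.
move=> sf; elim: n => [//|n IH]; rewrite derive1nS.
by have [f' sf' /derive1_is ->] := smooth_derive IH.
Qed.

Lemma smooth_derivable f n x : smooth f -> derivable (f^`(n))%classic x 1.
Proof. by move=> sf; have [f' _ /(_ x)[]] := smooth_derive (smooth_derive1n n sf). Qed.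

Lemma is_derive_continuous (f f' : R -> R) :
  (forall x : R, is_derive x 1 f (f' x)) -> continuous f.
Proof.
move=> df x; apply/differentiable_continuous/derivable1_diffP.
by have [] := df x.
Qed.

Lemma smooth_continuous f : smooth f -> continuous f.
Proof. by move=> /smooth_derive[f' _ /is_derive_continuous]. Qed.

(** The rising and falling flanks steepen with [n], so the bumps increase to the
indicator function of [`]a, b[]. *)
Definition bump (a b : R) (n : nat) (x : R) : R :=
  flat 0 (n%:R * x + - n%:R * a) * flat 0 (- n%:R * x + n%:R * b).

Lemma smooth_bump a b n : smooth (bump a b n).
Proof. by apply: smooth_mul; exact: smooth_flat. Qed.

Lemma flat0_itv (x : R) : 0 <= flat 0 x <= 1.
Proof.
rewrite flat_ge0 /flat; case: ifPn => x0; last exact: ler01.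
by rewrite expr0 mul1r expR_le1 oppr_le0 invr_ge0 ltW.
Qed.

Lemma bump_itv a b n x : 0 <= bump a b n x <= 1.
Proof.
have /andP[u0 u1] := flat0_itv (n%:R * x + - n%:R * a).
have /andP[v0 v1] := flat0_itv (- n%:R * x + n%:R * b).
by rewrite mulr_ge0//= -[leRHS]mulr1 ler_pM.
Qed.

Lemma bump_eq0 a b n x : ~ (a < x < b) -> bump a b n x = 0.
Proof.
move=> axb; have n0 : 0 <= n%:R :> R by [].
rewrite /bump /flat; case: ifPn => h1; rewrite ?mul0r//.
case: ifPn => h2; rewrite ?mulr0//; exfalso; apply: axb.
have : 0 < n%:R * (x - a) by lra.
have : 0 < n%:R * (b - x) by lra.
move=> k1 k2; apply/andP; split.
  by rewrite ltNge; apply/negP => h; move: k2; rewrite ltNge mulr_ge0_le0// subr_le0.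
by rewrite ltNge; apply/negP => h; move: k1; rewrite ltNge mulr_ge0_le0// subr_le0.
Qed.

Lemma flat0_cvg (c : R) : 0 < c -> flat 0 (n%:R * c) @[n --> \oo] --> (1 : R).
Proof.
move=> c0.
have H : expR (- (c^-1 * (n.+1%:R)^-1)) @[n --> \oo] --> (1 : R).
  have H0 : - (c^-1 * (n.+1%:R)^-1) @[n --> \oo] --> - (c^-1 * (0 : R)).
    by apply: cvgN; apply: cvgM; [exact: cvg_cst|exact: cvg_harmonic].
  rewrite mulr0 oppr0 in H0.
  by apply: (cvg_comp _ _ H0); rewrite -(@expR0 R); exact: continuous_expR.
rewrite -cvg_shiftS; apply: cvg_trans H; apply: near_eq_cvg; near=> n.
change (expR (- (c^-1 * n.+1%:R^-1)) = flat 0 (n.+1%:R * c)).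
by rewrite /flat mulr_gt0//= expr0 mul1r invfM mulrC.
Unshelve. all: by end_near. Qed.

Lemma bump_cvg a b x : a < x < b -> bump a b n x @[n --> \oo] --> (1 : R).
Proof.
move=> /andP[ax xb]; rewrite -(mulr1 1).
have E n : bump a b n x = flat 0 (n%:R * (x - a)) * flat 0 (n%:R * (b - x)).
  by rewrite /bump; congr (flat _ _ * flat _ _); ring.
under eq_fun do rewrite E.
by apply: cvgM; apply: flat0_cvg; rewrite subr_gt0.
Qed.

Lemma bump_test (Om : set R) a b n : `[a, b]%classic `<=` Om ->
  test_function Om (bump a b n).
Proof.
move=> abO; split; first by move=> k x; apply: smooth_derivable; exact: smooth_bump.
exists `[a, b]%classic; first by split => //; exact: segment_compact.
move=> x xab; apply: bump_eq0 => /andP[u v]; apply: xab.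
by rewrite /= in_itv /= !ltW.
Qed.

Lemma test_continuous Om (phi : R -> R) : test_function Om phi ->
  continuous phi /\ continuous (phi^`())%classic.
Proof.
move=> [d _]; split => x; apply/differentiable_continuous/derivable1_diffP.
  exact: (d 0 x).
exact: (d 1 x).
Qed.

Lemma test_is_derive Om (phi : R -> R) : test_function Om phi ->
  forall x : R, is_derive x 1 phi ((phi^`())%classic x).
Proof. by move=> [d _] x; split; [exact: (d 0 x)|rewrite derive1E]. Qed.

Lemma test_derive_eq0 (phi : R -> R) (K : set R) : compact K ->
  (forall x, ~ K x -> phi x = 0) -> forall x, ~ K x -> (phi^`())%classic x = 0.
Proof.
move=> cK K0 x Kx.
have oK : open (~` K) by apply: closed_openC; apply: compact_closed.
have [r /= r0 rK] : nbhs x (~` K) by apply: open_nbhs_nbhs; split.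
have d0 : is_derive x 1 phi 0.
  apply: (@is_derive_local _ (x - r) (x + r) (cst 0)); last by apply/andP; split; lra.
  move=> y /andP[y1 y2]; rewrite K0//; apply: rK.
  by rewrite /ball /= ltr_norml; apply/andP; split; lra.
by rewrite derive1E; have [_] := d0.
Qed.

Lemma loc_int_test (Om : set R) (g phi : R -> R) (K : set R) :
  locally_integrable Om g -> continuous phi -> compact K -> K `<=` Om ->
  (forall x, ~ K x -> phi x = 0) ->
  leb.-integrable Om (EFin \o (fun x => g x * phi x)).
Proof.
move=> [mg oO Kg] cphi cK KO K0.
have mO : measurable Om by exact: open_measurable.
have mK : measurable K by exact: compact_measurable.
have [M [_ HM]] := compact_bounded (continuous_compact (continuous_subspaceT cphi) cK).
have {}HM x : `|phi x| <= `|M| + 1.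
  have [Kx|Kx] := pselect (K x); last by rewrite K0// normr0.
  by apply: HM; [rewrite (le_lt_trans (ler_norm _))// ltrDl|exists x].
have ig : leb.-integrable K (EFin \o g).
  apply/integrableP; split; last exact: (Kg K).
  by apply/measurable_EFinP; exact: measurable_funS mg.
have ig2 : leb.-integrable Om (EFin \o (fun x => (`|M| + 1) * `|(g \_ K) x|)).
  apply: RintZ => //; apply: RintNorm => //; rewrite -restrict_EFin.
  apply: (@integrableS _ _ _ _ setT) => //.
  by apply: (iffLR (integrable_mkcond _ _)).
apply: (dom_integrable (mu := leb) mO _ ig2).
  by apply: measurable_funM => //; apply: measurable_funTS; exact: continuous_measurable_fun.
move=> x Ox; rewrite normrM mulrC patchE; case: ifPn => xK; first by rewrite ler_wpM2r.
rewrite K0; last by move=> /mem_set; rewrite (negbTE xK).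
by rewrite normr0 mul0r mulr_ge0.
Qed.


Lemma Rint_oo_cc (a b : R) (f : R -> R) : measurable_fun `]a, b[ f ->
  \int[leb]_(x in `]a, b[) f x = \int[leb]_(x in `[a, b]) f x.
Proof.
move=> mf; rewrite /Rintegral; congr fine; apply/esym/integral_itv_bndoo.
exact/measurable_EFinP.
Qed.

Lemma measurable_oo_cc (a b : R) (f : R -> R) :
  measurable_fun `]a, b[ f -> measurable_fun `[a, b] f.
Proof. by move=> mf; apply/measurable_fun_itv_obnd_cbndP/measurable_fun_itv_bndo_bndcP. Qed.

Lemma integrable_oo_cc (a b : R) (f : R -> R) :
  leb.-integrable `]a, b[ (EFin \o f) -> leb.-integrable `[a, b] (EFin \o f).
Proof.
move=> /integrableP[/measurable_EFinP mf fi]; have mf' := measurable_oo_cc mf.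
apply/integrableP; split; first exact/measurable_EFinP.
apply: le_lt_trans fi; rewrite (integral_itv_bndoo (f := fun x => `|(EFin \o f) x|%E))//.
by apply/measurable_EFinP; apply: measurableT_comp.
Qed.

Lemma itv_oo_cc (a b : R) : `]a, b[%classic `<=` `[a, b]%classic.
Proof. by move=> x /=; rewrite !in_itv /= => /andP[/ltW -> /ltW ->]. Qed.

(** As [n] grows the hypothesis becomes that [w] has integral 0 over every
subinterval; a primitive of [w] is then constant, and [w] is its derivative almost
everywhere. *)
Lemma bump_pairing_null_itv (w : R -> R) (c e : R) : c < e ->
  leb.-integrable `[c, e] (EFin \o w) ->
  (forall a b, c <= a -> a < b -> b <= e ->
     forall n, \int[leb]_(x in `[c, e]) (w x * bump a b n x) = 0) ->
  {ae leb, forall x, x \in `]c, e[ -> w x = 0}.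
Proof.
move=> ce iw H.
have mw := Rint_measurable iw.
have I0 a b : c <= a -> a < b -> b <= e -> \int[leb]_(x in `]a, b[) w x = 0.
  move=> ca ab be.
  have [] := @Rintegral_dct _ _ _ leb `[c, e]%classic (fun n x => w x * bump a b n x)
    (fun x => w x * \1_(`]a, b[%classic) x) (fun x => `|w x|).
  - exact: measurable_itv.
  - move=> n; apply: measurable_funM => //; apply: measurable_funTS.
    by apply: continuous_measurable_fun; exact: smooth_continuous (smooth_bump a b n).
  - by apply: measurable_funM => //; apply: measurable_funTS; exact: measurable_indic.
  - apply: aeW => x _; apply: cvgM; first exact: cvg_cst.
    have [xab|xab] := pselect (a < x < b).
      by rewrite indicE mem_set /= ?in_itv //; exact: bump_cvg.
    rewrite indicE memNset /= ?in_itv //.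
    rewrite (_ : (fun n => _) = cst 0); first exact: cvg_cst.
    by apply/funext => n; rewrite bump_eq0.
  - exact: RintNorm.
  - apply: aeW => x _ n; rewrite normrM ler_piMr//.
    by have /andP[u v] := bump_itv a b n x; rewrite ger0_norm.
  move=> _; under eq_fun do rewrite H//.
  move=> C; have E : \int[leb]_(x in `[c, e]) (w x * \1_(`]a, b[%classic) x) = 0.
    by apply: (cvg_unique (@Rhausdorff R) C); exact: cvg_cst.
  rewrite -[RHS]E [LHS]Rintegral_mkcond [RHS]Rintegral_mkcond.
  apply: eq_Rintegral => x _; rewrite !patchE indicE.
  have [xab|xab] := boolP (x \in `]a, b[%classic); rewrite ?mulr1 ?mulr0; last by case: ifP.
  rewrite mem_set//=; move: xab; rewrite inE /= !in_itv /= => /andP[u v].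
  by apply/andP; split; lra.
have iW : indef c e (fun=> 0) w.
  split => // x /andP[cx xe]; rewrite add0r.
  move: cx; rewrite le_eqVlt => /predU1P[<-|cx]; first by rewrite set_itv1 Rintegral_set1.
  rewrite -Rint_oo_cc ?I0//; apply: measurable_funS mw => //.
  by apply: subset_trans (itvcc_sub (lexx c) xe); exact: itv_oo_cc.
apply: ae_imply (indef_derive iW) => x H1 xce.
have [_ <-] := H1 xce; by have [_ ->] := is_derive_cst (0 : R) x 1.
Qed.

Lemma bump_pairing_null (Om : set R) (w : R -> R) : locally_integrable Om w ->
  (forall a b n, `[a, b]%classic `<=` Om -> \int[leb]_(x in Om) (w x * bump a b n x) = 0) ->
  {ae leb, forall x, Om x -> w x = 0}.
Proof.
move=> lw H; have [mw oO wK] := lw.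
have mO : measurable Om by exact: open_measurable.
have Hcd (c e : R) : c < e -> `[c, e]%classic `<=` Om ->
    {ae leb, forall x, x \in `]c, e[ -> w x = 0}.
  move=> ce ceO; apply: bump_pairing_null_itv => //.
    apply/integrableP; split.
      by apply/measurable_EFinP; apply: measurable_funS mw.
    by apply: wK => //; exact: segment_compact.
  move=> a b ca ab be n.
  have abO : `[a, b]%classic `<=` Om.
    by apply: subset_trans ceO; exact: itvcc_sub.
  rewrite -[RHS](H a b n abO) [LHS]Rintegral_mkcond [RHS]Rintegral_mkcond.
  apply: eq_Rintegral => x _; rewrite !patchE.
  have [xab|xab] := pselect (a < x < b); last by rewrite bump_eq0// mulr0; do 2 case: ifP => _.
  have xce : x \in `[c, e]%classic.
    by rewrite inE /= in_itv /=; case/andP: xab => u v; apply/andP; split; lra.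
  by rewrite xce; have /set_mem/ceO/mem_set -> := xce.
pose Q n := if @unpickle (rat * rat)%type n is Some (r, s) then
  (ratr r < ratr s :> R) && `[< `[ratr r, ratr s : R]%classic `<=` Om >] else false.
pose I n : set R := if @unpickle (rat * rat)%type n is Some (r, s) then
  `]ratr r, ratr s[%classic else set0.
have : {ae leb, forall x, forall n, Q n -> I n x -> w x = 0}.
  apply/ae_foralln => n; rewrite /Q /I; case: (unpickle n) => [[r s]|]; last exact: aeW.
  have [rs|rs] := boolP (ratr r < ratr s :> R); last exact: aeW.
  have [rO|rO] := pselect (`[ratr r, ratr s : R]%classic `<=` Om); last first.
    by apply: aeW => x; rewrite andTb => /asboolP.
  by apply: ae_imply (Hcd _ _ rs rO) => x K _ xI; apply: K; rewrite inE.
apply: ae_imply => x K Ox.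
have [r /= r0 rO] : nbhs x Om by apply: open_nbhs_nbhs; split.
have xr : x - r < x by lra.
have xr' : x < x + r by lra.
have [r1] := rat_in_itvoo xr; rewrite in_itv /= => /andP[u1 v1].
have [s1] := rat_in_itvoo xr'; rewrite in_itv /= => /andP[u2 v2].
apply: (K (pickle (r1, s1))); rewrite /Q /I pickleK.
  apply/andP; split; first exact: lt_trans u2.
  apply/asboolP => y /=; rewrite in_itv /= => /andP[h1 h2]; apply: rO.
  by rewrite /ball /= ltr_norml; apply/andP; split; lra.
by rewrite /= in_itv /= v1 u2.
Qed.


Lemma bump_int_gt0 (a b : R) : a < b -> 0 < \int[leb]_(x in `[a, b]) bump a b 1 x.
Proof.
move=> ab; have cb := smooth_continuous (smooth_bump a b 1).
have ib : leb.-integrable `[a, b] (EFin \o bump a b 1).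
  by apply: within_integrable; exact: continuous_subspaceT.
have I0 : 0 <= \int[leb]_(x in `[a, b]) bump a b 1 x.
  by apply: Rintegral_ge0 => x _; have /andP[] := bump_itv a b 1 x.
rewrite lt_neqAle I0 andbT; apply/negP => /eqP E.
have H : ae_eq leb `[a, b] (EFin \o bump a b 1) (cst 0%E).
  apply/ae_eq_integral_abs => //; first by case/integrableP : ib.
  rewrite -[RHS]/((0 : R)%:E) E EFin_Rint//; apply: eq_integral => x _ /=.
  by rewrite ger0_norm//; have /andP[] := bump_itv a b 1 x.
have [N [mN N0 sN]] := H.
have : (leb `]a, b[ <= leb N)%E.
  apply: le_measure; rewrite ?inE//.
  move=> x /=; rewrite in_itv /= => /andP[ax xb]; apply: sN => /=.
  move=> /(_ _); rewrite in_itv /= !ltW// => /(_ isT) [] /eqP.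
  rewrite /bump /flat; case: ifPn; last by move=> /negP []; lra.
  case: ifPn; last by move=> /negP []; lra.
  by move=> _ _; rewrite !expr0 !mul1r mulf_eq0 !gt_eqF ?expR_gt0.
move=> h; have : ((b - a)%:E <= (0 : R)%:E)%E.
  by rewrite -(leb_oo (ltW ab)); apply: (le_trans h); rewrite le_eqVlt; apply/orP; left; apply/eqP.
by rewrite lee_fin subr_le0 leNgt ab.
Qed.

(** [phi] vanishes at 0 and [l], so this is the product rule integrated. *)
Lemma indef_test (l : R) (q p : R -> R) (Om : set R) (phi : R -> R) : 0 < l -> indef 0 l q p ->
  test_function Om phi -> Om `<=` `]0, l[%classic ->
  \int[leb]_(x in `[0, l]) (q x * (phi^`())%classic x) =
  - \int[leb]_(x in `[0, l]) (p x * phi x).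
Proof.
move=> l0 iq tphi Ol; have [cphi cphi'] := test_continuous tphi.
have iphi := indef_C1 (ltW l0) (test_is_derive tphi) cphi'.
have im := indef_mul (ltW l0) iq iphi.
have [K [cK KO] K0] := tphi.2.
have phi0 : phi 0 = 0 by apply: K0 => /KO/Ol /=; rewrite in_itv /= ltxx.
have phil : phi l = 0 by apply: K0 => /KO/Ol /=; rewrite in_itv /= ltxx andbF.
have := indef_incr im (lexx 0) (ltW l0) (lexx l).
rewrite phi0 phil !mulr0 subrr.
have mI : measurable (`[0, l]%classic : set R) by exact: measurable_itv.
have [L L0 Lphi] := within_bounded (ltW l0) (continuous_subspaceT cphi).
have [L' L0' Lq] := within_bounded (ltW l0) (indef_continuous (ltW l0) iq).
have i1 : leb.-integrable `[0, l] (EFin \o (fun x => p x * phi x)).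
  apply: (dom_integrable (mu := leb) mI _ (RintZ (mu := leb) L mI (RintNorm (mu := leb) mI iq.1))).
    apply: measurable_funM; first exact: Rint_measurable iq.1.
    by apply: measurable_funTS; exact: continuous_measurable_fun.
  by move=> x /=; rewrite in_itv /= => /Lphi h; rewrite normrM mulrC ler_wpM2r.
have i2 : leb.-integrable `[0, l] (EFin \o (fun x => q x * (phi^`())%classic x)).
  apply: (dom_integrable (mu := leb) mI _ (RintZ (mu := leb) L' mI (RintNorm (mu := leb) mI (within_integrable (continuous_subspaceT cphi'))))).
    apply: measurable_funM; first exact: within_measurable (indef_continuous (ltW l0) iq).
    by apply: measurable_funTS; exact: continuous_measurable_fun.
  by move=> x /=; rewrite in_itv /= => /Lq h; rewrite normrM ler_wpM2r.
by rewrite RintegralD//; lra.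
Qed.

(** A function of mean zero supported in [`[a, b]] is the derivative of a test
function, namely of its own primitive. *)
Lemma dubois_prim (l : R) (w chi : R -> R) (a b : R) : 0 < a -> a < b -> b < l ->
  (forall phi, test_function `]0, l[ phi ->
     \int[leb]_(x in `[0, l]) (w x * (phi^`())%classic x) = 0) ->
  (forall n (x : R), derivable (chi^`(n))%classic x 1) ->
  (forall x, ~ (a < x < b) -> chi x = 0) ->
  \int[leb]_(x in `[0, l]) chi x = 0 -> \int[leb]_(x in `[0, l]) (w x * chi x) = 0.
Proof.
move=> a0 ab bl H dchi chi0 ichi.
have cchi : continuous chi.
  by move=> x; apply/differentiable_continuous/derivable1_diffP; exact: (dchi 0).
(* The lower limit -1 keeps 0 inside the domain of the primitive. *)
pose phi (x : R) := \int[leb]_(t in `[-1, x]) chi t.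
have phi_eq0 x : x <= a -> phi x = 0.
  move=> xa; have -> : phi x = \int[leb]_(t in `[-1, x]) cst 0 t.
    apply: eq_Rintegral => t; rewrite inE /= in_itv /= => /andP[_ tx]; rewrite chi0//.
    by move=> /andP[h _]; lra.
  by rewrite /Rintegral integral0.
have ichiT y z : leb.-integrable `[y, z] (EFin \o chi).
  by apply: within_integrable; exact: continuous_subspaceT.
have iphi (M : R) : indef (-1) M phi chi.
  by split => // y _; rewrite /phi set_itv1 Rintegral_set1 add0r.
have phi_l : phi l = 0.
  have h1 : -1 <= 0 :> R by lra.
  have h2 : 0 <= l by lra.
  have := indef_incr (iphi l) h1 h2 (lexx l).
  by rewrite ichi => /eqP; rewrite subr_eq0 => /eqP ->; apply: phi_eq0; exact: ltW.
have phi_bx x y : b <= x -> x <= y -> phi y = phi x.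
  move=> bx xy; apply/eqP; rewrite -subr_eq0.
  rewrite (indef_incr (iphi y) _ xy)//; last lra.
  have -> : \int[leb]_(t in `[x, y]) chi t = \int[leb]_(t in `[x, y]) cst 0 t.
    apply: eq_Rintegral => t; rewrite inE /= in_itv /= => /andP[h _]; rewrite chi0//.
    by move=> /andP[_ h2]; lra.
  by rewrite /Rintegral integral0.
have phi_b x : b <= x -> phi x = 0.
  move=> bx; have [xl|lx] := leP x l; first by rewrite -(phi_bx x l)//.
  by rewrite (phi_bx l x)// ltW.
have dphi : forall x : R, is_derive x 1 phi (chi x).
  move=> x; have [x1|x1] := ltP (-1) x.
    have := @continuous_FTC1_closed _ chi (-1) x (x + 1).
    rewrite ltrDl ltr01 => /(_ isT (ichiT _ _) x1 (cchi x)) [d1 d2].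
    by split; [exact: d1|rewrite -derive1E; exact: d2].
  have -> : chi x = 0 by apply: chi0 => /andP[h _]; lra.
  apply: (@is_derive_local _ (x - 1) a (cst 0)); last by apply/andP; split; lra.
  by move=> y /andP[_ ya]; rewrite phi_eq0// ltW.
have Ephi : (phi^`())%classic = chi by exact: derive1_is.
have Ephin n : (phi^`(n.+1))%classic = (chi^`(n))%classic.
  by elim: n => [//|n IH]; rewrite derive1nS IH -derive1nS.
rewrite -Ephi; apply: H; split.
  by case => [|n] x; [have [] := dphi x|rewrite Ephin].
exists `[a, b]%classic.
  split; first exact: segment_compact.
  by move=> x /=; rewrite !in_itv /= => /andP[h1 h2]; apply/andP; split; lra.
move=> x /=; rewrite in_itv /= => /negP; rewrite negb_and -!ltNge.
by move=> /orP[/ltW/phi_eq0|/ltW/phi_b].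
Qed.

(** Subtracting from a bump the right multiple of one fixed bump leaves a function of
mean zero, to which [dubois_prim] applies. Hence [w] minus a constant annihilates all
bumps. *)
Lemma dubois (l : R) (w : R -> R) : 0 < l -> leb.-integrable `[0, l] (EFin \o w) ->
  (forall phi, test_function `]0, l[ phi ->
     \int[leb]_(x in `[0, l]) (w x * (phi^`())%classic x) = 0) ->
  exists k, {ae leb, forall x, `]0, l[%classic x -> w x = k}.
Proof.
move=> l0 iw H.
have mI : measurable (`[0, l]%classic : set R) by exact: measurable_itv.
have mw := Rint_measurable iw.
(* The fixed bump sits strictly inside the interval. *)
pose a0 := l / 4; pose b0 := 3 * l / 4.
have a00 : 0 < a0 by rewrite /a0; lra.
have ab0 : a0 < b0 by rewrite /a0 /b0; lra.
have bl0 : b0 < l by rewrite /b0; lra.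
have ib a b n : leb.-integrable `[0, l] (EFin \o bump a b n).
  by apply: within_integrable; apply: continuous_subspaceT; exact: smooth_continuous (smooth_bump a b n).
have mb a b n : measurable_fun `[0, l] (bump a b n) by exact: Rint_measurable (ib a b n).
have iwb a b n : leb.-integrable `[0, l] (EFin \o (fun x => w x * bump a b n x)).
  apply: (dom_integrable (mu := leb) mI _ (RintNorm (mu := leb) mI iw)).
    by apply: measurable_funM; [exact: mw|exact: mb].
  move=> x _; rewrite normrM ler_piMr//.
  by have /andP[u v] := bump_itv a b n x; rewrite ger0_norm.
pose c0 := \int[leb]_(x in `[0, l]) bump a0 b0 1 x.
have c00 : 0 < c0.
  apply: (lt_le_trans (bump_int_gt0 ab0)); rewrite /c0 Rintegral_mkcond [leRHS]Rintegral_mkcond.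
  rewrite le_eqVlt; apply/orP; left; apply/eqP; apply: eq_Rintegral => x _.
  rewrite !patchE; case: ifPn => [|].
    rewrite inE /= in_itv /= => /andP[u v]; rewrite mem_set//= in_itv /=.
    by apply/andP; split; lra.
  rewrite notin_setE /= in_itv /= => h; case: ifPn => // _; rewrite bump_eq0//.
  by move=> /andP[u v]; apply: h; rewrite !ltW.
pose k := (\int[leb]_(x in `[0, l]) (w x * bump a0 b0 1 x)) / c0.
exists k.
have mo : measurable (`]0, l[%classic : set R) by exact: measurable_itv.
have iwk : leb.-integrable `[0, l] (EFin \o (fun x => w x - k)).
  apply: (RintB (mu := leb) mI iw); apply: within_integrable.
  by apply: continuous_subspaceT => x; exact: cvg_cst.
apply: ae_imply (bump_pairing_null (Om := `]0, l[%classic) (w := fun x => w x - k) _ _).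
- by move=> x h /h/eqP; rewrite subr_eq0 => /eqP.
- apply: open_integrable_locally; first exact: interval_open.
  by apply: integrableS iwk => //; exact: itv_oo_cc.
move=> a b n abO; rewrite Rint_oo_cc; last first.
  apply: (measurable_funS mI); first exact: itv_oo_cc.
  by apply: measurable_funM => //; exact: Rint_measurable iwk.
have [ba|ab] := leP b a.
  have -> : (fun x => (w x - k) * bump a b n x) = cst 0.
    apply/funext => x; rewrite bump_eq0 ?mulr0//.
    by move=> /andP[u v]; lra.
  by rewrite /Rintegral integral0.
have [a0' bl] : 0 < a /\ b < l.
  have := abO a; have := abO b; rewrite /= !in_itv /= !lexx !ltW// => /(_ isT) /andP[_ ->].
  by move=> /(_ isT) /andP[->].
pose c := \int[leb]_(x in `[0, l]) bump a b n x.
pose chi x := bump a b n x + (- (c / c0)) * bump a0 b0 1 x.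
have schi : smooth chi by apply: smooth_add; [|apply: smooth_scale]; exact: smooth_bump.
have : \int[leb]_(x in `[0, l]) (w x * chi x) = 0.
  apply: (@dubois_prim l w chi (Num.min a a0) (Num.max b b0)) => //.
  - by rewrite lt_min a0'.
  - by rewrite lt_max gt_min ab.
  - by rewrite gt_max bl.
  - by move=> m x; exact: smooth_derivable.
  - move=> x; rewrite lt_max gt_min => h; rewrite /chi !bump_eq0 ?mulr0 ?addr0//.
      by move=> /andP[u v]; apply: h; rewrite u v !orbT.
    by move=> /andP[u v]; apply: h; rewrite u v.
  - rewrite /chi RintegralD// ?RintegralZl//; last exact: RintZ.
    by rewrite -/c -/c0 mulNr divfK ?subrr// gt_eqF.
have -> : (fun x => w x * chi x) = (fun x => w x * bump a b n x + (- (c / c0)) * (w x * bump a0 b0 1 x)).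
  by apply/funext => x; rewrite /chi; ring.
rewrite RintegralD// ?RintegralZl//; last exact: RintZ.
move=> E.
have -> : (fun x => (w x - k) * bump a b n x) = (fun x => w x * bump a b n x - k * bump a b n x).
  by apply/funext => x; ring.
rewrite RintegralB// ?RintegralZl//; last exact: RintZ.
rewrite -/c; move: E; rewrite /k; set I1 := Rintegral _ _ _; set I2 := Rintegral _ _ _.
move=> E; rewrite mulrAC [_ * c]mulrC mulrAC; lra.
Qed.

(** The difference of [f] and a primitive of [g] has weak derivative 0, hence is
constant. *)
Lemma H1_rep (l : R) (f g : R -> R) : 0 < l -> is_weak_derivative `]0, l[ f g ->
  square_integrable `]0, l[ f -> leb.-integrable `]0, l[ (EFin \o g) ->
  exists q, indef 0 l q g /\ {ae leb, forall x, `]0, l[%classic x -> f x = q x}.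
Proof.
move=> l0 [lf lg wd] sf ig.
have mI : measurable (`[0, l]%classic : set R) by exact: measurable_itv.
have mo : measurable (`]0, l[%classic : set R) by exact: measurable_itv.
have lo : (leb `]0%R, l[ < +oo)%E by rewrite leb_oo ?ltW// ltry.
have ioc (h : R -> R) : leb.-integrable `]0, l[ (EFin \o h) ->
    leb.-integrable `[0, l] (EFin \o (h \_ `]0, l[)).
  move=> ih; rewrite -restrict_EFin.
  apply: (@integrableS _ _ _ _ setT) => //.
  by apply: (iffLR (integrable_mkcond _ _)).
have if_ : leb.-integrable `]0, l[ (EFin \o f) by exact: (L2_integrable (mu := leb) mo lo sf).
pose f0 := f \_ `]0, l[%classic; pose g0 := g \_ `]0, l[%classic.
have if0 := ioc _ if_; have ig0 := ioc _ ig.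
pose Gx x := \int[leb]_(t in `[0, x]) g0 t.
have iG : indef 0 l Gx g0.
  by split => // x _; rewrite /Gx set_itv1 Rintegral_set1 add0r.
have iGc := within_integrable (indef_continuous (ltW l0) iG).
have iw : leb.-integrable `[0, l] (EFin \o (fun x => f0 x - Gx x)).
  exact: (RintB (mu := leb) mI if0 iGc).
have Epatch (h h' : R -> R) : measurable_fun `]0, l[ (fun x => h x * h' x) ->
    \int[leb]_(x in `[0, l]) ((h \_ `]0, l[) x * h' x) = \int[leb]_(x in `]0, l[) (h x * h' x).
  move=> mh; rewrite Rint_oo_cc//; apply: ae_eq_Rint => //.
  exists [set 0; l]; split.
  - by apply: measurableU.
  - by apply: null_set_setU => //; exact: lebesgue_measure_set1.
  move=> x /= /not_implyP[]; rewrite in_itv /= => /andP[h1 h2] nE.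
  have [->|x0] := eqVneq x 0; first by left.
  have [->|xl] := eqVneq x l; first by right.
  exfalso; apply: nE; rewrite patchE mem_set//= in_itv /=.
  by rewrite !lt_neqAle h1 h2 eq_sym x0 xl.
have [k Hk] : exists k, {ae leb, forall x, `]0, l[%classic x -> f0 x - Gx x = k}.
  apply: dubois => // phi tphi; have [cphi cphi'] := test_continuous tphi.
  have [mf _ _] := lf; have [mg _ _] := lg.
  have mphi : measurable_fun `]0, l[ phi.
    by apply: measurable_funTS; exact: continuous_measurable_fun.
  have mphi' : measurable_fun `]0, l[ (phi^`())%classic.
    by apply: measurable_funTS; exact: continuous_measurable_fun.
  have [K [cK KO] K0] := tphi.2.
  have E1 := wd _ tphi.
  rewrite -Epatch in E1; last exact: measurable_funM.
  rewrite -[in RHS]Epatch in E1; last exact: measurable_funM.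
  have E2 := indef_test l0 iG tphi (@subset_refl _ _).
  have bphi := within_bounded (ltW l0) (continuous_subspaceT cphi').
  have [L L0 Lphi] := bphi.
  have Im (h : R -> R) : leb.-integrable `[0, l] (EFin \o h) ->
      leb.-integrable `[0, l] (EFin \o (fun x => h x * (phi^`())%classic x)).
    move=> ih; apply: (dom_integrable (mu := leb) mI _ (RintZ (mu := leb) L mI (RintNorm (mu := leb) mI ih))).
      apply: measurable_funM; first exact: Rint_measurable ih.
      by apply: measurable_funTS; exact: continuous_measurable_fun.
    by move=> x /=; rewrite in_itv /= => /Lphi h1; rewrite normrM mulrC ler_wpM2r.
  have -> : (fun x => (f0 x - Gx x) * (phi^`())%classic x) =
      (fun x => f0 x * (phi^`())%classic x - Gx x * (phi^`())%classic x).
    by apply/funext => x; rewrite mulrBl.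
  rewrite RintegralB//; [|exact: (Im _ if0)|exact: (Im _ iGc)].
  by rewrite [X in X - _]E1 [X in _ - X]E2 subrr.
have Eg x : 0 < x < l -> g0 x = g x.
  by move=> h; rewrite /g0 patchE mem_set//= in_itv.
exists (fun x => Gx x + k); split; last first.
  apply: ae_imply Hk => x H xl; have := H xl; rewrite /f0 patchE mem_set// => <-.
  by rewrite addrC subrK.
split; first exact: integrable_oo_cc.
move=> x /andP[x0 xl].
rewrite /Gx set_itv1 Rintegral_set1 add0r addrC; congr (_ + _).
have [mg _ _] := lg.
have sub : `]0, x[%classic `<=` `]0, l[%classic.
  by move=> y /=; rewrite !in_itv /= => /andP[-> h] /=; exact: lt_le_trans xl.
have [mg0 mg1] : measurable_fun `]0, x[ g0 /\ measurable_fun `]0, x[ g.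
  split; last exact: measurable_funS mg.
  apply: measurable_funS (Rint_measurable ig0) => //.
  by apply: subset_trans sub _; exact: itv_oo_cc.
rewrite -!Rint_oo_cc//; apply: eq_Rintegral => y; rewrite inE /= => /sub.
by rewrite /= in_itv /= => /Eg.
Qed.

End Bumps.

(** * Dyadic cells *)

Lemma sum_double (V : nmodType) (n : nat) (F : nat -> V) :
  \sum_(j < n.*2) F j = \sum_(i < n) (F i.*2 + F i.*2.+1).
Proof.
elim: n => [|n IH]; first by rewrite !big_ord0.
by rewrite doubleS !big_ord_recr /= IH addrA.
Qed.

Section Dyadic.
Context {R : realType}.
Variable l : R.
Hypothesis l0 : 0 < l.
Local Notation leb := (@lebesgue_measure R).
Local Notation D := (`[0, l]%classic : set R).

(** The truncation by [(2 ^ N).-1] puts the right end point [l] into the last cell, so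
that the cells partition [`[0, l]]. *)
Definition cell_idx (N : nat) (x : R) : nat := minn (Num.truncn (2 ^+ N * x / l)) (2 ^ N).-1.
Definition cell (N i : nat) : set R := [set x | 0 <= x <= l /\ cell_idx N x = i].
Definition dyad (N i : nat) : R := i%:R * l / 2 ^+ N.

Let p2 (N : nat) : 0 < 2 ^+ N :> R. Proof. exact: exprn_gt0. Qed.

Lemma pow2N N : (2 ^ N)%N%:R = 2 ^+ N :> R. Proof. by rewrite natrX. Qed.

Lemma dyad0 N : dyad N 0 = 0. Proof. by rewrite /dyad !mul0r. Qed.
Lemma dyad_last N : dyad N (2 ^ N) = l.
Proof. by rewrite /dyad pow2N mulrAC divff ?mul1r ?gt_eqF. Qed.
Lemma dyad_half N i : dyad N.+1 i.*2 = dyad N i.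
Proof. by rewrite /dyad exprS -muln2 natrM; field; rewrite gt_eqF. Qed.
Lemma dyadS N i : dyad N i.+1 = dyad N i + l / 2 ^+ N.
Proof. by rewrite /dyad -natr1; ring. Qed.
Lemma dyad_ge0 N i : 0 <= dyad N i.
Proof. by apply: divr_ge0; [apply: mulr_ge0 => //|]; exact: ltW. Qed.
Lemma dyad_le N i k : (i <= k)%N -> dyad N i <= dyad N k.
Proof. by move=> ik; rewrite /dyad ler_pM2r ?invr_gt0// ler_pM2r// ler_nat. Qed.
Lemma dyad_lel N i : (i <= 2 ^ N)%N -> dyad N i <= l.
Proof. by move=> iN; rewrite -[leRHS](dyad_last N) dyad_le. Qed.

Lemma cell_idx_lt N x : (cell_idx N x < 2 ^ N)%N.
Proof. by rewrite /cell_idx gtn_min; apply/orP; right; rewrite prednK ?expn_gt0. Qed.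

Lemma half_minn a b : ((minn a b)./2 = minn a./2 b./2)%N.
Proof.
have [ab|ba] := leqP a b; first by apply/esym/minn_idPl; exact: half_leq.
by apply/esym/minn_idPr; apply: half_leq; exact: ltnW.
Qed.

Lemma truncn_half (y : R) : (Num.truncn (2 * y))./2 = Num.truncn y.
Proof.
have [y0|y0] := leP 0 y; last first.
  have -> : Num.truncn y = 0%N by apply/truncn0Pn; rewrite -ltNge; lra.
  by have -> : Num.truncn (2 * y) = 0%N; [apply/truncn0Pn; rewrite -ltNge; lra|].
apply/esym/truncn_def.
have /truncn_itv : 0 <= 2 * y by lra.
set n := Num.truncn _; move=> /andP[n1 n2].
have := odd_double_half n; set m := n./2; move=> E.
have E2 : n%:R = (odd n)%:R + 2 * m%:R :> R by rewrite -[in LHS]E natrD -muln2 natrM mulrC.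
rewrite -natr1 in n2; rewrite -natr1.
have o1 : (0 : R) <= (odd n)%:R by exact: ler0n.
have o2 : (odd n)%:R <= (1 : R) by rewrite -[1 in X in _ <= X]/(1%:R) ler_nat leq_b1.
by apply/andP; split; lra.
Qed.

Lemma cell_idx_half N x : cell_idx N x = (cell_idx N.+1 x)./2.
Proof.
rewrite /cell_idx half_minn; congr minn.
  by rewrite exprS -!mulrA truncn_half.
have := expn_gt0 2 N; rewrite expnS; case: (2 ^ N)%N => // n _.
by rewrite mul2n doubleS /= uphalf_double.
Qed.

Lemma scaled_ge0 N (x : R) : 0 <= x -> 0 <= 2 ^+ N * x / l.
Proof. by move=> x0; apply: divr_ge0; [apply: mulr_ge0 => //|]; exact: ltW. Qed.

Lemma cell_idx_ltP N (x : R) i : 0 <= x -> (i < 2 ^ N)%N -> (i <= cell_idx N x)%N = (dyad N i <= x).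
Proof.
move=> x0 iN; rewrite /cell_idx leq_min.
have -> : (i <= (2 ^ N).-1)%N by rewrite -ltnS prednK ?expn_gt0.
rewrite andbT truncn_ge_nat; last exact: scaled_ge0.
by rewrite /dyad ler_pdivlMr// ler_pdivrMr// mulrC [x * _]mulrC.
Qed.

Lemma cellE N i : (i < 2 ^ N)%N -> cell N i =
  [set` Interval (BLeft (dyad N i)) (if i.+1 == (2 ^ N)%N then BRight l else BLeft (dyad N i.+1))].
Proof.
move=> iN; apply/seteqP; split => x; rewrite /cell /=.
  move=> [/andP[x0 xl] ix]; rewrite itv_boundlr /=; apply/andP; split.
    by rewrite bnd_simp -cell_idx_ltP// ix.
  case: eqP => [_|/eqP iN']; first by rewrite bnd_simp.
  rewrite bnd_simp ltNge -cell_idx_ltP//; last by rewrite ltn_neqAle iN' iN.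
  by rewrite ix ltnn.
rewrite itv_boundlr /= => /andP[]; rewrite bnd_simp => ix.
have x0 : 0 <= x by exact: le_trans (dyad_ge0 _ _) ix.
case: eqP => [iN'|/eqP iN']; rewrite bnd_simp => xl.
  split; first by rewrite x0.
  apply/eqP; rewrite eqn_leq; apply/andP; split; last by rewrite cell_idx_ltP.
  by rewrite -ltnS iN' cell_idx_lt.
have iN1 : (i.+1 < 2 ^ N)%N by rewrite ltn_neqAle iN' iN.
split; first by rewrite x0 (le_trans (ltW xl))// dyad_lel.
apply/eqP; rewrite eqn_leq; apply/andP; split; last by rewrite cell_idx_ltP.
by rewrite -ltnS ltnNge cell_idx_ltP// -ltNge.
Qed.

Lemma cell_set0 N i : (2 ^ N <= i)%N -> cell N i = set0.
Proof.
move=> iN; apply/seteqP; split => // x [_ E]; have := cell_idx_lt N x.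
by rewrite E ltnNge iN.
Qed.

Lemma measurable_cell N i : measurable (cell N i).
Proof.
have [iN|iN] := ltnP i (2 ^ N); last by rewrite cell_set0.
by rewrite cellE//; case: ifP => _; exact: measurable_itv.
Qed.

Lemma cell_sub N i : cell N i `<=` D.
Proof. by move=> x [xl _]; rewrite /= in_itv. Qed.

Lemma cell_itv N i x : cell N i x -> dyad N i <= x <= dyad N i.+1.
Proof.
have [iN|iN] := ltnP i (2 ^ N); last by rewrite cell_set0.
rewrite cellE//= itv_boundlr /= => /andP[]; rewrite bnd_simp => ->.
by case: eqP => [->|_]; rewrite bnd_simp ?dyad_last//; exact: ltW.
Qed.

Lemma cell_split N i : cell N i = cell N.+1 i.*2 `|` cell N.+1 i.*2.+1.
Proof.
apply/seteqP; split => x; rewrite /cell /=.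
  move=> [xl]; rewrite cell_idx_half => <-; have := odd_double_half (cell_idx N.+1 x).
  by case: odd => E; [right|left]; split => //; rewrite -E //= ?add1n ?add0n doubleK.
by move=> [] [xl E]; split => //; rewrite cell_idx_half E /= ?uphalf_double ?doubleK.
Qed.

Lemma cell_disj N i k : i != k -> [disjoint cell N i & cell N k].
Proof.
move=> ik; apply/eqP; rewrite -subset0 => x [[_ E1] [_ E2]].
by move: ik; rewrite -E1 -E2 eqxx.
Qed.

Lemma cell00 : cell 0 0 = D.
Proof.
apply/seteqP; split => x; first exact: cell_sub.
by rewrite /= in_itv /= => xl; split => //; rewrite /cell_idx expn0 minn0.
Qed.

Lemma cell_idx_gap (x y : R) : 0 <= x -> x < y -> y <= l ->
  exists N0, forall N, (N0 <= N)%N -> (cell_idx N x < cell_idx N y)%N.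
Proof.
move=> x0 xy yl.
have d0 : 0 < (y - x) / (2 * l) by rewrite divr_gt0 ?subr_gt0// mulr_gt0.
exists (Num.truncn ((y - x) / (2 * l))^-1) => N N0N.
have H : 2 * l <= 2 ^+ N * (y - x).
  have h1 : ((y - x) / (2 * l))^-1 < N.+1%:R.
    by apply: lt_le_trans (truncnS_gt _) _; rewrite ler_nat.
  have h2 : N.+1%:R <= 2 ^+ N :> R by rewrite -natrX ler_nat ltn_expl.
  have : ((y - x) / (2 * l))^-1 <= 2 ^+ N by apply: (le_trans (ltW h1)).
  by rewrite invf_div ler_pdivrMr ?subr_gt0.
set X := 2 ^+ N * x / l; set Y := 2 ^+ N * y / l.
have X0 : 0 <= X by exact: scaled_ge0.
have XY : X + 2 <= Y.
  by rewrite -lerBrDl /X /Y -mulrBl -mulrBr ler_pdivlMr.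
have YN : Y <= (2 ^ N)%:R.
  by rewrite pow2N /Y ler_pdivrMr// ler_wpM2l// ltW.
have /andP[a1 a2] := truncn_itv X0.
have Y0 : 0 <= Y by lra.
have tx1 : (Num.truncn X).+1%:R = (Num.truncn X)%:R + 1 :> R by rewrite natr1.
have h : (Num.truncn X < (2 ^ N).-1)%N.
  by rewrite -ltnS prednK ?expn_gt0// -(ltr_nat R) tx1; lra.
have h' : (Num.truncn X < Num.truncn Y)%N.
  by rewrite truncn_gt_nat tx1; lra.
by rewrite /cell_idx -/X -/Y; rewrite (minn_idPl (ltnW h)) leq_min h h'.
Qed.

Lemma sum_cells (m : {measure set (measurableTypeR R) -> \bar R}) (f : R -> R) N :
  m.-integrable D (EFin \o f) ->
  \int[m]_(x in D) f x = \sum_(i < (2 ^ N)%N) \int[m]_(x in cell N i) f x.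
Proof.
move=> fi; elim: N => [|N IH]; first by rewrite expn0 big_ord1 /= cell00.
have E := sum_double (2 ^ N)%N (fun i => \int[m]_(x in cell N.+1 i) f x).
rewrite IH expnS mul2n; apply: etrans (esym E); apply: eq_bigr => i _.
rewrite [in LHS]cell_split Rintegral_setU//; try exact: measurable_cell.
- apply: integrableS fi => //.
    by apply: measurableU; exact: measurable_cell.
  by rewrite -cell_split; exact: cell_sub.
- by apply: cell_disj; rewrite neq_ltn ltnSn.
Qed.

Lemma cell_gt (x : R) N : 0 <= x -> [set y | D y /\ (cell_idx N x < cell_idx N y)%N] =
  \big[setU/set0]_(i < (2 ^ N)%N) (if (cell_idx N x < i)%N then cell N i else set0).
Proof.
move=> x0; rewrite -(bigcup_mkord (2 ^ N)%N (fun i => if (cell_idx N x < i)%N then cell N i else set0)).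
apply/seteqP; split => y.
  move=> [Dy h]; exists (cell_idx N y) => /=; first exact: cell_idx_lt.
  by rewrite h; split => //; move: Dy; rewrite /= in_itv.
move=> [i /= iN]; case: ifP => // xi [yl E]; split; first by rewrite /= in_itv.
by rewrite E.
Qed.

(** Every ray meets [`[0, l]] in an increasing union of finite unions of cells, up
to its dyadic approximation ([cell_idx_gap]); rays generate the Borel sets. *)
Lemma dyadic_unique (m1 m2 : {finite_measure set (measurableTypeR R) -> \bar R}) :
  (forall N i, (i < 2 ^ N)%N -> m1 (cell N i) = m2 (cell N i)) ->
  forall A : set (measurableTypeR R), measurable A -> A `<=` D -> m1 A = m2 A.
Proof.
move=> H A mA AD.
have mD : measurable D by exact: measurable_itv.
have mG N (x : R) : measurable [set y | D y /\ (cell_idx N x < cell_idx N y)%N].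
  rewrite (_ : [set y | _] = \bigcup_(i in [set k | (cell_idx N x < k)%N]) cell N i).
    by apply: bigcup_measurable => i _; exact: measurable_cell.
  apply/seteqP; split => y.
    by move=> [Dy h]; exists (cell_idx N y) => //; split => //; move: Dy; rewrite /= in_itv.
  by move=> [i /= xi [yl E]]; split; [rewrite /= in_itv|rewrite E].
have ray0 (x : R) : 0 <= x -> m1 (`]x, +oo[%classic `&` D) = m2 (`]x, +oo[%classic `&` D).
  move=> x0; pose F N := [set y | D y /\ (cell_idx N x < cell_idx N y)%N].
  have FE : `]x, +oo[%classic `&` D = \bigcup_N F N.
    apply/seteqP; split => y.
      rewrite /= !in_itv /= andbT => -[xy /andP[y0 yl]].
      have [N0 HN] := cell_idx_gap x0 xy yl; exists N0 => //; split; last exact: HN.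
      by rewrite /= in_itv /= y0.
    move=> [N _ [Dy h]]; split => //; rewrite /= in_itv /= andbT.
    have Dy' : 0 <= y by move: Dy; rewrite /= in_itv => /andP[].
    rewrite ltNge; apply/negP => yx; move: h; rewrite ltnNge => /negP; apply.
    by rewrite cell_idx_ltP ?cell_idx_lt// (le_trans _ yx)// -cell_idx_ltP ?cell_idx_lt.
  have ndF : nondecreasing_seq F.
    apply/nondecreasing_seqP => N; apply/subsetPset => y [Dy h]; split => //.
    move: h; rewrite [cell_idx N x]cell_idx_half [cell_idx N y]cell_idx_half => h.
    by rewrite ltnNge; apply/negP => h2; move: h; rewrite ltnNge half_leq.
  have cv (m : {finite_measure set (measurableTypeR R) -> \bar R}) : m \o F @ \oo --> m (\bigcup_N F N).
    by apply: nondecreasing_cvg_mu => //; [move=> N; exact: mG|apply: bigcupT_measurable => N; exact: mG].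
  rewrite FE; apply: (cvg_unique _ (cv m1)); first exact: ereal_hausdorff.
  suff -> : m1 \o F = m2 \o F by exact: cv.
  apply/funext => N /=; rewrite /F cell_gt//.
  have mC (i : 'I_(2 ^ N)%N) : measurable (if (cell_idx N x < i)%N then cell N i else set0).
    by case: ifP => _ //; exact: measurable_cell.
  have tC : trivIset setT (fun i : 'I_(2 ^ N)%N => if (cell_idx N x < i)%N then cell N i else set0).
    move=> i k _ _ [y []]; case: ifP => // _ [_ E1]; case: ifP => // _ [_ E2].
    by apply/ord_inj; rewrite -E1 -E2.
  rewrite !measure_bigsetU_ord//; apply: eq_bigr => i _.
  by case: ifP => _; [exact: H|rewrite !measure0].
have ray (x : R) : m1 (`]x, +oo[%classic `&` D) = m2 (`]x, +oo[%classic `&` D).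
  have [x0|x0] := leP 0 x; first exact: ray0.
  have -> : `]x, +oo[%classic `&` D = D.
    apply/setIidPr => y /=; rewrite !in_itv /= andbT => /andP[y0 _].
    exact: lt_le_trans y0.
  by rewrite -cell00; exact: H.
have mrD (m : {finite_measure set (measurableTypeR R) -> \bar R}) B : B `<=` D -> mrestr m mD B = m B.
  by move=> BD; rewrite /mrestr; congr (m _); apply/setIidPl.
rewrite -(mrD m1)// -(mrD m2)//.
pose M1 : {measure set (measurableTypeR R) -> \bar R} := mrestr m1 mD.
pose M2 : {measure set (measurableTypeR R) -> \bar R} := mrestr m2 mD.
apply: (@measure_unique _ R (measurableTypeR R) (@RGenOInfty.G R)
  (fun n => `]- (n%:R), +oo[%classic) _ _ _ _ M1 M2) => //.
- exact: RGenOInfty.measurableE.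
- move=> _ _ [x ->] [y ->]; exists (Num.max x y).
  by apply/seteqP; split => z; rewrite /= !in_itv /= !andbT gt_max => /andP.
- by move=> n; exists (- n%:R).
- apply/seteqP; split => // z _; exists (Num.truncn `|z|).+1 => //=.
  rewrite in_itv /= andbT ltrNl; apply: le_lt_trans (truncnS_gt _).
  by rewrite -normrN ler_norm.
- by move=> _ [x ->]; exact: ray.
- move=> n; rewrite /= /mrestr; apply: (le_lt_trans (le_measure _ _ _ (@subsetT _ _))); rewrite ?inE//.
    by apply: measurableI => //; exact: measurable_itv.
  exact: fin_num_fun_lty.
Qed.

End Dyadic.

(** * Densities as limits of dyadic averages *)

Section Fatou.
Context d (T : measurableType d) (R : realType).
Variable mu : {measure set T -> \bar R}.

Lemma fatou_real (D : set T) (f_ : nat -> T -> R) (f : T -> R) (M : R) :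
  measurable D -> (forall n, mu.-integrable D (EFin \o f_ n)) ->
  (forall n x, D x -> 0 <= f_ n x) -> measurable_fun D f -> (forall x, D x -> 0 <= f x) ->
  {ae mu, forall x, D x -> f_ n x @[n --> \oo] --> f x} ->
  (forall n, \int[mu]_(x in D) f_ n x <= M) ->
  mu.-integrable D (EFin \o f) /\ \int[mu]_(x in D) f x <= M.
Proof.
move=> mD f_i f_0 mf f0 cf H.
have mg n : measurable_fun D (EFin \o f_ n) by case/integrableP: (f_i n).
have g0 n x : D x -> (0 <= (EFin \o f_ n) x)%E by move=> Dx; rewrite lee_fin f_0.
have := @fatou _ _ _ mu D mD (fun n => EFin \o f_ n) mg g0.
have -> : (\int[mu]_(x in D) limn_einf (fun n => (EFin \o f_ n) x) = \int[mu]_(x in D) (f x)%:E)%E.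
  apply: ae_eq_lower_integral; apply: ae_imply cf => x cx Dx.
  have c2 : (EFin \o f_ n) x @[n --> \oo] --> (f x)%:E.
    by apply: cvg_EFin; [near=> n|exact: cx].
  rewrite is_cvg_limn_einfE; first exact: cvg_lim.
  by apply/cvg_ex; eexists; exact: c2.
have leM : (limn_einf (fun n => \int[mu]_(x in D) (EFin \o f_ n) x) <= M%:E)%E.
  rewrite limn_einf_lim; apply: lime_le; first exact: is_cvg_einfs.
  apply: nearW => n; apply: (@le_trans _ _ (\int[mu]_(x in D) (EFin \o f_ n) x)%E).
    by apply: ereal_inf_lbound; exists n => /=.
  by rewrite -EFin_Rint ?lee_fin.
move=> /le_trans/(_ leM) fM.
have fi : mu.-integrable D (EFin \o f).
  apply/integrableP; split; first exact/measurable_EFinP.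
  apply: (@le_lt_trans _ _ (\int[mu]_(x in D) (f x)%:E)%E); last by rewrite (le_lt_trans fM)// ltry.
  apply: ge0_le_lower_integral => x Dx; first exact: abse_ge0.
  by rewrite gee0_abs// lee_fin f0.
by split => //; rewrite -lee_fin EFin_Rint.
Unshelve. all: by end_near. Qed.

Lemma fatou_sq (D : set T) (f_ : nat -> T -> R) (f : T -> R) (M : R) :
  measurable D -> (forall n, L2 mu D (f_ n)) -> measurable_fun D f ->
  {ae mu, forall x, D x -> f_ n x @[n --> \oo] --> f x} ->
  (forall n, \int[mu]_(x in D) (f_ n x ^+ 2) <= M) ->
  L2 mu D f /\ \int[mu]_(x in D) (f x ^+ 2) <= M.
Proof.
move=> mD Lf mf cf H.
have [||||||i2 leM] := @fatou_real D (fun n x => f_ n x ^+ 2) (fun x => f x ^+ 2) M mD.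
- by move=> n; case: (Lf n).
- by move=> n x _; exact: sqr_ge0.
- exact: measurable_funX.
- by move=> x _; exact: sqr_ge0.
- by apply: ae_imply cf => x cx Dx; rewrite expr2; apply: cvgM; exact: cx.
- exact: H.
- by [].
Qed.

End Fatou.

Section Martingale.
Context {R : realType}.
Variable l : R.
Hypothesis l0 : 0 < l.
Local Notation leb := (@lebesgue_measure R).
Local Notation D := (`[0, l]%classic : set (measurableTypeR R)).

Definition step (N : nat) (c : nat -> R) (x : R) : R :=
  \sum_(i < (2 ^ N)%N) c i * \1_(cell l N i) x.

Lemma stepE N c x : D x -> step N c x = c (cell_idx l N x).
Proof.
rewrite /= in_itv /= => xl.
rewrite /step (bigD1 (Ordinal (cell_idx_lt l N x)))//= big1 ?addr0.
  by rewrite indicE mem_set ?mulr1.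
move=> i ine; rewrite indicE memNset ?mulr0// => -[_ E].
by move: ine; rewrite -(inj_eq val_inj) /= E eqxx.
Qed.

Lemma measurable_step N c : measurable_fun setT (step N c).
Proof.
apply: measurable_sum => i; apply: measurable_funM => //.
by apply: measurable_indic; exact: measurable_cell.
Qed.

Lemma step_bounded N c : exists2 K : R, 0 <= K & forall x, D x -> `|step N c x| <= K.
Proof.
exists (\sum_(i < (2 ^ N)%N) `|c i|); first exact: sumr_ge0.
move=> x Dx; rewrite stepE// (bigD1 (Ordinal (cell_idx_lt l N x)))//= lerDl.
exact: sumr_ge0.
Qed.

Variable m : {measure set (measurableTypeR R) -> \bar R}.
Hypothesis mDfin : (m D < +oo)%E.
Let mD : measurable D. Proof. exact: measurable_itv. Qed.

Definition cell_mass (N i : nat) : R := fine (m (cell l N i)).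

Lemma cell_mass_ge0 N i : 0 <= cell_mass N i. Proof. exact: fine_ge0. Qed.

Lemma step_L2 N c : L2 m D (step N c).
Proof.
have [K _ H] := step_bounded N c.
apply: L2_bounded H => //; apply: measurable_funTS; exact: measurable_step.
Qed.

Lemma Rint_step N c (f : R -> R) : m.-integrable D (EFin \o f) ->
  \int[m]_(x in D) (f x * step N c x) =
  \sum_(i < (2 ^ N)%N) c i * \int[m]_(x in cell l N i) f x.
Proof.
move=> fi; have [K K0 H] := step_bounded N c.
have ifs : m.-integrable D (EFin \o (fun x => f x * step N c x)).
  apply: (dom_integrable mD _ (RintZ K mD (RintNorm mD fi))).
    apply: measurable_funM; first exact: Rint_measurable fi.
    by apply: measurable_funTS; exact: measurable_step.
  by move=> x Dx; rewrite normrM mulrC ler_wpM2r// H.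
rewrite (sum_cells l0 N ifs); apply: eq_bigr => i _.
have mC := measurable_cell l0 N i.
rewrite -RintegralZl//; last by apply: integrableS fi => //; exact: cell_sub.
apply: eq_Rintegral => x; rewrite inE => -[xl E].
by rewrite stepE ?E 1?mulrC//= in_itv.
Qed.

Lemma Rint_cell_step N c i :
  (i < 2 ^ N)%N -> \int[m]_(x in cell l N i) step N c x = c i * cell_mass N i.
Proof.
move=> iN; have mC := measurable_cell l0 N i.
have -> : \int[m]_(x in cell l N i) step N c x = \int[m]_(x in cell l N i) (cst (c i) x).
  by apply: eq_Rintegral => x; rewrite inE => -[xl E]; rewrite stepE ?E//= in_itv.
by rewrite Rintegral_cst.
Qed.

Variable nu : nat -> nat -> R.
Variable F : R.
Hypothesis nuA : forall N i, (i < 2 ^ N)%N -> nu N i = nu N.+1 i.*2 + nu N.+1 i.*2.+1.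
Hypothesis nu0 : forall N i, (i < 2 ^ N)%N -> cell_mass N i = 0 -> nu N i = 0.
Hypothesis nuF : forall N, \sum_(i < (2 ^ N)%N) nu N i ^+ 2 / cell_mass N i <= F.

Let b N := step N (fun i => nu N i / cell_mass N i).
Let E N := \sum_(i < (2 ^ N)%N) nu N i ^+ 2 / cell_mass N i.

Let ib N : m.-integrable D (EFin \o b N).
Proof. by apply: L2_integrable => //; exact: step_L2. Qed.

Let cell_b N i : (i < 2 ^ N)%N -> \int[m]_(x in cell l N i) b N x = nu N i.
Proof.
move=> iN; rewrite /b Rint_cell_step//.
have [w0|w0] := eqVneq (cell_mass N i) 0; last by rewrite divfK.
by rewrite w0 mulr0 nu0.
Qed.

Let cell_bk k : forall N i, (i < 2 ^ N)%N -> \int[m]_(x in cell l N i) b (N + k) x = nu N i.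
Proof.
elim: k => [|k IH] N i iN; first by rewrite addn0 cell_b.
have i1 : (i.*2 < 2 ^ N.+1)%N by rewrite expnS mul2n ltn_double.
have i2 : (i.*2.+1 < 2 ^ N.+1)%N by rewrite expnS mul2n -doubleS leq_double.
rewrite cell_split Rintegral_setU//; try exact: measurable_cell.
- by rewrite addnS -addSn !IH// -nuA.
- apply: integrableS (ib _) => //.
    by apply: measurableU; exact: measurable_cell.
  by rewrite -cell_split; exact: cell_sub.
- by apply: cell_disj; rewrite neq_ltn ltnSn.
Qed.

Let int_bb N k : \int[m]_(x in D) (b (N + k) x * b N x) = E N.
Proof.
rewrite /b Rint_step; last exact: ib.
apply: eq_bigr => i _.
by rewrite cell_bk// mulrAC -expr2.
Qed.

Let int_diff N k : \int[m]_(x in D) ((b (N + k) x - b N x) ^+ 2) = E (N + k) - E N.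
Proof.
have L N' := step_L2 N' (fun i => nu N' i / cell_mass N' i).
have e1 := int_bb N k; have e2 := int_bb N 0; have e3 := int_bb (N + k) 0.
rewrite !addn0 in e2 e3.
have -> : (fun x => (b (N + k) x - b N x) ^+ 2) =
  (fun x => b (N + k) x * b (N + k) x + b N x * b N x - 2 * (b (N + k) x * b N x)).
  by apply/funext => x; ring.
have i1 := L2_mul mD (L (N + k)%N) (L (N + k)%N).
have i2 := L2_mul mD (L N) (L N).
have i3 := L2_mul mD (L (N + k)%N) (L N).
rewrite RintegralB//; [|exact: RintD|exact: RintZ].
by rewrite RintegralD// RintegralZl// e1 e2 e3; ring.
Qed.

Let E_mono N k : E N <= E (N + k).
Proof.
by rewrite -subr_ge0 -int_diff; apply: Rintegral_ge0 => x _; exact: sqr_ge0.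
Qed.

Lemma step_b_int N k i : (i < 2 ^ N)%N -> \int[m]_(x in cell l N i) b (N + k) x = nu N i.
Proof. exact: cell_bk. Qed.

Lemma E_cauchy (e : R) : 0 < e -> exists n, forall N k, (n <= N)%N -> E (N + k) - E N <= e.
Proof.
move=> e0.
have ndE : nondecreasing_seq E.
  by apply/nondecreasing_seqP => n; rewrite -addn1.
have ubE : has_ubound (range E) by exists F => _ [n _ <-]; exact: nuF.
have cE := nondecreasing_cvgn ndE ubE.
have Esup N : E N <= sup (range E) by apply: ub_le_sup => //; exists N.
have /cvgrPdist_le /(_ _ e0) [n _ H] := cE.
exists n => N k nN; have := H N nN; rewrite /= ger0_norm ?subr_ge0// => h.
have := Esup (N + k)%N; lra.
Qed.

Definition mart_idx (k : nat) : nat := sval (cid (E_cauchy (exprn_gt0 k (divr_gt0 ltr01 (ltr0Sn R 3))))).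
Fixpoint mart_sub (k : nat) : nat :=
  if k is k'.+1 then maxn (mart_sub k').+1 (mart_idx k) else mart_idx 0.

Lemma mart_sub_idx k : (mart_idx k <= mart_sub k)%N.
Proof. by case: k => //= k; rewrite leq_max leqnn orbT. Qed.

Lemma mart_sub_mono k j : (mart_sub k <= mart_sub (k + j))%N.
Proof.
elim: j => [|j IH]; first by rewrite addn0.
by rewrite addnS /= (leq_trans IH)// leq_max leqnSn.
Qed.

Lemma mart_sub_ge k : (k <= mart_sub k)%N.
Proof. by elim: k => //= k IH; rewrite leq_max ltnS IH. Qed.

Let B k := b (mart_sub k).

Lemma B_diff k j : \int[m]_(x in D) ((B (k + j) x - B k x) ^+ 2) <= (1 / 4) ^+ k.
Proof.
rewrite /B -(subnKC (mart_sub_mono k j)) int_diff.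
apply: (svalP (cid (E_cauchy _)) (mart_sub k) _ (mart_sub_idx k)).
Qed.

Lemma B_L2 k : L2 m D (B k). Proof. exact: step_L2. Qed.

(** It turns an L^2 bound into an L^1 bound with the weight chosen per increment. *)
Lemma young_inv (A t : R) : 0 < A -> t <= A * t ^+ 2 + A^-1.
Proof.
move=> A0; rewrite -subr_ge0 -(pmulr_rge0 _ A0).
have -> : A * (A * t ^+ 2 + A^-1 - t) = (A * t - 1 / 2) ^+ 2 + 3 / 4.
  by field; rewrite gt_eqF.
by rewrite addr_ge0 ?sqr_ge0//; lra.
Qed.

Lemma half_sum n : \sum_(0 <= k < n) (1 / 2) ^+ k <= 2 :> R.
Proof.
suff -> : \sum_(0 <= k < n) (1 / 2) ^+ k = 2 - 2 * (1 / 2) ^+ n :> R.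
  have : 0 <= (1 / 2) ^+ n :> R by apply: exprn_ge0; lra.
  lra.
elim: n => [|n IH]; first by rewrite big_geq// expr0 mulr1 subrr.
by rewrite big_nat_recr//= IH exprS; lra.
Qed.

Lemma B_sum_fin : {ae m, forall x, D x ->
  (\sum_(k <oo) (`|B k.+1 x - B k x|)%:E < +oo)%E}.
Proof.
have mB k : measurable_fun D (fun x => `|B k.+1 x - B k x|).
  by apply: measurableT_comp => //; apply: measurable_funB; [case: (B_L2 k.+1)|case: (B_L2 k)].
have mB' k : measurable_fun D (fun x => (`|B k.+1 x - B k x|)%:E) by exact/measurable_EFinP.
pose S x := (\sum_(k <oo) (`|B k.+1 x - B k x|)%:E)%E.
have mS : measurable_fun D S.
  by apply: ge0_emeasurable_sum => [k x _ _|k _]; [rewrite lee_fin|exact: mB'].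
have intB k : (\int[m]_(x in D) (`|B k.+1 x - B k x|)%:E <=
    ((1 / 2) ^+ k * (1 + fine (m D)))%:E)%E.
  have L := L2B mD (B_L2 k.+1) (B_L2 k).
  have iL := L2_integrable mD mDfin L.
  rewrite -EFin_Rint//; last exact: RintNorm.
  rewrite lee_fin.
  have cs := B_diff k 1; rewrite addn1 in cs.
  have q0 : (0 : R) < 2 ^+ k by exact: exprn_gt0.
  have i2 : m.-integrable D (EFin \o (fun x => 2 ^+ k * (B k.+1 x - B k x) ^+ 2 + (1 / 2) ^+ k)).
    apply: RintD => //; first by apply: RintZ => //; case: L.
    by have := L2_integrable mD mDfin (L2_cst ((1 / 2) ^+ k) mD mDfin).
  apply: (@le_trans _ _ (\int[m]_(x in D) (2 ^+ k * (B k.+1 x - B k x) ^+ 2 + (1 / 2) ^+ k))).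
    apply: le_Rintegral => //; first exact: RintNorm.
    move=> x _; set t := `|_|; have -> : (B k.+1 x - B k x) ^+ 2 = t ^+ 2.
      by rewrite /t real_normK ?num_real.
    have -> : (1 / 2) ^+ k = (2 ^+ k)^-1 :> R by rewrite div1r exprVn.
    exact: young_inv.
  rewrite RintegralD//; last 2 first.
  - by apply: RintZ => //; case: L.
  - by have := L2_integrable mD mDfin (L2_cst ((1 / 2) ^+ k) mD mDfin).
  rewrite RintegralZl//; last by case: L.
  rewrite Rintegral_cst// mulrDr mulr1 lerD2r.
  have -> : (1 / 2) ^+ k = 2 ^+ k * (1 / 4) ^+ k :> R.
    by rewrite -exprMn; congr (_ ^+ _); lra.
  by rewrite ler_wpM2l// ltW.
have Sfin : (\int[m]_(x in D) S x < +oo)%E.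
  rewrite /S integral_nneseries//.
  apply: (@le_lt_trans _ _ (2 * (1 + fine (m D)))%:E); last exact: ltry.
  apply: lime_le; first by apply: is_cvg_nneseries => k _ _; exact: integral_ge0.
  apply: nearW => n.
  apply: (@le_trans _ _ (\sum_(0 <= k < n) ((1 / 2) ^+ k * (1 + fine (m D)))%:E)%E).
    by apply: lee_sum => k _; exact: intB.
  rewrite sumEFin lee_fin -mulr_suml ler_wpM2r ?half_sum//.

have : m.-integrable D S.
  apply/integrableP; split => //; apply: le_lt_trans Sfin.
  apply: ge0_le_integral => //; first exact: measurableT_comp.
  by move=> x _; rewrite gee0_abs//; apply: nneseries_ge0 => k _ _; rewrite lee_fin.
move=> /(integrable_ae mD); apply: ae_imply => x H /H.
by rewrite ge0_fin_numE//; apply: nneseries_ge0 => k _ _; rewrite lee_fin.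
Qed.

Lemma B_cvg : {ae m, forall x, D x -> cvgn (B ^~ x)}.
Proof.
apply: ae_imply B_sum_fin => x H /H {}H.
pose u k := B k.+1 x - B k x.
have cu : cvgn (series u).
  apply: normed_cvg; apply: nondecreasing_is_cvgn; first by apply: nondecreasing_series => n _ _; exact: normr_ge0.
  exists (fine (\sum_(k <oo) (`|u k|)%:E)%E) => _ [n _ <-].
  rewrite -lee_fin fineK; last first.
    by rewrite ge0_fin_numE//; apply: nneseries_ge0 => k _ _; rewrite lee_fin.
  rewrite /series /= -sumEFin; apply: nneseries_lim_ge => k _; rewrite lee_fin.
  by [].
have Eu n : series u n = B n x - B 0%N x.
  by rewrite /series /= telescope_sumr.
have : cvgn (fun n => series u n + B 0%N x) by apply: is_cvgD => //; exact: is_cvg_cst.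
by under eq_fun do rewrite Eu subrK.
Qed.

(** The cell averages [b N] of [nu] form a martingale in L^2([m]): orthogonality of
increments gives [\int (b (N + k) - b N) ^ 2 = E (N + k) - E N], where [E] is
nondecreasing and bounded by [F]. Along a subsequence the increments are summable
almost everywhere, and Fatou's lemma transfers the bounds to the limit. Additivity on cells is all that is
asked of [nu], so that the increments of a function qualify. *)
Lemma dyadic_density : exists bI, [/\ L2 m D bI,
  (forall N i, (i < 2 ^ N)%N -> \int[m]_(x in cell l N i) bI x = nu N i),
  \int[m]_(x in D) (bI x ^+ 2) <= F &
  forall e : R, 0 < e -> exists N c, \int[m]_(x in D) ((bI x - step N c x) ^+ 2) <= e].
Proof.
(* The upper limit is measurable without any convergence. *)
pose bI x := fine (limn_esup (fun k => (B k x)%:E)).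
have mbI : measurable_fun D bI.
  apply: (measurableT_comp (f := fine)) => //.
  apply: measurable_fun_limn_esup => k; apply/measurable_EFinP.
  by case: (B_L2 k).
have cB : {ae m, forall x, D x -> B k x @[k --> \oo] --> bI x}.
  apply: ae_imply B_cvg => x H /H cx.
  suff -> : bI x = limn (B ^~ x) by [].
  rewrite /bI is_cvg_limn_esupE; first by rewrite EFin_lim.
  apply/cvg_ex; exists (limn (B ^~ x))%:E; apply: cvg_EFin => //.
  by near=> n.
have [LbI intF] : L2 m D bI /\ \int[m]_(x in D) (bI x ^+ 2) <= F.
  apply: (fatou_sq (mu := m) (f_ := B) mD B_L2 mbI cB).
  move=> n; have := int_bb (mart_sub n) 0; rewrite addn0.
  move=> e1; apply: le_trans (nuF (mart_sub n)); rewrite -/(E _) -e1.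
  by rewrite le_eqVlt; apply/orP; left; apply/eqP; apply: eq_Rintegral => x _; rewrite expr2.
have dB k : \int[m]_(x in D) ((bI x - B k x) ^+ 2) <= (1 / 4) ^+ k.
  have L1 j : L2 m D (fun x => B (k + j) x - B k x) by apply: L2B => //; exact: B_L2.
  have m1 : measurable_fun D (fun x => bI x - B k x).
    by apply: measurable_funB => //; case: (B_L2 k).
  have c1 : {ae m, forall x, D x -> B (k + j) x - B k x @[j --> \oo] --> bI x - B k x}.
    apply: ae_imply cB => x H /H cx; apply: cvgB; last exact: cvg_cst.
    by under eq_fun do rewrite addnC; move: cx; rewrite -(cvg_shiftn k).
  by have [] := fatou_sq (mu := m) mD L1 m1 c1 (B_diff k).
have p4 : (1 / 4) ^+ k @[k --> \oo] --> (0 : R).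
  by apply: cvg_expr; rewrite ger0_norm; lra.
exists bI; split => //; last first.
  move=> e e0; have /cvgrPdist_le /(_ _ e0) [k _ H] := p4.
  exists (mart_sub k), (fun i => nu (mart_sub k) i / cell_mass (mart_sub k) i).
  apply: (le_trans (dB k)); have := H k (leqnn k); rewrite /= sub0r normrN.
  by apply: le_trans; exact: ler_norm.
move=> N i iN; have mC : measurable (cell l N i : set (measurableTypeR R)) by exact: measurable_cell.
have CD : cell l N i `<=` D by exact: cell_sub.
have mCfin : (m (cell l N i) < +oo)%E by apply: le_lt_trans mDfin; apply: le_measure => //; rewrite inE.
have diff0 k : (N <= k)%N ->
    (\int[m]_(x in cell l N i) bI x - nu N i) ^+ 2 <= cell_mass N i * (1 / 4) ^+ k.
  move=> Nk; have Nk' := leq_trans Nk (mart_sub_ge k).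
  have LC : L2 m (cell l N i) (fun x => bI x - B k x).
    by apply: (L2_subset mD) => //; apply: L2B => //; exact: B_L2.
  have -> : nu N i = \int[m]_(x in cell l N i) B k x.
    by rewrite /B -(subnKC Nk') cell_bk.
  rewrite -RintegralB//; last 2 first.
  - by apply: L2_integrable => //; exact: (L2_subset mD).
  - by apply: L2_integrable => //; apply: (L2_subset mD) => //; exact: B_L2.
  apply: (le_trans (cauchy_schwarz1 (mu := m) mC mCfin LC)); rewrite ler_wpM2l ?fine_ge0//.
  apply: le_trans (dB k); rewrite -lee_fin !EFin_Rint//; last by case: LC.
    apply: ge0_subset_integral => //.
    - by apply/measurable_EFinP; apply: measurable_funX; apply: measurable_funB => //; case: (B_L2 k).
    - by move=> x _; rewrite lee_fin sqr_ge0.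
  by case: (L2B mD LbI (B_L2 k)).
apply/eqP; rewrite -subr_eq0 -sqrf_eq0 eq_le sqr_ge0 andbT.
have c0 : cell_mass N i * (1 / 4) ^+ k @[k --> \oo] --> (0 : R).
  by rewrite -(mulr0 (cell_mass N i)); apply: cvgM => //; exact: cvg_cst.
rewrite -(cvg_lim _ c0)//; apply: limr_ge; first by apply/cvg_ex; exists 0.
by exists N => // k /= Nk; exact: diff0.
Unshelve. all: by end_near. Qed.

End Martingale.

(** * A dyadic criterion for the square root of a density to lie in H^1 *)

Section Limits.
Context {T : Type} {F : set_system T} {FF : Filter F} {R : realType}.

Lemma cvg_sqr (f : T -> R) (a : R) : f x @[x --> F] --> a -> f x ^+ 2 @[x --> F] --> a ^+ 2.
Proof. by move=> fa; rewrite expr2; under eq_fun do rewrite expr2; exact: cvgM. Qed.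

Lemma cvg_sumR (I : Type) (s : seq I) (f : I -> T -> R) (a : I -> R) :
  (forall i, f i x @[x --> F] --> a i) ->
  \sum_(i <- s) f i x @[x --> F] --> \sum_(i <- s) a i.
Proof.
move=> fa; elim: s => [|i s IH].
  by rewrite big_nil; under eq_fun do rewrite big_nil; exact: cvg_cst.
by rewrite big_cons; under eq_fun do rewrite big_cons; apply: cvgD.
Qed.

End Limits.

Section WeightedAverage.
Context d (T : measurableType d) (R : realType).
Variable m : {measure set T -> \bar R}.

(** The lower bound is only asked for when [V <= q0], where it says something about
the nonnegative root. *)
Lemma sqrt_near (U q0 V : R) : 0 <= q0 -> 0 <= V -> 0 <= U ->
  U <= (q0 + V) ^+ 2 -> (V <= q0 -> (q0 - V) ^+ 2 <= U) -> `|Num.sqrt U - q0| <= V.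
Proof.
move=> q00 V0 U0 up lo.
have s0 := sqrtr_ge0 U; have sU := sqr_sqrtr U0.
have up' : Num.sqrt U <= q0 + V.
  by rewrite -(@ler_pXn2r _ 2)// ?nnegrE ?sU// addr_ge0.
have lo' : q0 - V <= Num.sqrt U.
  have [Vq|Vq] := leP V q0; last by apply: (le_trans _ s0); lra.
  by rewrite -(@ler_pXn2r _ 2)// ?nnegrE ?sU ?lo// subr_ge0.
by rewrite ler_norml; apply/andP; split; lra.
Qed.

(** The root of a weighted mean of [q ^ 2] lies between the extreme values of
[q] where the weight is positive. *)
Lemma avg_sqrt_near (C : set T) (phi q : T -> R) (q0 V : R) :
  measurable C -> measurable_fun C q -> m.-integrable C (EFin \o phi) ->
  (forall x, C x -> 0 <= phi x) -> 0 < \int[m]_(x in C) phi x -> 0 <= q0 -> 0 <= V ->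
  (forall x, C x -> 0 <= q x) ->
  (forall x, C x -> phi x != 0 -> `|q x - q0| <= V) ->
  `|Num.sqrt (\int[m]_(x in C) (phi x * q x ^+ 2) / \int[m]_(x in C) phi x) - q0| <= V.
Proof.
move=> mC mq iphi phi0 W0 q00 V0 q_0 near.
set W := \int[m]_(x in C) phi x.
have mphi := Rint_measurable iphi.
have bd x : C x -> phi x * q x ^+ 2 <= (q0 + V) ^+ 2 * phi x.
  move=> Cx; have [->|n0] := eqVneq (phi x) 0; first by rewrite mul0r mulr0.
  rewrite mulrC ler_wpM2r ?phi0// lerXn2r ?nnegrE ?q_0//; first by rewrite addr_ge0.
  by have := near _ Cx n0; rewrite ler_norml => /andP[_]; lra.
have iq : m.-integrable C (EFin \o (fun x => phi x * q x ^+ 2)).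
  apply: (dom_integrable mC _ (RintZ ((q0 + V) ^+ 2) mC iphi)).
    by apply: measurable_funM => //; exact: measurable_funX.
  by move=> x Cx; rewrite ger0_norm ?bd// mulr_ge0 ?phi0// sqr_ge0.
have U0 : 0 <= (\int[m]_(x in C) (phi x * q x ^+ 2)) / W.
  by apply: divr_ge0; [apply: Rintegral_ge0 => x Cx; rewrite mulr_ge0 ?phi0 ?sqr_ge0|exact: ltW].
apply: sqrt_near => //.
  rewrite ler_pdivrMr// -RintegralZl//; apply: le_Rintegral => //; exact: RintZ.
move=> Vq; rewrite ler_pdivlMr// -RintegralZl//; apply: le_Rintegral => //; first exact: RintZ.
move=> x Cx; have [->|n0] := eqVneq (phi x) 0; first by rewrite mul0r mulr0.
rewrite [leRHS]mulrC ler_wpM2r ?phi0// lerXn2r ?nnegrE ?q_0//; first by rewrite subr_ge0.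
by have := near _ Cx n0; rewrite ler_norml => /andP[+ _]; lra.
Qed.

End WeightedAverage.

Section IndefBounds.
Context {R : realType}.
Local Notation leb := (@lebesgue_measure R).

Lemma indef_osc (a b : R) q p x y : indef a b q p -> a <= x <= b -> a <= y <= b ->
  `|q x - q y| <= \int[leb]_(t in `[a, b]) `|p t|.
Proof.
move=> H; wlog yx : x y / y <= x.
  move=> W xab yab; have [h|h] := leP y x; first exact: W.
  by rewrite distrC W// ltW.
move=> /andP[ax xb] /andP[ay yb]; rewrite (indef_incr H ay yx xb).
have mI u v : measurable (`[u, v]%classic : set (measurableTypeR R)) by exact: measurable_itv.
have iyx := integrable_cc_sub ay xb H.1.
apply: (le_trans (le_normr_Rintegral (mI y x) iyx)).
rewrite -lee_fin !EFin_Rint//; last 2 first.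
- exact: (RintNorm (mu := leb) (mI a b) H.1).
- exact: (RintNorm (mu := leb) (mI y x) iyx).
apply: ge0_subset_integral => //; last exact: itvcc_sub.
by apply/measurable_EFinP; apply: measurableT_comp => //; exact: Rint_measurable H.1.
Qed.

Lemma cs_itv (a b : R) p : a <= b -> L2 leb `[a, b] p ->
  (\int[leb]_(t in `[a, b]) `|p t|) ^+ 2 <= (b - a) * \int[leb]_(t in `[a, b]) (p t ^+ 2).
Proof.
move=> ab Lp.
have mI : measurable (`[a, b]%classic : set (measurableTypeR R)) by exact: measurable_itv.
have fI : (leb `[a, b] < +oo)%E by rewrite leb_cc// ltry.
have Ln : L2 leb `[a, b] (fun t => `|p t|).
  apply: (L2_dom (mu := leb) mI _ Lp); first by apply: measurableT_comp => //; case: Lp.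
  by move=> x _; rewrite normr_id.
have := cauchy_schwarz1 (mu := leb) mI fI Ln.
have -> : fine (leb `[a, b]) = b - a by rewrite leb_cc.
have -> // : \int[leb]_(x in `[a, b]) (`|p x| ^+ 2) = \int[leb]_(t in `[a, b]) (p t ^+ 2).
by apply: eq_Rintegral => x _; rewrite real_normK ?num_real.
Qed.

End IndefBounds.

Section LebesgueCells.
Context {R : realType}.
Variable l : R.
Hypothesis l0 : 0 < l.
Local Notation leb := (@lebesgue_measure R).

Lemma cell_mass_leb N i : (i < 2 ^ N)%N -> cell_mass l leb N i = l / 2 ^+ N.
Proof.
move=> iN; have h0 : 0 < l / 2 ^+ N by rewrite divr_gt0// exprn_gt0.
have -> : cell_mass l leb N i = fine (leb (cell l N i)) by [].
rewrite cellE//; case: ifP => [/eqP iE|_]; rewrite lebesgue_measure_itv /=.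
  have -> : l%:E = (dyad l N i + l / 2 ^+ N)%:E by rewrite -dyadS iE dyad_last.
  by rewrite lte_fin ltrDl h0 /= addrAC subrr add0r.
by rewrite lte_fin dyadS ltrDl h0 /= addrAC subrr add0r.
Qed.

End LebesgueCells.

Section Fisher.
Context {R : realType}.
Variable l : R.
Hypothesis l0 : 0 < l.
Local Notation leb := (@lebesgue_measure R).
Local Notation D := (`[0, l]%classic : set (measurableTypeR R)).
Variables (rho pi : {finite_measure set (measurableTypeR R) -> \bar R}).
Hypothesis wpi : forall N i, (i < 2 ^ N)%N -> 0 < cell_mass l pi N i.

Definition cell_root (N i : nat) : R := Num.sqrt (cell_mass l rho N i / cell_mass l pi N i).
(** A discrete version of [\int |q'| ^ 2], up to the factor [l]: the cells have
length [l / 2 ^+ N]. *)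
Definition fisher_sum (N : nat) : R :=
  2 ^+ N * \sum_(i < (2 ^ N)%N.-1) (cell_root N i.+1 - cell_root N i) ^+ 2.

Let mD : measurable D. Proof. exact: measurable_itv. Qed.
Let mC N i : measurable (cell l N i : set (measurableTypeR R)).
Proof. exact: measurable_cell. Qed.

Section FisherUpper.
Variables (q p : R -> R).
Hypothesis iq : indef 0 l q p.
Hypothesis Lp : L2 leb D p.
Hypothesis q0 : forall x, D x -> 0 <= q x.
Hypothesis rhoE : forall A, measurable A -> A `<=` D ->
  rho A = (\int[pi]_(x in A) (q x ^+ 2)%:E)%E.

Lemma fisher_near N i y : (i < 2 ^ N)%N -> dyad l N i <= y <= dyad l N i.+1 ->
  `|cell_root N i - q y| ^+ 2 <=
  l / 2 ^+ N * \int[leb]_(t in `[dyad l N i, dyad l N i.+1]) (p t ^+ 2).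
Proof.
set h := l / 2 ^+ N.
have dle k : dyad l N k <= dyad l N k.+1 by apply: dyad_le.
have mq := within_measurable (indef_continuous (ltW l0) iq).
move=> iN yi.
have d1 : 0 <= dyad l N i by exact: dyad_ge0.
have d2 : dyad l N i.+1 <= l by exact: dyad_lel.
have iqi := indef_sub iq d1 (dle i) d2.
have Lpi : L2 leb `[dyad l N i, dyad l N i.+1] p.
  by apply: (L2_subset (mu := leb) mD _ _ Lp); [exact: measurable_itv|exact: itvcc_sub].
have cs := cs_itv (dle i) Lpi.
set V := \int[leb]_(t in _) `|p t| in cs.
have V0 : 0 <= V by apply: Rintegral_ge0.
have yD : D y by rewrite /= in_itv /=; case/andP: yi => y1 y2; rewrite (le_trans d1)// (le_trans y2).
have := @avg_sqrt_near _ _ _ pi (cell l N i) (cst 1) q (q y) V (mC N i).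
have CD : cell l N i `<=` D by exact: cell_sub.
have W1 : \int[pi]_(x in cell l N i) (cst 1 x) = cell_mass l pi N i.
  by rewrite Rintegral_cst ?mul1r//; exact: mC.
have -> : \int[pi]_(x in cell l N i) (cst 1 x * q x ^+ 2) = cell_mass l rho N i.
  have -> : cell_mass l rho N i = fine (rho (cell l N i)) by []; rewrite rhoE; [|exact: mC|exact: cell_sub].
  by rewrite /Rintegral; congr fine; apply: eq_integral => x _; rewrite mul1r.
rewrite W1 => H.
have : `|cell_root N i - q y| <= V.
  apply: H => //.
  - exact: measurable_funS mq.
  - have := finite_measure_integrable_cst pi 1 (mC N i); apply.
  - exact: wpi.
  - exact: q0.
  - by move=> x /CD; exact: q0.
  - move=> x Cx _; apply: (indef_osc iqi) => //; exact: cell_itv.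
move=> QV; apply: (@le_trans _ _ (V ^+ 2)); first by rewrite lerXn2r ?nnegrE.
have -> : h = dyad l N i.+1 - dyad l N i by rewrite dyadS addrAC subrr add0r.
exact: cs.
Qed.

Lemma cell_root_cvg x : D x -> cell_root N (cell_idx l N x) @[N --> \oo] --> q x.
Proof.
move=> Dx; apply/cvgrPdist_le => e e0.
set K := \int[leb]_(t in D) (p t ^+ 2).
have K0 : 0 <= K by apply: Rintegral_ge0 => t _; exact: sqr_ge0.
have c : l / 2 ^+ N * K @[N --> \oo] --> (0 : R).
  rewrite -(mul0r K); apply: cvgM; last exact: cvg_cst.
  rewrite -(mulr0 l); apply: cvgM; first exact: cvg_cst.
  have -> : (fun N => (2 ^+ N)^-1 : R) = (fun N => (1 / 2) ^+ N).
    by apply/funext => N; rewrite div1r exprVn.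
  by apply: cvg_expr; rewrite ger0_norm; lra.
have /cvgrPdist_le /(_ _ (exprn_gt0 2 e0)) [N0 _ H] := c.
exists N0 => // N N0N; have := H N N0N; rewrite /= sub0r normrN => {}H.
rewrite -(@ler_pXn2r _ 2)// ?nnegrE ?normr_ge0//; last exact: ltW.
apply: le_trans H; apply: le_trans (ler_norm _).
have Dx' : 0 <= x <= l by move: Dx; rewrite /= in_itv.
have iN := cell_idx_lt l N x.
rewrite distrC; apply: (le_trans (fisher_near iN (y := x) (cell_itv l0 _))); first by split.
apply: ler_wpM2l; first by rewrite divr_ge0 ?exprn_ge0// ltW.
have SD : `[dyad l N (cell_idx l N x), dyad l N (cell_idx l N x).+1]%classic `<=` D.
  by apply: itvcc_sub; [exact: dyad_ge0|exact: dyad_lel].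
have mS : measurable (`[dyad l N (cell_idx l N x), dyad l N (cell_idx l N x).+1]%classic : set (measurableTypeR R)).
  exact: measurable_itv.
have [_ ip2] := Lp; rewrite -lee_fin !EFin_Rint//; last exact: integrableS ip2.
apply: ge0_subset_integral => //.
- by case/integrableP: ip2.
- by move=> t _; rewrite lee_fin sqr_ge0.
Qed.

(** Both neighbouring cell roots are close to the value of [q] at the common end
point ([fisher_near]). *)
Lemma fisher_le N : fisher_sum N <= 4 * l * \int[leb]_(x in D) (p x ^+ 2).
Proof.
rewrite /fisher_sum.
set h := l / 2 ^+ N.
have N0 : 0 < 2 ^+ N :> R by exact: exprn_gt0.
have h0 : 0 < h by rewrite divr_gt0.
pose I (i : nat) := \int[leb]_(t in `[dyad l N i, dyad l N i.+1]) (p t ^+ 2).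
have dle i : dyad l N i <= dyad l N i.+1 by apply: dyad_le.
have near := @fisher_near N.
have term i : (i.+1 < 2 ^ N)%N -> (cell_root N i.+1 - cell_root N i) ^+ 2 <= 2 * h * (I i + I i.+1).
  move=> iN.
  have n1 := near i (dyad l N i.+1) (ltnW iN) _; rewrite dle lexx -/h -/(I i) in n1.
  have n2 := near i.+1 (dyad l N i.+1) iN _; rewrite dle lexx -/h -/(I i.+1) in n2.
  have {}n1 := n1 isT; have {}n2 := n2 isT.
  rewrite !real_normK ?num_real// in n1 n2.
  set a := cell_root N i in n1 *; set b := cell_root N i.+1 in n2 *; set c := q _ in n1 n2.
  have := sqr_ge0 (a - c + (b - c)); nra.
have I0 i : 0 <= I i by apply: Rintegral_ge0 => x _; exact: sqr_ge0.
have sumI : \sum_(i < (2 ^ N)%N) I i = \int[leb]_(x in D) (p x ^+ 2).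
  pose J x := \int[leb]_(t in `[0, x]) (p t ^+ 2).
  have iJ : indef 0 l J (fun t => p t ^+ 2).
    by split; [case: Lp|move=> x _; rewrite /J set_itv1 Rintegral_set1 add0r].
  rewrite (eq_bigr (fun i : 'I_(2 ^ N)%N => J (dyad l N i.+1) - J (dyad l N i))); last first.
    move=> i _; rewrite (indef_incr iJ _ (dle i))//; [exact: dyad_ge0|exact: dyad_lel].
  rewrite -(big_mkord xpredT (fun i => J (dyad l N i.+1) - J (dyad l N i))).
  rewrite (telescope_sumr (fun i => J (dyad l N i)))// dyad_last dyad0.
  by rewrite {2}/J set_itv1 Rintegral_set1 subr0.
have pN : ((2 ^ N)%N.-1.+1 = 2 ^ N)%N by rewrite prednK ?expn_gt0.
apply: (@le_trans _ _ (2 ^+ N * \sum_(i < (2 ^ N)%N.-1) (2 * h * (I i + I i.+1)))).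
  (apply: ler_wpM2l; first exact: ltW); apply: ler_sum => i _; apply: term.
  by apply: leq_ltn_trans (ltn_ord i) _; rewrite ltn_predL expn_gt0.
rewrite -mulr_sumr big_split /= -sumI.
have s1 : \sum_(i < (2 ^ N)%N.-1) I i <= \sum_(i < (2 ^ N)%N) I i.
  by rewrite -[in leRHS]pN big_ord_recr /= lerDl.
have s2 : \sum_(i < (2 ^ N)%N.-1) I i.+1 <= \sum_(i < (2 ^ N)%N) I i.
  by rewrite -[in leRHS]pN big_ord_recl /= lerDr.
set S := \sum_(i < (2 ^ N)%N) I i in s1 s2 *.
have -> : 4 * l * S = 2 ^+ N * (2 * h * (S + S)) by rewrite /h; field; rewrite gt_eqF.
apply: ler_wpM2l; first exact: ltW.
by apply: ler_wpM2l; [rewrite mulr_ge0// ltW|exact: lerD].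
Qed.


End FisherUpper.

Section FisherRep.
Variable F : R.
Hypothesis FF : forall N, fisher_sum N <= F.

(* The numbers 4 and 3 below only say that [s] is dominated by a telescoping sequence: [s N.+1 <= 3 s N - 3 s N.+1]. *)
Let lam : R := Num.sqrt (1 / 2).
Let lam0 : 0 <= lam. Proof. exact: sqrtr_ge0. Qed.
Let lam2 : lam ^+ 2 = 1 / 2. Proof. by rewrite sqr_sqrtr; lra. Qed.
Let lam34 : 4 * lam <= 3.
Proof. by rewrite -(@ler_pXn2r _ 2)// ?nnegrE ?mulr_ge0// exprMn lam2; lra. Qed.
Let F0 : 0 <= F.
Proof.
by apply: le_trans (FF 0); rewrite /fisher_sum mulr_ge0// sumr_ge0// => i _; exact: sqr_ge0.
Qed.
Let s (N : nat) : R := Num.sqrt F * lam ^+ N.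
Let s0 N : 0 <= s N. Proof. by rewrite mulr_ge0 ?sqrtr_ge0 ?exprn_ge0. Qed.
Let sS N : 4 * s N.+1 <= 3 * s N.
Proof.
have -> : 4 * s N.+1 = s N * (4 * lam) by rewrite /s exprS; ring.
by rewrite [leRHS]mulrC ler_wpM2l.
Qed.
Let sqr_s N : s N ^+ 2 = F / 2 ^+ N.
Proof.
rewrite /s exprMn sqr_sqrtr// exprAC lam2 expr_div_n expr1n; congr (_ * _).
by rewrite div1r.
Qed.
Let s_cvg : s N @[N --> \oo] --> (0 : R).
Proof.
rewrite -(mulr0 (Num.sqrt F)); apply: cvgM; first exact: cvg_cst.
by apply: cvg_expr; rewrite ger0_norm//; have := lam34; lra.
Qed.

Let cell_root_ge0 N i : 0 <= cell_root N i. Proof. exact: sqrtr_ge0. Qed.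

Let Q_gap N i : (i.+1 < 2 ^ N)%N -> `|cell_root N i.+1 - cell_root N i| <= s N.
Proof.
move=> iN; rewrite -(@ler_pXn2r _ 2)// ?nnegrE// sqr_s ler_pdivlMr ?exprn_gt0//.
have pN : ((2 ^ N)%N.-1.+1 = 2 ^ N)%N by rewrite prednK ?expn_gt0.
have iN' : (i < (2 ^ N).-1)%N by rewrite -ltnS pN.
apply: le_trans (FF N); rewrite /fisher_sum mulrC ler_wpM2l ?exprn_ge0//.
rewrite real_normK ?num_real// (bigD1 (Ordinal iN'))//= lerDl.
by apply: sumr_ge0 => k _; exact: sqr_ge0.
Qed.

Let cell_massD (m : {finite_measure set (measurableTypeR R) -> \bar R}) N i :
  cell_mass l m N i = cell_mass l m N.+1 i.*2 + cell_mass l m N.+1 i.*2.+1.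
Proof.
rewrite /cell_mass cell_split measureU; [|exact: mC|exact: mC|].
  by rewrite fineD// fin_num_measure//; exact: mC.
by apply/eqP; apply: cell_disj; rewrite neq_ltn ltnSn.
Qed.

Let Q_avg (a b x y : R) : 0 < a -> 0 < b -> 0 <= x -> 0 <= y ->
  `|x - Num.sqrt ((x ^+ 2 * a + y ^+ 2 * b) / (a + b))| <= `|y - x|.
Proof.
move=> a0 b0 x0 y0; set V := `|y - x|.
have yV : x - V <= y <= x + V by rewrite /V; case: (ger0P (y - x)) => ?; lra.
rewrite distrC; apply: sqrt_near => //; rewrite ?normr_ge0//.
- by rewrite divr_ge0 ?addr_ge0 ?mulr_ge0 ?sqr_ge0// ltW.
- rewrite ler_pdivrMr ?addr_gt0// mulrDr lerD//; (apply: ler_wpM2r; first exact: ltW).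
    by rewrite lerXn2r ?nnegrE ?addr_ge0 ?normr_ge0// lerDl normr_ge0.
  by rewrite lerXn2r ?nnegrE ?addr_ge0 ?normr_ge0//; case/andP: yV.
- move=> Vx; rewrite ler_pdivlMr ?addr_gt0// mulrDr lerD//; (apply: ler_wpM2r; first exact: ltW).
    by rewrite lerXn2r ?nnegrE ?subr_ge0// gerBl normr_ge0.
  by rewrite lerXn2r ?nnegrE ?subr_ge0//; case/andP: yV.
Qed.

Let cell_mass_sqr N i : (i < 2 ^ N)%N -> cell_mass l rho N i = cell_root N i ^+ 2 * cell_mass l pi N i.
Proof.
move=> iN; rewrite sqr_sqrtr ?divr_ge0 ?cell_mass_ge0//; first by rewrite divfK// gt_eqF ?wpi.
Qed.

Let Q_child N k : (k < 2 ^ N.+1)%N -> `|cell_root N.+1 k - cell_root N k./2| <= s N.+1.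
Proof.
move=> kN; set i := k./2.
have iN : (i < 2 ^ N)%N by move: kN; rewrite /i expnS mul2n ltn_half_double.
have i2 : (i.*2.+1 < 2 ^ N.+1)%N by rewrite expnS mul2n -doubleS leq_double.
have i1 := ltnW i2.
have gap := Q_gap i2.
have a0 := wpi i1; have b0 := wpi i2.
have E : cell_root N i = Num.sqrt ((cell_root N.+1 i.*2 ^+ 2 * cell_mass l pi N.+1 i.*2 +
   cell_root N.+1 i.*2.+1 ^+ 2 * cell_mass l pi N.+1 i.*2.+1) / (cell_mass l pi N.+1 i.*2 + cell_mass l pi N.+1 i.*2.+1)).
  by rewrite {1}/cell_root cell_massD [cell_mass l pi N i]cell_massD !cell_mass_sqr.
have [ko|ke] := boolP (odd k).
  have -> : k = i.*2.+1 by rewrite -[LHS]odd_double_half ko.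
  have := Q_avg b0 a0 (cell_root_ge0 N.+1 i.*2.+1) (cell_root_ge0 N.+1 i.*2).
  rewrite [X in X / _]addrC [X in _ / X]addrC -E => /le_trans; apply.
  by rewrite distrC.
have -> : k = i.*2 by rewrite -[LHS]odd_double_half (negbTE ke).
by rewrite E; apply: le_trans (Q_avg a0 b0 (cell_root_ge0 _ _) (cell_root_ge0 _ _)) _.
Qed.

Let qN N x := cell_root N (cell_idx l N x).

Let qN_step N x : `|qN N.+1 x - qN N x| <= s N.+1.
Proof. by rewrite /qN [cell_idx l N x]cell_idx_half; apply: Q_child; exact: cell_idx_lt. Qed.

Let qN_diff N k x : `|qN (N + k) x - qN N x| <= 3 * s N - 3 * s (N + k)%N.
Proof.
elim: k => [|k IH]; first by rewrite addn0 !subrr normr0.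
have h := qN_step (N + k) x; have h2 := sS (N + k); rewrite addnS.
have := ler_normD (qN (N + k).+1 x - qN (N + k) x) (qN (N + k) x - qN N x).
have -> : qN (N + k).+1 x - qN (N + k) x + (qN (N + k) x - qN N x) =
  qN (N + k).+1 x - qN N x by ring.
lra.
Qed.

Definition qlim (x : R) : R := limn (qN ^~ x).

Let qN_cvg x : qN N x @[N --> \oo] --> qlim x.
Proof.
pose u N := qN N x + 3 * s N.
have cu : cvgn u.
  apply: nonincreasing_is_cvgn.
    apply/nonincreasing_seqP => N; rewrite /u.
    have := qN_step N x; rewrite ler_norml => /andP[_]; have := sS N; lra.
  exists 0 => _ [N _ <-]; rewrite /u; have := s0 N; have := cell_root_ge0 N (cell_idx l N x).
  by rewrite /qN; lra.
have E : qN ^~ x = (fun N => u N - 3 * s N) by apply/funext => N; rewrite /u addrK.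
have c : qN N x @[N --> \oo] --> limn u - 3 * 0.
  rewrite E; apply: cvgB; first exact: cu.
  by apply: cvgM; [exact: cvg_cst|exact: s_cvg].
by rewrite /qlim; rewrite (cvg_lim _ c).
Qed.

Let qlim_near N x : `|qlim x - qN N x| <= 3 * s N.
Proof.
have c : `|qN (k + N) x - qN N x| @[k --> \oo] --> `|qlim x - qN N x|.
  apply: cvg_norm; apply: cvgB; last exact: cvg_cst.
  by have := @qN_cvg x; rewrite -(cvg_shiftn N).
rewrite -(cvg_lim _ c)//; apply: limr_le; first by apply/cvg_ex; eexists; exact: c.
apply: nearW => k; rewrite addnC; apply: (le_trans (qN_diff N k x)).
by have := s0 (N + k); lra.
Qed.

Let qlim_ge0 x : 0 <= qlim x.
Proof.
have c := @qN_cvg x; rewrite -(cvg_lim _ c)//; apply: limr_ge; first by apply/cvg_ex; eexists; exact: c.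
by apply: nearW => k; exact: cell_root_ge0.
Qed.

Let same_idx N x y : cell_idx l N x = cell_idx l N y -> `|qlim x - qlim y| <= 6 * s N.
Proof.
move=> E; have := qlim_near N x; have := qlim_near N y; rewrite /qN E.
set c := cell_root N _ => h1 h2.
have := ler_normB (qlim x - c) (qlim y - c).
have -> : qlim x - c - (qlim y - c) = qlim x - qlim y by ring.
lra.
Qed.

Let qN_stepE N x : D x -> qN N x = step l N (cell_root N) x.
Proof. by move=> Dx; rewrite stepE. Qed.

Let mqlim : measurable_fun D qlim.
Proof.
apply: (measurable_fun_cvg (h := fun N => qN N)) => [N|x _]; last exact: qN_cvg.
apply: (eq_measurable_fun (step l N (cell_root N))); first by move=> x; rewrite inE => /qN_stepE.
by apply: measurable_funTS; exact: measurable_step.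
Qed.

Let qN_bd N x : `|qN N x| <= cell_root 0 0 + 3 * s 0.
Proof.
have := qN_diff 0 N x; rewrite add0n {2}/qN.
have -> : cell_idx l 0 x = 0%N by rewrite /cell_idx expn0 minn0.
have := ler_normD (qN N x - cell_root 0 0) (cell_root 0 0); rewrite subrK [`|cell_root 0 0|]ger0_norm//.
have := s0 N; lra.
Qed.

Let bd0 : 0 <= cell_root 0 0 + 3 * s 0. Proof. by have := s0 0; have := cell_root_ge0 0 0; lra. Qed.

Let piD : (pi D < +oo)%E. Proof. by rewrite -ge0_fin_numE// fin_num_measure. Qed.

Lemma qlim_cell N i : (i < 2 ^ N)%N ->
  \int[pi]_(x in cell l N i) (qlim x ^+ 2) = cell_mass l rho N i.
Proof.
move=> iN; have CD : cell l N i `<=` D by exact: cell_sub.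
pose c (N : nat) i := cell_mass l rho N i / cell_mass l pi N i.
have E k x : cell l N i x -> step l (N + k)%N (c (N + k)%N) x = qN (N + k)%N x ^+ 2.
  move=> /CD Dx; rewrite stepE// /c /qN sqr_sqrtr//.
  by rewrite divr_ge0 ?cell_mass_ge0.
have [|||||_ cv] := @Rintegral_dct _ _ _ pi (cell l N i) (fun k x => qN (N + k)%N x ^+ 2) (fun x => qlim x ^+ 2)
  (fun=> (cell_root 0 0 + 3 * s 0) ^+ 2) (mC N i).
- move=> k; apply: (eq_measurable_fun (step l (N + k)%N (c (N + k)%N))).
    by move=> x; rewrite inE => /E.
  by apply: measurable_funTS; exact: measurable_step.
- by apply: measurable_funX; exact: measurable_funS mqlim.
- apply: nearW => x _; apply: cvg_sqr.
  have := @qN_cvg x; rewrite -(cvg_shiftn N).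
  by under eq_fun do rewrite addnC.
- by have := finite_measure_integrable_cst pi ((cell_root 0 0 + 3 * s 0) ^+ 2) (mC N i); apply.
- apply: nearW => x _ k; rewrite normrX lerXn2r ?nnegrE//; exact: qN_bd.
have C k : \int[pi]_(x in cell l N i) (qN (N + k)%N x ^+ 2) = cell_mass l rho N i.
  rewrite -(@step_b_int R l l0 pi piD (cell_mass l rho) _ _ N k i iN)//.
  - by apply: eq_Rintegral => x; rewrite inE => /E <-.
  - by move=> M k' kM w0; have := wpi kM; rewrite w0 ltxx.
by rewrite -(cvg_lim _ cv)//; under eq_fun do rewrite C; rewrite lim_cst.
Qed.

Let qdens (x : R) : R := (qlim x * \1_D x) ^+ 2.
Let mqdens : measurable_fun setT (fun x => (qdens x)%:E).
Proof.
apply/measurable_EFinP; apply: measurable_funX.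
have -> : (fun x => qlim x * \1_D x) = qlim \_ D.
  apply/funext => x; rewrite patchE indicE; case: (x \in D); rewrite ?mulr1//.
  by rewrite mulr0.
exact: (measurable_restrictT _ mD).1.
Qed.

Lemma qlim_density : forall A : set (measurableTypeR R), measurable A -> A `<=` D ->
  rho A = (\int[pi]_(x in A) (qlim x ^+ 2)%:E)%E.
Proof.
have dE (A : set (measurableTypeR R)) : A `<=` D ->
    (\int[pi]_(x in A) (qlim x ^+ 2)%:E = \int[pi]_(x in A) (qdens x)%:E)%E.
  move=> AD; apply: eq_integral => x; rewrite inE => /AD Dx.
  by rewrite /qdens indicE mem_set ?mulr1.
have d0 x : (0 <= (qdens x)%:E)%E by rewrite lee_fin sqr_ge0.
pose m (A : set (measurableTypeR R)) := (\int[pi]_(x in A) (qdens x)%:E)%E.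
have m0 : m set0 = 0%E by rewrite /m integral_set0.
have mge0 A : (0 <= m A)%E by apply: integral_ge0.
have msa : semi_sigma_additive m by exact: semi_sigma_additive_nng_induced.
pose B := isMeasure.Build _ _ _ m m0 mge0 msa.
pose M : {measure set (measurableTypeR R) -> \bar R} := HB.pack m B.
have mT : (m setT < +oo)%E.
  apply: (@le_lt_trans _ _ (\int[pi]_x ((cell_root 0 0 + 3 * s 0) ^+ 2)%:E)%E).
    apply: ge0_le_integral => //.
    - move=> x _; rewrite lee_fin /qdens indicE; case: (x \in D); rewrite /= ?mulr1 ?mulr0 ?expr0n ?sqr_ge0//.
      rewrite lerXn2r ?nnegrE//.
      have c := @qN_cvg x; rewrite -(cvg_lim _ c)//; apply: limr_le; first by apply/cvg_ex; eexists; exact: c.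
      by apply: nearW => k; apply: le_trans (qN_bd k x); exact: ler_norm.
  rewrite integral_cst// lte_mul_pinfty ?lee_fin ?sqr_ge0//.
  by rewrite -ge0_fin_numE// fin_num_measure.
have mf : fin_num_fun m.
  move=> A mA; rewrite ge0_fin_numE//; apply: le_lt_trans mT.
  by rewrite -[m A]/(M A) -[m setT]/(M setT); apply: le_measure; rewrite ?inE.
pose M' : {finite_measure set (measurableTypeR R) -> \bar R} :=
  HB.pack m B (@Measure_isFinite.Build _ _ _ M mf).
move=> A mA AD; rewrite dE//.
apply: (@dyadic_unique R l l0 rho M' _ A mA AD) => N i iN.
rewrite /= /m -dE; last exact: cell_sub.
have := qlim_cell iN.
have piC : (pi (cell l N i) < +oo)%E by rewrite -ge0_fin_numE// fin_num_measure//; exact: mC.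
move=> H; rewrite -(EFin_Rint (mu := pi) (mC N i)); first last.
- apply: (bounded_integrable (mu := pi) (mC N i) piC (K := (cell_root 0 0 + 3 * s 0) ^+ 2)).
    by apply: measurable_funX; apply: measurable_funS mqlim => //; exact: cell_sub.
  move=> x _; rewrite normrX lerXn2r ?nnegrE//.
  have c : `|qN N' x| @[N' --> \oo] --> `|qlim x| by apply: cvg_norm; exact: qN_cvg.
  rewrite -(cvg_lim _ c)//; apply: limr_le; first by apply/cvg_ex; eexists; exact: c.
  by apply: nearW => k; exact: qN_bd.
by rewrite H /cell_mass fineK// fin_num_measure//; exact: mC.
Qed.

(* Difference quotients of the level [M] roots on the grid of level [N]; convexity makes them increase with [N], and at [N = M] they are the Fisher sum. *)
Let S M N : R := 2 ^+ N * \sum_(i < (2 ^ N)%N) (qN M (dyad l N i.+1) - qN M (dyad l N i)) ^+ 2.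

Let S_mono M N : S M N <= S M N.+1.
Proof.
have E := sum_double (2 ^ N)%N (fun i => (qN M (dyad l N.+1 i.+1) - qN M (dyad l N.+1 i)) ^+ 2).
rewrite /S exprS -mulrA mulrCA; apply: ler_wpM2l; first exact: exprn_ge0.
rewrite expnS mul2n E mulr_sumr; apply: ler_sum => i _.
rewrite -doubleS !dyad_half; set a := qN M _; set b := qN M _; set c := qN M _.
by have := sqr_ge0 (a - 2 * c + b); nra.
Qed.

Let S_diag M : S M M = fisher_sum M.
Proof.
rewrite /S /fisher_sum; congr (_ * _).
have pN : ((2 ^ M)%N.-1.+1 = 2 ^ M)%N by rewrite prednK ?expn_gt0.
have idd i : (i < 2 ^ M)%N -> cell_idx l M (dyad l M i) = i.
  move=> iM; apply/eqP; rewrite eqn_leq (cell_idx_ltP l0 _ iM) ?dyad_ge0// lexx andbT leqNgt.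
  apply/negP => h; have iM1 : (i.+1 < 2 ^ M)%N by apply: leq_ltn_trans h (cell_idx_lt _ _ _).
  move: h; rewrite (cell_idx_ltP l0 _ iM1) ?dyad_ge0// dyadS => h.
  have : 0 < l / 2 ^+ M by rewrite divr_gt0// exprn_gt0.
  lra.
have idl : cell_idx l M (dyad l M (2 ^ M)%N) = (2 ^ M)%N.-1.
  apply/eqP; rewrite eqn_leq -ltnS pN cell_idx_lt /= cell_idx_ltP ?dyad_ge0//.
    by apply: dyad_le => //; exact: leq_pred.
  by rewrite ltn_predL expn_gt0.
have e : qN M (dyad l M (2 ^ M)%N.-1.+1) - qN M (dyad l M (2 ^ M)%N.-1) = 0.
  by rewrite pN /qN idl idd ?subrr// ltn_predL expn_gt0.
rewrite -[in LHS]pN big_ord_recr /= e expr0n addr0; apply: eq_bigr => i _.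
have iM : (i.+1 < 2 ^ M)%N by apply: leq_ltn_trans (ltn_ord i) _; rewrite ltn_predL expn_gt0.
by rewrite /qN !idd// ltnW.
Qed.

Let S_le M N : (N <= M)%N -> S M N <= F.
Proof.
move=> NM; apply: le_trans (FF M); rewrite -S_diag.
have H k : S M N <= S M (N + k)%N.
  by elim: k => [|k IH]; rewrite ?addn0// addnS (le_trans IH).
by apply: (le_trans (H (M - N)%N)); rewrite subnKC.
Qed.

(** A bound on [fisher_sum] alone produces the H^1 root. It makes neighbouring cell roots
at level [N] differ by at most [s N], which decays like [2 ^+ N] to the power
-1/2; the root of a cell lies between those of its two halves, so the roots converge
uniformly to some [qlim], and [qlim ^ 2] is the density of [rho] because it
has the right integral over every cell. The squared difference quotients of [qlim]
on dyadic grids stay bounded by [F], so by [dyadic_density] its increments have an L^2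
density. *)
Lemma fisher_rep : exists q p, [/\ indef 0 l q p, L2 leb D p, (forall x, 0 <= q x) &
  forall A : set (measurableTypeR R), measurable A -> A `<=` D ->
    rho A = (\int[pi]_(x in A) (q x ^+ 2)%:E)%E].
Proof.
have lebD : (leb D < +oo)%E by rewrite leb_cc ?ltry// ltW.
pose nu N i := qlim (dyad l N i.+1) - qlim (dyad l N i).
have nuA N i : (i < 2 ^ N)%N -> nu N i = nu N.+1 i.*2 + nu N.+1 i.*2.+1.
  by move=> _; rewrite /nu -doubleS !dyad_half; ring.
have nu0 N i : (i < 2 ^ N)%N -> cell_mass l leb N i = 0 -> nu N i = 0.
  move=> iN; rewrite (cell_mass_leb l0)// => /eqP; rewrite gt_eqF//.
  by rewrite divr_gt0// exprn_gt0.
have nuF N : \sum_(i < (2 ^ N)%N) nu N i ^+ 2 / cell_mass l leb N i <= F / l.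
  have c : S (M + N)%N N / l @[M --> \oo] -->
      2 ^+ N * (\sum_(i < (2 ^ N)%N) nu N i ^+ 2) / l.
    apply: cvgM; last exact: cvg_cst; apply: cvgM; first exact: cvg_cst.
    apply: cvg_sumR => i; apply: cvg_sqr.
    by rewrite (cvg_shiftn N (fun M => qN M _ - qN M _)); apply: cvgB; exact: qN_cvg.
  have -> : \sum_(i < (2 ^ N)%N) nu N i ^+ 2 / cell_mass l leb N i =
      2 ^+ N * (\sum_(i < (2 ^ N)%N) nu N i ^+ 2) / l.
    rewrite mulr_sumr mulr_suml; apply: eq_bigr => i _; rewrite (cell_mass_leb l0)// invf_div.
    by ring.
  rewrite -(cvg_lim _ c)//; apply: limr_le; first by apply/cvg_ex; eexists; exact: c.
  by apply: nearW => M; rewrite ler_pM2r ?invr_gt0// S_le// leq_addl.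
have [p [Lp pc _ _]] := @dyadic_density R l l0 leb lebD nu _ nuA nu0 nuF.
have ip := L2_integrable mD lebD Lp.
exists qlim, p; split => //; last exact: qlim_density.
split => // x xl.
pose J x := qlim 0 + \int[leb]_(t in `[0, x]) p t.
have J0 : J 0 = qlim 0 by rewrite /J set_itv1 Rintegral_set1 addr0.
have iJ : indef 0 l J p by split => // y _; rewrite J0.
have dq N i : (i <= 2 ^ N)%N -> qlim (dyad l N i) = J (dyad l N i).
  elim: i => [|i IH] iN; first by rewrite dyad0 J0.
  apply/eqP; rewrite -subr_eq0; apply/eqP.
  have di : dyad l N i <= dyad l N i.+1 by exact: dyad_le.
  have : J (dyad l N i.+1) - J (dyad l N i) = nu N i.
    rewrite (indef_incr iJ (dyad_ge0 l0 N i) di (dyad_lel l0 iN)) -pc// cellE//.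
    case: ifP => [/eqP iE|_]; first by rewrite iE dyad_last.
    rewrite Rintegral_itv_bndo_bndc//.
    apply: (integrableS (mu := leb) mD _ _ ip); first exact: measurable_itv.
    apply: subset_trans (itvcc_sub (dyad_ge0 l0 N i) (dyad_lel l0 iN)).
    by apply: subset_itvl; rewrite bnd_simp.
  by rewrite /nu -(IH (ltnW iN)); lra.
set K := \int[leb]_(t in D) (p t ^+ 2).
have near N : `|qlim x - J x| <= (6 * Num.sqrt F + Num.sqrt (l * K)) * lam ^+ N.
  set i := cell_idx l N x; have iN : (i < 2 ^ N)%N := cell_idx_lt l N x.
  have xi : dyad l N i <= x <= dyad l N i.+1 by apply: (@cell_itv _ _ l0); split.
  have [d0 dx] : 0 <= dyad l N i /\ dyad l N i.+1 <= l.
    by split; [exact: dyad_ge0|exact: dyad_lel].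
  have di : dyad l N i <= dyad l N i.+1 by exact: dyad_le.
  have idi : cell_idx l N (dyad l N i) = i.
    apply/eqP; rewrite eqn_leq (cell_idx_ltP l0 (dyad_ge0 l0 N i) iN) lexx andbT.
    rewrite leqNgt; apply/negP => h.
    have iN1 : (i.+1 < 2 ^ N)%N by apply: leq_ltn_trans h (cell_idx_lt _ _ _).
    move: h; rewrite (cell_idx_ltP l0 _ iN1) ?dyad_ge0// dyadS => h.
    have : 0 < l / 2 ^+ N by rewrite divr_gt0// exprn_gt0.
    lra.
  have iJi := indef_sub iJ d0 di dx.
  have mI : measurable (`[dyad l N i, dyad l N i.+1]%classic : set (measurableTypeR R)).
    exact: measurable_itv.
  have ID : `[dyad l N i, dyad l N i.+1]%classic `<=` D by exact: itvcc_sub.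
  have Lpi : L2 leb `[dyad l N i, dyad l N i.+1] p by exact: (L2_subset (mu := leb) mD).
  have hJ : `|J x - J (dyad l N i)| <= Num.sqrt (l * K) * lam ^+ N.
    apply: (le_trans (indef_osc iJi xi _)); first by rewrite lexx.
    have V0 : 0 <= \int[leb]_(t in `[dyad l N i, dyad l N i.+1]) `|p t| by apply: Rintegral_ge0.
    have K0 : 0 <= K by apply: Rintegral_ge0 => t _; exact: sqr_ge0.
    rewrite -(@ler_pXn2r _ 2)// ?nnegrE//; last by rewrite mulr_ge0 ?sqrtr_ge0 ?exprn_ge0.
    apply: (le_trans (cs_itv di Lpi)); rewrite dyadS addrAC subrr add0r -dyadS.
    rewrite exprMn sqr_sqrtr ?mulr_ge0 ?(ltW l0)//.
    rewrite exprAC lam2 expr_div_n expr1n mul1r mulrAC; apply: ler_wpM2r.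
      by rewrite invr_ge0 exprn_ge0.
    apply: ler_wpM2l; first exact: ltW.
    have [_ ip2] := Lp; have [_ ip2i] := Lpi; rewrite -lee_fin !EFin_Rint//.
    apply: ge0_subset_integral => //; first by case/integrableP: ip2.
    by move=> t _; rewrite lee_fin sqr_ge0.
  have hq : `|qlim x - qlim (dyad l N i)| <= 6 * s N by apply: same_idx; rewrite idi.
  rewrite (dq N i (ltnW iN)) in hq.
  have := ler_normB (qlim x - J (dyad l N i)) (J x - J (dyad l N i)).
  have -> : qlim x - J (dyad l N i) - (J x - J (dyad l N i)) = qlim x - J x by ring.
  by rewrite /s in hq; lra.
have c : (6 * Num.sqrt F + Num.sqrt (l * K)) * lam ^+ N @[N --> \oo] --> (0 : R).
  rewrite -(mulr0 (6 * Num.sqrt F + Num.sqrt (l * K))); apply: cvgM; first exact: cvg_cst.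
  by apply: cvg_expr; rewrite ger0_norm//; have := lam34; lra.
apply/eqP; rewrite -subr_eq0 -normr_le0 -[leRHS](cvg_lim _ c)//.
apply: limr_ge; first by apply/cvg_ex; eexists; exact: c.
by apply: nearW => N; exact: near.
Qed.

End FisherRep.

End Fisher.

(** * Densities of measures and charges *)

Local Open Scope charge_scope.

Section ChangeOfMeasure.
Context d (T : measurableType d) (R : realType).
Variables (mu : {sigma_finite_measure set T -> \bar R})
          (nu : {finite_measure set T -> \bar R}) (g : T -> R).
Hypothesis mg : measurable_fun setT g.
Hypothesis g0 : forall x, 0 <= g x.
Hypothesis nuE : forall A, measurable A -> nu A = (\int[mu]_(x in A) (g x)%:E)%E.

Lemma density_dominates : nu `<< mu.
Proof.
apply/null_content_dominatesP => A mA A0; rewrite nuE//.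
by apply: null_set_integral => //; apply/measurable_EFinP; exact: measurable_funTS.
Qed.

Lemma density_integrable : mu.-integrable setT (EFin \o g).
Proof.
apply/integrableP; split; first exact/measurable_EFinP.
under eq_integral do rewrite /= ger0_norm//.
by rewrite -nuE// -ge0_fin_numE// fin_num_measure.
Qed.

Lemma change_ge0 E (f : T -> R) : measurable E -> measurable_fun E f ->
  (forall x, E x -> 0 <= f x) ->
  (\int[nu]_(x in E) (f x)%:E = \int[mu]_(x in E) (f x * g x)%:E)%E.
Proof.
move=> mE mf f0; have dom := density_dominates.
pose h := Radon_Nikodym_SigmaFinite.f nu mu.
have ih : mu.-integrable setT h by exact: Radon_Nikodym_SigmaFinite.f_integrable.
have hg : ae_eq mu setT h (EFin \o g).
  apply: integral_ae_eq => //; first by case/integrableP: density_integrable.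
  by move=> A _ mA; rewrite -nuE// -Radon_Nikodym_SigmaFinite.f_integral.
have := @Radon_Nikodym_SigmaFinite.change_of_variables _ _ _ nu mu dom
  (fun x => `|f x|%:E) E _ mE _.
rewrite (eq_integral (mu := nu) (fun x => (f x)%:E)); last first.
  by move=> x; rewrite inE => Ex; rewrite ger0_norm// f0.
move=> <- //; last by apply/measurable_EFinP; apply: measurableT_comp.
apply: ae_eq_lower_integral; apply: ae_imply hg => x H Ex.
by rewrite -/h H//= ger0_norm ?f0.
Qed.

Lemma change_integrable E (f : T -> R) : measurable E -> measurable_fun E f ->
  mu.-integrable E (EFin \o (fun x => f x * g x)) -> nu.-integrable E (EFin \o f).
Proof.
move=> mE mf /integrableP[_ H]; apply/integrableP; split; first exact/measurable_EFinP.
apply: le_lt_trans H; rewrite (change_ge0 mE (f := fun x => `|f x|))//; last exact: measurableT_comp.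
by rewrite le_eqVlt; apply/orP; left; apply/eqP; apply: eq_integral => x _; rewrite /= normrM (ger0_norm (g0 x)).
Qed.

Lemma change_integrable_inv E (f : T -> R) : measurable E ->
  nu.-integrable E (EFin \o f) -> mu.-integrable E (EFin \o (fun x => f x * g x)).
Proof.
move=> mE ig; have mf := Rint_measurable ig; case/integrableP: ig => [_ H].
apply/integrableP; split.
  by apply/measurable_EFinP; apply: measurable_funM => //; exact: measurable_funTS.
apply: le_lt_trans H; rewrite (change_ge0 mE (f := fun x => `|f x|))//; last exact: measurableT_comp.
by rewrite le_eqVlt; apply/orP; left; apply/eqP; apply: eq_integral => x _; rewrite /= normrM (ger0_norm (g0 x)).
Qed.

Lemma change_Rint E (f : T -> R) : measurable E -> nu.-integrable E (EFin \o f) ->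
  \int[nu]_(x in E) f x = \int[mu]_(x in E) (f x * g x).
Proof.
move=> mE ig; have mf := Rint_measurable ig.
pose fp x := Num.max (f x) 0; pose fn x := Num.max (- f x) 0.
have f_ x : f x = fp x - fn x by rewrite /fp /fn; case: (leP 0 (f x)) => h; case: (leP 0 (- f x)) => h'; lra.
have mp : measurable_fun E fp by exact: measurable_maxr.
have mn : measurable_fun E fn by apply: measurable_maxr => //; exact: measurableT_comp.
have ip : nu.-integrable E (EFin \o fp).
  apply: (dom_integrable mE mp (RintNorm mE ig)) => x _; rewrite /fp.
  by case: (leP (f x) 0) => h; rewrite ?normr0.
have inn : nu.-integrable E (EFin \o fn).
  apply: (dom_integrable mE mn (RintNorm mE ig)) => x _; rewrite /fn -(normrN (f x)).
  by case: (leP (- f x) 0) => h; rewrite ?normr0.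
have ip' := change_integrable_inv mE ip; have in' := change_integrable_inv mE inn.
have -> : \int[nu]_(x in E) f x = \int[nu]_(x in E) fp x - \int[nu]_(x in E) fn x.
  by rewrite -RintegralB//; apply: eq_Rintegral => x _.
have -> : \int[mu]_(x in E) (f x * g x) =
    \int[mu]_(x in E) (fp x * g x) - \int[mu]_(x in E) (fn x * g x).
  by rewrite -RintegralB//; apply: eq_Rintegral => x _; rewrite {1}f_ mulrBl.
congr (_ - _); rewrite /Rintegral change_ge0// => x _; first by rewrite /fp le_max lexx orbT.
by rewrite /fn le_max lexx orbT.
Qed.

End ChangeOfMeasure.

Section DensityMeasure.
Context d (T : measurableType d) (R : realType).
Variable mu : {measure set T -> \bar R}.

Lemma density_measure (f : T -> R) : (forall x, 0 <= f x) -> mu.-integrable setT (EFin \o f) ->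
  exists M : {finite_measure set T -> \bar R},
    forall A, measurable A -> M A = (\int[mu]_(x in A) (f x)%:E)%E.
Proof.
move=> f0 fi.
pose m (A : set T) := (\int[mu]_(x in A) (f x)%:E)%E.
have m0 : m set0 = 0%E by rewrite /m integral_set0.
have mge0 A : (0 <= m A)%E by apply: integral_ge0 => x _; rewrite lee_fin.
have mf : measurable_fun setT (EFin \o f) by case/integrableP: fi.
have msa : semi_sigma_additive m by apply: semi_sigma_additive_nng_induced => // x; rewrite lee_fin.
pose B := isMeasure.Build _ _ _ m m0 mge0 msa.
have mfin : fin_num_fun m.
  move=> A mA; rewrite ge0_fin_numE//; case/integrableP: fi => _; apply: le_lt_trans.
  rewrite (eq_integral (mu := mu) (fun x => (f x)%:E)); last by move=> x _; rewrite /= ger0_norm.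
  by apply: ge0_subset_integral => // x _; rewrite lee_fin.
pose M0 : {measure set T -> \bar R} := HB.pack m B.
pose M : {finite_measure set T -> \bar R} :=
  HB.pack m B (@Measure_isFinite.Build _ _ _ M0 mfin).
by exists M.
Qed.

Lemma sum_measure (m1 m2 : {finite_measure set T -> \bar R}) :
  exists M : {finite_measure set T -> \bar R},
    forall A, measurable A -> M A = (m1 A + m2 A)%E.
Proof.
pose m : {measure set T -> \bar R} := measure_add m1 m2.
have mE A : m A = (m1 A + m2 A)%E by exact: measure_addE.
have mfin : fin_num_fun m by move=> A mA; rewrite mE fin_numD !fin_num_measure.
pose M : {finite_measure set T -> \bar R} :=
  HB.pack (Measure.sort m) (Measure.class m) (@Measure_isFinite.Build _ _ _ m mfin).
by exists M => A mA; exact: mE.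
Qed.

End DensityMeasure.

Section ChargeDensity.
Context d (T : measurableType d) (R : realType).
Variable rho : {finite_measure set T -> \bar R}.
Variable j : {charge set T -> \bar R}.

Definition has_density (b : T -> R) :=
  rho.-integrable setT (EFin \o b) /\
  forall A : set T, measurable A -> j A = (\int[rho]_(x in A) (b x)%:E)%E.

Lemma has_density_dom b : has_density b -> j `<< rho.
Proof.
move=> [ib jE]; apply/null_content_dominatesP => A mA A0; rewrite jE//.
by apply: null_set_integral => //; apply/measurable_EFinP/measurable_funTS; exact: Rint_measurable ib.
Qed.

Variable b : T -> R.
Hypothesis jb : has_density b.
Variables (P N : set T).
Hypothesis jPN : hahn_decomposition j P N.

Let mP : measurable P. Proof. by have [[mP _] _ _ _] := jPN. Qed.
Let mN : measurable N. Proof. by have [_ [mN _] _ _] := jPN. Qed.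

Lemma jordan_pos_density : exists g : T -> R,
  [/\ measurable_fun setT g, (forall x, 0 <= g x),
  (forall A : set T, measurable A -> jordan_pos jPN A = (\int[rho]_(x in A) (g x)%:E)%E) &
  {ae rho, forall x, g x = b x * \1_P x}].
Proof.
have [ib jE] := jb.
have dom := jordan_pos_dominates jPN (has_density_dom jb).
pose h := Radon_Nikodym_SigmaFinite.f (jordan_pos jPN) rho.
have ih : rho.-integrable setT h by exact: Radon_Nikodym_SigmaFinite.f_integrable.
have hf x : ((fine (h x))%:E = h x)%E by rewrite fineK//; exact: Radon_Nikodym_SigmaFinite.f_fin_num.
have mb : measurable_fun setT (fun x => b x * \1_P x).
  by apply: measurable_funM; [exact: Rint_measurable ib|exact: measurable_indic].
have ibP : rho.-integrable setT (EFin \o (fun x => b x * \1_P x)).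
  apply: (dom_integrable _ mb (RintNorm _ ib)) => // x _.
  by rewrite normrM indicE; case: (x \in P); rewrite ?normr1 ?mulr1// normr0 mulr0.
exists (fine \o h); split.
- apply/measurable_EFinP; rewrite (_ : EFin \o (fine \o h) = h); last exact/funext.
  by case/integrableP: ih.
- by move=> x; apply: fine_ge0; exact: Radon_Nikodym_SigmaFinite.f_ge0.
- move=> A mA; under eq_integral do rewrite /= hf.
  exact: Radon_Nikodym_SigmaFinite.f_integral.
have : ae_eq rho setT h (EFin \o (fun x => b x * \1_P x)).
  apply: integral_ae_eq => //; first by case/integrableP: ibP.
  move=> A _ mA; rewrite -Radon_Nikodym_SigmaFinite.f_integral//.
  rewrite -[LHS]/(charge.cjordan_pos jPN A) cjordan_posE /crestr0 mem_set// /crestr jE; last exact: measurableI.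
  rewrite integral_mkcondr; apply: eq_integral => x _.
  by rewrite patchE /= indicE; case: (x \in P); rewrite ?mulr1 ?mulr0.
by apply: ae_imply => x H; rewrite /= H.
Qed.

Lemma jordan_neg_density : exists g : T -> R,
  [/\ measurable_fun setT g, (forall x, 0 <= g x),
  (forall A : set T, measurable A -> jordan_neg jPN A = (\int[rho]_(x in A) (g x)%:E)%E) &
  {ae rho, forall x, g x = - b x * \1_N x}].
Proof.
have [ib jE] := jb.
have dom := jordan_neg_dominates jPN (has_density_dom jb).
pose h := Radon_Nikodym_SigmaFinite.f (jordan_neg jPN) rho.
have ih : rho.-integrable setT h by exact: Radon_Nikodym_SigmaFinite.f_integrable.
have hf x : ((fine (h x))%:E = h x)%E by rewrite fineK//; exact: Radon_Nikodym_SigmaFinite.f_fin_num.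
have mb : measurable_fun setT (fun x => b x * \1_N x).
  by apply: measurable_funM; [exact: Rint_measurable ib|exact: measurable_indic].
have ibN : rho.-integrable setT (EFin \o (fun x => b x * \1_N x)).
  apply: (dom_integrable _ mb (RintNorm _ ib)) => // x _.
  by rewrite normrM indicE; case: (x \in N); rewrite ?normr1 ?mulr1// normr0 mulr0.
exists (fine \o h); split.
- apply/measurable_EFinP; rewrite (_ : EFin \o (fine \o h) = h); last exact/funext.
  by case/integrableP: ih.
- by move=> x; apply: fine_ge0; exact: Radon_Nikodym_SigmaFinite.f_ge0.
- move=> A mA; under eq_integral do rewrite /= hf.
  exact: Radon_Nikodym_SigmaFinite.f_integral.
have : ae_eq rho setT h (EFin \o (fun x => - 1 * (b x * \1_N x))).
  have ibN' := RintZ (-1) measurableT ibN.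
  apply: integral_ae_eq => //; first by case/integrableP: ibN'.
  move=> A mA0 mA; rewrite -Radon_Nikodym_SigmaFinite.f_integral//.
  rewrite -[LHS]/(charge.cjordan_neg jPN A) cjordan_negE /crestr0 mem_set// /crestr jE; last exact: measurableI.
  rewrite integral_mkcondr.
  have iA : rho.-integrable A (fun x => (b x * \1_N x)%:E) by apply: integrableS ibN.
  under [RHS]eq_integral do rewrite /= EFinM.
  rewrite integralZl// mulN1e; congr (- _)%E; apply: eq_integral => x _.
  by rewrite patchE /= indicE; case: (x \in N); rewrite ?mulr1 ?mulr0.
by apply: ae_imply => x H; rewrite /= H//= mulN1r mulNr.
Qed.

(** Both Jordan parts have the density of the charge restricted to a Hahn set. *)
Lemma jordan_integral (D : set T) (f : T -> R) : measurable D -> measurable_fun D f ->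
  rho.-integrable D (EFin \o (fun x => f x * b x)) ->
  (\int[jordan_pos jPN]_(x in D) (f x)%:E - \int[jordan_neg jPN]_(x in D) (f x)%:E =
   (\int[rho]_(x in D) (f x * b x))%:E)%E.
Proof.
move=> mD mf ifb.
have [g [mg g0 gE gb]] := jordan_pos_density.
have [k [mk k0 kE kb]] := jordan_neg_density.
have mgD := measurable_funTS (D := D) mg; have mkD := measurable_funTS (D := D) mk.
have le1 (X : set T) x : `|(\1_X x : R)| <= 1.
  by rewrite indicE; case: (x \in X); rewrite ?normr1 ?normr0.
have i1 : rho.-integrable D (EFin \o (fun x => f x * g x)).
  have i1' : rho.-integrable D (EFin \o (fun x => f x * b x * \1_P x)).
    apply: (dom_integrable mD _ (RintNorm mD ifb)).
      apply: measurable_funM; [exact: Rint_measurable ifb|exact: measurable_indic].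
    by move=> x _; rewrite normrM ler_piMr.
  apply/integrableP; split; first by apply/measurable_EFinP; exact: measurable_funM.
  case/integrableP: i1' => _; apply: le_lt_trans.
  rewrite le_eqVlt; apply/orP; left; apply/eqP; apply: ae_eq_lower_integral.
  by apply: ae_imply gb => x E _; rewrite /= E mulrA.
have i2 : rho.-integrable D (EFin \o (fun x => f x * k x)).
  have i1' : rho.-integrable D (EFin \o (fun x => f x * b x * \1_N x)).
    apply: (dom_integrable mD _ (RintNorm mD ifb)).
      apply: measurable_funM; [exact: Rint_measurable ifb|exact: measurable_indic].
    by move=> x _; rewrite normrM ler_piMr.
  apply/integrableP; split; first by apply/measurable_EFinP; exact: measurable_funM.
  case/integrableP: i1' => _; apply: le_lt_trans.
  rewrite le_eqVlt; apply/orP; left; apply/eqP; apply: ae_eq_lower_integral.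
  by apply: ae_imply kb => x E _; rewrite /= E mulNr mulrN normrN mulrA.
have j1 := change_integrable mg g0 gE mD mf i1.
have j2 := change_integrable mk k0 kE mD mf i2.
rewrite -(EFin_Rint mD j1) -(EFin_Rint mD j2).
rewrite (change_Rint mg g0 gE mD j1) (change_Rint mk k0 kE mD j2) -EFinB; congr EFin.
rewrite -RintegralB//; apply: ae_eq_Rint => //; apply: (ae_imply2 _ gb kb) => x E1 E2 _.
rewrite E1 E2 mulNr mulrN opprK -mulrDr -mulrDr.
have [_ _ PNT PN0] := jPN.
have -> : (\1_P x + \1_N x : R) = 1; last by rewrite mulr1.
rewrite !indicE; have [xP|xP] := boolP (x \in P); have [xN|xN] := boolP (x \in N) => /=.
- have : (P `&` N) x by split; apply/set_mem.
  by rewrite PN0.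
- by rewrite addr0.
- by rewrite add0r.
- have : (P `|` N) x by rewrite PNT.
  by move=> [/mem_set|/mem_set]; [rewrite (negbTE xP)|rewrite (negbTE xN)].
Qed.

End ChargeDensity.

Section ChargeIntegral.
Context {R : realType}.
Local Notation T := (measurableTypeR R).
Variable rho : {finite_measure set T -> \bar R}.
Variable j : {charge set T -> \bar R}.

Lemma charge_density : j `<< rho -> has_density rho j (density j rho).
Proof.
move=> dom.
have E : EFin \o density j rho = ('d j '/d rho).
  by apply/funext => x; rewrite /= /density fineK//; exact: Radon_Nikodym_fin_num.
split; first by rewrite E; exact: Radon_Nikodym_integrable.
move=> A mA; rewrite [LHS](Radon_Nikodym_integral dom mA).
by apply: eq_integral => x _; rewrite -[RHS]/((EFin \o density j rho) x) E.
Qed.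

Lemma charge_integralE (b : R -> R) (D : set T) (f : R -> R) : has_density rho j b ->
  measurable D -> measurable_fun D f ->
  rho.-integrable D (EFin \o (fun x => f x * b x)) ->
  charge_integral j D f = (\int[rho]_(x in D) (f x * b x))%:E.
Proof. by move=> jb mD mf ifb; exact: (jordan_integral jb). Qed.

Lemma charge_tv_ge0 (A : set R) : (0 <= charge_tv j A)%E.
Proof. by rewrite /charge_tv /charge_variation /= adde_ge0. Qed.

End ChargeIntegral.

Section RateCriterion.
Context {R : realType}.
Local Notation T := (measurableTypeR R).
Variable l : R.
Hypothesis l0 : 0 < l.
Local Notation D := (`[0, l]%classic : set T).
Variable rho : {finite_measure set T -> \bar R}.
Variable j : {charge set T -> \bar R}.
Hypothesis j_supp : j.-null_set (~` D).

Definition cell_charge (N i : nat) : R := fine (j (cell l N i)).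

Let mD : measurable D. Proof. exact: measurable_itv. Qed.
Let mC N i : measurable (cell l N i : set T). Proof. exact: measurable_cell. Qed.
Let jfin (A : set T) : measurable A -> j A \is a fin_num.
Proof. by move=> mA; rewrite fin_num_measure. Qed.

Lemma cell_charge_le b : has_density rho j b -> L2 rho D b ->
  forall N, \sum_(i < (2 ^ N)%N) cell_charge N i ^+ 2 / cell_mass l rho N i <= \int[rho]_(x in D) (b x ^+ 2).
Proof.
move=> [ib jE] [mb ib2] N; rewrite (sum_cells l0 N ib2); apply: ler_sum => i _.
have CD := @cell_sub _ l N i.
have Lb : L2 rho (cell l N i) b by apply: (L2_subset (mu := rho) mD).
have Cfin : (rho (cell l N i) < +oo)%E by rewrite -ge0_fin_numE// fin_num_measure.
have -> : cell_charge N i = \int[rho]_(x in cell l N i) b x by rewrite /cell_charge jE.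
have := cauchy_schwarz1 (mu := rho) (mC N i) Cfin Lb.
have := cell_mass_ge0 l rho N i; rewrite -/(cell_mass l rho N i) le_eqVlt => /orP[/eqP <-|w0 cs].
  by rewrite invr0 mulr0 => _; apply: Rintegral_ge0 => x _; exact: sqr_ge0.
by rewrite ler_pdivrMr// mulrC.
Qed.

(** [dyadic_density] yields a density on the cells. The charge is compared with it by moving
negative parts to the other side, which leaves two positive measures that agree on
cells, hence everywhere by [dyadic_unique]. *)
Lemma charge_rep F : (forall N i, (i < 2 ^ N)%N -> cell_mass l rho N i = 0 -> cell_charge N i = 0) ->
  (forall N, \sum_(i < (2 ^ N)%N) cell_charge N i ^+ 2 / cell_mass l rho N i <= F) ->
  exists b, has_density rho j b /\ L2 rho D b.
Proof.
move=> ct0 ctF.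
have rD : (rho D < +oo)%E by rewrite -ge0_fin_numE// fin_num_measure.
have ctA N i : (i < 2 ^ N)%N -> cell_charge N i = cell_charge N.+1 i.*2 + cell_charge N.+1 i.*2.+1.
  move=> _; rewrite /cell_charge (@cell_split _ l N i) chargeU//; first by rewrite fineD// jfin.
  by apply/eqP; apply: cell_disj; rewrite neq_ltn ltnSn.
have [b0 [Lb bc _ _]] := @dyadic_density R l l0 rho rD cell_charge F ctA ct0 ctF.
pose b := b0 \_ D.
have ib0 := L2_integrable mD rD Lb.
have ib : rho.-integrable setT (EFin \o b).
  have := (integrable_mkcond (mu := rho) (EFin \o b0) mD).1 ib0.
  by rewrite restrict_EFin.
have bE x : D x -> b x = b0 x by move=> Dx; rewrite /b patchE mem_set.
exists b; split; last first.
  by apply: (L2_ae (mu := rho) mD _ Lb); [apply: measurable_funTS; exact: Rint_measurable ib|apply: nearW => x /bE].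
split => // A mA.
have mAD : measurable (A `&` D) by exact: measurableI.
have -> : j A = j (A `&` D).
  rewrite (chargeDI j mA mD); have -> : j (A `\` D) = 0%E; last by rewrite add0e.
  by apply: j_supp; [exact: measurableD|move=> x []].
have -> : (\int[rho]_(x in A) (b x)%:E = \int[rho]_(x in A `&` D) (b x)%:E)%E.
  rewrite integral_mkcondr; apply: eq_integral => x _; rewrite patchE /b patchE.
  by case: (x \in D).
move: (A `&` D) mAD (@subIsetr _ A D) => {mA}{}A mA AD.
have mb := Rint_measurable ib.
pose bp x := Num.max (b x) 0; pose bn x := Num.max (- b x) 0.
have ibp : rho.-integrable setT (EFin \o bp).
  apply: (dom_integrable _ _ (RintNorm _ ib)) => //; first exact: measurable_maxr.
  by move=> x _; rewrite /bp; case: (leP (b x) 0) => h; rewrite ?normr0.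
have ibn : rho.-integrable setT (EFin \o bn).
  apply: (dom_integrable _ _ (RintNorm _ ib)) => //.
    by apply: measurable_maxr => //; exact: measurableT_comp.
  by move=> x _; rewrite /bn -(normrN (b x)); case: (leP (- b x) 0) => h; rewrite ?normr0.
have bp0 x : 0 <= bp x by rewrite /bp le_max lexx orbT.
have bn0 x : 0 <= bn x by rewrite /bn le_max lexx orbT.
have bpn x : b x = bp x - bn x.
  by rewrite /bp /bn; case: (leP 0 (b x)) => h; case: (leP 0 (- b x)) => h'; lra.
have [Mp MpE] := density_measure (mu := rho) bp0 ibp.
have [Mn MnE] := density_measure (mu := rho) bn0 ibn.
have [P [N jPN]] := Hahn_decomposition j.
have [M1 M1E] := sum_measure (jordan_pos jPN) Mn.
have [M2 M2E] := sum_measure (jordan_neg jPN) Mp.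
have split3 (B : set T) : measurable B ->
    (M1 B = M2 B <-> j B = \int[rho]_(x in B) (b x)%:E)%E.
  move=> mB; rewrite (jordan_decomp jPN mB) /cadd /= cscaleN1 M1E// M2E// MpE// MnE//.
  have iB f : rho.-integrable setT (EFin \o f) -> rho.-integrable B (EFin \o f).
    by move=> fi; apply: integrableS fi.
  rewrite -!(EFin_Rint mB)//; [|exact: iB..].
  have -> : \int[rho]_(x in B) b x = \int[rho]_(x in B) bp x - \int[rho]_(x in B) bn x.
    by rewrite -RintegralB//; [apply: eq_Rintegral => x _; exact: bpn|exact: iB..].
  have aux (X Y : \bar R) (x y : R) : X \is a fin_num -> Y \is a fin_num ->
      (X + y%:E = Y + x%:E <-> X - Y = (x - y)%:E)%E.
    by case: X => // u _; case: Y => // v _; rewrite -!EFinD; split => -[] h; congr EFin; lra.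
  by apply: aux; exact: fin_num_measure.
apply/split3 => //; apply: (dyadic_unique l0) => // N' i iN.
apply/split3; first exact: mC.
have CD := @cell_sub _ l N' i.
have ibC : rho.-integrable (cell l N' i) (EFin \o b) by apply: integrableS ib.
rewrite -(EFin_Rint (mC N' i) ibC).
have -> : \int[rho]_(x in cell l N' i) b x = cell_charge N' i.
  by rewrite -bc//; apply: eq_Rintegral => x; rewrite inE => /CD; exact: bE.
by rewrite /cell_charge fineK// jfin.
Qed.

End RateCriterion.

Local Close Scope charge_scope.

(** * The regularised logarithm and entropy *)

Section ScalarFunctions.
Context {R : realType}.

Lemma ln_le_sub1 (x : R) : 0 < x -> ln x <= x - 1.
Proof.
move=> x0; have := @le_ln1Dx R (x - 1).
have -> : 1 + (x - 1) = x by ring.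
by apply; lra.
Qed.

Lemma ln1D_bounds (x : R) : 0 <= x -> x / (1 + x) <= ln (1 + x) <= x.
Proof.
move=> x0; apply/andP; split; last by have := ln_le_sub1 (_ : 0 < 1 + x); lra.
have p : 0 < 1 + x by lra.
have := ln_le_sub1 (_ : 0 < (1 + x)^-1); rewrite invr_gt0 lnV ?posrE// => /(_ p).
have -> : x / (1 + x) = 1 - (1 + x)^-1 by field; lra.
lra.
Qed.

Lemma mono_derive (f f' : R -> R) (a b : R) : a <= b ->
  (forall x : R, a <= x <= b -> is_derive x 1 f (f' x)) ->
  (forall x : R, a <= x <= b -> 0 <= f' x) -> f a <= f b.
Proof.
move=> ab df f0; rewrite -subr_ge0.
have [||c cab ->] := @MVT_segment _ f f' a b ab.
- by move=> x xab; apply: df; move: xab; rewrite in_itv /= => /andP[/ltW-> /ltW->].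
- apply: derivable_within_continuous => x; rewrite in_itv /= => xab.
  by have [] := df x xab.
by rewrite mulr_ge0 ?subr_ge0// f0; move: cab; rewrite in_itv.
Qed.

Section Regularisation.
Variable d : R.
Hypothesis d0 : 0 < d.
Hypothesis d1 : d <= 1.

(** Nondecreasing on the half line, zero at 1 and bounded by [- ln d]; its increments
are at most those of [ln]. *)
Definition reg_log (r : R) : R := ln (r + d) - ln (1 + d * r).
(** The primitive of [reg_log] that vanishes at 1. *)
Definition reg_eta (r : R) : R :=
  (r + d) * ln (r + d) - (r + d^-1) * ln (1 + d * r) + (d^-1 - d) * ln (1 + d).

Let pos1 (r : R) : 0 <= r -> 0 < r + d. Proof. by move: d0; lra. Qed.
Let pos2 (r : R) : 0 <= r -> 0 < 1 + d * r.
Proof. by move=> r0; rewrite ltr_pwDl// mulr_ge0// ltW. Qed.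

Let affine_derive (a c x : R) : is_derive x 1 (fun x : R => a + c * x) c.
Proof. by apply: is_derive_eq; rewrite /GRing.scale /=; ring. Qed.

Lemma ln_affine_derive (a c x : R) : 0 < a + c * x ->
  is_derive x 1 (fun x : R => ln (a + c * x)) (c / (a + c * x)).
Proof.
move=> p; have H := is_derive1_ln p.
have := @is_derive1_comp _ (@ln R) (fun x => a + c * x) x _ _ H (affine_derive a c x).
by rewrite mulrC; exact.
Qed.

Let ln_affine_derive1 (r : R) : 0 <= r -> is_derive r 1 (fun r : R => ln (r + d)) ((r + d)^-1).
Proof.
move=> r0; have := @ln_affine_derive d 1 r; rewrite mul1r addrC => /(_ (pos1 r0)).
rewrite mul1r; have -> // : (fun x => ln (d + 1 * x)) = (fun r => ln (r + d)).
by apply/funext => x; rewrite mul1r addrC.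
Qed.

Let ln_affine_derive2 (r : R) : 0 <= r -> is_derive r 1 (fun r : R => ln (1 + d * r)) (d / (1 + d * r)).
Proof. by move=> r0; apply: ln_affine_derive; exact: pos2. Qed.

Let dd1 : d * d <= 1. Proof. exact: mulr_ile1 (ltW d0) (ltW d0) d1 d1. Qed.

Lemma reg_log_derive (r : R) : 0 <= r ->
  is_derive r 1 reg_log ((r + d)^-1 - d / (1 + d * r)).
Proof.
move=> r0.
have h1 := ln_affine_derive1 r0; have h2 := ln_affine_derive2 r0.
exact: is_deriveB.
Qed.

Lemma reg_eta_derive (r : R) : 0 <= r -> is_derive r 1 reg_eta (reg_log r).
Proof.
move=> r0.
have h1 := ln_affine_derive1 r0; have h2 := ln_affine_derive2 r0.
have k (c : R) : is_derive r 1 (fun r : R => r + c) 1 by apply: is_derive_eq; rewrite addr0.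
have m1 := is_deriveM (k d) h1; have m2 := is_deriveM (k d^-1) h2.
have m3 := is_deriveD (is_deriveB m1 m2) (is_derive_cst ((d^-1 - d) * ln (1 + d)) r 1).
apply: (is_derive_eq m3).
have p1 := pos1 r0; have p2 := pos2 r0.
rewrite /GRing.scale /= /reg_log addr0 !mulr1 mulfV ?gt_eqF//.
have -> : (r + d^-1) * (d / (1 + d * r)) = 1 by field; rewrite !gt_eqF.
ring.
Qed.

Lemma reg_log_mono (a b : R) : 0 <= a -> a <= b -> reg_log a <= reg_log b.
Proof.
move=> a0 ab; apply: (mono_derive ab) => x /andP[ax _].
  by apply: reg_log_derive; exact: le_trans ax.
have x0 : 0 <= x := le_trans a0 ax.
have p1 := pos1 x0; have p2 := pos2 x0.
rewrite subr_ge0 ler_pdivrMr// mulrC ler_pdivlMr//.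
by rewrite mulrDr addrC lerD2r.
Qed.

Lemma reg_log1 : reg_log 1 = 0.
Proof. by rewrite /reg_log mulr1 subrr. Qed.

Lemma reg_log_bound (r : R) : 0 <= r -> `|reg_log r| <= - ln d.
Proof.
move=> r0; have p1 := pos1 r0; have p2 := pos2 r0.
rewrite ler_norml opprK; apply/andP; split.
  rewrite /reg_log lerBrDr -lnM ?posrE// ler_ln ?posrE ?mulr_gt0//.
  by have := ler_piMl r0 dd1; rewrite mulrDr mulr1 mulrA; lra.
have : ln d + ln (r + d) <= ln (1 + d * r).
  rewrite -lnM ?posrE// ler_ln ?posrE ?mulr_gt0//.
  by rewrite mulrDr; have := dd1; lra.
by rewrite /reg_log; lra.
Qed.

Lemma reg_eta1 : reg_eta 1 = 0.
Proof. by rewrite /reg_eta mulr1; ring. Qed.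

Lemma reg_eta_tangent (u U : R) : 0 <= u -> 0 <= U ->
  reg_eta U + reg_log U * (u - U) <= reg_eta u.
Proof.
move=> u0 U0.
have dT (x : R) : 0 <= x -> is_derive x 1 (fun x => reg_eta x - reg_log U * x) (reg_log x - reg_log U).
  move=> x0; apply: is_derive_eq; first apply: is_deriveB.
    exact: reg_eta_derive.
  by rewrite /GRing.scale /= mulr1.
have [uU|/ltW Uu] := leP u U.
  have H (x : R) : u <= x <= U ->
      is_derive x 1 (fun x => - (reg_eta x - reg_log U * x)) (- (reg_log x - reg_log U)).
    by move=> /andP[ux _]; apply: is_deriveN; apply: dT; exact: le_trans ux.
  have S (x : R) : u <= x <= U -> 0 <= - (reg_log x - reg_log U).
    by move=> /andP[ux xU]; rewrite oppr_ge0 subr_le0 reg_log_mono// (le_trans u0).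
  have := mono_derive uU H S; lra.
have H (x : R) : U <= x <= u ->
    is_derive x 1 (fun x => reg_eta x - reg_log U * x) (reg_log x - reg_log U).
  by move=> /andP[ux _]; apply: dT; exact: le_trans ux.
have S (x : R) : U <= x <= u -> 0 <= reg_log x - reg_log U.
  by move=> /andP[ux xU]; rewrite subr_ge0 reg_log_mono.
have := mono_derive Uu H S; lra.
Qed.

Lemma reg_eta_ge0 (r : R) : 0 <= r -> 0 <= reg_eta r.
Proof.
move=> r0; have := reg_eta_tangent r0 ler01.
by rewrite reg_eta1 reg_log1 mul0r addr0.
Qed.

Lemma eta_derive (r : R) : 0 < r -> is_derive r 1 (@eta R) (ln r).
Proof.
move=> r0; have h := is_derive1_ln r0.
have m := is_deriveD (is_deriveB (is_deriveM (is_derive_id r 1) h) (is_derive_id r 1))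
  (is_derive_cst (1 : R) r 1).
apply: (is_derive_eq m); rewrite /GRing.scale /= mulfV ?gt_eqF//; ring.
Qed.

Lemma eta_ge0 (r : R) : 0 <= eta r.
Proof.
rewrite /eta; have [r0|r0] := leP r 0; first by rewrite ln0// mulr0; lra.
have := ln_le_sub1 (_ : 0 < r^-1); rewrite invr_gt0 lnV ?posrE// => /(_ r0).
move=> /(ler_wpM2l (ltW r0)); rewrite mulrBr mulfV ?gt_eqF// mulr1 mulrN; lra.
Qed.

(** The two functions and their derivatives vanish at 1, and [reg_log] is closer to 0
than [ln]. *)
Lemma reg_eta_le (r : R) : 0 <= r -> reg_eta r <= eta r.
Proof.
rewrite le_eqVlt => /orP[/eqP <-|r0].
  rewrite /reg_eta /eta !mulr0 mul0r !add0r addr0 ln1 mulr0 subr0 oppr0 add0r.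
  have /andP[_ h] := ln1D_bounds (ltW d0).
  have h1 : (d^-1 - d) * ln (1 + d) <= 1 - d * d.
    have -> : 1 - d * d = (d^-1 - d) * d by field; rewrite gt_eqF.
    by apply: ler_wpM2l => //; rewrite subr_ge0 -[d^-1]mul1r ler_pdivlMr.
  have h2 : d * ln d <= 0 by rewrite mulr_ge0_le0 ?(ltW d0)// ln_le0.
  have := mulr_gt0 d0 d0; lra.
have cmp (x : R) : 0 < x -> (1 <= x -> reg_log x <= ln x) /\ (x <= 1 -> ln x <= reg_log x).
  move=> x0; have p1 := pos1 (ltW x0); have p2 := pos2 (ltW x0).
  have dx := mulr_gt0 d0 x0; rewrite /reg_log; split => x1.
    rewrite lerBlDr -lnM ?posrE// ler_ln ?posrE ?mulr_gt0// mulrDr mulr1 lerD2l.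
    by rewrite mulrCA ler_peMr ?(ltW d0)// mulr_ege1.
  rewrite lerBrDr -lnM ?posrE// ler_ln ?posrE ?mulr_gt0// mulrDr mulr1 lerD2l.
  by rewrite mulrCA ler_piMr ?(ltW d0)// mulr_ile1 ?(ltW x0).
have dd (x : R) : 0 < x -> is_derive x 1 (fun x => eta x - reg_eta x) (ln x - reg_log x).
  by move=> x0; apply: is_deriveB; [exact: eta_derive|exact: reg_eta_derive (ltW x0)].
have e1 : eta 1 = 0 :> R by rewrite /eta ln1; ring.
have [r1|/ltW r1] := leP 1 r.
  have := @mono_derive (fun x => eta x - reg_eta x) (fun x => ln x - reg_log x) 1 r r1.
  rewrite e1 reg_eta1 => h; suff : 0 - 0 <= eta r - reg_eta r by lra.
  apply: h => x /andP[x1 _]; first by apply: dd; lra.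
  by have [h _] := cmp x (lt_le_trans ltr01 x1); rewrite subr_ge0 h.
have := @mono_derive (fun x => - (eta x - reg_eta x)) (fun x => - (ln x - reg_log x)) r 1 r1.
rewrite e1 reg_eta1 => h; suff : - (eta r - reg_eta r) <= - (0 - 0) by lra.
apply: h => x /andP[x1 x2]; have x0 := lt_le_trans r0 x1; first by apply: is_deriveN; exact: dd.
by have [_ h] := cmp x x0; rewrite oppr_ge0 subr_le0 h.
Qed.

(** The derivative of [reg_log] lies between 0 and that of [ln]. *)
Lemma reg_log_lip_ln (a b : R) : 0 < a -> 0 < b -> `|reg_log a - reg_log b| <= `|ln a - ln b|.
Proof.
move=> a0 b0; wlog ab : a b a0 b0 / a <= b.
  move=> W; have [h|/ltW h] := leP a b; first exact: W.
  by rewrite distrC [leRHS]distrC; exact: W.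
have H (x : R) : a <= x <= b ->
    is_derive x 1 (fun x => ln x - reg_log x) (x^-1 - ((x + d)^-1 - d / (1 + d * x))).
  move=> /andP[ax _]; have x0 := lt_le_trans a0 ax.
  by apply: is_deriveB; [exact: is_derive1_ln|exact: reg_log_derive (ltW x0)].
have S (x : R) : a <= x <= b -> 0 <= x^-1 - ((x + d)^-1 - d / (1 + d * x)).
  move=> /andP[ax _]; have x0 := lt_le_trans a0 ax.
  have p1 := pos1 (ltW x0); have p2 := pos2 (ltW x0).
  have : (x + d)^-1 <= x^-1 by rewrite lef_pV2 ?posrE// lerDl ltW.
  have : 0 <= d / (1 + d * x) by rewrite divr_ge0 ?ltW.
  lra.
have := mono_derive ab H S; have := reg_log_mono (ltW a0) ab.
have lab : ln a <= ln b by rewrite ler_ln ?posrE.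
by move=> h1 h2; rewrite !ler0_norm ?subr_le0//; lra.
Qed.

Definition reg_log_sq (z : R) : R := reg_log (z ^+ 2).
Definition reg_log_sq' (z : R) : R := 2 * z / (z ^+ 2 + d) - 2 * d * z / (1 + d * z ^+ 2).

Lemma reg_log_sq_derive (z : R) : is_derive z 1 reg_log_sq (reg_log_sq' z).
Proof.
have h := reg_log_derive (sqr_ge0 z).
have hX : is_derive z 1 (fun z : R => z ^+ 2) (2 * z).
  by apply: is_derive_eq; rewrite /GRing.scale /=; ring.
have := @is_derive1_comp _ reg_log (fun z => z ^+ 2) z _ _ h hX.
have p1 := pos1 (sqr_ge0 z); have p2 := pos2 (sqr_ge0 z).
have -> : ((z ^+ 2 + d)^-1 - d / (1 + d * z ^+ 2)) * (2 * z) = reg_log_sq' z.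
  by rewrite /reg_log_sq'; field; rewrite !gt_eqF.
exact.
Qed.

Lemma reg_log_sq'_bound (z : R) : `|z * reg_log_sq' z| <= 2.
Proof.
have p1 := pos1 (sqr_ge0 z); have p2 := pos2 (sqr_ge0 z).
have -> : z * reg_log_sq' z = 2 * (z ^+ 2 / (z ^+ 2 + d)) - 2 * (d * z ^+ 2 / (1 + d * z ^+ 2)).
  by rewrite /reg_log_sq'; field; rewrite !gt_eqF.
have z2 := sqr_ge0 z.
have b1 : 0 <= z ^+ 2 / (z ^+ 2 + d) <= 1.
  by rewrite divr_ge0 ?(ltW p1)//= ler_pdivrMr// mul1r lerDl ltW.
have b2 : 0 <= d * z ^+ 2 / (1 + d * z ^+ 2) <= 1.
  have dz : 0 <= d * z ^+ 2 by rewrite mulr_ge0// ltW.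
  by rewrite divr_ge0 ?(ltW p2)//= ler_pdivrMr// mul1r lerDr.
rewrite ler_norml; apply/andP; split; lra.
Qed.

Lemma reg_log_sq'_continuous : continuous reg_log_sq'.
Proof.
move=> z; have p1 := pos1 (sqr_ge0 z); have p2 := pos2 (sqr_ge0 z).
have cz : y ^+ 2 @[y --> z] --> z ^+ 2 by apply: cvg_sqr; exact: cvg_id.
apply: cvgB; apply: cvgM.
- by apply: cvgM; [exact: cvg_cst|exact: cvg_id].
- apply: cvgV; first by rewrite gt_eqF.
  by apply: cvgD => //; exact: cvg_cst.
- by apply: cvgM; [exact: cvg_cst|exact: cvg_id].
- apply: cvgV; first by rewrite gt_eqF.
  by apply: cvgD; [exact: cvg_cst|apply: cvgM => //; exact: cvg_cst].
Qed.

(** The factor [y] compensates the steepness of the logarithm near 0. If [x] is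
at least [y / 2], the derivative is at most [4 / y] between [x] and
[y]; otherwise [y] is at most twice the distance of [x] and [y], and
boundedness of [reg_log] suffices. *)
Lemma reg_log_sq_lip (x y : R) : 0 <= x -> 0 <= y ->
  ((reg_log_sq x - reg_log_sq y) * y) ^+ 2 <= 16 * (1 + ln d ^+ 2) * (x - y) ^+ 2.
Proof.
move=> x0; rewrite le_eqVlt => /orP[/eqP <-|y0].
  by rewrite mulr0 expr0n /= mulr_ge0 ?sqr_ge0// mulr_ge0// addr_ge0// sqr_ge0.
have [hx|hx] := leP (y / 2) x; last first.
  have hy : y ^+ 2 <= 4 * (x - y) ^+ 2.
    have -> : 4 * (x - y) ^+ 2 = (2 * (y - x)) ^+ 2 by ring.
    by rewrite lerXn2r ?nnegrE//; lra.
  have hG : (reg_log_sq x - reg_log_sq y) ^+ 2 <= 4 * ln d ^+ 2.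
    have -> : 4 * ln d ^+ 2 = (2 * - ln d) ^+ 2 by ring.
    rewrite -[leLHS]real_normK ?num_real// lerXn2r ?nnegrE//.
      by rewrite mulr_ge0// oppr_ge0 ln_le0.
    apply: (le_trans (ler_normB _ _)).
    have := reg_log_bound (sqr_ge0 x); have := reg_log_bound (sqr_ge0 y).
    by rewrite /reg_log_sq; lra.
  rewrite exprMn; apply: (le_trans (ler_pM (sqr_ge0 _) (sqr_ge0 _) hG hy)).
  have := sqr_ge0 (x - y); set A := (x - y) ^+ 2; set B := ln d ^+ 2 => h.
  have -> : 16 * (1 + B) * A = 4 * B * (4 * A) + 16 * A by ring.
  by rewrite lerDl mulr_ge0.
have xy2 z : y / 2 <= z -> `|reg_log_sq' z| <= 4 / y.
  move=> yz; have z0 : 0 < z by lra.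
  have := reg_log_sq'_bound z; rewrite normrM (gtr0_norm z0).
  rewrite mulrC -ler_pdivlMr// => /le_trans; apply.
  by rewrite ler_pdivlMr// mulrAC ler_pdivrMr//; lra.
have L : `|reg_log_sq x - reg_log_sq y| <= 4 / y * `|x - y|.
  apply: (@is_derive_lip R reg_log_sq reg_log_sq' (y / 2) (Num.max x y)) => [z _|z /andP[+ _]||].
  - exact: reg_log_sq_derive.
  - exact: xy2.
  - by rewrite hx le_max lexx.
  - by rewrite le_max lexx orbT andbT; lra.
have : (`|reg_log_sq x - reg_log_sq y| * y) ^+ 2 <= (4 * `|x - y|) ^+ 2.
  rewrite lerXn2r ?nnegrE ?mulr_ge0 ?(ltW y0)//.
  by apply: (le_trans (ler_wpM2r (ltW y0) L)); rewrite mulrAC divfK ?gt_eqF.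
rewrite !exprMn !real_normK ?num_real// => /le_trans; apply.
have := sqr_ge0 (x - y); have := sqr_ge0 (ln d); set A := (x - y) ^+ 2; set B := ln d ^+ 2 => hB hA.
have -> : 16 * (1 + B) * A = 4 ^+ 2 * A + 16 * (B * A) by ring.
by rewrite lerDl mulr_ge0// mulr_ge0.
Qed.

End Regularisation.

Section Limits.
Variable d_ : nat -> R.
Hypothesis d0 : forall n, 0 < d_ n.
Hypothesis dcvg : d_ n @[n --> \oo] --> (0 : R).

Let ln_cvg (u : nat -> R) (r : R) : 0 < r -> u n @[n --> \oo] --> r -> ln (u n) @[n --> \oo] --> ln r.
Proof. by move=> r0 ur; apply: continuous_cvg => //; exact: continuous_ln. Qed.

Let cd (r : R) : 1 + d_ n * r @[n --> \oo] --> (1 : R).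
Proof.
rewrite -[X in _ --> X]addr0 -[X in _ + X](mul0r r); apply: cvgD; first exact: cvg_cst.
by apply: cvgM => //; exact: cvg_cst.
Qed.

Let cr (r : R) : r + d_ n @[n --> \oo] --> r.
Proof. by rewrite -[X in _ --> X]addr0; apply: cvgD => //; exact: cvg_cst. Qed.

Lemma reg_log_cvg (r : R) : 0 < r -> reg_log (d_ n) r @[n --> \oo] --> ln r.
Proof.
move=> r0; rewrite -[X in _ --> X]subr0 -ln1; apply: cvgB; apply: ln_cvg => //.
Qed.

Lemma reg_log_sq'_cvg (z : R) : 0 < z -> reg_log_sq' (d_ n) z @[n --> \oo] --> 2 / z.
Proof.
move=> z0; have z2 := exprn_gt0 2 z0.
have -> : 2 / z = 2 * z / z ^+ 2 - 2 * 0 * z / 1 by field; rewrite gt_eqF.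
apply: cvgB; apply: cvgM.
- exact: cvg_cst.
- by apply: cvgV; rewrite ?gt_eqF.
- by apply: cvgM; [apply: cvgM => //; exact: cvg_cst|exact: cvg_cst].
- by apply: cvgV; rewrite ?gt_eqF.
Qed.

Let ln1d_cvg (r : R) : 0 <= r -> ln (1 + d_ n * r) / d_ n @[n --> \oo] --> r.
Proof.
move=> r0.
apply: (@squeeze_cvgr _ _ _ _ (fun n => r / (1 + d_ n * r)) (fun=> r)); last 2 first.
- rewrite -[X in _ --> X]divr1; apply: cvgM; first exact: cvg_cst.
  by apply: cvgV; rewrite ?oner_neq0.
- exact: cvg_cst.
apply: nearW => n; have x0 : 0 <= d_ n * r by rewrite mulr_ge0 ?(ltW (d0 n)).
have /andP[h1 h2] := ln1D_bounds x0; apply/andP; split.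
  by rewrite ler_pdivlMr ?d0// mulrAC [r * _]mulrC.
by rewrite ler_pdivrMr ?d0// [r * _]mulrC.
Qed.

Lemma reg_eta_cvg (r : R) : 0 <= r -> reg_eta (d_ n) r @[n --> \oo] --> eta r.
Proof.
move=> r0.
have c0 : (r + d_ n) * ln (r + d_ n) @[n --> \oo] --> r * ln r.
  move: r0; rewrite le_eqVlt => /orP[/eqP <-|r0]; last by apply: cvgM => //; apply: ln_cvg.
  rewrite mul0r; apply/cvgrPdist_le => e e0; near=> n.
  rewrite sub0r normrN add0r; have p := d0 n; have s0 : 0 < Num.sqrt (d_ n) by rewrite sqrtr_gt0.
  have d1 : d_ n <= 1.
    suff : `|0 - d_ n| <= 1 by rewrite sub0r normrN ger0_norm ?(ltW p).
    by near: n; move/cvgrPdist_le : dcvg; apply.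
  have hs := sqr_sqrtr (ltW p).
  have l0 : ln (d_ n) <= 0 by rewrite ln_le0.
  rewrite ler0_norm ?mulr_ge0_le0 ?(ltW p)// -mulrN.
  have : - ln (d_ n) <= 2 * (Num.sqrt (d_ n))^-1.
    have := ln_le_sub1 (_ : 0 < (Num.sqrt (d_ n))^-1); rewrite invr_gt0 lnV ?posrE// => /(_ s0).
    rewrite -{3}hs expr2 lnM ?posrE//; have : 0 < (Num.sqrt (d_ n))^-1 by rewrite invr_gt0.
    lra.
  move=> /(ler_wpM2l (ltW p)) /le_trans; apply.
  have -> : d_ n * (2 * (Num.sqrt (d_ n))^-1) = 2 * Num.sqrt (d_ n).
    by rewrite -{1}hs; field; rewrite gt_eqF.
  rewrite -ler_pdivlMl// -(@ler_pXn2r _ 2)// ?nnegrE ?(ltW s0)//; last by rewrite mulr_ge0 ?(ltW e0).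
  rewrite hs; suff : `|0 - d_ n| <= (2^-1 * e) ^+ 2 by rewrite sub0r normrN ger0_norm ?(ltW p).
  by near: n; move/cvgrPdist_le : dcvg; apply; rewrite exprn_gt0// mulr_gt0.
have c1 := ln1d_cvg r0; have c2 := @ln1d_cvg 1 ler01.
have c3 : r * ln (1 + d_ n * r) @[n --> \oo] --> r * ln 1.
  by apply: cvgM; [exact: cvg_cst|exact: ln_cvg].
have c4 : d_ n * ln (1 + d_ n * 1) @[n --> \oo] --> 0 * ln 1.
  by apply: cvgM => //; exact: ln_cvg.
have -> : eta r = r * ln r - (r * ln 1 + r) + (1 - 0 * ln 1) by rewrite /eta ln1; ring.
have -> : (fun n => reg_eta (d_ n) r) = (fun n => (r + d_ n) * ln (r + d_ n)
   - (r * ln (1 + d_ n * r) + ln (1 + d_ n * r) / d_ n)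
   + (ln (1 + d_ n * 1) / d_ n - d_ n * ln (1 + d_ n * 1))).
  by apply/funext => n; rewrite /reg_eta mulr1; ring.
by apply: cvgD; apply: cvgB => //; apply: cvgD.
Unshelve. all: by end_near. Qed.

End Limits.

Section CoshDuality.

(** [cosh_cost] and [4 (cosh (x / 2) - 1)] are convex conjugates. With [y] the
optimal dual variable over 2, the tangents of the two exponentials at [y] and
[- y] add up to the claim. *)
Lemma cosh_young (r x : R) :
  `|r * x| <= cosh_cost r + 2 * (expR (x / 2) + expR (- (x / 2)) - 2).
Proof.
set s := Num.sqrt (r ^+ 2 + 4).
have s2 : s ^+ 2 = r ^+ 2 + 4 by rewrite sqr_sqrtr// addr_ge0 ?sqr_ge0.
have s0 : 0 <= s by exact: sqrtr_ge0.
have rs : `|r| < s.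
  rewrite -(@ltr_pXn2r _ 2)// ?nnegrE// s2 real_normK ?num_real//; lra.
have [rs1 rs2] : - s < r /\ r < s by apply/andP; rewrite -ltr_norml.
have a0 : 0 < (r + s) / 2 by lra.
(* The maximiser of [r * x - 4 (cosh (x / 2) - 1)] is [2 y]. *)
set y := ln ((r + s) / 2).
have ey : expR y = (r + s) / 2 by rewrite lnK ?posrE.
have eNy : expR (- y) = (s - r) / 2.
  rewrite expRN ey; apply: (mulfI (lt0r_neq0 a0)); rewrite mulfV ?gt_eqF//.
  have -> : (r + s) / 2 * ((s - r) / 2) = (s ^+ 2 - r ^+ 2) / 4 by field.
  by rewrite s2; field.
have key (u : R) : r * u <= cosh_cost r + 2 * (expR (u / 2) + expR (- (u / 2)) - 2).
  have h1 : expR y * (1 + (u / 2 - y)) <= expR (u / 2).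
    have -> : expR (u / 2) = expR y * expR (u / 2 - y) by rewrite -expRD addrC subrK.
    by apply: ler_wpM2l; [exact: expR_ge0|exact: expR_ge1Dx].
  have h2 : expR (- y) * (1 - (u / 2 - y)) <= expR (- (u / 2)).
    have -> : expR (- (u / 2)) = expR (- y) * expR (- (u / 2 - y)).
      by rewrite -expRD; congr expR; ring.
    by apply: ler_wpM2l; [exact: expR_ge0|exact: expR_ge1Dx].
  rewrite ey in h1; rewrite eNy in h2; rewrite /cosh_cost -/s -/y.
  set A := expR _ in h1 *; set B := expR _ in h2 *.
  have e : (r + s) / 2 * (1 + (u / 2 - y)) + (s - r) / 2 * (1 - (u / 2 - y)) =
    s + r * (u / 2) - r * y by field.
  have : 2 * (s + r * (u / 2) - r * y) <= 2 * (A + B) by rewrite -e; lra.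
  have -> : 2 * (s + r * (u / 2) - r * y) = 2 * s + r * u - 2 * r * y by field.
  lra.
rewrite ler_norml; apply/andP; split; last exact: key.
have := key (- x); rewrite !mulNr opprK mulrN; lra.
Qed.

Lemma cosh_cost_ge0 (r : R) : 0 <= cosh_cost r.
Proof.
have := cosh_young r 0; rewrite mulr0 normr0 mul0r oppr0 expR0.
have -> : cosh_cost r + 2 * (1 + 1 - 2) = cosh_cost r by ring.
exact.
Qed.

End CoshDuality.
End ScalarFunctions.

(** * A C^1 partition of unity *)

Section C1Step.
Context {R : realType}.

Definition pos_sq (z : R) : R := Num.max z 0 ^+ 2.

Lemma pos_sq_derive (t : R) : is_derive t 1 pos_sq (2 * Num.max t 0).
Proof.
apply/is_deriveP1 => e e0; exists e => // y yt.
apply: (@le_trans _ _ (`|y - t| * `|y - t|)); last by rewrite ler_wpM2r// ltW.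
rewrite -normrM -expr2 [leRHS]ger0_norm ?sqr_ge0// /pos_sq.
case: (leP y 0) => hy; case: (leP t 0) => ht; rewrite ler_norml; apply/andP; split;
  have := sqr_ge0 (y - t); nra.
Qed.

(** A piecewise quadratic C^1 function rising from 0 to 1 on [`[0, 1]]. Its translates
differ by hats, so the hats sum to 1 by telescoping. *)
Definition step1 (z : R) : R := 2 * pos_sq z - 4 * pos_sq (z - 1 / 2) + 2 * pos_sq (z - 1).
Definition step1' (z : R) : R :=
  4 * Num.max z 0 - 8 * Num.max (z - 1 / 2) 0 + 4 * Num.max (z - 1) 0.

Lemma step1_derive (z : R) : is_derive z 1 step1 (step1' z).
Proof.
have h (c : R) : is_derive z 1 (fun z => pos_sq (z - c)) (2 * Num.max (z - c) 0).
  have H2 : is_derive z 1 (fun z : R => z - c) 1 by apply: is_derive_eq; rewrite oppr0 addr0.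
  have := @is_derive1_comp _ pos_sq (fun z => z - c) z _ _ (pos_sq_derive (z - c)) H2.
  by rewrite mulr1; exact.
have h0 := pos_sq_derive z; have h1 := h (1 / 2); have h2 := h 1.
have m := is_deriveD (is_deriveB (is_deriveZ 2 h0) (is_deriveZ 4 h1)) (is_deriveZ 2 h2).
apply: (is_derive_eq m); rewrite /GRing.scale /= /step1'; ring.
Qed.

Lemma step1'_continuous : continuous step1'.
Proof.
have h (c : R) : continuous (fun z : R => Num.max (z - c) 0).
  have -> : (fun z : R => Num.max (z - c) 0) = (fun z => (z - c + `|z - c|) / 2).
    by apply/funext => z; case: (leP (z - c) 0) => h; [rewrite ler0_norm//|rewrite gtr0_norm//]; lra.
  have cc z : y - c @[y --> z] --> z - c by apply: cvgB; [exact: cvg_id|exact: cvg_cst].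
  by move=> z; apply: cvgM; [apply: cvgD; [|apply: cvg_norm]; exact: cc|exact: cvg_cst].
have h0' : continuous (fun z : R => Num.max z 0).
  have := h 0; rewrite (_ : (fun z => Num.max (z - 0) 0) = (fun z => Num.max z 0))//.
  by apply/funext => z; rewrite subr0.
move=> z; have h0 := h0' z; have h1 := h (1 / 2) z; have h2 := h 1 z.
apply: cvgD; first apply: cvgB; apply: cvgM => //; try exact: cvg_cst.
Qed.

Lemma step1_le0 (z : R) : z <= 0 -> step1 z = 0.
Proof.
move=> z0; rewrite /step1 /pos_sq.
have -> : Num.max z 0 = 0 by apply/max_idPr.
have -> : Num.max (z - 1 / 2) 0 = 0 by apply/max_idPr; lra.
have -> : Num.max (z - 1) 0 = 0 by apply/max_idPr; lra.
ring.
Qed.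

Lemma step1_ge1 (z : R) : 1 <= z -> step1 z = 1.
Proof.
move=> z0; rewrite /step1 /pos_sq.
have -> : Num.max z 0 = z by apply/max_idPl; lra.
have -> : Num.max (z - 1 / 2) 0 = z - 1 / 2 by apply/max_idPl; lra.
have -> : Num.max (z - 1) 0 = z - 1 by apply/max_idPl; lra.
by field.
Qed.

Lemma step1'_le0 (z : R) : z <= 0 -> step1' z = 0.
Proof.
move=> z0; rewrite /step1'.
have -> : Num.max z 0 = 0 by apply/max_idPr.
have -> : Num.max (z - 1 / 2) 0 = 0 by apply/max_idPr; lra.
have -> : Num.max (z - 1) 0 = 0 by apply/max_idPr; lra.
ring.
Qed.

Lemma step1'_ge1 (z : R) : 1 <= z -> step1' z = 0.
Proof.
move=> z0; rewrite /step1'.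
have -> : Num.max z 0 = z by apply/max_idPl; lra.
have -> : Num.max (z - 1 / 2) 0 = z - 1 / 2 by apply/max_idPl; lra.
have -> : Num.max (z - 1) 0 = z - 1 by apply/max_idPl; lra.
by field.
Qed.

Lemma step1'_itv (z : R) : 0 <= step1' z <= 2.
Proof.
rewrite /step1'; case: (leP z 0) => h0; case: (leP (z - 1 / 2) 0) => h1;
  case: (leP (z - 1) 0) => h2; apply/andP; split; lra.
Qed.

Lemma step1_mono (x y : R) : x <= y -> step1 x <= step1 y.
Proof.
move=> xy; apply: (mono_derive (f' := step1') xy) => z _; first exact: step1_derive.
by case/andP: (step1'_itv z).
Qed.

Lemma step1_itv (z : R) : 0 <= step1 z <= 1.
Proof.
have [h0|h0] := leP z 0; first by rewrite step1_le0// lexx ler01.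
have [h1|h1] := leP 1 z; first by rewrite step1_ge1// lexx ler01.
have := step1_mono (ltW h0); have := step1_mono (ltW h1).
by rewrite (step1_le0 (lexx 0)) (step1_ge1 (lexx 1)) => -> ->.
Qed.

Lemma step1_half (z : R) : z <= 1 / 2 -> step1 z <= 1 / 2.
Proof.
move=> h; apply: (le_trans (step1_mono h)); rewrite /step1 /pos_sq.
have -> : Num.max (1 / 2 : R) 0 = 1 / 2 by apply/max_idPl; lra.
have -> : Num.max (1 / 2 - 1 / 2 : R) 0 = 0 by apply/max_idPr; lra.
have -> : Num.max (1 / 2 - 1 : R) 0 = 0 by apply/max_idPr; lra.
lra.
Qed.

Lemma step1_half_ge (z : R) : 1 / 2 <= z -> 1 / 2 <= step1 z.
Proof.
move=> h; apply: le_trans (step1_mono h); rewrite /step1 /pos_sq.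
have -> : Num.max (1 / 2 : R) 0 = 1 / 2 by apply/max_idPl; lra.
have -> : Num.max (1 / 2 - 1 / 2 : R) 0 = 0 by apply/max_idPr; lra.
have -> : Num.max (1 / 2 - 1 : R) 0 = 0 by apply/max_idPr; lra.
lra.
Qed.

End C1Step.

Section PartitionOfUnity.
Context {R : realType}.
Variable l : R.
Hypothesis l0 : 0 < l.

Definition pou (N i : nat) (x : R) : R :=
  step1 (2 ^+ N * x / l - i%:R + 1) - step1 (2 ^+ N * x / l - i%:R).
Definition pou' (N i : nat) (x : R) : R :=
  2 ^+ N / l * (step1' (2 ^+ N * x / l - i%:R + 1) - step1' (2 ^+ N * x / l - i%:R)).

Lemma pou_derive N i (x : R) : is_derive x 1 (pou N i) (pou' N i x).
Proof.
have H (c : R) : is_derive x 1 (fun x : R => 2 ^+ N * x / l - i%:R + c) (2 ^+ N / l).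
  by apply: is_derive_eq; rewrite /GRing.scale /=; ring.
have h1 := @is_derive1_comp _ step1 _ x _ _ (step1_derive _) (H 1).
have h0 := @is_derive1_comp _ step1 _ x _ _ (step1_derive _) (H 0).
have m := is_deriveB h1 h0.
have -> : pou N i = (step1 \o (fun x0 : R => 2 ^+ N * x0 / l - i%:R + 1)) -
   (step1 \o (fun x0 : R => 2 ^+ N * x0 / l - i%:R + 0)).
  by apply/funext => y; rewrite /pou -[RHS]/(step1 _ - step1 _) addr0.
by apply: (is_derive_eq m); rewrite /pou' addr0; ring.
Qed.

Lemma pou'_continuous N i : continuous (pou' N i).
Proof.
move=> x; have H (c : R) : step1' (2 ^+ N * y / l - i%:R + c) @[y --> x] -->
    step1' (2 ^+ N * x / l - i%:R + c).
  apply: continuous_cvg; first exact: step1'_continuous.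
  apply: cvgD; last exact: cvg_cst; apply: cvgB; last exact: cvg_cst.
  by apply: cvgM; last exact: cvg_cst; apply: cvgM; [exact: cvg_cst|exact: cvg_id].
apply: cvgM; first exact: cvg_cst.
apply: cvgB; first exact: H.
by have := H 0; under eq_fun do rewrite addr0; rewrite addr0.
Qed.

Lemma pou_ge0 N i x : 0 <= pou N i x.
Proof. by rewrite subr_ge0 step1_mono// lerDl. Qed.

Lemma pou_le1 N i x : pou N i x <= 1.
Proof.
rewrite /pou; have /andP[_ h1] := step1_itv (2 ^+ N * x / l - i%:R + 1).
by have /andP[h2 _] := step1_itv (2 ^+ N * x / l - i%:R); lra.
Qed.

Lemma pou_eq0 N i (x : R) : 1 <= `|2 ^+ N * x / l - i%:R| -> pou N i x = 0 /\ pou' N i x = 0.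
Proof.
rewrite /pou /pou'; set z := 2 ^+ N * x / l - i%:R.
case: (ger0P z) => z0 h.
  by rewrite !step1_ge1 ?step1'_ge1 ?subrr ?mulr0//; lra.
by rewrite !step1_le0 ?step1'_le0 ?subrr ?mulr0//; lra.
Qed.

Lemma pou_sum N x : `[0, l]%classic x -> \sum_(i < (2 ^ N)%N.+1) pou N i x = 1.
Proof.
rewrite /= in_itv /= => /andP[x0 xl].
pose a (i : nat) := - step1 (2 ^+ N * x / l - i%:R + 1).
rewrite (eq_bigr (fun i : 'I__ => a i.+1 - a i)); last first.
  move=> i _; rewrite /a /pou.
  have -> : 2 ^+ N * x / l - i.+1%:R + 1 = 2 ^+ N * x / l - i%:R by rewrite -natr1; ring.
  by rewrite opprK addrC.
rewrite -(big_mkord xpredT (fun i => a i.+1 - a i)) (telescope_sumr a)// /a opprK subr0.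
rewrite (step1_ge1 (z := 2 ^+ N * x / l + 1)); last first.
  by rewrite lerDr; apply: divr_ge0; [rewrite mulr_ge0 ?exprn_ge0|exact: ltW].
rewrite step1_le0 ?oppr0 ?add0r// -[(2 ^ N).+1%:R]natr1 pow2N.
have : 2 ^+ N * x / l <= 2 ^+ N by rewrite ler_pdivrMr// ler_wpM2l ?exprn_ge0.
lra.
Qed.

Lemma scaled_cell N k x : dyad l N k <= x <= dyad l N k.+1 ->
  k%:R <= 2 ^+ N * x / l <= k%:R + 1.
Proof.
have p : (0 : R) < 2 ^+ N by exact: exprn_gt0.
rewrite /dyad -[k.+1%:R]natr1 => /andP[].
rewrite ler_pdivrMr// [x * _]mulrC ler_pdivlMr// [x * _]mulrC => h1 h2.
by rewrite ler_pdivlMr// h1 ler_pdivrMr.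
Qed.

(** On one cell only the hats centred at its two end points are not constant 0, and
they interpolate between the two coefficients. *)
Lemma pou_two_terms N k x (c : nat -> R) : (k < 2 ^ N)%N ->
  dyad l N k <= x <= dyad l N k.+1 ->
  \sum_(i < (2 ^ N)%N.+1) c i * pou N i x =
    c k + (c k.+1 - c k) * step1 (2 ^+ N * x / l - k%:R) /\
  \sum_(i < (2 ^ N)%N.+1) c i * pou' N i x =
    (c k.+1 - c k) * (2 ^+ N / l * step1' (2 ^+ N * x / l - k%:R)).
Proof.
move=> kN /scaled_cell; set z := 2 ^+ N * x / l => /andP[z1 z2].
have two (psi : nat -> R) : (forall i : nat, i != k -> i != k.+1 -> psi i = 0) ->
    \sum_(i < (2 ^ N)%N.+1) c i * psi i = c k * psi k + c k.+1 * psi k.+1.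
  move=> psi0; have k1 : (k < (2 ^ N)%N.+1)%N by exact: ltnW.
  rewrite (bigD1 (Ordinal k1))//= (bigD1 (Ordinal (kN : (k.+1 < (2 ^ N)%N.+1)%N)))/=; last first.
    by rewrite -(inj_eq val_inj) /= neq_ltn ltnSn orbT.
  rewrite big1 ?addr0// => i /andP[i1 i2]; rewrite psi0 ?mulr0//.
have far (i : nat) : i != k -> i != k.+1 -> 1 <= `|z - i%:R|.
  rewrite neq_ltn => /orP[ik _|].
    have : i%:R + 1 <= k%:R :> R by rewrite natr1 ler_nat.
    by move=> h; rewrite ger0_norm; lra.
  move=> ki; rewrite neq_ltn ltnS leqNgt ki /= => ki2.
  have : k%:R + 1 + 1 <= i%:R :> R by rewrite !natr1 ler_nat.
  by move=> h; rewrite ler0_norm; lra.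
have s1 : step1 (z - k%:R + 1) = 1 by rewrite step1_ge1//; lra.
have s0 : step1 (z - k.+1%:R) = 0 by rewrite step1_le0// -natr1; lra.
have t1 : step1' (z - k%:R + 1) = 0 by rewrite step1'_ge1//; lra.
have t0 : step1' (z - k.+1%:R) = 0 by rewrite step1'_le0// -natr1; lra.
have zk : z - k.+1%:R + 1 = z - k%:R by rewrite -natr1; ring.
split; [rewrite (two (fun i => pou N i x))|rewrite (two (fun i => pou' N i x))].
- by rewrite /pou -/z s1 s0 zk; ring.
- by move=> i i1 i2; case: (pou_eq0 (far i i1 i2)).
- by rewrite /pou' -/z t1 t0 zk; ring.
- by move=> i i1 i2; case: (pou_eq0 (far i i1 i2)).
Qed.

End PartitionOfUnity.

(** * Test functions adapted to a density *)

Section ChangeOn.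
Context d (T : measurableType d) (R : realType).
Variables (mu : {sigma_finite_measure set T -> \bar R})
          (nu : {finite_measure set T -> \bar R}) (D : set T) (g : T -> R).
Hypothesis mD : measurable D.
Hypothesis mg : measurable_fun D g.
Hypothesis g0 : forall x, D x -> 0 <= g x.
Hypothesis nuD : nu.-null_set (~` D).
Hypothesis nuE : forall A, measurable A -> A `<=` D -> nu A = (\int[mu]_(x in A) (g x)%:E)%E.

Let h := g \_ D.
Let hE x : D x -> h x = g x. Proof. by move=> Dx; rewrite /h patchE mem_set. Qed.
Let mh : measurable_fun setT h. Proof. exact: (measurable_restrictT _ mD).1. Qed.
Let h0 x : 0 <= h x.
Proof. by rewrite /h patchE; case: ifPn => // /set_mem; exact: g0. Qed.

Lemma null_setI (A : set T) : measurable A -> nu A = nu (A `&` D).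
Proof.
move=> mA; rewrite -{1}(setUIDK A D) measureU ?setUIDK.
- have H : nu (A `\` D) = 0%E by apply: nuD; [exact: measurableD|move=> x []].
  apply: etrans (adde0 _); congr (_ + _)%E; exact: H.
- exact: measurableI.
- exact: measurableD.
- by rewrite setDE setIACA setICr setI0.
Qed.

Let nuh A : measurable A -> nu A = (\int[mu]_(x in A) (h x)%:E)%E.
Proof.
move=> mA; rewrite null_setI// nuE//; last exact: measurableI.
rewrite integral_mkcondr; apply: eq_integral => x _.
by rewrite patchE /h patchE; case: ifP.
Qed.

Variable E : set T.
Hypothesis mE : measurable E.
Hypothesis ED : E `<=` D.

Lemma change_on_ge0 (f : T -> R) : measurable_fun E f ->
  (forall x, E x -> 0 <= f x) ->
  (\int[nu]_(x in E) (f x)%:E = \int[mu]_(x in E) (f x * g x)%:E)%E.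
Proof.
move=> mf f0; rewrite (change_ge0 mh h0 nuh)//.
by apply: eq_integral => x; rewrite inE => /ED Dx; rewrite hE.
Qed.

Let fh (f : T -> R) : mu.-integrable E (EFin \o (fun x => f x * h x)) <->
  mu.-integrable E (EFin \o (fun x => f x * g x)).
Proof.
by split; apply: eq_integrable => // x; rewrite inE => /ED Dx; rewrite /= hE.
Qed.

Lemma change_on_integrable (f : T -> R) : measurable_fun E f ->
  mu.-integrable E (EFin \o (fun x => f x * g x)) -> nu.-integrable E (EFin \o f).
Proof. by move=> mf /fh; exact: (change_integrable mh h0 nuh). Qed.

Lemma change_on_integrable_inv (f : T -> R) :
  nu.-integrable E (EFin \o f) -> mu.-integrable E (EFin \o (fun x => f x * g x)).
Proof. by move=> fi; apply/fh; exact: (change_integrable_inv mh h0 nuh). Qed.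

Lemma change_on_Rint (f : T -> R) : nu.-integrable E (EFin \o f) ->
  \int[nu]_(x in E) f x = \int[mu]_(x in E) (f x * g x).
Proof.
move=> fi; rewrite (change_Rint mh h0 nuh)//.
by apply: eq_Rintegral => x; rewrite inE => /ED Dx; rewrite hE.
Qed.

End ChangeOn.

Section StepDense.
Context {R : realType}.
Variable l : R.
Hypothesis l0 : 0 < l.
Local Notation leb := (@lebesgue_measure R).
Local Notation D := (`[0, l]%classic : set (measurableTypeR R)).
Let mD : measurable D. Proof. exact: measurable_itv. Qed.
Let lebD : (leb D < +oo)%E. Proof. by rewrite leb_cc ?ltry// ltW. Qed.
Let mC N i : measurable (cell l N i : set (measurableTypeR R)).
Proof. exact: measurable_cell. Qed.

Lemma Rint_cell_cc (f : R -> R) N i : (i < 2 ^ N)%N -> leb.-integrable D (EFin \o f) ->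
  \int[leb]_(x in cell l N i) f x = \int[leb]_(x in `[dyad l N i, dyad l N i.+1]) f x.
Proof.
move=> iN fi; rewrite cellE//.
case: ifP => [/eqP iE|_]; first by rewrite iE dyad_last.
rewrite Rintegral_itv_bndo_bndc//.
apply: (integrableS (mu := leb) mD _ _ fi); first exact: measurable_itv.
apply: subset_trans (itvcc_sub (dyad_ge0 l0 N i) (dyad_lel l0 iN)).
by apply: subset_itvl; rewrite bnd_simp.
Qed.

Lemma ae_neq (c : R) : {ae leb, forall x, x <> c}.
Proof.
exists [set c]; split; [exact: measurable_set1|exact: lebesgue_measure_set1|].
by move=> x /= /contrapT.
Qed.

Lemma cells_ae0 (m : {measure set (measurableTypeR R) -> \bar R}) (f : R -> R) :
  m.-integrable D (EFin \o f) ->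
  (forall N i, (i < 2 ^ N)%N -> \int[m]_(x in cell l N i) f x = 0) ->
  {ae m, forall x, D x -> f x = 0}.
Proof.
move=> fi f0; have mf := Rint_measurable fi.
have dens (g : R -> R) : (forall x, 0 <= g x) -> m.-integrable D (EFin \o g) ->
    exists M : {finite_measure set (measurableTypeR R) -> \bar R},
    forall A, measurable A -> A `<=` D -> M A = (\int[m]_(x in A) g x)%:E.
  move=> g0 gi.
  have gD x : 0 <= (g \_ D) x by rewrite patchE; case: ifP.
  have iD : m.-integrable setT (EFin \o g \_ D).
    have := (integrable_mkcond (mu := m) (EFin \o g) mD).1 gi; congr (is_true (m.-integrable setT _)).
    by apply/funext => x; rewrite /= !patchE; case: ifP.
  have [M ME] := density_measure gD iD.
  exists M => A mA AD; rewrite ME// EFin_Rint//; last exact: (integrableS (mu := m) mD).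
  apply: eq_integral => x; rewrite inE => Ax; rewrite patchE mem_set//.
  exact: AD.
have ip : m.-integrable D (EFin \o (fun x => Num.max (f x) 0)).
  apply: (dom_integrable mD _ (RintNorm mD fi)).
    by apply: measurable_maxr => //; exact: measurable_cst.
  by move=> x _; rewrite ger0_norm ?le_max ?lexx ?orbT// ge_max normr_ge0 andbT ler_norm.
have ineg : m.-integrable D (EFin \o (fun x => Num.max (- f x) 0)).
  apply: (dom_integrable mD _ (RintNorm mD fi)).
    by apply: measurable_maxr; [exact: measurableT_comp mf|exact: measurable_cst].
  by move=> x _; rewrite ger0_norm ?le_max ?lexx ?orbT// ge_max normr_ge0 andbT -normrN ler_norm.
have [|M1 M1E] := dens _ _ ip; first by move=> x; rewrite le_max lexx orbT.
have [|M2 M2E] := dens _ _ ineg; first by move=> x; rewrite le_max lexx orbT.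
have fE x : f x = Num.max (f x) 0 - Num.max (- f x) 0.
  by have [h|h] := leP (f x) 0; have [h'|h'] := leP (- f x) 0; lra.
have M12 (A : set (measurableTypeR R)) : measurable A -> A `<=` D -> M1 A = M2 A.
  apply: (dyadic_unique l0) => N i iN.
  have mA := mC N i; have AD := @cell_sub _ l N i.
  rewrite M1E// M2E//; congr EFin; apply/eqP; rewrite -subr_eq0 -RintegralB//; last 2 first.
  - exact: (integrableS (mu := m) mD).
  - exact: (integrableS (mu := m) mD).
  apply/eqP; rewrite -[RHS](f0 N i iN); apply: eq_Rintegral => x _; exact/esym/fE.
have H : ae_eq m D (EFin \o f) (cst 0%E).
  apply: (integral_ae_eq mD fi) => [|A AD mA]; first exact: measurable_cst.
  rewrite integral0 -EFin_Rint//; last exact: (integrableS (mu := m) mD).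
  rewrite (_ : \int[m]_(x in A) f x = \int[m]_(x in A) (Num.max (f x) 0 - Num.max (- f x) 0)); last first.
    by apply: eq_Rintegral => x _; exact: fE.
  rewrite RintegralB//; last 2 first.
  - exact: (integrableS (mu := m) mD).
  - exact: (integrableS (mu := m) mD).
  by have := M12 A mA AD; rewrite M1E// M2E// => -[->]; rewrite subrr.
by apply: ae_imply H => x h /h [].
Qed.

(** The cell averages of [b] converge to a function with the same cell integrals,
which is [b] by [cells_ae0]. *)
Lemma step_dense (m : {measure set (measurableTypeR R) -> \bar R}) (b : R -> R) :
  (m D < +oo)%E -> L2 m D b -> forall e : R, 0 < e ->
  exists N c, \int[m]_(x in D) ((b x - step l N c x) ^+ 2) <= e.
Proof.
move=> mfin Lb e e0; have ib := L2_integrable mD mfin Lb.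
pose nu N i := \int[m]_(x in cell l N i) b x.
have nuA N i : (i < 2 ^ N)%N -> nu N i = nu N.+1 i.*2 + nu N.+1 i.*2.+1.
  move=> iN; rewrite /nu cell_split Rintegral_setU//.
  - apply: (integrableS (mu := m) mD _ _ ib); first by apply: measurableU; exact: mC.
    by rewrite -cell_split; exact: cell_sub.
  - by apply: cell_disj; rewrite neq_ltn ltnSn.
have Cfin N i : (m (cell l N i) < +oo)%E.
  have mCi := mC N i; have CD := @cell_sub _ l N i.
  by apply: (le_lt_trans _ mfin); apply: le_measure => //; rewrite inE.
have cs N i : nu N i ^+ 2 <= cell_mass l m N i * \int[m]_(x in cell l N i) (b x ^+ 2).
  have LC : L2 m (cell l N i) b by apply: (L2_subset (mu := m) mD) => //; exact: cell_sub.
  exact: (cauchy_schwarz1 (mu := m) (mC N i) (Cfin N i) LC).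
have nu0 N i : (i < 2 ^ N)%N -> cell_mass l m N i = 0 -> nu N i = 0.
  move=> _ w0; have := cs N i; rewrite w0 mul0r => h.
  by apply/eqP; rewrite -sqrf_eq0 eq_le h sqr_ge0.
have nuF N : \sum_(i < (2 ^ N)%N) nu N i ^+ 2 / cell_mass l m N i <= \int[m]_(x in D) (b x ^+ 2).
  rewrite (sum_cells l0 N (Lb.2)); apply: ler_sum => i _.
  have := cell_mass_ge0 l m N i; rewrite le_eqVlt => /orP[/eqP <-|wp].
    by rewrite invr0 mulr0; apply: Rintegral_ge0 => x _; exact: sqr_ge0.
  by rewrite ler_pdivrMr// mulrC.
have [b' [Lb' bc _ bs]] := @dyadic_density R l l0 m mfin nu _ nuA nu0 nuF.
have ib' := L2_integrable mD mfin Lb'.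
have bb : {ae m, forall x, D x -> b x - b' x = 0}.
  apply: cells_ae0; first exact: RintB.
  move=> N i iN; rewrite RintegralB ?bc ?subrr//.
  - by apply: (integrableS (mu := m) mD _ _ ib) => //; exact: cell_sub.
  - by apply: (integrableS (mu := m) mD _ _ ib') => //; exact: cell_sub.
have [N [c H]] := bs e e0; exists N, c; apply: le_trans H.
rewrite le_eqVlt; apply/orP; left; apply/eqP; apply: ae_eq_Rint => //.
by apply: ae_imply bb => x E /E /eqP; rewrite subr_eq0 => /eqP ->.
Qed.

End StepDense.

Lemma sqr_le4 (R : realType) (t : R) : 0 <= t <= 2 -> t ^+ 2 <= 4.
Proof.
move=> /andP[t0 t2]; have : 0 <= (2 - t) * (2 + t) by apply: mulr_ge0; lra.
have -> : (2 - t) * (2 + t) = 4 - t ^+ 2 by ring.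
lra.
Qed.

Section FiberLimits.
Context {R : realType}.
Variable l : R.
Hypothesis l0 : 0 < l.
Local Notation leb := (@lebesgue_measure R).
Local Notation D := (`[0, l]%classic : set (measurableTypeR R)).
Variables (rho pi : {finite_measure set (measurableTypeR R) -> \bar R}).
Hypothesis wpi : forall N i, (i < 2 ^ N)%N -> 0 < cell_mass l pi N i.
Hypothesis rho_supp : rho.-null_set (~` D).
Variables (q p : R -> R).
Hypothesis iq : indef 0 l q p.
Hypothesis Lp : L2 leb D p.
Hypothesis q0 : forall x, D x -> 0 <= q x.
Hypothesis rhoE : forall A, measurable A -> A `<=` D ->
  rho A = (\int[pi]_(x in A) (q x ^+ 2)%:E)%E.

Let mD : measurable D. Proof. exact: measurable_itv. Qed.
Let lebD : (leb D < +oo)%E. Proof. by rewrite leb_cc ?ltry// ltW. Qed.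
Let cq := indef_continuous (ltW l0) iq.
Let mq := within_measurable cq.

Definition pou_mass (m : {finite_measure set (measurableTypeR R) -> \bar R}) N i : R :=
  \int[m]_(x in D) pou l N i x.

Lemma pou_measurable N i : measurable_fun setT (pou l N i).
Proof.
apply: continuous_measurable_fun; apply: (is_derive_continuous (f' := pou' l N i)).
exact: pou_derive.
Qed.

Lemma pou_integrable (m : {finite_measure set (measurableTypeR R) -> \bar R}) N i :
  m.-integrable D (EFin \o pou l N i).
Proof.
apply: (bounded_integrable (mu := m) mD _ _ (K := 1)).
- by rewrite -ge0_fin_numE// fin_num_measure.
- by apply: measurable_funTS; exact: pou_measurable.
- by move=> x _; rewrite ger0_norm ?pou_ge0// pou_le1.
Qed.

Lemma pou_mass_ge0 m N i : 0 <= pou_mass m N i.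
Proof. by apply: Rintegral_ge0 => x _; exact: pou_ge0. Qed.

(** A hat is at least 1/2 on one cell of the next level. *)
Lemma pou_mass_gt0 N i : (i <= 2 ^ N)%N -> 0 < pou_mass pi N i.
Proof.
move=> iN.
have N1 : (2 ^ N.+1 = (2 ^ N).*2)%N by rewrite expnS mul2n.
have P0 : (0 < 2 ^ N)%N by rewrite expn_gt0.
have p2 : (0 : R) < 2 ^+ N by exact: exprn_gt0.
have [k [kN H]] : exists k, (k < 2 ^ N.+1)%N /\
    forall x, cell l N.+1 k x -> 1 / 2 <= pou l N i x.
  have half k x : cell l N.+1 k x ->
      k%:R / 2 <= 2 ^+ N * x / l <= (k%:R + 1) / 2.
    move=> /(cell_itv l0)/(scaled_cell l0); rewrite exprS -!mulrA => /andP[h1 h2].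
    by apply/andP; split; lra.
  move: iN; rewrite leq_eqVlt => /orP[/eqP iE|iN].
    exists (2 ^ N).*2.-1; split; first by rewrite N1 prednK// double_gt0.
    move=> x /half; rewrite /pou; set z := 2 ^+ N * x / l.
    have -> : (2 ^ N).*2.-1%:R = 2 * i%:R - 1 :> R.
      rewrite iE -[X in _ = X - 1]natrM mul2n -{2}[(2 ^ N).*2]prednK ?double_gt0//.
      by rewrite -natr1 addrK.
    move=> /andP[h1 h2].
    have s1 : 1 / 2 <= step1 (z - i%:R + 1) by apply: step1_half_ge; lra.
    have s0 : step1 (z - i%:R) = 0 by apply: step1_le0; lra.
    by rewrite s0 subr0.
  exists i.*2; split; first by rewrite N1 ltn_double.
  move=> x /half; rewrite /pou -muln2 natrM; set z := 2 ^+ N * x / l => /andP[h1 h2].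
  have s1 : step1 (z - i%:R + 1) = 1 by apply: step1_ge1; lra.
  have s0 : step1 (z - i%:R) <= 1 / 2 by apply: step1_half; lra.
  by rewrite s1; lra.
have mC : measurable (cell l N.+1 k : set (measurableTypeR R)) by exact: measurable_cell.
have CD := @cell_sub _ l N.+1 k.
apply: (@lt_le_trans _ _ (\int[pi]_(x in cell l N.+1 k) cst (1 / 2) x)).
  by rewrite Rintegral_cst//; have := wpi kN; rewrite /cell_mass => h; rewrite mulr_gt0//; lra.
have ip := pou_integrable pi N i.
have ipC : pi.-integrable (cell l N.+1 k) (EFin \o pou l N i) by apply: integrableS ip.
apply: (@le_trans _ _ (\int[pi]_(x in cell l N.+1 k) pou l N i x)).
  apply: le_Rintegral => //; first by have := finite_measure_integrable_cst pi (1 / 2) mC; apply.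
rewrite -lee_fin !EFin_Rint//; apply: ge0_subset_integral => //.
- by case/integrableP: ip.
- by move=> x _; rewrite lee_fin pou_ge0.
Qed.

Lemma pou_mass_rho N i : pou_mass rho N i = \int[pi]_(x in D) (pou l N i x * q x ^+ 2).
Proof.
apply: (change_on_Rint mD _ _ rho_supp rhoE mD (@subset_refl _ D)).
- exact: measurable_funX.
- by move=> x _; exact: sqr_ge0.
- exact: pou_integrable.
Qed.

(** The value of [q] suggested by the mass of a hat; coefficients of test functions
are functions of these numbers only, so they depend on [rho] through finitely many
pairings. *)
Definition avg_sqrt N i : R := Num.sqrt (pou_mass rho N i / pou_mass pi N i).

(** The window of cell [k]: the cell together with its neighbours, that is the union of
the supports of the hats that do not vanish on the cell. *)
Definition win_lo N k : R := dyad l N k.-1.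
Definition win_hi N k : R := dyad l N (minn k.+2 (2 ^ N)).
Definition win_osc N k : R := \int[leb]_(t in `[win_lo N k, win_hi N k]) `|p t|.
Definition win_energy N k : R := \int[leb]_(t in `[win_lo N k, win_hi N k]) (p t ^+ 2).

Let win_lo_ge0 N k : 0 <= win_lo N k. Proof. exact: dyad_ge0. Qed.
Let win_hi_le N k : win_hi N k <= l. Proof. by apply: dyad_lel => //; exact: geq_minr. Qed.
Let win_lo_hi N k : (k < 2 ^ N)%N -> win_lo N k <= win_hi N k.
Proof.
move=> kN; apply: dyad_le => //; rewrite leq_min; apply/andP; split.
  by apply: leq_trans (leq_pred k) _; rewrite (leq_trans (leqnSn k)).
by apply: leq_trans (leq_pred k) _; exact: ltnW.
Qed.

Lemma window N k i x : `[0, l]%classic x -> (i == k) || (i == k.+1) ->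
  `|2 ^+ N * x / l - i%:R| < 1 -> win_lo N k <= x <= win_hi N k.
Proof.
have p2 : (0 : R) < 2 ^+ N by exact: exprn_gt0.
move=> /=; rewrite in_itv /= => /andP[x0 xl] ik; rewrite ltr_norml => /andP[h1 h2].
have [k1 k2] : k%:R <= i%:R :> R /\ i%:R <= k%:R + 1 :> R.
  by split; case/orP: ik => /eqP ->; rewrite ?lerDl// -natr1 ?lerDl.
have lo : (k.-1)%:R * l <= 2 ^+ N * x.
  rewrite -ler_pdivlMr//; case: k {ik} k1 k2 => [|k] k1 k2 /=.
    by apply: divr_ge0; [rewrite mulr_ge0// ltW|exact: ltW].
  by move: k1; rewrite -natr1; lra.
have hi : 2 ^+ N * x <= (k.+2)%:R * l.
  by rewrite -ler_pdivrMr// -[k.+2%:R]natr1 -[k.+1%:R]natr1; lra.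
apply/andP; split; first by rewrite /win_lo /dyad ler_pdivrMr// [x * _]mulrC.
rewrite /win_hi; case: leqP => _; last by rewrite dyad_last.
by rewrite /dyad ler_pdivlMr// [x * _]mulrC.
Qed.

Lemma avg_near N k i x : (k < 2 ^ N)%N -> (i == k) || (i == k.+1) ->
  win_lo N k <= x <= win_hi N k -> `|avg_sqrt N i - q x| <= win_osc N k.
Proof.
move=> kN ik wx; have iN : (i <= 2 ^ N)%N by case/orP: ik => /eqP -> //; exact: ltnW.
have Dx : D x by rewrite /= in_itv /=; case/andP: wx => h1 h2; rewrite (le_trans (win_lo_ge0 N k))// (le_trans h2).
rewrite /avg_sqrt pou_mass_rho; apply: (avg_sqrt_near (m := pi) mD mq).
- exact: pou_integrable.
- by move=> y _; exact: pou_ge0.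
- exact: pou_mass_gt0.
- exact: q0.
- by apply: Rintegral_ge0.
- exact: q0.
- move=> y Dy n0; apply: (indef_osc (indef_sub iq (win_lo_ge0 N k) (win_lo_hi kN) (win_hi_le N k))) => //.
  apply: (window (i := i)) => //; rewrite ltNge; apply/negP => h.
  by move: n0; have [-> _] := pou_eq0 h; rewrite eqxx.
Qed.

Lemma cell_window N k x : (k < 2 ^ N)%N -> dyad l N k <= x <= dyad l N k.+1 ->
  win_lo N k <= x <= win_hi N k.
Proof.
move=> kN /andP[h1 h2]; apply/andP; split; first by apply: le_trans h1; apply: dyad_le => //; exact: leq_pred.
by apply: (le_trans h2); apply: dyad_le => //; rewrite leq_min leqnSn.
Qed.

Lemma win_osc_sq N k : (k < 2 ^ N)%N -> win_osc N k ^+ 2 <= 3 * (l / 2 ^+ N) * win_energy N k.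
Proof.
move=> kN; have p2 : (0 : R) < 2 ^+ N by exact: exprn_gt0.
have Lw : L2 leb `[win_lo N k, win_hi N k] p.
  apply: (L2_subset (mu := leb) mD _ _ Lp); first exact: measurable_itv.
  by apply: itvcc_sub; [exact: win_lo_ge0|exact: win_hi_le].
apply: (le_trans (cs_itv (win_lo_hi kN) Lw)); apply: ler_wpM2r.
  by apply: Rintegral_ge0 => t _; exact: sqr_ge0.
rewrite lerBlDr; apply: (@le_trans _ _ (dyad l N k.+2)).
  by apply: dyad_le => //; exact: geq_minl.
rewrite !dyadS /win_lo; case: k {kN Lw} => [|k] /=; last by rewrite dyadS; lra.
have : 0 < l / 2 ^+ N by rewrite divr_gt0.
by rewrite dyad0; lra.
Qed.

(** Each cell lies in at most three windows. *)
Lemma sum_win_energy N : \sum_(k < (2 ^ N)%N) win_energy N k <= 3 * \int[leb]_(x in D) (p x ^+ 2).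
Proof.
pose J x := \int[leb]_(t in `[0, x]) (p t ^+ 2).
have iJ : indef 0 l J (fun t => p t ^+ 2).
  by split; [case: Lp|move=> x _; rewrite /J set_itv1 Rintegral_set1 add0r].
pose a k := J (dyad l N (minn k (2 ^ N))).
have J0 : J 0 = 0 by rewrite /J set_itv1 Rintegral_set1.
have dl k : dyad l N (minn k (2 ^ N)) <= l by apply: dyad_lel => //; exact: geq_minr.
have am i k : (i <= k)%N -> a i <= a k.
  move=> ik; rewrite -subr_ge0 (indef_incr iJ)//.
  - by apply: Rintegral_ge0 => t _; exact: sqr_ge0.
  - exact: dyad_ge0.
  - by apply: dyad_le => //; rewrite leq_min geq_minr andbT (leq_trans (geq_minl _ _)).
have aF k : a k <= J l.
  rewrite -subr_ge0 (indef_incr iJ)//; last exact: dyad_ge0.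
  by apply: Rintegral_ge0 => t _; exact: sqr_ge0.
have a00 : a 0%N = 0 by rewrite /a min0n dyad0 J0.
have a0 k : 0 <= a k by have := am 0%N k (leq0n k); rewrite a00.
have wE k : (k < 2 ^ N)%N -> win_energy N k = a k.+2 - a k.-1.
  move=> kN; have := indef_incr iJ (win_lo_ge0 N k) (win_lo_hi kN) (win_hi_le N k).
  rewrite /win_energy => <-; congr (_ - J _); rewrite /win_lo (minn_idPl _)//.
  by apply: leq_trans (leq_pred k) (ltnW kN).
rewrite (eq_bigr (fun k : 'I_(2 ^ N)%N => a k.+2 - a k.-1)); last by move=> k _; rewrite wE.
have tel n : \sum_(k < n) (a k.+2 - a k.-1) <= a n.+1 + a n + a n.-1.
  elim: n => [|n IH]; first by rewrite big_ord0 !addr_ge0.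
  rewrite big_ord_recr /=; apply: (le_trans (lerD IH (lexx _))).
  have := am n.-1 n (leq_pred n); lra.
apply: (le_trans (tel _)); rewrite -/(J l).
have := aF (2 ^ N)%N.+1; have := aF (2 ^ N)%N; have := aF (2 ^ N)%N.-1; lra.
Qed.

Section Composite.
Variables (G G' : R -> R) (K C : R).
Hypothesis dG : forall z : R, is_derive z 1 G (G' z).
Hypothesis cG' : continuous G'.
Hypothesis GK : forall z, `|G z| <= K.
Hypothesis C0 : 0 <= C.
Hypothesis GC : forall x y, 0 <= x -> 0 <= y -> ((G x - G y) * y) ^+ 2 <= C * (x - y) ^+ 2.

Definition pou_comb N (x : R) : R := \sum_(i < (2 ^ N)%N.+1) G (avg_sqrt N i) * pou l N i x.
Definition pou_comb' N (x : R) : R := \sum_(i < (2 ^ N)%N.+1) G (avg_sqrt N i) * pou' l N i x.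

Lemma pou_comb_derive N (x : R) : is_derive x 1 (pou_comb N) (pou_comb' N x).
Proof.
have -> : pou_comb N = \sum_(i < (2 ^ N)%N.+1) (fun x => G (avg_sqrt N i) * pou l N i x).
  by apply/funext => y; rewrite /pou_comb fct_sumE.
apply: is_derive_sum => i.
by apply: is_derive_eq (is_deriveZ (G (avg_sqrt N i)) (pou_derive l N i x)) _.
Qed.

Lemma pou_comb'_continuous N : continuous (pou_comb' N).
Proof.
by move=> x; apply: cvg_sumR => i; apply: cvgM; [exact: cvg_cst|exact: pou'_continuous].
Qed.

Let K0 : 0 <= K. Proof. exact: le_trans (GK 0). Qed.
Let CK0 (c : R) : 0 <= c -> 0 <= c * (C + K ^+ 2).
Proof. by move=> c0; rewrite mulr_ge0// addr_ge0// sqr_ge0. Qed.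

Lemma pou_comb_le N x : D x -> `|pou_comb N x| <= K.
Proof.
move=> Dx; apply: (le_trans (ler_norm_sum _ _ _)).
apply: (@le_trans _ _ (\sum_(i < (2 ^ N)%N.+1) K * pou l N i x)).
  by apply: ler_sum => i _; rewrite normrM (ger0_norm (pou_ge0 _ _ _ _)) ler_wpM2r// pou_ge0.
by rewrite -mulr_sumr pou_sum// mulr1.
Qed.

Let Dx0l x : D x -> 0 <= x <= l. Proof. by rewrite /= in_itv. Qed.

Let xcell N x : D x -> dyad l N (cell_idx l N x) <= x <= dyad l N (cell_idx l N x).+1.
Proof. by move=> /Dx0l Dx; apply: (@cell_itv _ _ l0); split. Qed.

Let avg_ge0 N i : 0 <= avg_sqrt N i. Proof. exact: sqrtr_ge0. Qed.

Lemma win_osc_cvg x : D x -> win_osc N (cell_idx l N x) @[N --> \oo] --> (0 : R).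
Proof.
move=> Dx; set I := \int[leb]_(x in D) (p x ^+ 2).
have I0 : 0 <= I by apply: Rintegral_ge0 => t _; exact: sqr_ge0.
have c : 3 * (l / 2 ^+ N) * (3 * I) @[N --> \oo] --> (0 : R).
  rewrite -(mul0r (3 * I)); apply: cvgM; last exact: cvg_cst.
  rewrite -(mulr0 3); apply: cvgM; first exact: cvg_cst.
  rewrite -(mulr0 l); apply: cvgM; first exact: cvg_cst.
  have -> : (fun N => (2 ^+ N)^-1 : R) = (fun N => (1 / 2) ^+ N).
    by apply/funext => N; rewrite div1r exprVn.
  by apply: cvg_expr; rewrite ger0_norm; lra.
apply/cvgrPdist_le => e e0.
have /cvgrPdist_le /(_ _ (exprn_gt0 2 e0)) [N0 _ H] := c.
exists N0 => // N /= N0N; have := H N N0N; rewrite /= !sub0r !normrN => {}H.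
have o0 : 0 <= win_osc N (cell_idx l N x) by apply: Rintegral_ge0.
have iN := cell_idx_lt l N x.
rewrite ger0_norm// -(@ler_pXn2r _ 2)// ?nnegrE//; last exact: ltW.
apply: le_trans H; apply: le_trans (ler_norm _).
apply: (le_trans (win_osc_sq iN)); apply: ler_wpM2l.
  by rewrite mulr_ge0// divr_ge0 ?exprn_ge0// ltW.
apply: le_trans (sum_win_energy N); rewrite (bigD1 (Ordinal iN))//= lerDl.
by apply: sumr_ge0 => k _; apply: Rintegral_ge0 => t _; exact: sqr_ge0.
Qed.

Lemma pou_comb_cvg x : D x -> pou_comb N x @[N --> \oo] --> G (q x).
Proof.
move=> Dx; have co := win_osc_cvg Dx.
have near N i : (i == cell_idx l N x) || (i == (cell_idx l N x).+1) ->
    `|avg_sqrt N i - q x| <= win_osc N (cell_idx l N x).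
  move=> ik; apply: avg_near => //; first exact: cell_idx_lt.
  by apply: cell_window; [exact: cell_idx_lt|exact: xcell].
have ca (i : nat -> nat) : (forall N, (i N == cell_idx l N x) || (i N == (cell_idx l N x).+1)) ->
    G (avg_sqrt N (i N)) @[N --> \oo] --> G (q x).
  move=> ik; apply: continuous_cvg; first exact: (is_derive_continuous dG).
  apply/cvgrPdist_le => e e0; have /cvgrPdist_le /(_ _ e0) [N0 _ H] := co.
  exists N0 => // N /= N0N; have := H N N0N; rewrite /= sub0r normrN => h.
  by rewrite distrC (le_trans (near N (i N) (ik N)))// (le_trans (ler_norm _)).
have c0 := ca (fun N => cell_idx l N x) (fun N => _).
have {}c0 : G (avg_sqrt N (cell_idx l N x)) @[N --> \oo] --> G (q x) by apply: c0 => M; rewrite eqxx.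
have c1 := ca (fun N => (cell_idx l N x).+1) (fun N => _).
have {}c1 : G (avg_sqrt N (cell_idx l N x).+1) @[N --> \oo] --> G (q x) by apply: c1 => M; rewrite eqxx orbT.
have cd : `|G (avg_sqrt N (cell_idx l N x).+1) - G (avg_sqrt N (cell_idx l N x))| @[N --> \oo] --> (0 : R).
  have -> : (0 : R) = `|G (q x) - G (q x)| by rewrite subrr normr0.
  by apply: cvg_norm; apply: cvgB.
apply/cvgrPdist_le => e e0.
have e2 : 0 < e / 2 by rewrite divr_gt0.
have /cvgrPdist_le /(_ _ e2) [N0 _ H0] := c0.
have /cvgrPdist_le /(_ _ e2) [N1 _ H1] := cd.
exists (maxn N0 N1) => // N /=; rewrite geq_max => /andP[n0 n1].
have := H0 N n0; have := H1 N n1; rewrite /= sub0r normrN normr_id => h1 h2.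
rewrite /pou_comb; have [-> _] := pou_two_terms l0 (fun i => G (avg_sqrt N i)) (cell_idx_lt l N x) (xcell N Dx).
set s := step1 _; have /andP[s0 s1] : 0 <= s <= 1 by exact: step1_itv.
rewrite opprD addrA; apply: (le_trans (ler_normB _ _)).
have : `|(G (avg_sqrt N (cell_idx l N x).+1) - G (avg_sqrt N (cell_idx l N x))) * s| <= e / 2.
  by rewrite normrM (ger0_norm s0); apply: le_trans h1; rewrite ler_piMr.
lra.
Qed.

(** On the cell the derivative is a difference of two coefficients times the slope
[2 ^+ N / l] of a hat. Multiplication by [q] instead of by the average at
which the coefficient is taken costs an oscillation of [q], so the square is controlled by the energy of
[q] in the window. *)
Lemma pou_comb'_q N k x : (k < 2 ^ N)%N -> dyad l N k <= x <= dyad l N k.+1 ->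
  (pou_comb' N x * q x) ^+ 2 <= 96 * (C + K ^+ 2) * (2 ^+ N / l) * win_energy N k.
Proof.
move=> kN xk; rewrite /pou_comb'; have [_ ->] := pou_two_terms l0 (fun i => G (avg_sqrt N i)) kN xk.
have p2 : (0 : R) < 2 ^+ N by exact: exprn_gt0.
set a := G _; set b := G _; set t := step1' _.
have /andP[t0 t2] : 0 <= t <= 2 by exact: step1'_itv.
have xw := cell_window kN xk.
have Dx : D x.
  rewrite /= in_itv /=; case/andP: xk => h1 h2.
  by rewrite (le_trans (dyad_ge0 l0 N k))// (le_trans h2)// dyad_lel.
have n0 := avg_near (i := k) kN _ xw; rewrite eqxx in n0; have {}n0 := n0 isT.
have n1 := avg_near (i := k.+1) kN _ xw; rewrite eqxx orbT in n1; have {}n1 := n1 isT.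
set V := win_osc N k in n0 n1; set S := avg_sqrt N k in n0; set S1 := avg_sqrt N k.+1 in n1.
have V0 : 0 <= V by apply: Rintegral_ge0.
have hS : (S1 - S) ^+ 2 <= 4 * V ^+ 2.
  have -> : 4 * V ^+ 2 = (2 * V) ^+ 2 by ring.
  rewrite -[leLHS]real_normK ?num_real// lerXn2r ?nnegrE ?mulr_ge0//.
  have := ler_normB (S1 - q x) (S - q x).
  have -> : S1 - q x - (S - q x) = S1 - S by ring.
  lra.
have hq : (q x - S) ^+ 2 <= V ^+ 2.
  by rewrite -[leLHS]real_normK ?num_real// lerXn2r ?nnegrE// distrC.
have h1 : ((a - b) * S) ^+ 2 <= 4 * C * V ^+ 2.
  apply: (le_trans (GC (avg_ge0 N k.+1) (avg_ge0 N k))).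
  by have := ler_wpM2l C0 hS; rewrite -/S1 -/S; lra.
have h2 : (a - b) ^+ 2 <= 4 * K ^+ 2.
  have -> : 4 * K ^+ 2 = (2 * K) ^+ 2 by ring.
  rewrite -[leLHS]real_normK ?num_real// lerXn2r ?nnegrE ?mulr_ge0//.
  apply: (le_trans (ler_normB _ _)).
  by have := GK S1; have := GK S; rewrite -/a -/b; lra.
have h3 : ((a - b) * q x) ^+ 2 <= 8 * (C + K ^+ 2) * V ^+ 2.
  have e : (a - b) * q x = (a - b) * S + (a - b) * (q x - S) by ring.
  have h4 : ((a - b) * (q x - S)) ^+ 2 <= 4 * K ^+ 2 * V ^+ 2.
    by rewrite exprMn; apply: ler_pM => //; exact: sqr_ge0.
  rewrite e; set u := (a - b) * S in h1 *; set v := (a - b) * (q x - S) in h4 *.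
  have := sqr_ge0 (u - v); have -> : (u + v) ^+ 2 = 2 * u ^+ 2 + 2 * v ^+ 2 - (u - v) ^+ 2 by ring.
  lra.
have -> : ((a - b) * (2 ^+ N / l * t) * q x) ^+ 2 = t ^+ 2 * ((2 ^+ N / l) ^+ 2 * ((a - b) * q x) ^+ 2) by ring.
have tt : t ^+ 2 <= 4 by apply: sqr_le4; rewrite t0.
have h5 : (2 ^+ N / l) ^+ 2 * ((a - b) * q x) ^+ 2 <= (2 ^+ N / l) ^+ 2 * (8 * (C + K ^+ 2) * (3 * (l / 2 ^+ N) * win_energy N k)).
  apply: ler_wpM2l; first exact: sqr_ge0.
  apply: (le_trans h3); apply: ler_wpM2l; last exact: win_osc_sq.
  by rewrite mulr_ge0// addr_ge0// sqr_ge0.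
have n5 : 0 <= (2 ^+ N / l) ^+ 2 * ((a - b) * q x) ^+ 2 by rewrite mulr_ge0 ?sqr_ge0.
(* The constant 96 is 4 from [t <= 2], 8 from [h3] and 3 from the width of the window. *)
apply: (le_trans (ler_pM (sqr_ge0 t) n5 tt h5)).
rewrite le_eqVlt; apply/orP; left; apply/eqP; field.
by rewrite !gt_eqF.
Qed.

Let cF N : {within `[0, l], continuous (fun x => pou_comb' N x * q x)}.
Proof.
by move=> x; apply: cvgM; [apply: continuous_subspaceT; exact: pou_comb'_continuous|exact: cq].
Qed.

Lemma pou_comb'_L2 N : L2 leb D (fun x => pou_comb' N x * q x).
Proof.
split; first exact: within_measurable.
by apply: (within_integrable (q := fun x => (pou_comb' N x * q x) ^+ 2)) => x; apply: cvg_sqr; exact: cF.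
Qed.

Lemma pou_comb'_bound N : \int[leb]_(x in D) ((pou_comb' N x * q x) ^+ 2) <=
  288 * (C + K ^+ 2) * \int[leb]_(x in D) (p x ^+ 2).
Proof.
have p2 : (0 : R) < 2 ^+ N by exact: exprn_gt0.
have [_ iF] := pou_comb'_L2 N.
rewrite (sum_cells l0 N iF).
apply: (@le_trans _ _ (\sum_(k < (2 ^ N)%N) 96 * (C + K ^+ 2) * win_energy N k)); last first.
  rewrite -mulr_sumr; have CK : 0 <= 96 * (C + K ^+ 2) by apply: CK0; exact: ler0n.
  by have := ler_wpM2l CK (sum_win_energy N); lra.
apply: ler_sum => k _.
have mC : measurable (cell l N k : set (measurableTypeR R)) by exact: measurable_cell.
have CD := @cell_sub _ l N k.
have Cfin : (leb (cell l N k) < +oo)%E.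
  by apply: (le_lt_trans _ lebD); apply: le_measure => //; rewrite inE.
apply: (@le_trans _ _ (\int[leb]_(x in cell l N k) cst (96 * (C + K ^+ 2) * (2 ^+ N / l) * win_energy N k) x)).
  apply: le_Rintegral => //.
  - by apply: (integrableS (mu := leb) mD _ _ iF).
  - by apply: L2_integrable => //; exact: L2_cst.
  - by move=> x /(cell_itv l0); exact: pou_comb'_q.
rewrite Rintegral_cst// -[fine _]/(cell_mass l leb N k) (cell_mass_leb l0)//.
rewrite le_eqVlt; apply/orP; left; apply/eqP; field.
by rewrite !gt_eqF.
Qed.

Let cGq : {within `[0, l], continuous (fun x => G' (q x))}.
Proof. by move=> x; apply: (@continuous_comp (subspace `[0, l]) R R q G'); [exact: cq|exact: cG']. Qed.

Lemma comp_L2 : L2 leb D (fun x => G' (q x) * p x * q x).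
Proof.
have [k1 k10 H1] := within_bounded (ltW l0) cGq; have [k2 k20 H2] := within_bounded (ltW l0) cq.
apply: (L2_dom (mu := leb) mD _ (L2Z (k1 * k2) mD Lp)).
  apply: measurable_funM => //; apply: measurable_funM; last by case: Lp.
  exact: (within_measurable cGq).
move=> x /Dx0l xl; rewrite mulrAC !normrM ler_wpM2r// ler_pM//.
  by apply: (le_trans (H1 x xl)); exact: ler_norm.
by apply: (le_trans (H2 x xl)); exact: ler_norm.
Qed.

(** Integration by parts on the cell moves the derivative from the hat combination to
[q]; the combination itself converges boundedly. *)
Lemma pou_comb'_cell n i : (i < 2 ^ n)%N ->
  \int[leb]_(x in cell l n i) (pou_comb' N x * q x) @[N --> \oo] -->
  \int[leb]_(x in cell l n i) (G' (q x) * p x * q x).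
Proof.
move=> iN.
have ip := L2_integrable mD lebD Lp.
have mC : measurable (cell l n i : set (measurableTypeR R)) by exact: measurable_cell.
have CD := @cell_sub _ l n i.
set u := dyad l n i; set v := dyad l n i.+1.
have u0 : 0 <= u by exact: dyad_ge0.
have uv : u <= v by apply: dyad_le.
have vl : v <= l by exact: dyad_lel.
have mI : measurable (`[u, v]%classic : set (measurableTypeR R)) by exact: measurable_itv.
have parts (f f' : R -> R) : indef 0 l f f' -> leb.-integrable D (EFin \o (fun x => f' x * q x)) ->
    \int[leb]_(x in cell l n i) (f' x * q x) =
    f v * q v - f u * q u - \int[leb]_(x in `[u, v]) (f x * p x).
  move=> jf jfq; have jm := indef_mul (ltW l0) jf iq.
  rewrite (Rint_cell_cc l0 iN jfq) (indef_incr jm u0 uv vl) -RintegralB.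
  - by apply: eq_Rintegral => x _; rewrite addrK.
  - exact: mI.
  - exact: integrable_cc_sub u0 vl jm.1.
  - have jfp : leb.-integrable D (EFin \o (fun x => f x * p x)).
      have [k k0 H] := within_bounded (ltW l0) (indef_continuous (ltW l0) jf).
      apply: (dom_integrable mD _ (RintZ k mD (RintNorm mD ip))).
        apply: measurable_funM; last by case: Lp.
        exact: within_measurable (indef_continuous (ltW l0) jf).
      by move=> x /Dx0l xl; rewrite normrM ler_wpM2r// H.
    exact: integrable_cc_sub u0 vl jfp.
have iF N : leb.-integrable D (EFin \o (fun x => pou_comb' N x * q x)).
  by apply: L2_integrable => //; exact: pou_comb'_L2.
have iL := L2_integrable mD lebD comp_L2.
have jG : indef 0 l (G \o q) (fun x => G' (q x) * p x) by apply: indef_comp => //; exact: ltW.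
rewrite (parts _ _ jG iL).
have -> : (fun N => \int[leb]_(x in cell l n i) (pou_comb' N x * q x)) =
  (fun N => pou_comb N v * q v - pou_comb N u * q u - \int[leb]_(x in `[u, v]) (pou_comb N x * p x)).
  apply/funext => N; apply: parts => //; apply: (indef_C1 (ltW l0)).
    exact: pou_comb_derive.
  exact: pou_comb'_continuous.
have Du : D u by rewrite /= in_itv /= u0 (le_trans uv).
have Dv : D v by rewrite /= in_itv /= vl (le_trans u0).
have ID : `[u, v]%classic `<=` D by exact: itvcc_sub.
apply: cvgB; first apply: cvgB.
- by apply: cvgM; [exact: pou_comb_cvg|exact: cvg_cst].
- by apply: cvgM; [exact: pou_comb_cvg|exact: cvg_cst].
have mp : measurable_fun `[u, v] p by apply: measurable_funS Lp.1.
have mc N : measurable_fun `[u, v] (pou_comb N).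
  apply: measurable_funTS; apply: continuous_measurable_fun.
  by apply: (is_derive_continuous (f' := pou_comb' N)); exact: pou_comb_derive.
have mGq : measurable_fun `[u, v] (G \o q).
  apply: (measurable_funS mD) => //.
  exact: within_measurable (indef_continuous (ltW l0) jG).
have ipI := integrable_cc_sub u0 vl ip.
apply: (Rintegral_dct (mu := leb) mI _ _ _ (RintZ K mI (RintNorm mI ipI)) _).2.
- by move=> N; apply: measurable_funM; [exact: mc|exact: mp].
- by apply: measurable_funM; [exact: mGq|exact: mp].
- by apply: aeW => x /ID Dx; apply: cvgM; [exact: pou_comb_cvg|exact: cvg_cst].
- by apply: aeW => x /ID Dx N; rewrite normrM ler_wpM2r// pou_comb_le.
Qed.

(** The sequence is bounded in L^2 ([pou_comb'_bound]) and converges when tested with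
indicators of cells, whose combinations are dense. *)
Lemma pou_comb'_weak (b : R -> R) : L2 leb D b ->
  \int[leb]_(x in D) (pou_comb' N x * q x * b x) @[N --> \oo] -->
  \int[leb]_(x in D) (G' (q x) * p x * q x * b x).
Proof.
move=> Lb.
set Fl := fun x => G' (q x) * p x * q x.
have [M [M0 MA MB]] : exists M : R, [/\ 0 < M,
    288 * (C + K ^+ 2) * \int[leb]_(x in D) (p x ^+ 2) <= M &
    \int[leb]_(x in D) (Fl x ^+ 2) <= M].
  have : 0 <= 288 * (C + K ^+ 2) * \int[leb]_(x in D) (p x ^+ 2).
    apply: mulr_ge0; last by apply: Rintegral_ge0 => t _; exact: sqr_ge0.
    by apply: CK0; exact: ler0n.
  have : 0 <= \int[leb]_(x in D) (Fl x ^+ 2) by apply: Rintegral_ge0 => t _; exact: sqr_ge0.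
  move: (\int[leb]_(x in D) (Fl x ^+ 2)) (_ * \int[leb]_(x in D) _) => X Y X0 Y0.
  by exists (X + Y + 1); split; lra.
apply/cvgrPdist_le => e e0.
have e3 : 0 < (e / 3) ^+ 2 / M by rewrite divr_gt0// exprn_gt0// divr_gt0.
(* The error of replacing [b] by a step is at most [e / 3] on both sides by Cauchy-Schwarz. *)
have [n [c Hc]] := step_dense (m := leb) l0 lebD Lb e3.
have Ls : L2 leb D (step l n c) by exact: step_L2.
have Lbs := L2B mD Lb Ls.
have cs (f : R -> R) : L2 leb D f -> \int[leb]_(x in D) (f x ^+ 2) <= M ->
    `|\int[leb]_(x in D) (f x * (b x - step l n c x))| <= e / 3.
  move=> Lf fM; rewrite -(@ler_pXn2r _ 2)// ?nnegrE ?divr_ge0 ?(ltW e0)//.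
  rewrite real_normK ?num_real//; apply: (le_trans (cauchy_schwarz mD Lf Lbs)).
  have -> : (e / 3) ^+ 2 = M * ((e / 3) ^+ 2 / M) by rewrite [RHS]mulrC divfK// gt_eqF.
  apply: ler_pM => //; by apply: Rintegral_ge0 => t _; exact: sqr_ge0.
have split_ (f : R -> R) : L2 leb D f -> \int[leb]_(x in D) (f x * b x) =
    \int[leb]_(x in D) (f x * (b x - step l n c x)) + \sum_(i < (2 ^ n)%N) c i * \int[leb]_(x in cell l n i) f x.
  move=> Lf; rewrite -Rint_step//; last exact: L2_integrable.
  rewrite -RintegralD//; [|exact: L2_mul|exact: L2_mul].
  by apply: eq_Rintegral => x _; ring.
have cc : \sum_(i < (2 ^ n)%N) c i * \int[leb]_(x in cell l n i) (pou_comb' N x * q x)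
    @[N --> \oo] --> \sum_(i < (2 ^ n)%N) c i * \int[leb]_(x in cell l n i) Fl x.
  by apply: cvg_sumR => i; apply: cvgM; [exact: cvg_cst|exact: pou_comb'_cell].
have e3' : 0 < e / 3 by rewrite divr_gt0.
have /cvgrPdist_le /(_ _ e3') [N0 _ H] := cc.
exists N0 => // N /= N0N; have := H N N0N => /= h.
rewrite (split_ _ comp_L2) (split_ _ (pou_comb'_L2 N)).
have h1 := cs _ comp_L2 _; have h2 := cs _ (pou_comb'_L2 N) _.
have {}h1 : `|\int[leb]_(x in D) (Fl x * (b x - step l n c x))| <= e / 3 by exact: h1.
have {}h2 : `|\int[leb]_(x in D) (pou_comb' N x * q x * (b x - step l n c x))| <= e / 3.
  by apply: h2; apply: (le_trans (pou_comb'_bound N)).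
move: h h1 h2; rewrite -/Fl; set A := \sum_(i < _) _; set B := \sum_(i < _) _.
set X := \int[leb]_(x in D) _; set Y := \int[leb]_(x in D) _ => h h1 h2.
have -> : X + A - (Y + B) = (A - B) + X - Y by ring.
apply: (le_trans (ler_normB _ _)); have := ler_normD (A - B) X; lra.
Qed.

End Composite.

End FiberLimits.

(** * Continuous representatives and the weak derivative of the logarithm *)

Section ContinuousRepresentative.
Context {R : realType}.
Local Notation leb := (@lebesgue_measure R).
Variable l : R.
Hypothesis l0 : 0 < l.

(** Two functions that are continuous on an interval and agree almost everywhere agree on
a dense set. *)
Lemma within_agree (U : ptopologicalType) (u v : R -> U) : hausdorff_space U ->
  {within `[0, l], continuous u} -> {within `[0, l], continuous v} ->
  ae_eq leb `[0, l] u v -> forall x, 0 <= x <= l -> u x = v x.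
Proof.
move=> hU cu cv [N [mN N0 sN]] x xl.
have sN' y : 0 <= y <= l -> ~ N y -> u y = v y.
  by move=> yl nN; apply: contrapT => h; apply: nN; apply: sN => H; apply: h; apply: H; rewrite /= in_itv.
have Dx : `[0, l]%classic x by rewrite /= in_itv.
have cux : u @ within `[0, l] (nbhs x) --> u x by have := cu x; rewrite /continuous_at nbhs_subspace_in.
have cvx : v @ within `[0, l] (nbhs x) --> v x by have := cv x; rewrite /continuous_at nbhs_subspace_in.
apply: hU => A B nA nB; have := cux A nA; have := cvx B nB => hB hA.
have hAB : nbhs x (fun y => `[0, l]%classic y -> A (u y) /\ B (v y)).
  have hA' : nbhs x (fun y => `[0, l]%classic y -> A (u y)) by exact: hA.
  have hB' : nbhs x (fun y => `[0, l]%classic y -> B (v y)) by exact: hB.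
  by apply: (@filterS2 _ _ _ _ _ _ _ hA' hB') => y h1 h2 Dy; split; [exact: h1|exact: h2].
have /nbhs_ballP[r /= r0 br] := hAB.
pose lo := Num.max 0 (x - r); pose hi := Num.min l (x + r).
have [x0 xl'] : 0 <= x /\ x <= l by case/andP: xl.
have lohi : lo < hi.
  rewrite /lo /hi gt_max !lt_min l0 /=; apply/andP; split; first lra.
  by apply/andP; split; lra.
have [y [yI nN]] : exists y, `]lo, hi[%classic y /\ ~ N y.
  apply: contrapT => h.
  have IN : `]lo, hi[%classic `<=` N.
    by move=> y yI; apply: contrapT => nN; apply: h; exists y.
  have mI : measurable (`]lo, hi[%classic : set (measurableTypeR R)) by exact: measurable_itv.
  have : (leb `]lo, hi[ <= leb N)%E by apply: le_measure => //; rewrite inE.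
  rewrite N0 leb_oo; last exact: ltW.
  by rewrite lee_fin leNgt subr_gt0 lohi.
move: yI; rewrite /= in_itv /= gt_max lt_min => /andP[/andP[y0 y1] /andP[y2 y3]].
have Dy : 0 <= y <= l by rewrite (ltW y0) (ltW y2).
have [||hAy hBy] := br y.
- by rewrite /ball /= ltr_norml; apply/andP; split; lra.
- by rewrite /= in_itv.
by exists (u y); split => //; rewrite (sN' y Dy nN).
Qed.

(** The representative is unique, so exhibiting one computes it. *)
Lemma cont_repE (U : ptopologicalType) (u f : R -> U) : hausdorff_space U ->
  {within `[0, l], continuous u} -> ae_eq leb `[0, l] u f ->
  forall x, 0 <= x <= l -> continuous_representative l f x = u x.
Proof.
move=> hU cu uf; have [cv vf] := getI (P := [set u | {within `[0, l], continuous u} /\ ae_eq leb `[0, l] u f]) (conj cu uf).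
apply: within_agree => //.
by apply: (ae_imply2 _ uf vf) => x H1 H2 Dx; exact: etrans (H2 Dx) (esym (H1 Dx)).
Qed.

End ContinuousRepresentative.

Section LogContinuity.
Context {R : realType}.

Lemma lne_cvg (T : Type) (F : set_system T) {FF : Filter F} (f : T -> R) (a : R) :
  0 <= a -> f x @[x --> F] --> a -> lne (f x)%:E @[x --> F] --> lne a%:E.
Proof.
move=> a0 fa.
move: a0; rewrite le_eqVlt => /orP[/eqP a0|a0].
  rewrite -a0 in fa *; rewrite [X in _ --> X]le0_lneNy//; apply/cvgeNyPle => A.
  have /cvgrPdist_lt /(_ _ (expR_gt0 A)) := fa; apply: filterS => x; rewrite sub0r normrN => h.
  have [fx|fx] := leP (f x) 0; first by rewrite le0_lneNy ?lee_fin// leNye.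
  rewrite lne_EFin// lee_fin -(expRK A) ler_ln ?posrE ?expR_gt0//.
  by apply: (le_trans (ler_norm _)); exact: ltW.
rewrite [X in _ --> X]lne_EFin//.
have e : \forall x \near F, (ln (f x))%:E = lne (f x)%:E.
  have /cvgrPdist_lt /(_ _ a0) := fa; apply: filterS => x; rewrite ltr_norml => /andP[_ h].
  by rewrite lne_EFin//; lra.
apply: (cvg_trans (near_eq_cvg e)); apply: cvg_EFin; first by near=> x.
by apply: continuous_cvg => //; exact: continuous_ln.
Unshelve. all: by end_near. Qed.

End LogContinuity.

Section WeakDerivative.
Context {R : realType}.
Local Notation leb := (@lebesgue_measure R).

Lemma weak_derivativeE (Om : set R) (f g : R -> R) : is_weak_derivative Om f g ->
  {ae leb, forall x, Om x -> weak_derivative Om f x = g x}.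
Proof.
move=> fg; rewrite /weak_derivative.
have fh := getI fg; move: (get _) fh => h fh.
have [_ lg Hg] := fg; have [_ lh Hh] := fh.
have [mg oO _] := lg; have [mh _ _] := lh.
have mO : measurable Om by exact: open_measurable.
have := @bump_pairing_null R Om (fun x => h x - g x) (locally_integrableB lh lg).
move=> /(_ _)/ae_imply; apply => [x H Ox|a b n abO].
  by have := H Ox; rewrite patchE mem_set// => /eqP; rewrite subr_eq0 => /eqP.
have tphi := bump_test n abO.
have [_ [K cK [KO K0]]] : smooth (bump a b n) /\ exists2 K : set R, compact K & K `<=` Om /\
    forall x, ~ K x -> bump a b n x = 0.
  split; first exact: smooth_bump.
  exists `[a, b]%classic; first exact: segment_compact.
  split => // x nx; rewrite bump_eq0// => /andP[xa xb]; apply: nx; rewrite /= in_itv /=.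
  by rewrite !ltW.
have cb : continuous (bump a b n) by exact: smooth_continuous (smooth_bump a b n).
have ih := loc_int_test lh cb cK KO K0; have ig := loc_int_test lg cb cK KO K0.
have -> : \int[leb]_(x in Om) ((h x - g x) * bump a b n x) =
  \int[leb]_(x in Om) (h x * bump a b n x) - \int[leb]_(x in Om) (g x * bump a b n x).
  by rewrite -RintegralB//; apply: eq_Rintegral => x _; ring.
by have := Hg _ tphi; rewrite (Hh _ tphi) => /oppr_inj ->; rewrite subrr.
Qed.

Lemma weak_derivative_measurable (Om : set R) (f g : R -> R) : is_weak_derivative Om f g ->
  measurable_fun (setT : set (measurableTypeR R)) (weak_derivative Om f).
Proof.
move=> fg; rewrite /weak_derivative; have [_ [mh oO _] _] := getI fg.
by apply: (measurable_restrictT _ _).1 => //; exact: open_measurable.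
Qed.

Variable l : R.
Hypothesis l0 : 0 < l.
Local Notation D := (`[0, l]%classic : set (measurableTypeR R)).
Variables q p : R -> R.
Hypothesis iq : indef 0 l q p.
Hypothesis q0 : forall x, 0 <= x <= l -> 0 <= q x.
Definition pos_part : set R := [set x | 0 < x < l /\ 0 < q x].
Let cq := indef_continuous (ltW l0) iq.
Let mD : measurable D. Proof. exact: measurable_itv. Qed.

Lemma open_pos_part : open pos_part.
Proof.
rewrite openE => x [xl qx]; rewrite /interior.
have xo : x \in `]0, l[%R by rewrite in_itv.
have Dx : `[0, l]%classic x by move: xl; rewrite /= in_itv /= => /andP[/ltW-> /ltW->].
have hI : nbhs x (fun y => 0 < y < l).
  by apply: (filterS _ (near_in_itvoo xo)) => y; rewrite in_itv.
have cqx : q @ within `[0, l] (nbhs x) --> q x.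
  by have := @cq x; rewrite /continuous_at nbhs_subspace_in.
have h2 : nbhs x (fun y => `[0, l]%classic y -> `|q x - q y| < q x).
  by have /cvgrPdist_lt /(_ _ qx) := cqx.
apply: (@filterS2 _ _ _ _ _ _ _ hI h2) => y yl h; split => //.
have /h : `[0, l]%classic y by move: yl; rewrite /= in_itv /= => /andP[/ltW-> /ltW->].
by rewrite ltr_norml => /andP[_]; lra.
Qed.

Let OD : pos_part `<=` D.
Proof. by move=> x [/andP[/ltW a /ltW b] _]; rewrite /= in_itv /= a b. Qed.
Let mO : measurable (pos_part : set (measurableTypeR R)).
Proof. exact: open_measurable open_pos_part. Qed.

Lemma pos_part_lower (K : set R) : compact K -> K `<=` pos_part ->
  exists2 c : R, 0 < c & forall x, K x -> c <= q x.
Proof.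
move=> cK KO; have [->|/set0P K0] := eqVneq K set0; first by exists 1.
have cqK : {within K, continuous q} by apply: continuous_subspaceW cq; apply: subset_trans OD.
have [c /set_mem cK' H] := compact_EVT_min K0 cK cqK.
by exists (q c); [case: (KO _ cK')|move=> x /mem_set; exact: H].
Qed.

Let dn (n : nat) : R := n.+1%:R^-1.
Let dn0 n : 0 < dn n. Proof. by rewrite invr_gt0. Qed.
Let dn1 n : dn n <= 1. Proof. by rewrite invf_le1// ler1n. Qed.
Let dn_cvg : dn n @[n --> \oo] --> (0 : R). Proof. exact: cvg_harmonic. Qed.

Let reg_cvg x : pos_part x -> reg_log_sq (dn n) (q x) @[n --> \oo] --> ln (q x ^+ 2).
Proof. by move=> [_ qx]; apply: reg_log_cvg => //; exact: exprn_gt0. Qed.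
Let reg_le n x : pos_part x -> `|reg_log_sq (dn n) (q x)| <= `|ln (q x ^+ 2)|.
Proof.
move=> [_ qx]; have := reg_log_lip_ln (dn0 n) (dn1 n) (exprn_gt0 2 qx) ltr01.
by rewrite reg_log1 ln1 !subr0.
Qed.
Let reg'_cvg x : pos_part x -> reg_log_sq' (dn n) (q x) @[n --> \oo] --> 2 / q x.
Proof. by move=> [_ qx]; exact: reg_log_sq'_cvg. Qed.
Let reg'_le n x : pos_part x -> `|reg_log_sq' (dn n) (q x)| <= `|2 / q x|.
Proof.
move=> [_ qx]; rewrite (ger0_norm (_ : 0 <= 2 / q x)) ?divr_ge0 ?(ltW qx)//.
rewrite ler_pdivlMr//; have := reg_log_sq'_bound (dn0 n) (q x).
by rewrite normrM (gtr0_norm qx) mulrC.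
Qed.
Let mq : measurable_fun pos_part q.
Proof. by apply: measurable_funS (within_measurable cq). Qed.
Let mreg n : measurable_fun pos_part (fun x => reg_log_sq (dn n) (q x)).
Proof.
apply: measurableT_comp mq; apply: continuous_measurable_fun.
apply: (is_derive_continuous (f' := reg_log_sq' (dn n))) => z.
exact: reg_log_sq_derive.
Qed.
Let mreg' n : measurable_fun pos_part (fun x => reg_log_sq' (dn n) (q x)).
Proof.
apply: measurableT_comp mq; apply: continuous_measurable_fun.
exact: reg_log_sq'_continuous.
Qed.
Let mL : measurable_fun pos_part (fun x => ln (q x ^+ 2)).
Proof. exact: (measurable_fun_cvg (h := fun n x => reg_log_sq (dn n) (q x))). Qed.
Let mp : measurable_fun pos_part p.
Proof. by apply: measurable_funS (Rint_measurable iq.1). Qed.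
Let mg : measurable_fun pos_part (fun x => 2 / q x * p x).
Proof.
apply: measurable_funM => //.
exact: (measurable_fun_cvg (h := fun n x => reg_log_sq' (dn n) (q x))).
Qed.

Let compD (K : set R) : K `<=` pos_part -> compact K ->
  measurable (K : set (measurableTypeR R)) /\ (leb K < +oo)%E.
Proof.
move=> KO cK; have mK : measurable (K : set (measurableTypeR R)) by exact: compact_measurable.
split => //; apply: (@le_lt_trans _ _ (leb D)); last by rewrite leb_cc ?ltry// ltW.
by apply: le_measure; rewrite ?inE//; apply: subset_trans OD.
Qed.

Lemma locally_integrable_log : locally_integrable pos_part (fun x => ln (q x ^+ 2)).
Proof.
split => //; first exact: open_pos_part.
move=> K KO cK; have [mK Kfin] := compD KO cK.
have [c c0 cqK] := pos_part_lower cK KO.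
have [M M0 HM] := within_bounded (ltW l0) cq.
have ib : leb.-integrable K (EFin \o (fun x => ln (q x ^+ 2))).
  apply: (bounded_integrable (mu := leb) mK Kfin (K := `|ln (c ^+ 2)| + `|ln (M ^+ 2)|)).
    exact: measurable_funS mL.
  move=> x Kx; have cx := cqK x Kx; have [xl qx] := KO x Kx.
  have xM : q x <= M.
    by apply: le_trans (ler_norm _) (HM x _); case/andP: xl => /ltW-> /ltW->.
  have l1 : ln (c ^+ 2) <= ln (q x ^+ 2).
    by rewrite ler_ln ?posrE ?exprn_gt0// lerXn2r ?nnegrE ?(ltW c0) ?(ltW qx).
  have l2 : ln (q x ^+ 2) <= ln (M ^+ 2).
    rewrite ler_ln ?posrE ?exprn_gt0 ?(lt_le_trans qx)//.
    by rewrite lerXn2r ?nnegrE ?(ltW qx).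
  have := ler_norm (ln (M ^+ 2)); have := ler_norm (- ln (c ^+ 2)); rewrite normrN.
  have := normr_ge0 (ln (M ^+ 2)); have := normr_ge0 (ln (c ^+ 2)).
  by rewrite ler_norml => *; apply/andP; split; lra.
by case/integrableP: ib.
Qed.

Lemma locally_integrable_dlog : locally_integrable pos_part (fun x => 2 / q x * p x).
Proof.
split => //; first exact: open_pos_part.
move=> K KO cK; have [mK Kfin] := compD KO cK.
have [c c0 cqK] := pos_part_lower cK KO.
have ipK : leb.-integrable K (EFin \o p).
  by apply: (integrableS (mu := leb) mD mK _ iq.1); apply: subset_trans OD.
have ib : leb.-integrable K (EFin \o (fun x => 2 / q x * p x)).
  apply: (dom_integrable mK _ (RintZ (2 / c) mK (RintNorm mK ipK))).
    exact: measurable_funS mg.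
  move=> x Kx; have cx := cqK x Kx; have [xl qx] := KO x Kx.
  rewrite normrM ler_wpM2r// ger0_norm ?divr_ge0 ?(ltW qx)//.
  by rewrite ler_pM2l// lef_pV2.
by case/integrableP: ib.
Qed.

(** [reg_log_sq] composed with [q] satisfies the chain rule on the whole interval;
on compact subsets of [pos_part] the limit is dominated because [q] is bounded
below there. *)
Lemma log_weak_derivative (f : R -> R) : measurable_fun D f ->
  {ae leb, forall x, D x -> f x = ln (q x ^+ 2)} ->
  is_weak_derivative pos_part f (fun x => 2 / q x * p x).
Proof.
move=> mf fL; have lL := locally_integrable_log; have lg := locally_integrable_dlog.
have fLO : {ae leb, forall x, pos_part x -> f x = ln (q x ^+ 2)}.
  by apply: ae_imply fL => x H /OD; exact: H.
split => //.
  have [_ oO HL] := lL; split => //; first by apply: measurable_funS mf.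
  move=> K KO cK; have := HL K KO cK; congr (_ < _)%E; apply: ae_eq_lower_integral.
  by apply: ae_imply fLO => x H /KO /H ->.
move=> phi tphi; have [cphi cphi'] := test_continuous tphi.
have dphi := test_is_derive tphi.
have [_ [K [cK KO] K0]] := tphi.
have K0' := test_derive_eq0 cK K0.
have mphi' : measurable_fun pos_part (phi^`())%classic.
  by apply: measurable_funTS; exact: continuous_measurable_fun.
have mphi : measurable_fun pos_part phi.
  by apply: measurable_funTS; exact: continuous_measurable_fun.
have -> : \int[leb]_(x in pos_part) (f x * (phi^`())%classic x) =
    \int[leb]_(x in pos_part) (ln (q x ^+ 2) * (phi^`())%classic x).
  by apply: ae_eq_Rint => //; apply: ae_imply fLO => x H /H ->.
have OtoD (F psi : R -> R) : (forall x, ~ K x -> psi x = 0) ->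
    \int[leb]_(x in pos_part) (F x * psi x) = \int[leb]_(x in `[0, l]) (F x * psi x).
  move=> psi0; rewrite [LHS]Rintegral_mkcond [RHS]Rintegral_mkcond.
  apply: eq_Rintegral => x _; rewrite !patchE.
  have [xO|xO] := boolP (x \in pos_part); first by have /set_mem/OD/mem_set -> := xO.
  have nK : ~ K x by move=> /KO/mem_set; rewrite (negbTE xO).
  by rewrite psi0// mulr0; case: ifP.
have I1 := loc_int_test lL cphi' cK KO K0'.
have I2 := loc_int_test lg cphi cK KO K0.
have [_ c1] : leb.-integrable pos_part (EFin \o (fun x => ln (q x ^+ 2) * (phi^`())%classic x)) /\
   \int[leb]_(x in pos_part) (reg_log_sq (dn n) (q x) * (phi^`())%classic x) @[n --> \oo] -->
   \int[leb]_(x in pos_part) (ln (q x ^+ 2) * (phi^`())%classic x).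
  apply: (Rintegral_dct (mu := leb) mO _ _ _ (RintNorm mO I1)).
  - by move=> n; apply: measurable_funM; [exact: mreg|exact: mphi'].
  - by apply: measurable_funM; [exact: mL|exact: mphi'].
  - by apply: aeW => x Ox; apply: cvgM; [exact: reg_cvg|exact: cvg_cst].
  - by apply: aeW => x Ox n; rewrite !normrM ler_wpM2r// reg_le.
have [_ c2] : leb.-integrable pos_part (EFin \o (fun x => 2 / q x * p x * phi x)) /\
   \int[leb]_(x in pos_part) (reg_log_sq' (dn n) (q x) * p x * phi x) @[n --> \oo] -->
   \int[leb]_(x in pos_part) (2 / q x * p x * phi x).
  apply: (Rintegral_dct (mu := leb) mO _ _ _ (RintNorm mO I2)).
  - by move=> n; apply: measurable_funM; [apply: measurable_funM; [exact: mreg'|exact: mp]|exact: mphi].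
  - by apply: measurable_funM; [exact: mg|exact: mphi].
  - apply: aeW => x Ox; apply: cvgM; last exact: cvg_cst.
    by apply: cvgM; [exact: reg'_cvg|exact: cvg_cst].
  - by apply: aeW => x Ox n; rewrite !normrM ler_wpM2r// ler_wpM2r// -normrM reg'_le.
have E n : \int[leb]_(x in pos_part) (reg_log_sq (dn n) (q x) * (phi^`())%classic x) =
    - \int[leb]_(x in pos_part) (reg_log_sq' (dn n) (q x) * p x * phi x).
  rewrite OtoD// (OtoD (fun x => reg_log_sq' (dn n) (q x) * p x))//.
  have j : indef 0 l (reg_log_sq (dn n) \o q) (fun x => reg_log_sq' (dn n) (q x) * p x).
    apply: indef_comp => //; [exact: ltW|move=> z; exact: reg_log_sq_derive|].
    exact: reg_log_sq'_continuous.
  apply: (indef_test l0 j tphi).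
  by move=> x [xl _]; rewrite /= in_itv.
apply: (cvg_unique (@Rhausdorff R) c1).
by rewrite (funext E); apply: cvgN; exact: c2.
Qed.

End WeakDerivative.

(** * Densities on one edge *)

Local Open Scope charge_scope.

Section DensityUnique.
Context {R : realType}.
Local Notation T := (measurableTypeR R).
Variables (mu : {sigma_finite_measure set T -> \bar R})
          (nu : {finite_measure set T -> \bar R}).

Lemma mdensity_integral : nu `<< mu -> forall A, measurable A ->
  nu A = (\int[mu]_(x in A) (mdensity nu mu x)%:E)%E.
Proof.
move=> dom A mA.
have domc : charge_of_finite_measure nu `<< mu by exact: dom.
rewrite -[LHS]/(charge_of_finite_measure nu A) (Radon_Nikodym_integral domc mA).
apply: eq_integral => x _; rewrite /mdensity /density fineK//.
exact: Radon_Nikodym_fin_num.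
Qed.

Lemma mdensity_integrable : nu `<< mu -> mu.-integrable setT (EFin \o mdensity nu mu).
Proof.
move=> dom; have domc : charge_of_finite_measure nu `<< mu by exact: dom.
have -> : EFin \o mdensity nu mu = 'd (charge_of_finite_measure nu) '/d mu.
  by apply/funext => x; rewrite /= /mdensity /density fineK//; exact: Radon_Nikodym_fin_num.
exact: Radon_Nikodym_integrable.
Qed.

Lemma mdensity_ge0 : nu `<< mu -> {ae mu, forall x, 0 <= mdensity nu mu x}.
Proof.
move=> dom; have h0 := Radon_Nikodym_SigmaFinite.f_ge0 dom.
have := @ae_eq_Radon_Nikodym_SigmaFinite _ _ _ nu mu dom setT measurableT.
by apply: ae_imply => x /(_ I) E; rewrite /mdensity /density -E fine_ge0.
Qed.

Lemma mdensity_unique (g : T -> R) : measurable_fun (setT : set T) g -> (forall x, 0 <= g x) ->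
  (forall A, measurable A -> nu A = (\int[mu]_(x in A) (g x)%:E)%E) ->
  {ae mu, forall x, mdensity nu mu x = g x}.
Proof.
move=> mg g0 nuE; have dom := density_dominates mg nuE.
have : ae_eq mu setT (EFin \o mdensity nu mu) (EFin \o g).
  apply: integral_ae_eq => //.
  - exact: mdensity_integrable.
  - exact/measurable_EFinP.
  - by move=> A _ mA; rewrite -mdensity_integral// nuE.
by apply: ae_imply => x H; have [] := H I.
Qed.

Lemma mdensity_unique_on (D : set T) (g : T -> R) : measurable D -> measurable_fun D g ->
  (forall x, D x -> 0 <= g x) -> nu.-null_set (~` D) ->
  (forall A, measurable A -> A `<=` D -> nu A = (\int[mu]_(x in A) (g x)%:E)%E) ->
  {ae mu, forall x, D x -> mdensity nu mu x = g x}.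
Proof.
move=> mD mg g0 nuD nuE.
have H : {ae mu, forall x, mdensity nu mu x = (g \_ D) x}.
  apply: mdensity_unique.
  - exact: (measurable_restrictT _ mD).1.
  - by move=> x; rewrite patchE; case: ifPn => // /set_mem; exact: g0.
  - move=> A mA; rewrite (null_setI mD nuD mA) nuE//; last exact: measurableI.
    rewrite integral_mkcondr; apply: eq_integral => x _.
    by rewrite !patchE; case: ifP.
by apply: ae_imply H => x -> Dx; rewrite patchE mem_set.
Qed.

End DensityUnique.

Section WeightedEdge.
Context {R : realType}.
Local Notation T := (measurableTypeR R).
Local Notation leb := (@lebesgue_measure R).
Variable l : R.
Hypothesis l0 : 0 < l.
Local Notation D := (`[0, l]%classic : set T).
Variable P : R -> R.
Hypothesis P_lip : [lipschitz P x | x in `[0, l]].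
Variable pi : {finite_measure set T -> \bar R}.
Hypothesis piE : forall A, measurable A ->
  pi A = (\int[leb]_(x in A `&` D) (expR (- P x))%:E)%E.

Let mD : measurable D. Proof. exact: measurable_itv. Qed.
Local Notation w := (fun x => expR (- P x)).

Lemma P_continuous : {within `[0, l], continuous P}.
Proof.
have [M0 [_ HM]] := P_lip.
pose M := Num.max M0 0 + 1.
have M1 : 0 < M by rewrite ltr_wpDl// le_max lexx orbT.
have L x y : `[0, l]%classic x -> `[0, l]%classic y -> `|P x - P y| <= M * `|x - y|.
  move=> Dx Dy; have : M0 < M by rewrite ltr_pwDr// le_max lexx.
  by move=> /HM /(_ (x, y)); apply.
rewrite continuous_subspace_in => x /set_mem Dx.
suff : P @ within `[0, l] (nbhs x) --> P x by rewrite nbhs_subspace_in.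
apply/cvgrPdist_lt => e e0.
rewrite near_withinE; near=> y => Dy.
apply: (le_lt_trans (L _ _ Dx Dy)); rewrite -ltr_pdivlMl//.
near: y; exists (M^-1 * e) => /=; first by rewrite mulr_gt0// invr_gt0.
by move=> y; rewrite /= distrC distrC.
Unshelve. all: by end_near. Qed.

Lemma weight_continuous : {within `[0, l], continuous w}.
Proof.
move=> x.
have cP := P_continuous.
apply: (@continuous_comp (subspace `[0, l]) R R (fun x => - P x) expR); last exact: continuous_expR.
by apply: cvgN; exact: cP.
Qed.

Lemma weight_measurable : measurable_fun D w.
Proof. exact: within_measurable weight_continuous. Qed.

Lemma weight_bound : exists2 M : R, 0 < M & forall x, 0 <= x <= l -> expR (- P x) <= M.
Proof.
have [K K0 H] := within_bounded (ltW l0) weight_continuous.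
exists (K + 1); first by lra.
by move=> x xl; have := H x xl; rewrite ger0_norm ?expR_ge0//; lra.
Qed.

Lemma pi_supp : pi.-null_set (~` D).
Proof.
move=> A mA AD; rewrite piE// (_ : A `&` D = set0) ?integral_set0//.
by rewrite -subset0 => x [/AD].
Qed.

Lemma pi_on A : measurable A -> A `<=` D -> pi A = (\int[leb]_(x in A) (expR (- P x))%:E)%E.
Proof. by move=> mA AD; rewrite piE// (setIidl AD). Qed.

(** The weight is positive, so the two measures have the same null sets. *)
Lemma leb_pi_null A : measurable A -> A `<=` D -> leb A = 0 <-> pi A = 0.
Proof.
move=> mA AD; rewrite pi_on//.
have mw : measurable_fun A (fun x => (expR (- P x))%:E).
  by apply/measurable_EFinP; apply: measurable_funS weight_measurable.
split => [A0|I0]; first exact: null_set_integral.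
have : (\int[leb]_(x in A) `|(expR (- P x))%:E| = 0)%E.
  by rewrite -I0; apply: eq_integral => x _; rewrite gee0_abs// lee_fin expR_ge0.
move=> /(ae_eq_integral_abs leb mA mw) [N [mN N0 sN]].
apply/eqP; rewrite eq_le measure_ge0 andbT -N0; apply: le_measure; rewrite ?inE//.
move=> x Ax; apply: sN => /(_ Ax) /= [] /eqP; apply/negP.
by rewrite gt_eqF// expR_gt0.
Qed.

Lemma ae_leb_pi (Q : R -> Prop) : {ae leb, forall x, D x -> Q x} <-> {ae pi, forall x, D x -> Q x}.
Proof.
split => -[N [mN N0 sN]]; exists (N `&` D); split; try exact: measurableI.
- apply/leb_pi_null; [exact: measurableI|exact: subIsetr|].
  apply/eqP; rewrite eq_le measure_ge0 andbT -N0; apply: le_measure; rewrite ?inE//.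
  exact: measurableI.
- by move=> x /= h; split; [exact: sN|apply: contrapT => nD; apply: h => /nD].
- apply/leb_pi_null; [exact: measurableI|exact: subIsetr|].
  apply/eqP; rewrite eq_le measure_ge0 andbT -N0; apply: le_measure; rewrite ?inE//.
  exact: measurableI.
- by move=> x /= h; split; [exact: sN|apply: contrapT => nD; apply: h => /nD].
Qed.

Lemma cell_mass_pi_gt0 N i : (i < 2 ^ N)%N -> 0 < cell_mass l pi N i.
Proof.
move=> iN; rewrite lt_neqAle cell_mass_ge0 andbT eq_sym; apply/negP => /eqP w0.
have mC : measurable (cell l N i : set T) by exact: measurable_cell.
have : pi (cell l N i) = 0.
  by rewrite -(fineK (fin_num_measure pi _ mC)) -[fine _]/(cell_mass l pi N i) w0.
move/(leb_pi_null mC (@cell_sub _ l N i)).2.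
move=> c0; have := cell_mass_leb l0 iN; rewrite -[cell_mass _ _ _ _]/(fine (leb (cell l N i))) c0 /= => /esym/eqP.
by rewrite gt_eqF// divr_gt0// exprn_gt0.
Qed.

Lemma pi_Rint (E : set T) (f : R -> R) : measurable E -> E `<=` D -> pi.-integrable E (EFin \o f) ->
  \int[pi]_(x in E) f x = \int[leb]_(x in E) (f x * expR (- P x)).
Proof.
move=> mE ED; apply: (change_on_Rint mD weight_measurable _ pi_supp pi_on mE ED).
by move=> x _; exact: expR_ge0.
Qed.

Lemma pi_integrable (E : set T) (f : R -> R) : measurable E -> E `<=` D ->
  leb.-integrable E (EFin \o f) -> pi.-integrable E (EFin \o f).
Proof.
move=> mE ED fi; have mf := Rint_measurable fi.
have [M M0 HM] := weight_bound.
apply: (change_on_integrable mD weight_measurable _ pi_supp pi_on mE ED mf).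
  by move=> x _; exact: expR_ge0.
apply: (dom_integrable mE _ (RintZ M mE (RintNorm mE fi))).
  by apply: measurable_funM => //; apply: measurable_funS weight_measurable.
move=> x /ED Dx; rewrite normrM mulrC ler_wpM2r// ger0_norm ?expR_ge0// HM//.
Qed.

Lemma L2_pi f : L2 leb D f -> L2 pi D f.
Proof. by move=> [mf fi]; split => //; exact: pi_integrable. Qed.

Section Representation.
Variable rho : {finite_measure set T -> \bar R}.
Hypothesis rho_supp : rho.-null_set (~` D).

(** The relative density of [rho] is [q ^ 2] with [q] in H^1: the traces and weak
derivatives that occur in rate, slope and energy production are expressed through [q]
and [p] by the lemmas that follow. *)
Definition H1_density (q p : R -> R) := [/\ indef 0 l q p, L2 leb D p,
  (forall x, 0 <= x <= l -> 0 <= q x) &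
  forall A : set T, measurable A -> A `<=` D -> rho A = (\int[pi]_(x in A) (q x ^+ 2)%:E)%E].

Variables q p : R -> R.
Hypothesis H : H1_density q p.

Let cq : {within `[0, l], continuous q}.
Proof. by have [iq _ _ _] := H; exact: indef_continuous (ltW l0) iq. Qed.
Let mq2 : measurable_fun D (fun x => q x ^+ 2).
Proof. by apply: measurable_funX; exact: within_measurable. Qed.

Lemma H1_dominates : rho `<< pi.
Proof.
have [_ _ _ rE] := H; apply/null_content_dominatesP => A mA A0.
rewrite (null_setI mD rho_supp mA) rE//; last exact: measurableI.
apply: null_set_integral; first exact: measurableI.
  by apply/measurable_EFinP; apply: measurable_funS mq2.
apply/eqP; rewrite eq_le measure_ge0 andbT -A0; apply: le_measure; rewrite ?inE//.
exact: measurableI.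
Qed.

Lemma H1_rel_density : {ae leb, forall x, D x -> mdensity rho pi x = q x ^+ 2}.
Proof.
have [_ _ _ rE] := H; apply/ae_leb_pi; apply: mdensity_unique_on => // x _.
exact: sqr_ge0.
Qed.

Lemma H1_leb_density : {ae leb, forall x, D x -> mdensity rho leb x = q x ^+ 2 * expR (- P x)}.
Proof.
have [_ _ _ rE] := H; apply: mdensity_unique_on => //.
- by apply: measurable_funM => //; exact: weight_measurable.
- by move=> x _; rewrite mulr_ge0 ?sqr_ge0 ?expR_ge0.
- move=> A mA AD; rewrite rE//.
  apply: (change_on_ge0 mD weight_measurable _ pi_supp pi_on mA AD).
  + by move=> x _; exact: expR_ge0.
  + by apply: measurable_funS mq2.
  + by move=> x _; exact: sqr_ge0.
Qed.

Lemma H1_log_density_rep x : 0 <= x <= l ->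
  continuous_representative l (fun x => lne (mdensity rho pi x)%:E) x = lne (q x ^+ 2)%:E.
Proof.
apply: (cont_repE l0 (u := fun x => lne (q x ^+ 2)%:E)); first exact: ereal_hausdorff.
  by move=> y; apply: lne_cvg; [exact: sqr_ge0|apply: cvg_sqr; exact: cq].
by apply: ae_imply H1_rel_density => y Hy Dy; rewrite Hy.
Qed.

Lemma H1_leb_density_rep x : 0 <= x <= l ->
  continuous_representative l (mdensity rho leb) x = q x ^+ 2 * expR (- P x).
Proof.
apply: (cont_repE l0 (u := fun x => q x ^+ 2 * expR (- P x))); first exact: Rhausdorff.
  by move=> y; apply: cvgM; [apply: cvg_sqr; exact: cq|exact: weight_continuous].
by apply: ae_imply H1_leb_density => y Hy Dy; rewrite Hy.
Qed.

Lemma H1_sqrt_density_rep x : 0 <= x <= l ->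
  continuous_representative l (fun x => Num.sqrt (mdensity rho pi x)) x = q x.
Proof.
have [_ _ q0 _] := H.
apply: (cont_repE l0); [exact: Rhausdorff|exact: cq|].
apply: ae_imply H1_rel_density => y Hy Dy; rewrite Hy// sqrtr_sqr ger0_norm// q0//.
Qed.

(** The weak derivative of the logarithm is taken where its representative is finite,
which is [pos_part]; elsewhere it is 0 by convention. *)
Lemma H1_dlog_density : measurable_fun D (weak_derivative [set x | 0 < x < l /\
     continuous_representative l (fun x => lne (mdensity rho pi x)%:E) x != -oo%E]
    (fine \o (fun x => lne (mdensity rho pi x)%:E))) /\
  {ae leb, forall x, D x ->
  weak_derivative [set x | 0 < x < l /\
     continuous_representative l (fun x => lne (mdensity rho pi x)%:E) x != -oo%E]
    (fine \o (fun x => lne (mdensity rho pi x)%:E)) x =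
  if `[< 0 < x < l >] && (0 < q x) then 2 / q x * p x else 0}.
Proof.
have [iq _ q0 _] := H.
have -> : [set x | 0 < x < l /\
     continuous_representative l (fun x => lne (mdensity rho pi x)%:E) x != -oo%E] = pos_part l q.
  apply/seteqP; split => x [xl h]; split => //; move: h.
    have xl' : 0 <= x <= l by case/andP: xl => /ltW-> /ltW->.
    rewrite H1_log_density_rep// => h; rewrite lt_neqAle q0// andbT eq_sym.
    by apply/negP => /eqP qx; move: h; rewrite qx expr0n le0_lneNy.
  have xl' : 0 <= x <= l by case/andP: xl => /ltW-> /ltW->.
  by move=> qx; rewrite H1_log_density_rep// lne_EFin ?exprn_gt0.
set f := fine \o _.
have wd : is_weak_derivative (pos_part l q) f (fun x => 2 / q x * p x).
  apply: log_weak_derivative => //.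
  - apply: measurable_funTS; rewrite /f.
    have mr := Rint_measurable (mdensity_integrable H1_dominates).
    have -> : (fine \o (fun x => lne (mdensity rho pi x)%:E)) = (@ln R) \o mdensity rho pi.
      apply/funext => x; rewrite /comp; have [h|h] := leP (mdensity rho pi x) 0; last by rewrite lne_EFin.
      by rewrite le0_lneNy ?ln0// lee_fin.
    exact: measurableT_comp.
  - apply: ae_imply H1_rel_density => x Hx Dx; rewrite /f /comp Hx//.
    have := sqr_ge0 (q x); rewrite le_eqVlt => /orP[/eqP <-|h]; last by rewrite lne_EFin.
    by rewrite le0_lneNy//= ln0.
split; first by apply: measurable_funTS; exact: weak_derivative_measurable wd.
apply: ae_imply (weak_derivativeE wd) => x Hx Dx; case: ifPn.
  by move=> /andP[/asboolP h1 h2]; apply: Hx.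
move=> /negP h; rewrite /weak_derivative patchE memNset// => -[h1 h2]; apply: h.
by rewrite h2 andbT; apply/asboolP.
Qed.

End Representation.

Lemma pi_leb_density_rep x : 0 <= x <= l ->
  continuous_representative l (mdensity pi leb) x = expR (- P x).
Proof.
apply: (cont_repE l0 (u := fun x => expR (- P x))); first exact: Rhausdorff.
  exact: weight_continuous.
suff: {ae leb, forall x, D x -> mdensity pi leb x = expR (- P x)}.
  by apply: ae_imply => y Hy Dy; rewrite Hy.
by apply: mdensity_unique_on; [exact: mD|exact: weight_measurable|move=> y _; exact: expR_ge0|exact: pi_supp|exact: pi_on].
Qed.

Lemma H1_of_sqrt (rho : {finite_measure set T -> \bar R}) : rho.-null_set (~` D) ->
  rho `<< pi -> in_H1 l (fun x => Num.sqrt (mdensity rho pi x)) ->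
  exists q p, H1_density rho q p /\
    (\int[pi]_(x in D) (`|weak_derivative `]0%R, l[ (fun x => Num.sqrt (mdensity rho pi x)) x| ^+ 2)%:E
     = (\int[pi]_(x in D) (p x ^+ 2))%:E)%E.
Proof.
move=> rs dom [[mf sf] [g wg [mg sg]]].
set f := fun x => Num.sqrt _ in mf sf wg *.
have ooF : (leb `]0%R, l[ < +oo)%E by rewrite leb_oo ?ltry// ltW.
have mI : measurable (`]0, l[%classic : set T) by exact: measurable_itv.
have ig : leb.-integrable `]0, l[ (EFin \o g) by apply: (L2_integrable (mu := leb) mI ooF).
have [q [iq fq]] := H1_rep l0 wg (conj mf sf) ig.
have cq := indef_continuous (ltW l0) iq.
have ae2 (Q : R -> Prop) : {ae leb, forall x, `]0, l[%classic x -> Q x} -> {ae leb, forall x, D x -> Q x}.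
  have ae0l : {ae leb, forall x, x <> 0 /\ x <> l}.
    by apply: (ae_imply2 _ (ae_neq 0) (ae_neq l)) => x h1 h2.
  apply: (ae_imply2 _ ae0l) => x [n0 nl] HQ; rewrite /= in_itv /= => /andP[x0 xl]; apply: HQ.
  by rewrite /= in_itv /= !lt_neqAle x0 xl !andbT eq_sym; apply/andP; split; apply/eqP.
have fqD := ae2 _ fq.
have q0 x : 0 <= x <= l -> 0 <= q x.
  move=> xl; suff -> : q x = `|q x| by [].
  apply: (within_agree l0 (@Rhausdorff R) cq (v := fun x => `|q x|) _ _ xl).
    by move=> y; apply: cvg_norm; exact: cq.
  by apply: ae_imply fqD => y H Dy; rewrite -H// ger0_norm// sqrtr_ge0.
have Lg : L2 leb D g by split; [exact: measurable_oo_cc|exact: (integrable_oo_cc (f := fun x => g x ^+ 2))].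
exists q, g; split.
  split => // A mA AD; rewrite (mdensity_integral dom)//.
  apply: ae_eq_lower_integral.
  apply: (ae_imply2 _ ((ae_leb_pi _).1 fqD) (mdensity_ge0 dom)) => x H h0 /AD Dx.
  by rewrite -H// /f sqr_sqrtr.
rewrite EFin_Rint//; last by case: (L2_pi Lg).
apply: ae_eq_lower_integral; apply/ae_leb_pi; apply: ae2.
by apply: ae_imply (weak_derivativeE wg) => x H Ox; rewrite H// real_normK ?num_real.
Qed.

End WeightedEdge.

Local Close Scope charge_scope.

(** * Fluxes on one edge *)

Section EdgeFlux.
Context {R : realType}.
Local Notation T := (measurableTypeR R).
Local Notation leb := (@lebesgue_measure R).
Variable l : R.
Hypothesis l0 : 0 < l.
Local Notation D := (`[0, l]%classic : set T).
Variable P : R -> R.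
Hypothesis P_lip : [lipschitz P x | x in `[0, l]].
Variable pi : {finite_measure set T -> \bar R}.
Hypothesis piE : forall A, measurable A ->
  pi A = (\int[leb]_(x in A `&` D) (expR (- P x))%:E)%E.

Let mD : measurable D. Proof. exact: measurable_itv. Qed.
Let lebD : (leb D < +oo)%E. Proof. by rewrite leb_cc ?ltry// ltW. Qed.
Let mw := weight_measurable P_lip.
Let wpi := cell_mass_pi_gt0 l0 P_lip piE.

Lemma weight_lower : exists2 m : R, 0 < m & forall x, 0 <= x <= l -> m <= expR (- P x).
Proof.
have [K K0 H] := within_bounded (ltW l0) (P_continuous P_lip).
exists (expR (- K)); first exact: expR_gt0.
by move=> x xl; rewrite ler_expR lerN2 (le_trans (ler_norm _))// H.
Qed.

Lemma pi_L2_lower : exists2 C : R, 0 < C & forall p, L2 leb D p ->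
  \int[leb]_(x in D) (p x ^+ 2) <= C * \int[pi]_(x in D) (p x ^+ 2).
Proof.
have [m m0 hm] := weight_lower.
exists m^-1; first by rewrite invr_gt0.
move=> p Lp; have [_ ip] := L2_pi l0 P_lip piE Lp; have [_ ip'] := Lp.
rewrite (pi_Rint P_lip piE mD (@subset_refl _ D) ip) ler_pdivlMl// -RintegralZl//.
apply: le_Rintegral => //; first exact: RintZ.
  have [M M0 HM] := weight_bound l0 P_lip.
  apply: (dom_integrable mD _ (RintZ M mD ip')).
    by apply: measurable_funM => //; apply: measurable_funX; case: Lp.
  move=> x Dx; rewrite ger0_norm ?(mulr_ge0 (sqr_ge0 _) (expR_ge0 _))//.
  by rewrite [leLHS]mulrC; apply: (ler_wpM2r (sqr_ge0 (p x))); exact: HM.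
by move=> x Dx; rewrite [leLHS]mulrC; apply: (ler_wpM2l (sqr_ge0 (p x))); exact: hm.
Qed.

Section Flux.
Variable rho : {finite_measure set T -> \bar R}.
Hypothesis rho_supp : rho.-null_set (~` D).
Variables q p : R -> R.
Hypothesis H : H1_density l pi rho q p.
Variable j : {charge set T -> \bar R}.
Variable b : R -> R.
Hypothesis jb : has_density rho j b.
Hypothesis Lb : L2 rho D b.

Let iq : indef 0 l q p. Proof. by case: H. Qed.
Let Lp : L2 leb D p. Proof. by case: H. Qed.
Let q0 : forall x, 0 <= x <= l -> 0 <= q x. Proof. by case: H. Qed.
Let cq : {within `[0, l], continuous q}. Proof. exact: indef_continuous (ltW l0) iq. Qed.
Let mq : measurable_fun D q. Proof. exact: within_measurable. Qed.

(** The Lebesgue density of the flux is [b q ^ 2 e ^ (- P)]; one factor [q] is left to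
the test function, since only [q] times its derivative is bounded in L^2. *)
Definition flux_dens (x : R) : R := b x * q x * expR (- P x).

Let g x := q x ^+ 2 * expR (- P x).
Let mg : measurable_fun D g.
Proof. by apply: measurable_funM => //; exact: measurable_funX. Qed.
Let g0 x : D x -> 0 <= g x.
Proof. by move=> _; rewrite mulr_ge0 ?sqr_ge0 ?expR_ge0. Qed.
Let rhoE A : measurable A -> A `<=` D -> rho A = (\int[leb]_(x in A) (g x)%:E)%E.
Proof.
move=> mA AD; have [_ _ _ rE] := H; rewrite rE//.
apply: (change_on_ge0 mD mw _ (pi_supp piE) (pi_on piE) mA AD).
+ by move=> x _; exact: expR_ge0.
+ by apply: (measurable_funS mD) => //; exact: measurable_funX.
+ by move=> x _; exact: sqr_ge0.
Qed.

Let mb : measurable_fun D b. Proof. by case: Lb. Qed.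

Lemma flux_dens_measurable : measurable_fun D flux_dens.
Proof. by apply: measurable_funM => //; exact: measurable_funM. Qed.

Lemma flux_dens_L2 : L2 leb D flux_dens.
Proof.
split; first exact: flux_dens_measurable.
have [M M0 HM] := weight_bound l0 P_lip.
have ib := change_on_integrable_inv mD mg g0 rho_supp rhoE mD (@subset_refl _ D) Lb.2.
apply: (dom_integrable mD _ (RintZ M mD ib)).
  by apply: measurable_funX; exact: flux_dens_measurable.
move=> x Dx; rewrite ger0_norm ?sqr_ge0//.
have -> : flux_dens x ^+ 2 = expR (- P x) * (b x ^+ 2 * g x) by rewrite /flux_dens /g; ring.
by apply: ler_wpM2r; [rewrite mulr_ge0 ?sqr_ge0 ?g0|exact: HM].
Qed.

Lemma flux_dens_le M : (forall x, 0 <= x <= l -> expR (- P x) <= M) ->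
  \int[leb]_(x in D) (flux_dens x ^+ 2) <= M * \int[rho]_(x in D) (b x ^+ 2).
Proof.
move=> HM.
have ib := change_on_integrable_inv mD mg g0 rho_supp rhoE mD (@subset_refl _ D) Lb.2.
rewrite (change_on_Rint mD mg g0 rho_supp rhoE mD (@subset_refl _ D) Lb.2) -RintegralZl//.
apply: le_Rintegral => //; first by case: flux_dens_L2.
  exact: RintZ.
move=> x Dx.
have -> : flux_dens x ^+ 2 = expR (- P x) * (b x ^+ 2 * g x) by rewrite /flux_dens /g; ring.
by apply: ler_wpM2r; [rewrite mulr_ge0 ?sqr_ge0 ?g0|exact: HM].
Qed.

Lemma charge_flux (F : R -> R) : measurable_fun D F -> L2 leb D (fun x => F x * q x) ->
  charge_integral j D F = (\int[leb]_(x in D) (F x * q x * flux_dens x))%:E.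
Proof.
move=> mF LF.
have iF := L2_mul mD LF flux_dens_L2.
have E : (fun x => F x * q x * flux_dens x) = (fun x => F x * b x * g x).
  by apply/funext => x; rewrite /flux_dens /g; ring.
rewrite E in iF *.
have iFb := change_on_integrable mD mg g0 rho_supp rhoE mD (@subset_refl _ D) (measurable_funM mF mb) iF.
rewrite (charge_integralE jb mD mF iFb); congr EFin.
exact: (change_on_Rint mD mg g0 rho_supp rhoE mD (@subset_refl _ D) iFb).
Qed.

Lemma charge_flux_continuous (F : R -> R) : {within `[0, l], continuous F} ->
  charge_integral j D F = (\int[leb]_(x in D) (F x * q x * flux_dens x))%:E.
Proof.
move=> cF; apply: charge_flux; first exact: within_measurable.
have cFq : {within `[0, l], continuous (fun x => F x * q x)}.
  by move=> x; apply: cvgM; [exact: cF|exact: cq].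
split; first exact: within_measurable.
by apply: (within_integrable (q := fun x => (F x * q x) ^+ 2)) => x; apply: cvg_sqr; exact: cFq.
Qed.

(** The singular factor [2 / q] of the logarithmic derivative is cancelled by [q]. *)
Lemma charge_dlog : charge_integral j D
  (weak_derivative [set x | 0 < x < l /\
     continuous_representative l (fun x => lne (mdensity rho pi x)%:E) x != -oo%E]
    (fine \o (fun x => lne (mdensity rho pi x)%:E))) =
  (\int[leb]_(x in D) (2 * p x * flux_dens x))%:E.
Proof.
set W := weak_derivative _ _.
have [mW WE] := H1_dlog_density l0 P_lip piE rho_supp H; rewrite -/W in mW WE.
have LW : L2 leb D (fun x => W x * q x).
  have L2p := L2Z 2 mD Lp.
  have mWq : measurable_fun D (fun x => W x * q x) by exact: measurable_funM.
  pose V x := if `[< 0 < x < l >] && (0 < q x) then 2 * p x else 0.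
  have VE : {ae leb, forall x, D x -> W x * q x = V x}.
    apply: ae_imply WE => x HW Dx; rewrite HW// /V; case: ifPn => [/andP[_ qx]|_]; last by rewrite mul0r.
    by rewrite mulrAC divfK// gt_eqF.
  split => //; apply/integrableP; split; first by apply/measurable_EFinP; exact: measurable_funX.
  case/integrableP: L2p.2 => _; apply: le_lt_trans; apply: ae_ge0_le_lower_integral => //.
  apply: ae_imply VE => x HV Dx; rewrite HV// lee_fin /V !ger0_norm ?sqr_ge0//.
  by case: ifP => _ //; rewrite expr0n sqr_ge0.
rewrite charge_flux//; congr EFin; apply: ae_eq_Rint => //.
apply: (ae_imply2 _ WE (ae_imply2 (fun x h1 h2 => conj h1 h2) (ae_neq 0) (ae_neq l))) => x HW [n0 nl] Dx.
rewrite HW//; move: (Dx); rewrite /= in_itv /= => xl.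
have xo : 0 < x < l.
  case/andP: xl => x0 xl.
  by rewrite !lt_neqAle x0 xl !andbT eq_sym; apply/andP; split; apply/eqP.
rewrite asboolT//=; have := q0 xl; rewrite le_eqVlt => /orP[/eqP e|qx].
  by rewrite /flux_dens -e ltxx; ring.
by rewrite qx; congr (_ * _); rewrite mulrAC divfK// gt_eqF.
Qed.

Section Regularised.
Variables (G G' : R -> R) (K C : R).
Hypothesis dG : forall z : R, is_derive z 1 G (G' z).
Hypothesis cG' : continuous G'.
Hypothesis GK : forall z, `|G z| <= K.
Hypothesis C0 : 0 <= C.
Hypothesis GC : forall x y, 0 <= x -> 0 <= y -> ((G x - G y) * y) ^+ 2 <= C * (x - y) ^+ 2.

Let q0D : forall x, D x -> 0 <= q x. Proof. by move=> x; rewrite /= in_itv; exact: q0. Qed.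
Let rE A : measurable A -> A `<=` D -> rho A = (\int[pi]_(x in A) (q x ^+ 2)%:E)%E.
Proof. by case: H => _ _ _; exact. Qed.

Lemma charge_pou_cvg :
  fine (charge_integral j D (pou_comb' l rho pi G N)) @[N --> \oo] -->
  \int[leb]_(x in D) (G' (q x) * p x * q x * flux_dens x).
Proof.
have -> : (fun N => fine (charge_integral j D (pou_comb' l rho pi G N))) =
    (fun N => \int[leb]_(x in D) (pou_comb' l rho pi G N x * q x * flux_dens x)).
  apply/funext => N; rewrite charge_flux_continuous//.
  by apply: continuous_subspaceT => x; exact: pou_comb'_continuous.
apply: (pou_comb'_weak l0 wpi rho_supp iq Lp q0D rE dG cG' GK C0 GC).
exact: flux_dens_L2.
Qed.

Lemma charge_pou_le N B M : (forall x, 0 <= x <= l -> expR (- P x) <= M) -> 0 < B -> 0 <= M ->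
  (forall p, L2 leb D p -> \int[leb]_(x in D) (p x ^+ 2) <= B * \int[pi]_(x in D) (p x ^+ 2)) ->
  `|fine (charge_integral j D (pou_comb' l rho pi G N))| <=
  288 * (C + K ^+ 2) * B * \int[pi]_(x in D) (p x ^+ 2) + M * \int[rho]_(x in D) (b x ^+ 2).
Proof.
move=> HM B0 M0 HB; rewrite charge_flux_continuous/=; last first.
  by apply: continuous_subspaceT => x; exact: pou_comb'_continuous.
have LF := pou_comb'_L2 l0 rho pi iq G N.
have bF := pou_comb'_bound l0 wpi rho_supp iq Lp q0D rE GK C0 GC N.
have bb := flux_dens_le HM.
have [mF iF] := LF; have [mB iB] := flux_dens_L2.
apply: (@le_trans _ _ (\int[leb]_(x in D) ((pou_comb' l rho pi G N x * q x) ^+ 2 + flux_dens x ^+ 2))).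
  apply: le_Rint_norm => //; [exact: measurable_funM|exact: RintD|].
  move=> x _; rewrite ler_norml.
  have := sqr_ge0 (pou_comb' l rho pi G N x * q x - flux_dens x).
  have := sqr_ge0 (pou_comb' l rho pi G N x * q x + flux_dens x).
  move: (pou_comb' _ _ _ _ _ _ * _) (flux_dens x) => u v h1 h2.
  have h3 := sqr_ge0 u; have h4 := sqr_ge0 v.
  have e1 : (u + v) ^+ 2 = u ^+ 2 + 2 * (u * v) + v ^+ 2 by ring.
  have e2 : (u - v) ^+ 2 = u ^+ 2 - 2 * (u * v) + v ^+ 2 by ring.
  by apply/andP; split; lra.
rewrite RintegralD//; apply: lerD => //.
apply: (le_trans bF); rewrite -[leRHS]mulrA; apply: ler_wpM2l; last exact: HB.
by apply: mulr_ge0; [exact: ler0n|rewrite addr_ge0// sqr_ge0].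
Qed.

End Regularised.

Lemma flux_dens_eq0 x : q x = 0 -> flux_dens x = 0.
Proof. by rewrite /flux_dens => ->; ring. Qed.

Let q0x x : D x -> 0 <= q x. Proof. by rewrite /= in_itv; exact: q0. Qed.

Let mreg d (d0 : 0 < d) : measurable_fun D (fun x => reg_log_sq' d (q x) * p x * q x * flux_dens x).
Proof.
apply: measurable_funM; last exact: flux_dens_measurable.
apply: measurable_funM => //; apply: measurable_funM; last by case: Lp.
apply: measurableT_comp mq; apply: continuous_measurable_fun.
exact: reg_log_sq'_continuous.
Qed.

Let reg_le d x : 0 < d -> `|reg_log_sq' d (q x) * p x * q x * flux_dens x| <= `|2 * p x * flux_dens x|.
Proof.
move=> d0; have -> : reg_log_sq' d (q x) * p x * q x * flux_dens x =
  q x * reg_log_sq' d (q x) * (p x * flux_dens x) by ring.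
rewrite normrM -(mulrA 2) [leRHS]normrM; apply: ler_wpM2r => //.
by apply: (le_trans (reg_log_sq'_bound d0 (q x))); exact: ler_norm.
Qed.

Let i2p : leb.-integrable D (EFin \o (fun x => 2 * p x * flux_dens x)).
Proof. by apply: L2_mul => //; [exact: L2Z|exact: flux_dens_L2]. Qed.

(** [z * reg_log_sq' d z] is bounded by 2 and converges to 2 for [z > 0]; where
[q] vanishes so does [flux_dens]. *)
Lemma charge_reg_cvg (d_ : nat -> R) : (forall n, 0 < d_ n) -> d_ n @[n --> \oo] --> (0 : R) ->
  \int[leb]_(x in D) (reg_log_sq' (d_ n) (q x) * p x * q x * flux_dens x) @[n --> \oo] -->
  \int[leb]_(x in D) (2 * p x * flux_dens x).
Proof.
move=> d0 dc; apply: (Rintegral_dct (mu := leb) mD _ _ _ (RintNorm mD i2p) _).2.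
- by move=> n; exact: mreg.
- exact: Rint_measurable i2p.
- apply: aeW => x /q0x; rewrite le_eqVlt => /orP[/eqP e|qx].
    rewrite flux_dens_eq0// mulr0; under eq_fun do rewrite mulr0; exact: cvg_cst.
  apply: cvgM; last exact: cvg_cst.
  have -> : 2 * p x = 2 / q x * p x * q x by rewrite mulrAC divfK// gt_eqF.
  apply: cvgM; last exact: cvg_cst; apply: cvgM; last exact: cvg_cst.
  exact: reg_log_sq'_cvg.
- by apply: aeW => x _ n; exact: reg_le.
Qed.

Lemma charge_reg_le d B M : 0 < d -> (forall x, 0 <= x <= l -> expR (- P x) <= M) -> 0 < B -> 0 <= M ->
  (forall p, L2 leb D p -> \int[leb]_(x in D) (p x ^+ 2) <= B * \int[pi]_(x in D) (p x ^+ 2)) ->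
  `|\int[leb]_(x in D) (reg_log_sq' d (q x) * p x * q x * flux_dens x)| <=
  B * \int[pi]_(x in D) (p x ^+ 2) + M * \int[rho]_(x in D) (b x ^+ 2).
Proof.
move=> d0 HM B0 M0 HB; have bb := flux_dens_le HM.
have [mF iF] := Lp; have [mB iB] := flux_dens_L2.
apply: (@le_trans _ _ (\int[leb]_(x in D) (p x ^+ 2 + flux_dens x ^+ 2))).
  apply: le_Rint_norm => //; [exact: mreg|exact: RintD|].
  move=> x _; apply: (le_trans (reg_le x d0)); rewrite ler_norml.
  have := sqr_ge0 (p x - flux_dens x).
  have := sqr_ge0 (p x + flux_dens x).
  move: (p x) (flux_dens x) => u v h1 h2.
  have e1 : (u + v) ^+ 2 = u ^+ 2 + 2 * u * v + v ^+ 2 by ring.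
  have e2 : (u - v) ^+ 2 = u ^+ 2 - 2 * u * v + v ^+ 2 by ring.
  by apply/andP; split; lra.
by rewrite RintegralD//; apply: lerD => //; exact: HB.
Qed.
End Flux.
End EdgeFlux.

(** * The node terms *)

Section FiniteSums.
Context {R : realType} {I : finType}.

Lemma le_sum_term (P : pred I) (f : I -> \bar R) i : (forall i, P i -> 0 <= f i)%E -> P i ->
  (f i <= \sum_(i | P i) f i)%E.
Proof.
by move=> f0 Pi; rewrite (bigD1 i)//= leeDl//; apply: sume_ge0 => k /andP[/f0].
Qed.

End FiniteSums.

Section NodeBound.
Context {R : realType}.

Lemma cosh_persp_ge0 (J s : R) : (0 <= cosh_persp J s)%E.
Proof.
rewrite /cosh_persp; case: ifPn => s0; last by case: ifP => _ //; rewrite leey.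
by rewrite lee_fin mulr_ge0 ?cosh_cost_ge0// ltW.
Qed.

Lemma ln_sqr_half (u v : R) : 0 < u -> 0 < v -> (ln (u ^+ 2) - ln (v ^+ 2)) / 2 = ln (u / v).
Proof.
move=> u0 v0; rewrite ln_div ?posrE// !lnXn//.
by move: (ln u) (ln v) => a b; rewrite !mulr2n; field.
Qed.

Lemma norm_div_mul (s x J : R) : 0 < s -> `|x * J| = s * `|J / s * x|.
Proof.
move=> s0; have -> : x * J = s * (J / s * x) by field; rewrite gt_eqF.
by rewrite normrM (gtr0_norm s0).
Qed.

Variables (ga om ka w q J : R).
Hypothesis ga0 : 0 <= ga.
Hypothesis om0 : 0 < om.
Hypothesis ka0 : 0 < ka.
Hypothesis w0 : 0 < w.
Hypothesis q0 : 0 <= q.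
Local Notation s := (ka * Num.sqrt (ga * (q ^+ 2 * w))).

(** The perspective of a superlinear cost is infinite at a nonzero flux when the
mobility is 0. *)
Lemma cosh_persp_flux0 : (cosh_persp J s < +oo)%E -> ga * q = 0 -> J = 0.
Proof.
move=> H gq; move: H; rewrite /cosh_persp.
have -> : ga * (q ^+ 2 * w) = 0.
  have -> : ga * (q ^+ 2 * w) = ga * q * (q * w) by ring.
  by rewrite gq mul0r.
by rewrite sqrtr0 mulr0 ltxx; case: eqP.
Qed.

(** [cosh_young] at [x = ln (ga / om) - ln (q ^ 2)]: with [a ^ 2 = ga / om] the dual
cost times the mobility [s] is [2 ka sqrt (om w) (a - q) ^ 2], the node term of the
slope. Regularising the logarithms only shrinks their difference. *)
Lemma node_bound d : 0 < d -> d <= 1 -> (cosh_persp J s < +oo)%E ->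
  ((`|(reg_log d (ga / om) - reg_log d (q ^+ 2)) * J|)%:E <=
   cosh_persp J s + (2 * ka * Num.sqrt (om * w) * (q - Num.sqrt (ga / om)) ^+ 2)%:E)%E.
Proof.
move=> d0 d1 H.
have r0 : (0 <= (2 * ka * Num.sqrt (om * w) * (q - Num.sqrt (ga / om)) ^+ 2)%:E)%E.
  rewrite lee_fin; apply: mulr_ge0; last exact: sqr_ge0.
  apply: mulr_ge0; last exact: sqrtr_ge0.
  by apply: mulr_ge0 => //; exact: ltW.
have [gq|gq] := eqVneq (ga * q) 0.
  by rewrite (cosh_persp_flux0 H gq) mulr0 normr0 adde_ge0// cosh_persp_ge0.
move: gq; rewrite mulf_eq0 negb_or => /andP[gn qn].
have gp : 0 < ga by rewrite lt_neqAle eq_sym gn.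
have qp : 0 < q by rewrite lt_neqAle eq_sym qn.
set a := Num.sqrt (ga / om).
have a0 : 0 < a by rewrite sqrtr_gt0 divr_gt0.
have a2 : ga / om = a ^+ 2 by rewrite sqr_sqrtr// ltW// divr_gt0.
have sE : s = ka * Num.sqrt (om * w) * (a * q).
  have -> : ga * (q ^+ 2 * w) = (om * w) * (a * q) ^+ 2.
    by rewrite exprMn -a2; field; rewrite gt_eqF.
  rewrite sqrtrM ?mulr_ge0 ?(ltW om0) ?(ltW w0)// sqrtr_sqr ger0_norm ?mulrA//.
  by rewrite mulr_ge0// ltW.
have s0 : 0 < s by rewrite sE !mulr_gt0// sqrtr_gt0 mulr_gt0.
rewrite /cosh_persp s0 -EFinD lee_fin.
set x := ln (ga / om) - ln (q ^+ 2).
have xE : x / 2 = ln (a / q).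
  by rewrite /x a2 ln_sqr_half.
have := cosh_young (J / s) x; rewrite expRN xE lnK ?posrE ?divr_gt0// => hy.
have h1 : `|(reg_log d (ga / om) - reg_log d (q ^+ 2)) * J| <= `|x * J|.
  rewrite !normrM ler_wpM2r// reg_log_lip_ln//; first exact: divr_gt0.
  exact: exprn_gt0.
apply: (le_trans h1).
have -> : `|x * J| = s * `|J / s * x|.
  exact: norm_div_mul.
apply: (le_trans (ler_wpM2l (ltW s0) hy)); rewrite mulrDr lerD2l.
have {sE s0 hy h1 H r0 xE} -> : s = ka * Num.sqrt (om * w) * (a * q) by [].
move: (Num.sqrt (om * w)) => u; rewrite le_eqVlt; apply/orP; left; apply/eqP.
by clearbody a; field; rewrite !gt_eqF.
Qed.

End NodeBound.

(** * Finite dissipation at a fixed time *)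

Section FixedTime.
Context {R : realType} {G : metric_graph R}.
Local Notation T := (measurableTypeR R).
Local Notation leb := (@lebesgue_measure R).
Variables (ref : prob G) (P : edge G -> R -> R) (d : edge G -> R) (kappa : edge G -> node G -> R).
Hypothesis omega_gt0 : forall v, 0 < gam ref v.
Hypothesis P_lip : forall e, [lipschitz P e x | x in edge_itv e].
Hypothesis pi_density : forall e (A : set R), measurable A ->
  rho ref e A = (\int[leb]_(x in A `&` edge_itv e) (expR (- P e x))%:E)%E.
Hypothesis d_gt0 : forall e, 0 < d e.
Hypothesis kappa_gt0 : forall e v, v \in ends e -> 0 < kappa e v.

Let mE (e : edge G) : measurable (edge_itv e : set T). Proof. exact: measurable_itv. Qed.
Let l0 (e : edge G) : 0 < len e := len_gt0 e.

Lemma end_point_itv (e : edge G) v : 0 <= end_point e v <= len e.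
Proof. by rewrite /end_point; case: ifP => _; rewrite ?lexx/= ltW. Qed.

Lemma finite_bound (I : finType) (Q : I -> R -> Prop) :
  (forall i, exists2 C, 0 < C & Q i C) -> (forall i C C', Q i C -> C <= C' -> Q i C') ->
  exists2 C, 0 < C & forall i, Q i C.
Proof.
move=> H Qm; have /choice[C HC] : forall i, exists C, 0 < C /\ Q i C.
  by move=> i; have [C] := H i; exists C.
have S0 : 0 <= \sum_i C i by apply: sumr_ge0 => i _; apply: ltW; case: (HC i).
exists (1 + \sum_i C i); first by lra.
move=> i; apply: (Qm i (C i)); first by case: (HC i).
rewrite (bigD1 i)//= -[leLHS]addr0 addrCA; apply: lerD => //.
by rewrite addr_ge0//; apply: sumr_ge0 => k _; apply: ltW; case: (HC k).
Qed.

(** The consequences of finite dissipation that do not mention its value; they can be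
tested by countably many measurable functions of time ([ae_good]). *)
Record good (mu : prob G) (j : flux G) (q p b : edge G -> R -> R) : Prop := Good {
  good_H1 : forall e, H1_density (len e) (rho ref e) (rho mu e) (q e) (p e);
  good_density : forall e, has_density (rho mu e) (jint j e) (b e);
  good_L2 : forall e, L2 (rho mu e) (edge_itv e) (b e);
  good_node : forall e v, v \in ends e -> gam mu v * q e (end_point e v) = 0 -> jbar j e v = 0 }.

(** The quantitative consequences, all bounded by one number. *)
Record budget (mu : prob G) (j : flux G) (q p b : edge G -> R -> R) (X : R) : Prop := Budget {
  budget_flux : forall e, \int[rho mu e]_(x in edge_itv e) (b e x ^+ 2) <= X;
  budget_slope : forall e, \int[rho ref e]_(x in edge_itv e) (p e x ^+ 2) <= X;
  budget_node : forall e v dl, v \in ends e -> 0 < dl -> dl <= 1 ->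
    `|(reg_log dl (gam mu v / gam ref v) - reg_log dl (q e (end_point e v) ^+ 2)) * jbar j e v| <= X }.

Definition rate_node mu (j : flux G) e v := cosh_persp (jbar j e v)
         (kappa e v * Num.sqrt (gam mu v * trace e v (leb_density mu e)))%R.
Definition rate_edge (mu : prob G) (j : flux G) e := (((2 * d e)^-1)%:E
         * \int[rho mu e]_(x in edge_itv e)
             (`|density (jint j e) (rho mu e) x| ^+ 2)%:E)%E.
Definition slope_node mu e v := (2 * kappa e v
          * Num.sqrt (gam ref v * trace e v (leb_density ref e))
          * `|trace e v (sqrt_density ref mu e)
               - Num.sqrt (gam mu v / gam ref v)| ^+ 2)%:E.
Definition slope_edge mu e := ((2 * d e)%:E
         * \int[rho ref e]_(x in edge_itv e)
             (`|weak_derivative `]0%R, len e[ (sqrt_density ref mu e) x| ^+ 2)%:E)%E.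

Let rn0 mu j e v : (0 <= rate_node mu j e v)%E. Proof. exact: cosh_persp_ge0. Qed.
Let re0 mu j e : (0 <= rate_edge mu j e)%E.
Proof.
apply: mule_ge0; first by rewrite lee_fin invr_ge0 mulr_ge0// ltW.
by apply: integral_ge0 => x _; rewrite lee_fin exprn_ge0.
Qed.
Let sn0 mu e v : v \in ends e -> (0 <= slope_node mu e v)%E.
Proof.
move=> ve; rewrite lee_fin; apply: mulr_ge0; last exact: exprn_ge0.
by apply: mulr_ge0; [apply: mulr_ge0 => //; exact/ltW/kappa_gt0|exact: sqrtr_ge0].
Qed.
Let se0 mu e : (0 <= slope_edge mu e)%E.
Proof.
apply: mule_ge0; first by rewrite lee_fin mulr_ge0// ltW.
by apply: integral_ge0 => x _; rewrite lee_fin exprn_ge0.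
Qed.

Lemma rate_ge0 mu j : (0 <= rate d kappa mu j)%E.
Proof.
rewrite /rate; case: ifP => _; last by rewrite leey.
rewrite adde_ge0//; apply: sume_ge0 => e _; last exact: re0.
by apply: sume_ge0 => v _; exact: rn0.
Qed.

Lemma slope_ge0 mu : (0 <= slope ref d kappa mu)%E.
Proof.
rewrite /slope; case: ifP => _; last by rewrite leey.
rewrite adde_ge0//; apply: sume_ge0 => e _; last exact: se0.
by apply: sume_ge0 => v; exact: sn0.
Qed.


Lemma cost_terms mu j : (rate d kappa mu j + slope ref d kappa mu < +oo)%E ->
  [/\ (forall e, jint j e `<< rho mu e),
   (forall e, rho mu e `<< rho ref e /\ in_H1 (len e) (sqrt_density ref mu e)),
   (forall e v, v \in ends e ->
     (rate_node mu j e v + slope_node mu e v <= rate d kappa mu j + slope ref d kappa mu)%E),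
   (forall e, (rate_edge mu j e <= rate d kappa mu j + slope ref d kappa mu)%E) &
   (forall e, (slope_edge mu e <= rate d kappa mu j + slope ref d kappa mu)%E)].
Proof.
have r0 := rate_ge0 mu j; have s0 := slope_ge0 mu; move=> S.
have rF : (rate d kappa mu j < +oo)%E by apply: le_lt_trans S; rewrite leeDl.
have sF : (slope ref d kappa mu < +oo)%E by apply: le_lt_trans S; rewrite leeDr.
move: S r0 s0 rF sF; rewrite /rate /slope; case: ifPn => [/asboolP jr|_]; last by rewrite ltxx.
case: ifPn => [/asboolP rp|_]; last by rewrite ltxx.
rewrite -/(slope_node mu) -/(slope_edge mu).
set A := (\sum_e \sum_(v in ends e) cosh_persp _ _)%E.
set B := (\sum_e _ * _)%E; set C := (\sum_e \sum_(v in ends e) _%:E)%E; set F := (\sum_e _ * _)%E.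
move=> S _ _ _ _.
have A0 : (0 <= A)%E by do 2 (apply: sume_ge0 => ? _); exact: rn0.
have B0 : (0 <= B)%E by apply: sume_ge0 => ? _; exact: re0.
have C0 : (0 <= C)%E by apply: sume_ge0 => e _; apply: sume_ge0 => v; exact: sn0.
have F0 : (0 <= F)%E by apply: sume_ge0 => ? _; exact: se0.
split => //.
- move=> e v ve; apply: leeD.
    apply: (@le_trans _ _ A); last by rewrite leeDl.
    apply: (le_trans (le_sum_term (P := mem (ends e)) (f := rate_node mu j e) _ ve)) => //.
    apply: (le_sum_term (P := xpredT) (f := fun e => (\sum_(v in ends e) rate_node mu j e v)%E)) => // i _.
    by apply: sume_ge0 => ? _; exact: rn0.
  apply: (@le_trans _ _ C); last by rewrite leeDl.
  apply: (le_trans (le_sum_term (P := mem (ends e)) (f := slope_node mu e) _ ve)) => [?|]; first exact: sn0.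
  apply: (le_sum_term (P := xpredT) (f := fun e => (\sum_(v in ends e) slope_node mu e v)%E)) => // i _.
  by apply: sume_ge0 => ?; exact: sn0.
- move=> e; apply: (@le_trans _ _ (A + B)%E); last by rewrite leeDl// adde_ge0.
  apply: (@le_trans _ _ B); last by rewrite leeDr.
  exact: (le_sum_term (P := xpredT) (f := rate_edge mu j)).
- move=> e; apply: (@le_trans _ _ (C + F)%E); last by rewrite leeDr// adde_ge0.
  apply: (@le_trans _ _ F); last by rewrite leeDr.
  exact: (le_sum_term (P := xpredT) (f := slope_edge mu)).
Qed.

Lemma sqr_integral_bound (m : {finite_measure set T -> \bar R}) (D : set T) (f : R -> R) (c X : R) :
  measurable D -> measurable_fun D f -> 0 < c ->
  (c%:E * \int[m]_(x in D) (f x ^+ 2)%:E <= X%:E)%E ->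
  L2 m D f /\ \int[m]_(x in D) (f x ^+ 2) <= c^-1 * X.
Proof.
move=> mD mf c0 H.
have H' : (\int[m]_(x in D) (f x ^+ 2)%:E <= (c^-1 * X)%:E)%E.
  by rewrite EFinM lee_pdivlMl.
have Lf : L2 m D f.
  split => //; apply/integrableP; split; first by apply/measurable_EFinP; exact: measurable_funX.
  apply: (@le_lt_trans _ _ (c^-1 * X)%:E); last exact: ltry.
  apply: le_trans H'; apply: ge0_le_lower_integral => x _; first exact: abse_ge0.
  by rewrite gee0_abs// lee_fin sqr_ge0.
by split => //; rewrite -lee_fin EFin_Rint//; case: Lf.
Qed.

Lemma finite_good : exists2 C : R, 0 < C & forall mu j,
  (rate d kappa mu j + slope ref d kappa mu < +oo)%E ->
  exists q p b, good mu j q p b /\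
    budget mu j q p b (C * fine (rate d kappa mu j + slope ref d kappa mu)%E).
Proof.
have [C C0 HC] : exists2 C, 0 < C & forall e : edge G, 2 * d e <= C /\ (2 * d e)^-1 <= C.
  apply: (finite_bound (Q := fun e C => 2 * d e <= C /\ (2 * d e)^-1 <= C)).
    move=> e; have de : 0 < 2 * d e by rewrite mulr_gt0.
    exists (2 * d e + (2 * d e)^-1); first by rewrite addr_gt0// invr_gt0.
    by rewrite lerDl lerDr invr_ge0 !ltW.
  by move=> e C C' [h1 h2] h; split; [exact: le_trans h1 h|exact: le_trans h2 h].
exists (1 + C); first by lra.
(* All terms of rate and slope are nonnegative, hence each is below the total. *)
move=> mu j S; have [jr rp node redge sedge] := cost_terms S.
have r0 := rate_ge0 mu j; have s0 := slope_ge0 mu.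
set X := fine _; have XE : (rate d kappa mu j + slope ref d kappa mu)%E = X%:E.
  by rewrite /X fineK// ge0_fin_numE// adde_ge0.
have X0 : 0 <= X by rewrite -lee_fin -XE adde_ge0.
rewrite XE in node redge sedge.
have /choice[qp Hqp] : forall e, exists qp, H1_density (len e) (rho ref e) (rho mu e) qp.1 qp.2 /\
    \int[rho ref e]_(x in edge_itv e) (qp.2 x ^+ 2) <= C * X.
  move=> e; have [dom h1] := rp e.
  have [q [p [Hq pE]]] := H1_of_sqrt (l0 e) (P_lip e) (@pi_density e) (@rho_supp _ _ mu e) dom h1.
  exists (q, p); split => //=.
  have := sedge e; rewrite /slope_edge.
  have -> : (\int[rho ref e]_(x in edge_itv e)
      (`|weak_derivative `]0%R, len e[ (sqrt_density ref mu e) x| ^+ 2)%:E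
     = \int[rho ref e]_(x in edge_itv e) (p x ^+ 2)%:E)%E.
    rewrite [LHS]pE EFin_Rint//; have [_ Lp _ _] := Hq.
    by case: (L2_pi (l0 e) (P_lip e) (@pi_density e) Lp).
  have [_ Lp _ _] := Hq; have [mp _] := Lp.
  move=> /(sqr_integral_bound (mE e) mp (mulr_gt0 (ltr0n R 2) (d_gt0 e)))[_ h].
  by apply: (le_trans h); apply: ler_wpM2r => //; case: (HC e).
pose q e := (qp e).1; pose p e := (qp e).2.
have Hq e : H1_density (len e) (rho ref e) (rho mu e) (q e) (p e) by case: (Hqp e).
pose b e := density (jint j e) (rho mu e).
have jb e : has_density (rho mu e) (jint j e) (b e) by exact: charge_density.
have Hb e : L2 (rho mu e) (edge_itv e) (b e) /\ \int[rho mu e]_(x in edge_itv e) (b e x ^+ 2) <= C * X.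
  have [ib _] := jb e; have mb := measurable_funTS (Rint_measurable ib).
  have := redge e; rewrite /rate_edge.
  have -> : (\int[rho mu e]_(x in edge_itv e) (`|density (jint j e) (rho mu e) x| ^+ 2)%:E
     = \int[rho mu e]_(x in edge_itv e) (b e x ^+ 2)%:E)%E.
    by apply: eq_integral => x _; rewrite real_normK ?num_real.
  have c0 : 0 < (2 * d e)^-1 by rewrite invr_gt0 mulr_gt0.
  move=> /(sqr_integral_bound (mE e) (mb (edge_itv e)) c0)[Lb h]; split => //.
  by apply: (le_trans h); rewrite invrK; apply: ler_wpM2r => //; case: (HC e).
have CX : C * X <= (1 + C) * X by rewrite mulrDl mul1r lerDr.
have node' e v : v \in ends e ->
    (cosh_persp (jbar j e v) (kappa e v * Num.sqrt (gam mu v * (q e (end_point e v) ^+ 2 * expR (- P e (end_point e v))))) +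
     (2 * kappa e v * Num.sqrt (gam ref v * expR (- P e (end_point e v))) *
       (q e (end_point e v) - Num.sqrt (gam mu v / gam ref v)) ^+ 2)%:E <= X%:E)%E.
  move=> ve; have := node e v ve; rewrite /rate_node /slope_node /trace.
  have xe := end_point_itv e v.
  rewrite (H1_leb_density_rep (l0 e) (P_lip e) (@pi_density e) (@rho_supp _ _ mu e) (Hq e) xe).
  rewrite (pi_leb_density_rep (l0 e) (P_lip e) (@pi_density e) xe).
  rewrite (H1_sqrt_density_rep (l0 e) (P_lip e) (@pi_density e) (@rho_supp _ _ mu e) (Hq e) xe).
  by rewrite real_normK ?num_real.
have q0 e v : 0 <= q e (end_point e v).
  by have [_ _ h _] := Hq e; apply: h; exact: end_point_itv.
have cfin e v : v \in ends e -> (cosh_persp (jbar j e v) (kappa e v * Num.sqrt (gam mu v * (q e (end_point e v) ^+ 2 * expR (- P e (end_point e v))))) < +oo)%E.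
  move=> ve; apply: (@le_lt_trans _ _ X%:E); last exact: ltry.
  apply: le_trans (node' e v ve); rewrite leeDl// lee_fin; apply: mulr_ge0; last exact: sqr_ge0.
  by apply: mulr_ge0; [apply: mulr_ge0 => //; exact/ltW/kappa_gt0|exact: sqrtr_ge0].
exists q, p, b; split; split => //.
- by move=> e; case: (Hb e).
- move=> e v ve; apply: (cosh_persp_flux0 (cfin e v ve)).
- by move=> e; apply: le_trans CX; case: (Hb e).
- by move=> e; apply: le_trans CX; case: (Hqp e).
- move=> e v dl ve dl0 dl1; apply: (@le_trans _ _ X); last by rewrite mulrDl mul1r lerDl mulr_ge0// ltW.
  rewrite -lee_fin; apply: le_trans (node' e v ve).
  exact: (node_bound (gam_ge0 mu v) (omega_gt0 v) (kappa_gt0 ve) (expR_gt0 _) (q0 e v) dl0 dl1 (cfin e v ve)).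
Qed.

End FixedTime.

(** * Discrete, regularised and true energy production *)

Lemma cvg_sum_cond {R : realType} (T : Type) (F : set_system T) {FF : Filter F} (I : Type)
    (s : seq I) (Q : pred I) (f : I -> T -> R) (a : I -> R) :
  (forall i, Q i -> f i x @[x --> F] --> a i) ->
  \sum_(i <- s | Q i) f i x @[x --> F] --> \sum_(i <- s | Q i) a i.
Proof.
move=> fa; rewrite big_mkcond; under eq_fun do rewrite big_mkcond.
by apply: cvg_sumR => i; case: ifP => [/fa//|_]; exact: cvg_cst.
Qed.

Section Production.
Context {R : realType} {G : metric_graph R}.
Local Notation T := (measurableTypeR R).
Local Notation leb := (@lebesgue_measure R).
Variables (ref : prob G) (P : edge G -> R -> R).
Hypothesis omega_gt0 : forall v, 0 < gam ref v.
Hypothesis P_lip : forall e, [lipschitz P e x | x in edge_itv e].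
Hypothesis pi_density : forall e (A : set R), measurable A ->
  rho ref e A = (\int[leb]_(x in A `&` edge_itv e) (expR (- P e x))%:E)%E.

Let mE (e : edge G) : measurable (edge_itv e : set T). Proof. exact: measurable_itv. Qed.
Let l0 (e : edge G) : 0 < len e := len_gt0 e.
Let wpi e := cell_mass_pi_gt0 (l0 e) (P_lip e) (@pi_density e).

Definition node_test (dl : R) (mu : prob G) v := reg_log dl (gam mu v / gam ref v).
Definition edge_test dl N (mu : prob G) e := pou_comb (len e) (rho mu e) (rho ref e) (reg_log_sq dl) N.
Definition edge_test' dl N (mu : prob G) e := pou_comb' (len e) (rho mu e) (rho ref e) (reg_log_sq dl) N.

(** The coefficients are those of the derivative of the discrete entropy at [mu]: this
is the rate at which the flux changes [energy_disc]. *)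
Definition prod_disc dl N mu j :=
  flux_pairing (node_test dl mu) (edge_test dl N mu) (edge_test' dl N mu) j.

Definition prod_reg dl (mu : prob G) (j : flux G) (q p b : edge G -> R -> R) : R :=
  \sum_v \sum_(e in edges_at v)
    (reg_log dl (gam mu v / gam ref v) - reg_log dl (q e (end_point e v) ^+ 2)) * jbar j e v
  + \sum_e \int[leb]_(x in edge_itv e)
      (reg_log_sq' dl (q e x) * p e x * q e x * flux_dens (P e) (q e) (b e) x).

Definition prod_lim (mu : prob G) (j : flux G) (q p b : edge G -> R -> R) : R :=
  \sum_v \sum_(e in edges_at v)
    (ln (gam mu v / gam ref v) - ln (q e (end_point e v) ^+ 2)) * jbar j e v
  + \sum_e \int[leb]_(x in edge_itv e) (2 * p e x * flux_dens (P e) (q e) (b e) x).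

Definition jbar_norm (j : flux G) : R := \sum_v \sum_(e in edges_at v) `|jbar j e v|.

Section Good.
Variables (mu : prob G) (j : flux G) (q p b : edge G -> R -> R).
Hypothesis gd : good ref mu j q p b.
Let H := good_H1 gd.
Let jb := good_density gd.
Let Lb := good_L2 gd.
Let q0 e x : edge_itv e x -> 0 <= q e x.
Proof. by have [_ _ h _] := H e; rewrite /edge_itv /= in_itv; exact: h. Qed.
Let gr0 v : 0 <= gam mu v / gam ref v.
Proof. by rewrite divr_ge0 ?gam_ge0// ltW. Qed.
Let endD (e : edge G) v : edge_itv e (end_point e v).
Proof. by rewrite /edge_itv /= in_itv; exact: end_point_itv. Qed.

Lemma prod_disc_cvg dl : 0 < dl -> dl <= 1 ->
  prod_disc dl N mu j @[N --> \oo] --> prod_reg dl mu j q p b.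
Proof.
move=> d0 d1; apply: cvgD; [apply: cvg_sum_cond => v _|apply: cvg_sum_cond => e _]; last first.
  have dG z := reg_log_sq_derive d0 z.
  have K z := @reg_log_bound _ dl d0 d1 (z ^+ 2) (sqr_ge0 z).
  have C0 : 0 <= 16 * (1 + ln dl ^+ 2) by apply: mulr_ge0 => //; rewrite addr_ge0// sqr_ge0.
  exact: (charge_pou_cvg (l0 e) (P_lip e) (@pi_density e) (@rho_supp _ _ mu e) (H e) (jb e) (Lb e)
    dG (@reg_log_sq'_continuous _ dl d0) K C0 (fun x y h1 h2 => reg_log_sq_lip d0 d1 h1 h2)).
apply: cvg_sum_cond => e _; apply: cvgM; last exact: cvg_cst.
apply: cvgB; first exact: cvg_cst.
have [iq Lp _ rE] := H e.
rewrite -[reg_log dl _]/(reg_log_sq dl (q e (end_point e v))) /edge_test.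
exact: (pou_comb_cvg (l0 e) (wpi e) (@rho_supp _ _ mu e) iq Lp (@q0 e) rE (reg_log_sq_derive d0) (endD e v)).
Qed.

(** At the nodes, either the flux vanishes or both arguments of the logarithms are
positive. *)
Lemma prod_reg_cvg (d_ : nat -> R) : (forall n, 0 < d_ n) -> d_ n @[n --> \oo] --> (0 : R) ->
  prod_reg (d_ n) mu j q p b @[n --> \oo] --> prod_lim mu j q p b.
Proof.
move=> d0 dc; apply: cvgD; [apply: cvg_sum_cond => v _|apply: cvg_sum_cond => e _]; last first.
  exact: (charge_reg_cvg (l0 e) (P_lip e) (@pi_density e) (@rho_supp _ _ mu e) (H e) (Lb e) d0 dc).
apply: cvg_sum_cond => e; rewrite inE => ve.
have [->|J0] := eqVneq (jbar j e v) 0.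
  by rewrite mulr0; under eq_fun do rewrite mulr0; exact: cvg_cst.
have : gam mu v * q e (end_point e v) != 0.
  by apply: contra J0 => /eqP h; apply/eqP; exact: (good_node gd ve h).
rewrite mulf_eq0 negb_or => /andP[gn qn].
apply: cvgM; last exact: cvg_cst.
apply: cvgB; apply: reg_log_cvg => //.
  by rewrite divr_gt0// lt_neqAle eq_sym gn gam_ge0.
by rewrite exprn_gt0// lt_neqAle eq_sym qn q0.
Qed.

(** Where the mass of the node or the trace is 0 the jump of the logarithm may be
infinite, but there the node flux vanishes. *)
Lemma energy_productionE : energy_production ref mu j = (prod_lim mu j q p b)%:E.
Proof.
rewrite /energy_production /prod_lim EFinD -!sumEFin; congr (_ + _)%E; [apply: eq_bigr => v _|apply: eq_bigr => e _]; last first.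
  exact: (charge_dlog (l0 e) (P_lip e) (@pi_density e) (@rho_supp _ _ mu e) (H e) (jb e) (Lb e)).
rewrite -sumEFin; apply: eq_bigr => e; rewrite inE => ve.
have [->|J0] := eqVneq (jbar j e v) 0; first by rewrite mule0 mulr0.
have : gam mu v * q e (end_point e v) != 0.
  by apply: contra J0 => /eqP h; apply/eqP; exact: (good_node gd ve h).
rewrite mulf_eq0 negb_or => /andP[gn qn].
rewrite /log_jump /trace.
rewrite (H1_log_density_rep (l0 e) (P_lip e) (@pi_density e) (@rho_supp _ _ mu e) (H e) (end_point_itv e v)).
rewrite !lne_EFin//.
  by rewrite exprn_gt0// lt_neqAle eq_sym qn q0.
by rewrite divr_gt0// lt_neqAle eq_sym gn gam_ge0.
Qed.

End Good.

Lemma unif_consts : exists2 M : R, 0 < M & forall e : edge G,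
  (forall x, 0 <= x <= len e -> expR (- P e x) <= M) /\
  (forall p, L2 leb (edge_itv e) p ->
    \int[leb]_(x in edge_itv e) (p x ^+ 2) <= M * \int[rho ref e]_(x in edge_itv e) (p x ^+ 2)).
Proof.
apply: (finite_bound (Q := fun e M => (forall x, 0 <= x <= len e -> expR (- P e x) <= M) /\
  (forall p, L2 leb (edge_itv e) p ->
    \int[leb]_(x in edge_itv e) (p x ^+ 2) <= M * \int[rho ref e]_(x in edge_itv e) (p x ^+ 2)))).
  move=> e; have [M M0 HM] := weight_bound (l0 e) (P_lip e).
  have [B B0 HB] := pi_L2_lower (l0 e) (P_lip e) (@pi_density e).
  exists (M + B); first exact: addr_gt0.
  split=> [x xl|p Lp]; first by apply: (le_trans (HM x xl)); rewrite lerDl ltW.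
  apply: (le_trans (HB p Lp)); apply: ler_wpM2r; last by rewrite lerDr ltW.
  by apply: Rintegral_ge0 => x _; exact: sqr_ge0.
move=> e C C' [h1 h2] CC; split=> [x xl|p Lp]; first by apply: le_trans (h1 x xl) CC.
apply: (le_trans (h2 p Lp)); apply: ler_wpM2r => //.
by apply: Rintegral_ge0 => x _; exact: sqr_ge0.
Qed.

Lemma prod_reg_le : exists2 C : R, 0 < C & forall mu j q p b X dl,
  good ref mu j q p b -> budget ref mu j q p b X -> 0 <= X -> 0 < dl -> dl <= 1 ->
  `|prod_reg dl mu j q p b| <= C * X.
Proof.
have [M M0 HM] := unif_consts.
pose C1 : R := \sum_(v : node G) \sum_(e in edges_at v) 1.
pose C2 : R := \sum_(e : edge G) (M + M).
exists (1 + C1 + C2).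
  have h1 : 0 <= C1 by do 2 (apply: sumr_ge0 => ? _).
  by have h2 : 0 <= C2 by [apply: sumr_ge0 => ? _; lra]; lra.
move=> mu j q p b X dl gd bd X0 d0 d1.
have -> : (1 + C1 + C2) * X = X + (C1 * X + C2 * X) by ring.
rewrite -[leLHS]add0r; apply: lerD => //.
apply: (le_trans (ler_normD _ _)); apply: lerD.
  rewrite /C1 mulr_suml; apply: (le_trans (ler_norm_sum _ _ _)); apply: ler_sum => v _.
  rewrite mulr_suml; apply: (le_trans (ler_norm_sum _ _ _)); apply: ler_sum => e; rewrite inE => ve.
  by rewrite mul1r; apply: (budget_node bd).
rewrite /C2 mulr_suml; apply: (le_trans (ler_norm_sum _ _ _)); apply: ler_sum => e _.
have [h1 h2] := HM e.
apply: (le_trans (charge_reg_le (l0 e) (P_lip e) (@pi_density e) (@rho_supp _ _ mu e) (good_H1 gd e) (good_L2 gd e) d0 h1 M0 (ltW M0) h2)).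
by rewrite mulrDl; apply: lerD; apply: ler_wpM2l; rewrite ?(ltW M0)//; [exact: budget_slope bd e|exact: budget_flux bd e].
Qed.

(** The node part is estimated by the bound on [reg_log]; the constant explodes as
[dl] tends to 0, but the node fluxes are integrable in time, so this bound serves for
the limit in [N]. For the limit in [dl] there is [prod_reg_le]. *)
Lemma prod_disc_le dl : 0 < dl -> dl <= 1 -> exists2 C : R, 0 < C & forall mu j q p b X N,
  good ref mu j q p b -> budget ref mu j q p b X -> 0 <= X ->
  `|prod_disc dl N mu j| <= C * X + 2 * (- ln dl) * jbar_norm j.
Proof.
move=> d0 d1; have [M M0 HM] := unif_consts.
have L0 : 0 <= - ln dl by rewrite oppr_ge0 ln_le0.
pose C0 := 288 * (16 * (1 + ln dl ^+ 2) + (- ln dl) ^+ 2) * M + M.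
have h0 : 0 <= 16 * (1 + ln dl ^+ 2) by apply: mulr_ge0 => //; rewrite addr_ge0// sqr_ge0.
have C00 : 0 <= C0.
  apply: addr_ge0; last exact: ltW.
  apply: mulr_ge0; last exact: ltW.
  by apply: mulr_ge0; [exact: ler0n|rewrite addr_ge0// sqr_ge0].
exists (1 + \sum_(e : edge G) C0).
  by have h2 : 0 <= \sum_(e : edge G) C0 by [apply: sumr_ge0 => ? _]; lra.
move=> mu j q p b X N gd bd X0.
have K z := @reg_log_bound _ dl d0 d1 (z ^+ 2) (sqr_ge0 z).
apply: (le_trans (ler_normD _ _)); rewrite addrC; apply: lerD.
  rewrite mulrDl mul1r -[leLHS]add0r; apply: lerD => //.
  rewrite mulr_suml; apply: (le_trans (ler_norm_sum _ _ _)); apply: ler_sum => e _.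
  have [h1 h2] := HM e.
  apply: (le_trans (charge_pou_le (l0 e) (P_lip e) (@pi_density e) (@rho_supp _ _ mu e) (good_H1 gd e)
    (good_density gd e) (good_L2 gd e) K h0 (fun x y a1 a2 => reg_log_sq_lip d0 d1 a1 a2) N h1 M0 (ltW M0) h2)).
  rewrite /C0 [leRHS]mulrDl; apply: lerD; apply: ler_wpM2l; [|exact: budget_slope bd e|exact: ltW|exact: budget_flux bd e].
  apply: mulr_ge0; last exact: ltW.
  by apply: mulr_ge0; [exact: ler0n|rewrite addr_ge0// sqr_ge0].
rewrite /jbar_norm mulr_sumr; apply: (le_trans (ler_norm_sum _ _ _)); apply: ler_sum => v _.
rewrite mulr_sumr; apply: (le_trans (ler_norm_sum _ _ _)); apply: ler_sum => e _.
rewrite normrM; apply: ler_wpM2r => //; apply: (le_trans (ler_normB _ _)).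
have g0 : 0 <= gam mu v / gam ref v by rewrite divr_ge0 ?gam_ge0// ltW.
have a1 := reg_log_bound d0 d1 g0.
have a2 : `|edge_test dl N mu e (end_point e v)| <= - ln dl.
  by apply: (pou_comb_le (l0 e) (rho mu e) (rho ref e) K); rewrite /= in_itv; exact: end_point_itv.
by rewrite mulr_natl mulr2n; exact: lerD.
Qed.


End Production.

(** * Discrete and regularised energy on one edge *)

Section EtaBounds.
Context {R : realType}.

Lemma eta_le_sqr (r : R) : 0 <= r -> eta r <= (r - 1) ^+ 2.
Proof.
rewrite /eta le_eqVlt => /orP[/eqP <-|r0]; first by rewrite mul0r; lra.
have := ler_wpM2l (ltW r0) (ln_le_sub1 r0).
move: (ln r) => a; rewrite expr2; nra.
Qed.

Lemma reg_eta_growth (dl r : R) : 0 < dl -> dl <= 1 -> 0 <= r -> reg_eta dl r <= (- ln dl) * (1 + r).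
Proof.
move=> d0 d1 r0; have := reg_eta_tangent d0 d1 ler01 r0.
rewrite reg_eta1 => h; have := reg_log_bound d0 d1 r0; rewrite ler_norml => /andP[h1 h2].
by move: h h1 h2; move: (reg_eta _ _) (reg_log _ _) (ln _) => a c k; nra.
Qed.

Lemma eta_measurable : measurable_fun setT (@eta R).
Proof.
apply: measurable_funD; last exact: measurable_cst.
apply: measurable_funB; last exact: measurable_id.
by apply: measurable_funM; [exact: measurable_id|exact: measurable_ln].
Qed.

End EtaBounds.

Section EdgeEnergy.
Context {R : realType}.
Local Notation T := (measurableTypeR R).
Local Notation leb := (@lebesgue_measure R).
Variable l : R.
Hypothesis l0 : 0 < l.
Local Notation D := (`[0, l]%classic : set T).
Variables (rho pi : {finite_measure set T -> \bar R}).
Hypothesis wpi : forall N i, (i < 2 ^ N)%N -> 0 < cell_mass l pi N i.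
Hypothesis rho_supp : rho.-null_set (~` D).

Let mD : measurable D. Proof. exact: measurable_itv. Qed.
Let piD : (pi D < +oo)%E. Proof. by rewrite -ge0_fin_numE// fin_num_measure. Qed.

Definition edge_energy_disc dl N : R :=
  \sum_(i < (2 ^ N)%N.+1) pou_mass l pi N i * reg_eta dl (pou_mass l rho N i / pou_mass l pi N i).

Let w0 N i : 0 <= pou_mass l pi N i. Proof. exact: pou_mass_ge0. Qed.
Let wr0 N i : 0 <= pou_mass l rho N i. Proof. exact: pou_mass_ge0. Qed.

Section Limit.
Variables (q p : R -> R).
Hypothesis iq : indef 0 l q p.
Hypothesis Lp : L2 leb D p.
Hypothesis q0 : forall x, D x -> 0 <= q x.
Hypothesis rhoE : forall A : set T, measurable A -> A `<=` D ->
  rho A = (\int[pi]_(x in A) (q x ^+ 2)%:E)%E.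

Let cq := indef_continuous (ltW l0) iq.

Lemma reg_eta_sq_derive dl (z : R) : 0 < dl -> dl <= 1 ->
  is_derive z 1 (fun z => reg_eta dl (z ^+ 2)) (2 * z * reg_log dl (z ^+ 2)).
Proof.
move=> d0 d1; have h := reg_eta_derive d0 (sqr_ge0 z).
have hX : is_derive z 1 (fun z : R => z ^+ 2) (2 * z).
  by apply: is_derive_eq; rewrite /GRing.scale /=; ring.
by rewrite [2 * z * _]mulrC; exact: (is_derive1_comp (f := reg_eta dl) (g := fun z : R => z ^+ 2)).
Qed.

Lemma q_bounded : exists2 Q : R, 0 < Q & forall x, D x -> q x ^+ 2 <= Q.
Proof.
have cq2 : {within `[0, l], continuous (fun x => q x ^+ 2)} by move=> x; apply: cvg_sqr; exact: cq.
have [K K0 H] := within_bounded (ltW l0) cq2.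
exists (K + 1); first by lra.
move=> x; rewrite /= in_itv => xl; have := H x xl.
by rewrite ger0_norm ?sqr_ge0//; lra.
Qed.

Lemma avg_sqr_le Q : 0 < Q -> (forall x, D x -> q x ^+ 2 <= Q) -> forall N i, (i < (2 ^ N)%N.+1)%N ->
  pou_mass l rho N i / pou_mass l pi N i <= Q.
Proof.
move=> Q0 HQ N i iN; rewrite ler_pdivrMr ?(pou_mass_gt0 l0 wpi)//.
rewrite (pou_mass_rho l0 rho_supp iq rhoE) -RintegralZl//; last exact: pou_integrable.
have iz := RintZ Q mD (pou_integrable l pi N i).
have mq2 : measurable_fun D (fun x => q x ^+ 2).
  by apply: measurable_funX; exact: within_measurable.
apply: le_Rintegral => //.
  apply: (dom_integrable mD _ iz).
    by apply: measurable_funM => //; apply: measurable_funTS; exact: pou_measurable.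
  move=> x Dx; rewrite ger0_norm; last by rewrite mulr_ge0 ?pou_ge0// sqr_ge0.
  by rewrite mulrC; apply: ler_wpM2r; [exact: pou_ge0|exact: HQ].
by move=> x Dx; rewrite mulrC; apply: ler_wpM2r; [exact: pou_ge0|exact: HQ].
Qed.

(** The discrete energy is the integral of the hat combination with values
[reg_eta dl] at the averages. *)
Lemma edge_energy_disc_cvg dl : 0 < dl -> dl <= 1 ->
  edge_energy_disc dl N @[N --> \oo] --> \int[pi]_(x in D) reg_eta dl (q x ^+ 2).
Proof.
move=> d0 d1; pose g z := reg_eta dl (z ^+ 2).
have dg z := @reg_eta_sq_derive dl z d0 d1.
have [Q Q0 HQ] := q_bounded.
have EE N : edge_energy_disc dl N = \int[pi]_(x in D) pou_comb l rho pi g N x.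
  have [_ ->] := Rint_sum (mu := pi) (index_enum _) mD (fun i : 'I_(2 ^ N).+1 => RintZ (g (avg_sqrt l rho pi N i)) mD (pou_integrable l pi N i)).
  apply: eq_bigr => i _; rewrite RintegralZl//; last exact: pou_integrable.
  rewrite mulrC; congr (_ * _); rewrite /g /avg_sqrt sqr_sqrtr// divr_ge0//.
under eq_fun do rewrite EE.
have cg : continuous g.
  by move=> z; apply: differentiable_continuous; apply/derivable1_diffP; case: (dg z).
apply: (Rintegral_dct (mu := pi) (g := cst ((- ln dl) * (1 + Q))) mD _ _ _ _ _).2.
- move=> N; apply: measurable_funTS; apply: continuous_measurable_fun.
  exact: (is_derive_continuous (pou_comb_derive l rho pi g N)).
- apply: (within_measurable (q := fun x => g (q x))) => x.
  by apply: (@continuous_comp (subspace `[0, l]) R R q g); [exact: cq|exact: cg].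
- apply: aeW => x Dx.
  exact: (pou_comb_cvg (G := g) l0 wpi rho_supp iq Lp q0 rhoE dg Dx).
- by apply: (bounded_integrable (mu := pi) (K := `|(- ln dl) * (1 + Q)|)) => //; exact: measurable_cst.
- apply: aeW => x Dx N; apply: (le_trans (ler_norm_sum _ _ _)).
  rewrite -[leRHS]mulr1 -[X in _ <= _ * X](pou_sum l0 N Dx) mulr_sumr; apply: ler_sum => i _.
  rewrite normrM (ger0_norm (pou_ge0 _ _ _ _)); apply: ler_wpM2r; first exact: pou_ge0.
  have a0 : 0 <= pou_mass l rho N i / pou_mass l pi N i by rewrite divr_ge0.
  rewrite /g /avg_sqrt sqr_sqrtr// ger0_norm ?reg_eta_ge0//.
  apply: (le_trans (reg_eta_growth d0 d1 a0)); apply: ler_wpM2l.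
    by rewrite oppr_ge0 ln_le0.
  by rewrite lerD2l; exact: avg_sqr_le.
Qed.

Lemma edge_energy_reg_cvg (d_ : nat -> R) : (forall n, 0 < d_ n) -> (forall n, d_ n <= 1) ->
  d_ n @[n --> \oo] --> (0 : R) ->
  pi.-integrable D (EFin \o (fun x => eta (q x ^+ 2))) /\
  \int[pi]_(x in D) reg_eta (d_ n) (q x ^+ 2) @[n --> \oo] --> \int[pi]_(x in D) eta (q x ^+ 2).
Proof.
move=> d0 d1 dc; have [Q Q0 HQ] := q_bounded.
have eb x : D x -> `|eta (q x ^+ 2)| <= (Q + 1) ^+ 2.
  move=> Dx; rewrite ger0_norm ?eta_ge0//; apply: (le_trans (eta_le_sqr (sqr_ge0 _))).
  have := HQ x Dx; have := sqr_ge0 (q x); move: (q x ^+ 2) => u u0 uQ.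
  rewrite -[leLHS]real_normK ?num_real//; apply: lerXn2r; rewrite ?nnegrE//; first by lra.
  by rewrite ler_norml; apply/andP; split; lra.
apply: (Rintegral_dct (mu := pi) (g := cst ((Q + 1) ^+ 2)) mD).
- move=> n; have cg : continuous (fun z : R => reg_eta (d_ n) (z ^+ 2)).
    by move=> z; apply: differentiable_continuous; apply/derivable1_diffP; case: (@reg_eta_sq_derive (d_ n) z (d0 n) (d1 n)).
  apply: (within_measurable (q := fun x => reg_eta (d_ n) (q x ^+ 2))) => x.
  by apply: (@continuous_comp (subspace `[0, l]) R R q (fun z : R => reg_eta (d_ n) (z ^+ 2))); [exact: cq|exact: cg].
- apply: measurableT_comp; first exact: eta_measurable.
  by apply: measurable_funX; exact: within_measurable.
- by apply: aeW => x Dx; apply: reg_eta_cvg => //; exact: sqr_ge0.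
- by apply: (bounded_integrable (mu := pi) (K := `|(Q + 1) ^+ 2|)) => //; exact: measurable_cst.
- apply: aeW => x Dx n; rewrite ger0_norm ?(reg_eta_ge0 (d0 n) (d1 n) (sqr_ge0 _))//.
  apply: le_trans (eb x Dx); apply: le_trans (ler_norm _).
  by apply: reg_eta_le => //; exact: sqr_ge0.
Qed.

End Limit.

(** Jensen's inequality for each hat, proved with the tangent of [reg_eta] at the
average; the hats sum to 1. *)
Lemma edge_jensen (u : T -> R) dl N : 0 < dl -> dl <= 1 ->
  measurable_fun D u -> (forall x, D x -> 0 <= u x) ->
  (forall A : set T, measurable A -> A `<=` D -> rho A = (\int[pi]_(x in A) (u x)%:E)%E) ->
  pi.-integrable D (EFin \o (fun x => eta (u x))) ->
  edge_energy_disc dl N <= \int[pi]_(x in D) eta (u x).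
Proof.
move=> d0 d1 mu u0 rhoE ie.
pose U i := pou_mass l rho N i / pou_mass l pi N i.
have U0 i : 0 <= U i by rewrite divr_ge0.
pose c i := reg_log dl (U i); pose a i := reg_eta dl (U i) - c i * U i.
have iu i : pi.-integrable D (EFin \o (fun x => pou l N i x * u x)).
  exact: (change_on_integrable_inv mD mu u0 rho_supp rhoE mD (@subset_refl _ D) (pou_integrable l rho N i)).
have uE i : \int[pi]_(x in D) (pou l N i x * u x) = pou_mass l rho N i.
  by rewrite -(change_on_Rint mD mu u0 rho_supp rhoE mD (@subset_refl _ D) (pou_integrable l rho N i)).
pose F (i : 'I_(2 ^ N).+1) x := a i * pou l N i x + c i * (pou l N i x * u x).
have iF i : pi.-integrable D (EFin \o F i).
  by apply: RintD => //; apply: RintZ => //; exact: pou_integrable.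
have [isum sE] := Rint_sum (mu := pi) (index_enum _) mD iF.
have -> : edge_energy_disc dl N = \int[pi]_(x in D) (\sum_i F i x).
  rewrite sE; apply: eq_bigr => i _; rewrite /F RintegralD//; last 2 first.
  - by apply: RintZ => //; exact: pou_integrable.
  - exact: RintZ.
  rewrite !RintegralZl//; last exact: pou_integrable.
  rewrite uE -/(pou_mass l pi N i) /a -/(U i).
  have wp := pou_mass_gt0 l0 wpi (ltn_ord i : (i <= 2 ^ N)%N).
  have -> : pou_mass l rho N i = U i * pou_mass l pi N i by rewrite /U divfK// gt_eqF.
  ring.
apply: le_Rintegral => // x Dx.
rewrite -[leRHS]mulr1 -[X in _ <= _ * X](pou_sum l0 N Dx) mulr_sumr; apply: ler_sum => i _.
have -> : F i x = (reg_eta dl (U i) + c i * (u x - U i)) * pou l N i x by rewrite /F /a; ring.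
apply: ler_wpM2r; first exact: pou_ge0.
apply: le_trans (reg_eta_le d0 d1 (u0 x Dx)).
exact: (reg_eta_tangent d0 d1 (u0 x Dx) (U0 i)).
Qed.

End EdgeEnergy.

(** * Discrete and regularised energy on the graph *)

Section RelativeEntropy.
Context {R : realType}.
Local Notation T := (measurableTypeR R).
Variables (rho pi : {finite_measure set T -> \bar R}).

Lemma edge_relent_ge0 : (0 <= edge_relent rho pi)%E.
Proof.
rewrite /edge_relent; case: ifP => _; last by rewrite leey.
by apply: integral_ge0 => x _; rewrite lee_fin eta_ge0.
Qed.

Lemma edge_relent_disc_le l dl N : 0 < l -> (forall N i, (i < 2 ^ N)%N -> 0 < cell_mass l pi N i) ->
  rho.-null_set (~` `[0, l]) -> 0 < dl -> dl <= 1 ->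
  ((edge_energy_disc l rho pi dl N)%:E <= edge_relent rho pi)%E.
Proof.
move=> l0 wpi rs d0 d1; rewrite /edge_relent; case: ifPn => [/asboolP dom|_]; last by rewrite leey.
have mD : measurable (`[0, l]%classic : set T) by exact: measurable_itv.
have mm := Rint_measurable (mdensity_integrable dom).
have mem_ : measurable_fun setT (fun x => (eta (mdensity rho pi x))%:E).
  by apply/measurable_EFinP; exact: measurableT_comp eta_measurable mm.
pose u x := Num.max (mdensity rho pi x) 0.
have uE : {ae pi, forall x, mdensity rho pi x = u x}.
  by apply: ae_imply (mdensity_ge0 dom) => x h; rewrite /u max_l.
have mu : measurable_fun setT u by apply: measurable_maxr => //; exact: measurable_cst.
have [h|] := ltP (\int[pi]_x (eta (mdensity rho pi x))%:E)%E +oo%E; last by rewrite leye_eq => /eqP ->; rewrite leey.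
have DT : (\int[pi]_(x in `[0%R, l]) (eta (u x))%:E <= \int[pi]_x (eta (mdensity rho pi x))%:E)%E.
  rewrite (@ae_eq_lower_integral _ _ _ pi _ _ (fun x => (eta (mdensity rho pi x))%:E)).
    by apply: ge0_subset_integral => // x _; rewrite lee_fin eta_ge0.
  by apply: ae_imply uE => x -> _.
have ie : pi.-integrable `[0, l] (EFin \o (fun x => eta (u x))).
  apply/integrableP; split.
    by apply/measurable_EFinP; apply: measurable_funTS; exact: measurableT_comp eta_measurable mu.
  apply: le_lt_trans h; apply: le_trans DT.
  by apply: ge0_le_lower_integral => x _; [exact: abse_ge0|rewrite gee0_abs// lee_fin eta_ge0].
apply: le_trans DT; rewrite -EFin_Rint// lee_fin.
apply: edge_jensen => //.
- exact: measurable_funTS.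
- by move=> x _; rewrite /u le_max lexx orbT.
- move=> A mA AD; rewrite (mdensity_integral dom)//; apply: ae_eq_lower_integral.
  by apply: ae_imply uE => x -> _.
Qed.

End RelativeEntropy.

Section GraphEnergy.
Context {R : realType} {G : metric_graph R}.
Local Notation T := (measurableTypeR R).
Local Notation leb := (@lebesgue_measure R).
Variables (ref : prob G) (P : edge G -> R -> R).
Hypothesis omega_gt0 : forall v, 0 < gam ref v.
Hypothesis P_lip : forall e, [lipschitz P e x | x in edge_itv e].
Hypothesis pi_density : forall e (A : set R), measurable A ->
  rho ref e A = (\int[leb]_(x in A `&` edge_itv e) (expR (- P e x))%:E)%E.

Let mE (e : edge G) : measurable (edge_itv e : set T). Proof. exact: measurable_itv. Qed.
Let l0 (e : edge G) : 0 < len e := len_gt0 e.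
Let wpi e := cell_mass_pi_gt0 (l0 e) (P_lip e) (@pi_density e).

Definition energy_disc dl N (mu : prob G) : R :=
  \sum_e edge_energy_disc (len e) (rho mu e) (rho ref e) dl N
  + \sum_v gam ref v * reg_eta dl (gam mu v / gam ref v).

Definition energy_reg dl (mu : prob G) (q : edge G -> R -> R) : R :=
  \sum_e \int[rho ref e]_(x in edge_itv e) reg_eta dl (q e x ^+ 2)
  + \sum_v gam ref v * reg_eta dl (gam mu v / gam ref v).

(** The energy written through [q]; real-valued, so that limits can be taken in the
reals. *)
Definition energy_lim (mu : prob G) (q : edge G -> R -> R) : R :=
  \sum_e \int[rho ref e]_(x in edge_itv e) eta (q e x ^+ 2)
  + \sum_v gam ref v * eta (gam mu v / gam ref v).

Lemma node_relentE (mu : prob G) v :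
  node_relent (gam mu v) (gam ref v) = (gam ref v * eta (gam mu v / gam ref v))%:E.
Proof. by rewrite /node_relent (gt_eqF (omega_gt0 v)) orbT. Qed.

Let gr0 (mu : prob G) v : 0 <= gam mu v / gam ref v.
Proof. by rewrite divr_ge0 ?gam_ge0// ltW. Qed.

Lemma energy_ge0 mu : (0 <= energy ref mu)%E.
Proof.
apply: adde_ge0; apply: sume_ge0 => ? _; first exact: edge_relent_ge0.
by rewrite node_relentE lee_fin; apply: mulr_ge0; [exact: ltW|exact: eta_ge0].
Qed.

Lemma energy_disc_le dl N mu : 0 < dl -> dl <= 1 -> ((energy_disc dl N mu)%:E <= energy ref mu)%E.
Proof.
move=> d0 d1; rewrite /energy_disc EFinD -!sumEFin; apply: leeD; [apply: lee_sum => e _|apply: lee_sum => v _].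
  exact: (edge_relent_disc_le N (l0 e) (wpi e) (@rho_supp _ _ mu e) d0 d1).
rewrite node_relentE lee_fin; apply: ler_wpM2l; first exact: ltW.
exact: (reg_eta_le d0 d1).
Qed.

Section Density.
Variables (mu : prob G) (q p : edge G -> R -> R).
Hypothesis H : forall e, H1_density (len e) (rho ref e) (rho mu e) (q e) (p e).

Lemma energy_disc_cvg dl : 0 < dl -> dl <= 1 ->
  energy_disc dl N mu @[N --> \oo] --> energy_reg dl mu q.
Proof.
move=> d0 d1; apply: cvgD; last exact: cvg_cst.
apply: cvg_sum_cond => e _; have [iq Lp q0 rE] := H e.
apply: (edge_energy_disc_cvg (l0 e) (wpi e) (@rho_supp _ _ mu e) iq Lp _ rE d0 d1).
by move=> x; rewrite /= in_itv; exact: q0.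
Qed.

Lemma energy_reg_cvg (d_ : nat -> R) : (forall n, 0 < d_ n) -> (forall n, d_ n <= 1) ->
  d_ n @[n --> \oo] --> (0 : R) ->
  energy_reg (d_ n) mu q @[n --> \oo] --> energy_lim mu q.
Proof.
move=> d0 d1 dc; apply: cvgD; [apply: cvg_sum_cond => e _|apply: cvg_sum_cond => v _].
  have [iq _ _ _] := H e.
  by have [] := edge_energy_reg_cvg (l0 e) (rho ref e) iq d0 d1 dc.
apply: cvgM; first exact: cvg_cst.
exact: reg_eta_cvg.
Qed.

End Density.

End GraphEnergy.

(** * Domination by a lower integral, and continuous approximation of cells *)

Section LowerDominated.
Context d (T : measurableType d) (R : realType).
Variable mu : {measure set T -> \bar R}.
Variable D : set T.
Hypothesis mD : measurable D.

(** It makes an almost everywhere limit measurable when the measure is not known to be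
complete. *)
Lemma ae_measurable_rep (f_ : nat -> T -> R) (f : T -> R) :
  (forall n, measurable_fun D (f_ n)) ->
  {ae mu, forall x, D x -> f_ n x @[n --> \oo] --> f x} ->
  exists2 g, measurable_fun D g & {ae mu, forall x, D x -> f x = g x}.
Proof.
move=> mf [N [mN N0 sN]]; exists (f \_ (~` N)).
  apply: (@measurable_fun_cvg _ _ _ _ (fun n => f_ n \_ (~` N))).
    move=> n; rewrite -[f_ n \_ _]/((f_ n) \_ (~` N)).
    have h : measurable_fun (D `&` ~` N) (f_ n).
      by apply: measurable_funS (mf n) => //; exact: subIsetl.
    apply/measurable_restrict => //; exact: measurableC.
  move=> x Dx; rewrite patchE; case: ifPn => h.
    under eq_fun do rewrite patchE h.
    by apply: contrapT => nc; move: h; rewrite inE; apply; apply: sN => /(_ Dx).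
  under eq_fun do rewrite patchE (negbTE h); exact: cvg_cst.
exists N; split => // x /= H; apply: contrapT => nx; apply: H => Dx.
by rewrite patchE mem_set.
Qed.

(** The supremum [h] of the sequence is measurable, and the positive part of
[h - k] is a measurable function below a multiple of [B], hence integrable. *)
Lemma lower_dominated (a_ : nat -> T -> R) (k : T -> R) (C : R) (B : T -> \bar R) :
  (forall n, measurable_fun D (a_ n)) -> mu.-integrable D (EFin \o k) -> (forall x, D x -> 0 <= k x) ->
  0 < C -> (forall x, D x -> (0 <= B x)%E) -> (\int[mu]_(x in D) B x < +oo)%E ->
  {ae mu, forall x, D x -> forall n, (`|a_ n x|%:E <= C%:E * B x + (k x)%:E)%E} ->
  exists2 H, mu.-integrable D (EFin \o H) & {ae mu, forall x, D x -> forall n, `|a_ n x| <= H x}.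
Proof.
move=> ma ik k0 C0 B0 iB ab.
pose h x := ereal_sup (range (fun n => `|a_ n x|%:E)).
have h0 x : (0 <= h x)%E.
  by apply: (@le_trans _ _ `|a_ 0%N x|%:E) => //; apply: ereal_sup_ubound; exists 0%N.
have mh : measurable_fun D h.
  have -> : h = (fun x => esups (fun n => `|a_ n x|%:E) 0%N).
    by apply/funext => x; rewrite /esups /sdrop /h; congr ereal_sup; apply/seteqP; split => y [n h1 h2]; exists n.
  apply: measurable_fun_esups => n; apply/measurable_EFinP; exact: measurableT_comp (ma n).
have mk : measurable_fun D k := Rint_measurable ik.
pose g x := maxe (h x - (k x)%:E)%E 0%E.
have mg : measurable_fun D g.
  apply: measurable_maxe; last exact: measurable_cst.
  by apply: emeasurable_funB => //; exact/measurable_EFinP.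
have g0 x : (0 <= g x)%E by rewrite /g le_max lexx orbT.
have gB : {ae mu, forall x, D x -> (C^-1%:E * g x <= B x)%E}.
  apply: ae_imply ab => x H Dx; rewrite lee_pdivrMl// /g ge_max; apply/andP; split; last first.
    by rewrite mule_ge0 ?B0// lee_fin ltW.
  rewrite leeBlDr//; apply: ge_ereal_sup => _ [n _ <-]; exact: H.
have ig : (\int[mu]_(x in D) g x < +oo)%E.
  have : (\int[mu]_(x in D) (C^-1%:E * g x) < +oo)%E.
    apply: le_lt_trans iB; apply: ae_ge0_le_lower_integral => // x Dx.
    by rewrite mule_ge0// lee_fin invr_ge0 ltW.
  rewrite ge0_integralZl_EFin//; last by rewrite invr_ge0; exact: ltW.
  have := integral_ge0 mu (fun x (_ : D x) => g0 x).
  move: (integral _ _ _) => [r| |]//= _; first by rewrite !ltry.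
  by rewrite gt0_muley// lte_fin invr_gt0.
have ih : mu.-integrable D h.
  apply/integrableP; split => //.
  apply: (@le_lt_trans _ _ (\int[mu]_(x in D) (g x + `|(k x)%:E|))%E).
    apply: ge0_le_lower_integral => x Dx; first exact: abse_ge0.
    rewrite gee0_abs// gee0_abs ?lee_fin ?k0// -leeBlDr// /g le_max lexx//.
  rewrite ge0_integralD//; last 1 first.
  - by apply: measurableT_comp => //; exact/measurable_EFinP.
  by rewrite lte_add_pinfty//; case/integrableP: ik.
have hfin := integrable_ae mD ih.
exists (fine \o h).
  apply/integrableP; split; first by apply/measurable_EFinP; exact: measurableT_comp mh.
  case/integrableP: ih => _; apply: le_lt_trans; apply: ge0_le_lower_integral => x Dx; first exact: abse_ge0.
  by rewrite /comp; case: (h x) => [r| |] //=; rewrite leey.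
apply: ae_imply hfin => x H Dx n; rewrite -lee_fin /= fineK ?H//.
by apply: ereal_sup_ubound; exists n.
Qed.

End LowerDominated.

Section CellHat.
Context {R : realType}.
Variable l : R.
Hypothesis l0 : 0 < l.

(** Continuous, and increasing in [n] to the indicator of the ray left of [a];
differences of two of them approximate cells pointwise. *)
Definition ray_hat (a : R) (n : nat) (x : R) : R := Num.min 1 (Num.max 0 (n%:R * (a - x))).

Lemma ray_hat_continuous a n : continuous (ray_hat a n).
Proof.
move=> x.
apply: (@continuous_min R R (cst 1) (fun y => Num.max 0 (n%:R * (a - y)))); first exact: cvg_cst.
apply: (@continuous_max R R (cst 0) (fun y => n%:R * (a - y))); first exact: cvg_cst.
apply: cvgM; first exact: cvg_cst.
by apply: cvgB; [exact: cvg_cst|exact: cvg_id].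
Qed.

Lemma ray_hat_range a n x : 0 <= ray_hat a n x <= 1.
Proof. by rewrite /ray_hat ge_min lexx le_min ler01 le_max lexx. Qed.

Lemma ray_hat_cvg a x : ray_hat a n x @[n --> \oo] --> ((x < a)%R%:R : R).
Proof.
have [xa|ax] := ltP x a; last first.
  have -> : (fun n => ray_hat a n x) = fun=> 0.
    apply/funext => n; rewrite /ray_hat max_l ?min_r//.
    by rewrite mulr_ge0_le0// subr_le0.
  exact: cvg_cst.
have p : 0 < a - x by rewrite subr_gt0.
apply: (@cvg_trans _ ((fun=> 1 : R) @ \oo)); last exact: cvg_cst.
apply: near_eq_cvg; exists (Num.truncn (a - x)^-1).+1 => // n /= hn.
apply/esym; rewrite /ray_hat min_l//; apply: (@le_trans _ _ (n%:R * (a - x))); last by rewrite le_max lexx orbT.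
rewrite -ler_pdivrMr// mul1r; apply: le_trans (ltW (truncnS_gt _)) _.
by rewrite ler_nat.
Qed.

Definition cell_hat N i n (x : R) : R :=
  ray_hat (if i.+1 == (2 ^ N)%N then l + 1 else dyad l N i.+1) n x - ray_hat (dyad l N i) n x.

Lemma cell_hat_continuous N i n : continuous (cell_hat N i n).
Proof. by move=> x; apply: cvgB; exact: ray_hat_continuous. Qed.

Lemma cell_hat_le1 N i n x : `|cell_hat N i n x| <= 1.
Proof.
have /andP[h1 h2] := ray_hat_range (if i.+1 == (2 ^ N)%N then l + 1 else dyad l N i.+1) n x.
have /andP[h3 h4] := ray_hat_range (dyad l N i) n x.
by rewrite ler_norml /cell_hat; apply/andP; split; lra.
Qed.

Lemma cell_hat_cvg N i x : (i < 2 ^ N)%N -> 0 <= x <= l ->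
  cell_hat N i n x @[n --> \oo] --> (\1_(cell l N i) x : R).
Proof.
move=> iN xl; have -> : \1_(cell l N i) x =
    ((x < if i.+1 == (2 ^ N)%N then l + 1 else dyad l N i.+1)%R%:R - (x < dyad l N i)%R%:R : R).
  rewrite indicE (cellE l0 iN).
  have di : dyad l N i <= dyad l N i.+1 by exact: dyad_le.
  have dl : dyad l N i.+1 <= l by exact: dyad_lel.
  case/andP: xl => x0 xl.
  case: ifP => _.
    have -> : (x < l + 1)%R by lra.
    rewrite (_ : (x \in _) = (dyad l N i <= x)); last by apply/idP/idP; rewrite inE /= in_itv /= xl andbT.
    by case: leP => _; rewrite ?subr0 ?subrr.
  rewrite (_ : (x \in _) = (dyad l N i <= x < dyad l N i.+1)); last by apply/idP/idP; rewrite inE /= in_itv.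
  case: (leP (dyad l N i) x) => h1 /=; first by rewrite subr0.
  by have -> : (x < dyad l N i.+1)%R by [exact: lt_le_trans di]; rewrite subrr.
by apply: cvgB; exact: ray_hat_cvg.
Qed.

End CellHat.

(** * The entropy as a supremum over continuous functions *)

Section Duality.
Context {R : realType}.
Local Notation T := (measurableTypeR R).
Variable l : R.
Hypothesis l0 : 0 < l.
Local Notation D := (`[0, l]%classic : set T).
Variables (rho pi : {finite_measure set T -> \bar R}).
Let mD : measurable D. Proof. exact: measurable_itv. Qed.
Let finD (m : {finite_measure set T -> \bar R}) : (m D < +oo)%E.
Proof. by rewrite -ge0_fin_numE// fin_num_measure. Qed.

Let icst (m : {finite_measure set T -> \bar R}) (K : R) : m.-integrable D (EFin \o cst K).
Proof.
by apply: (bounded_integrable (mu := m) mD (finD m) (measurable_cst _) (K := `|K|)) => x _.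
Qed.

(** The functional whose supremum over [psi] is the relative entropy: [exp s - 1] is
the convex conjugate of [eta]. *)
Definition dual_value (psi : R -> R) : R :=
  \int[rho]_(x in D) psi x - \int[pi]_(x in D) (expR (psi x) - 1).

Lemma exp_young (r s : R) : 0 <= r -> s * r - (expR s - 1) <= eta r.
Proof.
rewrite /eta le_eqVlt => /orP[/eqP <-|r0].
  by rewrite mulr0 mul0r; have := expR_gt0 s; lra.
have := expR_ge1Dx (s - ln r); rewrite expRD expRN lnK ?posrE//.
move=> /(ler_wpM2l (ltW r0)); rewrite mulrCA mulfV ?gt_eqF// mulr1.
move: (ln r) (expR s) => a b; lra.
Qed.

Lemma dual_value0 : dual_value (cst 0) = 0.
Proof.
rewrite /dual_value (_ : \int[pi]_(x in D) (expR ((cst 0 : R -> R) x) - 1) = \int[pi]_(x in D) (cst 0 x)).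
  by rewrite !Rintegral_cst// !mul0r subr0.
by apply: eq_Rintegral => x _; rewrite /cst expR0 subrr.
Qed.

Let exp_measurable (f : R -> R) : measurable_fun D f -> measurable_fun D (fun x => expR (f x) - 1).
Proof.
move=> mf; apply: measurable_funB; last exact: measurable_cst.
exact: measurableT_comp mf.
Qed.

Let exp_bound (s K : R) : `|s| <= K -> `|expR s - 1| <= expR K + 1.
Proof.
move=> h; apply: (le_trans (ler_normB _ _)); rewrite normr1 lerD2r ger0_norm ?expR_ge0//.
by rewrite ler_expR; apply: le_trans h; exact: ler_norm.
Qed.

Lemma dual_value_cvg (f_ : nat -> R -> R) (f : R -> R) (K : R) :
  (forall n, measurable_fun D (f_ n)) -> measurable_fun D f ->
  (forall n x, D x -> `|f_ n x| <= K) ->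
  (forall x, D x -> f_ n x @[n --> \oo] --> f x) ->
  dual_value (f_ n) @[n --> \oo] --> dual_value f.
Proof.
move=> mf_ mf fK cf; apply: cvgB.
  apply: (Rintegral_dct (mu := rho) (g := cst K) mD mf_ mf _ _ _).2.
  - by apply: aeW => x; exact: cf.
  - exact: icst.
  - by apply: aeW => x Dx n; exact: fK.
apply: (Rintegral_dct (mu := pi) (g := cst (expR K + 1)) mD _ _ _ _ _).2.
- by move=> n; exact: exp_measurable.
- exact: exp_measurable.
- apply: aeW => x Dx; apply: cvgB; last exact: cvg_cst.
  by apply: continuous_cvg; [exact: continuous_expR|exact: cf].
- exact: icst.
- by apply: aeW => x Dx n; apply: exp_bound; exact: fK.
Qed.

Variable B : R.
Hypothesis dualB : forall psi : R -> R, continuous psi -> dual_value psi <= B.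

Lemma dual_step N c : dual_value (step l N c) <= B.
Proof.
pose f_ n x := \sum_(i < (2 ^ N)%N) c i * cell_hat l N i n x.
have cf_ n : continuous (f_ n).
  move=> x; apply: cvg_sum_cond => i _; apply: cvgM; first exact: cvg_cst.
  exact: cell_hat_continuous.
have H : dual_value (f_ n) @[n --> \oo] --> dual_value (step l N c).
  apply: (@dual_value_cvg _ _ (\sum_(i < (2 ^ N)%N) `|c i|)).
  - by move=> n; apply: measurable_funTS; exact: continuous_measurable_fun.
  - by apply: measurable_funTS; exact: measurable_step.
  - move=> n x Dx; apply: (le_trans (ler_norm_sum _ _ _)); apply: ler_sum => i _.
    by rewrite normrM -[leRHS]mulr1; apply: ler_wpM2l => //; exact: cell_hat_le1.
  - move=> x; rewrite /= in_itv /= => xl; apply: cvg_sum_cond => i _.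
    by apply: cvgM; [exact: cvg_cst|exact: cell_hat_cvg].
by apply: (cvgr_to_le H); apply: nearW => n; exact: dualB.
Qed.

Lemma expR_lip (a b K : R) : `|a| <= K -> `|b| <= K -> `|expR a - expR b| <= expR K * `|a - b|.
Proof.
wlog ab : a b / b <= a.
  move=> W ha hb; have [h|/ltW h] := leP b a; first exact: W.
  by rewrite distrC [`|a - b|]distrC; exact: W.
move=> ha _; rewrite !ger0_norm ?subr_ge0 ?ler_expR//.
have := expR_ge1Dx (b - a); rewrite expRD expRN.
have a0 := expR_gt0 a => /(ler_wpM2l (ltW a0)); rewrite mulrCA mulfV ?gt_eqF// mulr1 => h.
have aK : expR a <= expR K by rewrite ler_expR (le_trans (ler_norm _)).
have := ler_wpM2r (_ : 0 <= a - b) aK; rewrite subr_ge0 => /(_ ab).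
by move: h; move: (expR a) (expR b) (expR K) => u v w; lra.
Qed.

(** A bounded function is approximated by steps in L^2([rho] + [pi]); clamping their
values to [- K, K] keeps the exponentials Lipschitz. *)
Lemma dual_bounded (psi : R -> R) K : measurable_fun D psi -> (forall x, D x -> `|psi x| <= K) ->
  dual_value psi <= B.
Proof.
move=> mp pK; have K0 : 0 <= K.
  by apply: le_trans (pK 0 _) => //; rewrite /= in_itv /= lexx ltW.
pose m := measure_add rho pi.
have mDfin : (m D < +oo)%E by rewrite /m measure_addE; apply: lte_add_pinfty; exact: finD.
have ip (nu : {measure set T -> \bar R}) : (nu D < +oo)%E -> L2 nu D psi.
  by move=> h; apply: (L2_bounded (mu := nu) mD h mp pK).
pose mR := fine (m D); have mR0 : 0 <= mR by exact: fine_ge0.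
apply/ler_addgt0Pl => e0 e00.
pose A := (1 + expR K) * (mR + 1).
have A0 : 0 < A by apply: mulr_gt0; [have := expR_gt0 K; lra|lra].
pose e := e0 / A; have e1 : 0 < e by exact: divr_gt0.
have [N [c Hc]] := step_dense l0 mDfin (ip _ mDfin) (exprn_gt0 2 e1).
pose cl (y : R) := Num.max (- K) (Num.min K y).
have cl_le y : `|cl y| <= K.
  by rewrite /cl ler_norml le_max lexx /= ge_max ge_min lexx /= andbT; lra.
have cl_near x y : `|x| <= K -> `|x - cl y| <= `|x - y|.
  rewrite ler_norml => /andP[h1 h2]; rewrite /cl.
  have [h3|h3] := leP K y.
    rewrite max_r; last by lra.
    by rewrite !ler0_norm; lra.
  have [h4|h4] := leP (- K) y; first by [].
  by rewrite !ger0_norm; lra.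
pose s := step l N (cl \o c).
have sE x : D x -> s x = cl (step l N c x) by move=> Dx; rewrite /s !stepE.
have ms : measurable_fun D s by apply: measurable_funTS; exact: measurable_step.
have sK x : D x -> `|s x| <= K by move=> Dx; rewrite sE//.
have md : measurable_fun D (fun x => `|psi x - s x|).
  by apply: measurableT_comp => //; exact: measurable_funB.
have d2K x : D x -> Num.norm `|psi x - s x| <= 2 * K.
  move=> Dx; rewrite normr_id; apply: (le_trans (ler_normB _ _)).
  by have := pK x Dx; have := sK x Dx; lra.
have idf (nu : {measure set T -> \bar R}) : (nu D < +oo)%E -> nu.-integrable D (EFin \o (fun x => `|psi x - s x|)).
  by move=> h; exact: (bounded_integrable (mu := nu) mD h md d2K).
have dm : \int[m]_(x in D) `|psi x - s x| <= e * (mR + 1).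
  have is2 : m.-integrable D (EFin \o (fun x => (psi x - step l N c x) ^+ 2)).
    by have [] := L2B (mu := m) mD (ip _ mDfin) (step_L2 l0 mDfin N c).
  have ie : m.-integrable D (EFin \o cst e).
    by apply: (bounded_integrable (mu := m) (K := `|e|)) => //; exact: measurable_cst.
  apply: (@le_trans _ _ (\int[m]_(x in D) (e + e^-1 * (psi x - step l N c x) ^+ 2))).
    apply: le_Rintegral => //; first exact: idf.
      by apply: RintD => //; exact: RintZ.
    move=> x Dx; rewrite sE//; apply: (le_trans (cl_near _ _ (pK x Dx))).
    have := young_inv `|psi x - step l N c x| (_ : 0 < e^-1); rewrite invrK invr_gt0 => /(_ e1).
    by rewrite real_normK ?num_real// => h; rewrite [leRHS]addrC.
  rewrite RintegralD//; last exact: RintZ.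
  rewrite Rintegral_cst// RintegralZl// mulrDr mulr1 -/mR; apply: lerD => //.
  by rewrite ler_pdivrMl// -expr2.
have sub (nu : {measure set T -> \bar R}) : (forall f : T -> \bar R, (forall x, D x -> (0 <= f x)%E) -> measurable_fun D f ->
    (\int[nu]_(x in D) f x <= \int[m]_(x in D) f x)%E) -> (nu D < +oo)%E -> \int[nu]_(x in D) `|psi x - s x| <= e * (mR + 1).
  move=> h f; apply: le_trans dm; rewrite -lee_fin !EFin_Rint//; [|exact: idf|exact: (idf nu f)].
  by apply: h => [x _|]; [rewrite lee_fin|exact/measurable_EFinP].
have dr : \int[rho]_(x in D) `|psi x - s x| <= e * (mR + 1).
  by apply: (sub _ _ (finD _)) => f f0 mf; rewrite /m ge0_integral_measure_add// leeDl//; exact: integral_ge0.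
have dp : \int[pi]_(x in D) `|psi x - s x| <= e * (mR + 1).
  by apply: (sub _ _ (finD _)) => f f0 mf; rewrite /m ge0_integral_measure_add// leeDr//; exact: integral_ge0.
have ib (nu : {finite_measure set T -> \bar R}) (f : R -> R) (K' : R) : measurable_fun D f -> (forall x, D x -> `|f x| <= K') ->
    nu.-integrable D (EFin \o f).
  by move=> mf fK'; exact: (bounded_integrable (mu := nu) mD (finD nu) mf fK').
have h1 : \int[rho]_(x in D) psi x - \int[rho]_(x in D) s x <= e * (mR + 1).
  rewrite -RintegralB//; [|exact: ib pK|exact: ib sK].
  apply: le_trans dr; apply: (le_trans (ler_norm _)).
  by apply: (le_Rint_norm (mu := rho) mD (measurable_funB mp ms) (idf rho (finD rho))).
have eK (f : R -> R) : (forall x, D x -> `|f x| <= K) -> forall x, D x -> `|expR (f x) - 1| <= expR K + 1.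
  by move=> fK x Dx; apply: exp_bound; exact: fK.
have h2 : \int[pi]_(x in D) (expR (s x) - 1) - \int[pi]_(x in D) (expR (psi x) - 1) <= expR K * (e * (mR + 1)).
  rewrite -RintegralB//; [|exact: ib (exp_measurable ms) (eK _ sK)|exact: ib (exp_measurable mp) (eK _ pK)].
  apply: (@le_trans _ _ (expR K * \int[pi]_(x in D) `|psi x - s x|)); last by apply: ler_wpM2l; rewrite ?expR_ge0.
  rewrite -RintegralZl//; last exact: (idf pi (finD pi)).
  apply: (le_trans (ler_norm _)); apply: le_Rint_norm => //.
  - by apply: measurable_funB; exact: exp_measurable.
  - by apply: RintZ => //; exact: (idf pi (finD pi)).
  - move=> x Dx; rewrite [`|psi x - s x|]distrC.
    have -> : expR (s x) - 1 - (expR (psi x) - 1) = expR (s x) - expR (psi x) by ring.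
    by apply: expR_lip; [exact: sK|exact: pK].
have h3 := dual_step N (cl \o c).
have -> : e0 = e * (mR + 1) + expR K * (e * (mR + 1)).
  have -> : e * (mR + 1) + expR K * (e * (mR + 1)) = e * A by rewrite /A; ring.
  by rewrite /e divfK// gt_eqF.
by move: h3; rewrite /dual_value -/s; lra.
Qed.

Hypothesis rho_supp : rho.-null_set (~` D).

(** If [A] is null for [pi], the functions [n * \1_A] give [n * rho A <= B]. *)
Lemma dual_dominates : rho `<< pi.
Proof.
apply/null_content_dominatesP => A mA A0.
rewrite (null_setI mD rho_supp mA).
have mAD : measurable (A `&` D) by exact: measurableI.
have pAD : pi (A `&` D) = 0.
  apply/eqP; rewrite eq_le measure_ge0 andbT -A0; apply: le_measure; rewrite ?inE//.
have B0 : 0 <= B.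
  have c0 : continuous (cst 0 : R -> R) by move=> x; exact: cvg_cst.
  by have := dualB c0; rewrite dual_value0.
have H n : n%:R * fine (rho (A `&` D)) <= B.
  have m1 : measurable_fun D (fun x => n%:R * \1_(A `&` D) x : R).
    by apply: measurable_funM; [exact: measurable_cst|apply: measurable_funTS; exact: measurable_indic].
  have := @dual_bounded (fun x => n%:R * \1_(A `&` D) x) n%:R m1.
  rewrite /dual_value.
  have -> : \int[pi]_(x in D) (expR (n%:R * \1_(A `&` D) x) - 1) = 0.
    rewrite (ae_eq_Rint (mu := pi) (g := cst 0)) ?Rintegral_cst ?mul0r//.
    exists (A `&` D); split => // x /= h; apply: contrapT => nx; apply: h => _.
    by rewrite indicE memNset// mulr0 expR0 subrr.
  have i1 : rho.-integrable D (EFin \o (\1_(A `&` D) : T -> R)).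
    apply: (bounded_integrable (mu := rho) mD (finD rho) (K := 1)).
      by apply: measurable_funTS; exact: measurable_indic.
    by move=> x _; rewrite indicE; case: (_ \in _); rewrite ?normr1 ?normr0.
  rewrite RintegralZl// subr0; have -> : \int[rho]_(x in D) \1_(A `&` D) x = fine (rho (A `&` D)).
    by rewrite /Rintegral integral_indic// -setIA setIid.
  apply => x _; rewrite indicE; case: (_ \in _); rewrite ?mulr1 ?mulr0 ?normr0 ?normr_nat//.
have : fine (rho (A `&` D)) <= 0.
  rewrite leNgt; apply/negP => p.
  have := H (Num.truncn (B / fine (rho (A `&` D)))).+1; rewrite -ler_pdivlMr//.
  by rewrite leNgt truncnS_gt.
move=> h; rewrite -(fineK (fin_num_measure rho _ mAD)); congr EFin.
by apply/eqP; rewrite eq_le h fine_ge0.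
Qed.

Definition clamp (k : nat) (u : R) : R := Num.max k.+1%:R^-1 (Num.min k.+1%:R u).

(** The left-hand side is the integrand of [dual_value] at [psi = ln (clamp k u)];
it is at least [eta (clamp k u)], since clamping moves [u] towards 1. *)
Lemma clamp_young k u : 0 <= u -> 0 <= u * ln (clamp k u) - (clamp k u - 1).
Proof.
have k0 : 0 < k.+1%:R :> R by [].
have k1 : 1 <= k.+1%:R :> R by rewrite ler1n.
have ki : k.+1%:R^-1 <= 1 :> R by rewrite invf_le1.
have ki0 : 0 < k.+1%:R^-1 :> R by rewrite invr_gt0.
have cp : 0 < clamp k u by rewrite /clamp lt_max ki0.
move=> u0; suff : (clamp k u) * ln (clamp k u) <= u * ln (clamp k u).
  by have := eta_ge0 (clamp k u); rewrite /eta; lra.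
rewrite -subr_ge0 -mulrBl /clamp.
have [ku|uk] := leP k.+1%:R u.
  rewrite max_r; last exact: le_trans k1.
  by apply: mulr_ge0; [rewrite subr_ge0|exact: ln_ge0].
have [h|h] := leP k.+1%:R^-1 u; first by rewrite subrr mul0r.
by apply: mulr_le0; [rewrite subr_le0 ltW|exact: ln_le0].
Qed.

Lemma clamp_cvg u : 0 <= u -> u * ln (clamp k u) - (clamp k u - 1) @[k --> \oo] --> eta u.
Proof.
have hc : (k.+1%:R^-1 : R) @[k --> \oo] --> (0 : R) by exact: cvg_harmonic.
rewrite le_eqVlt => /orP[/eqP <-|u0].
  have -> : (fun k => 0 * ln (clamp k 0) - (clamp k 0 - 1)) = (fun k => - (k.+1%:R^-1 - 1)).
    by apply/funext => k; rewrite /clamp min_r// max_l ?invr_ge0// mul0r sub0r.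
  have -> : eta 0 = - (0 - 1) :> R by rewrite /eta mul0r; ring.
  by apply: cvgN; apply: cvgB => //; exact: cvg_cst.
apply: (@cvg_trans _ ((fun=> eta u) @ \oo)); last exact: cvg_cst.
apply: near_eq_cvg; near=> k.
have -> : clamp k u = u.
  rewrite /clamp min_r ?max_r//.
    near: k; have /cvgrPdist_le/(_ u u0) := hc; apply: filterS => k.
    by rewrite sub0r normrN ger0_norm ?invr_ge0.
  near: k; exists (Num.truncn u).+1 => // k /= hk; apply: (le_trans (ltW (truncnS_gt u))).
  by rewrite ler_nat; apply: leq_trans hk _.
by rewrite /eta; ring.
Unshelve. all: by end_near. Qed.

(** [psi] is the logarithm of the density, clamped; the integrands are nonnegative and
Fatou's lemma removes the clamp. *)
Lemma dual_relent : pi.-null_set (~` D) -> (edge_relent rho pi <= B%:E)%E.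
Proof.
move=> pi_supp; have dom := dual_dominates.
rewrite /edge_relent asboolT//.
have mm := Rint_measurable (mdensity_integrable dom).
pose u x := Num.max (mdensity rho pi x) 0.
have u0 x : 0 <= u x by rewrite /u le_max lexx orbT.
have uE : {ae pi, forall x, mdensity rho pi x = u x}.
  by apply: ae_imply (mdensity_ge0 dom) => x h; rewrite /u max_l.
have mu : measurable_fun D u by apply: measurable_funTS; apply: measurable_maxr => //; exact: measurable_cst.
have rhoE (A : set T) : measurable A -> A `<=` D -> rho A = (\int[pi]_(x in A) (u x)%:E)%E.
  move=> mA AD; rewrite (mdensity_integral dom)//; apply: ae_eq_lower_integral.
  by apply: ae_imply uE => x -> _.
have inD : {ae pi, forall x, D x}.
  exists (~` D); split; [exact: measurableC| |by move=> x /= nx dx; apply: nx].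
  by apply: pi_supp => //; exact: measurableC.
have -> : (\int[pi]_x (eta (mdensity rho pi x))%:E = \int[pi]_(x in D) (eta (u x))%:E)%E.
  rewrite [RHS]integral_mkcond; apply: ae_eq_lower_integral.
  by apply: (ae_imply2 _ uE inD) => x -> Dx _; rewrite patchE mem_set.
(* The optimal choice is [ln u]; clamping makes it bounded. *)
pose psi k x := ln (clamp k (u x)).
have k0 k : 0 < k.+1%:R :> R by [].
have cp k y : k.+1%:R^-1 <= clamp k y <= k.+1%:R.
  rewrite /clamp le_max lexx /= ge_max ge_min lexx /= andbT.
  by apply: (@le_trans _ _ 1); [rewrite invf_le1// ler1n|rewrite ler1n].
have cp0 k y : 0 < clamp k y by have /andP[h _] := cp k y; apply: lt_le_trans h; rewrite invr_gt0.
have mc k : measurable_fun D (fun x => clamp k (u x)).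
  apply: measurable_maxr; first exact: measurable_cst.
  by apply: measurable_minr => //; exact: measurable_cst.
have mpsi k : measurable_fun D (psi k) by exact: measurableT_comp (mc k).
have psiK k x : `|psi k x| <= ln k.+1%:R.
  have /andP[h1 h2] := cp k (u x); rewrite ler_norml -lnV ?posrE//.
  by rewrite !ler_ln ?posrE ?invr_gt0// h1 h2.
pose F k x := u x * psi k x - (clamp k (u x) - 1).
have irp k : rho.-integrable D (EFin \o psi k).
  exact: (bounded_integrable (mu := rho) mD (finD rho) (mpsi k) (fun x _ => psiK k x)).
have ipc k : pi.-integrable D (EFin \o (fun x => clamp k (u x) - 1)).
  apply: (bounded_integrable (mu := pi) (K := k.+1%:R + 1) mD (finD pi)).
    by apply: measurable_funB => //; exact: measurable_cst.
  move=> x _; have /andP[h1 h2] := cp k (u x); have := cp0 k (u x) => h3.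
  by rewrite ler_norml; apply/andP; split; lra.
have iup k : pi.-integrable D (EFin \o (fun x => u x * psi k x)).
  have := change_on_integrable_inv mD mu (fun x _ => u0 x) rho_supp rhoE mD (@subset_refl _ D) (irp k).
  by congr (is_true (integrable _ _ _)); apply/funext => x; rewrite /= mulrC.
have FB k : \int[pi]_(x in D) F k x <= B.
  rewrite RintegralB//.
  have -> : \int[pi]_(x in D) (u x * psi k x) = \int[rho]_(x in D) psi k x.
    rewrite (change_on_Rint mD mu (fun x _ => u0 x) rho_supp rhoE mD (@subset_refl _ D) (irp k)).
    by apply: eq_Rintegral => x _; rewrite mulrC.
  have := dual_bounded (mpsi k) (fun x _ => psiK k x); rewrite /dual_value.
  rewrite (_ : \int[pi]_(x in D) (expR (psi k x) - 1) = \int[pi]_(x in D) (clamp k (u x) - 1))//.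
  by apply: eq_Rintegral => x _; rewrite /psi lnK// posrE.
have [||||||ie le] := @fatou_real _ _ _ pi D F (fun x => eta (u x)) B mD.
- by move=> k; apply: RintB.
- by move=> k x _; exact: clamp_young.
- exact: measurableT_comp eta_measurable mu.
- by move=> x _; exact: eta_ge0.
- by apply: aeW => x _; exact: clamp_cvg.
- exact: FB.
- by rewrite -EFin_Rint// lee_fin.
Qed.

End Duality.

Section FenchelYoung.
Context {R : realType}.
Local Notation T := (measurableTypeR R).
Variable l : R.
Hypothesis l0 : 0 < l.
Local Notation D := (`[0, l]%classic : set T).
Variables (rho pi : {finite_measure set T -> \bar R}).
Hypothesis rho_supp : rho.-null_set (~` D).

Lemma dual_value_le (q psi : R -> R) : measurable_fun D (fun x => q x ^+ 2) ->
  (forall A : set T, measurable A -> A `<=` D -> rho A = (\int[pi]_(x in A) (q x ^+ 2)%:E)%E) ->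
  pi.-integrable D (EFin \o (fun x => eta (q x ^+ 2))) -> {within `[0, l], continuous psi} ->
  dual_value l rho pi psi <= \int[pi]_(x in D) eta (q x ^+ 2).
Proof.
have mD : measurable D by exact: measurable_itv.
move=> mq rhoE ie cp; have mp := within_measurable cp.
have [K K0 pK] := within_bounded (ltW l0) cp.
have fin (m : {finite_measure set T -> \bar R}) : (m D < +oo)%E by rewrite -ge0_fin_numE// fin_num_measure.
have ip : rho.-integrable D (EFin \o psi).
  by apply: (bounded_integrable (mu := rho) mD (fin rho) mp (K := K)) => x; rewrite /= in_itv; exact: pK.
have iexp : pi.-integrable D (EFin \o (fun x => expR (psi x) - 1)).
  apply: (bounded_integrable (mu := pi) mD (fin pi) (K := expR K + 1)).
    by apply: measurable_funB; [exact: measurableT_comp mp|exact: measurable_cst].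
  move=> x; rewrite /= in_itv => /pK h.
  apply: (le_trans (ler_normB _ _)); rewrite normr1 lerD2r ger0_norm ?expR_ge0// ler_expR.
  by apply: le_trans h; exact: ler_norm.
have q20 x : D x -> 0 <= q x ^+ 2 by move=> _; exact: sqr_ge0.
have iq := change_on_integrable_inv mD mq q20 rho_supp rhoE mD (@subset_refl _ D) ip.
rewrite /dual_value (change_on_Rint mD mq q20 rho_supp rhoE mD (@subset_refl _ D) ip).
rewrite -RintegralB//; apply: le_Rintegral => //; first exact: RintB.
by move=> x Dx; apply: exp_young; exact: sqr_ge0.
Qed.

End FenchelYoung.

(** * Almost every time *)

Section NotBad.
Context d (T : measurableType d) (R : realType).
Variable mu : {measure set T -> \bar R}.
Variable D : set T.
Hypothesis mD : measurable D.
Variable B : T -> \bar R.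
Hypothesis B0 : forall x, D x -> (0 <= B x)%E.
Hypothesis iB : (\int[mu]_(x in D) B x < +oo)%E.

(** The times at which the conclusion fails form a measurable set, on which [B] is
infinite. Properties of the form [exists k, forall i, f k i x <= 0] with measurable
[f] are thus inherited from the times of finite [B] by almost every time, although
the set of those times may be non-measurable. *)
Lemma ae_not_bad (J : countType) (f : nat -> J -> T -> R) :
  (forall k i, measurable_fun D (f k i)) ->
  (forall x, D x -> (B x < +oo)%E -> exists k, forall i, f k i x <= 0) ->
  {ae mu, forall x, D x -> exists k, forall i, f k i x <= 0}.
Proof.
move=> mf H; pose S := \bigcap_k \bigcup_i (D `&` f k i @^-1` `]0, +oo[).
have mS : measurable S.
  apply: bigcapT_measurable => k; apply: countable_bigcupT_measurable => [|i]; first exact: countableP.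
  by apply: mf => //; exact: measurable_itv.
exists S; split => //.
  apply: (lower_integral_pinfty_null mS _ B0 iB).
    by move=> x Sx; have [i _ []] := Sx 0%N I.
  move=> x Sx; have Dx : D x by have [i _ []] := Sx 0%N I.
  apply/eqP; rewrite eq_le leey /= leNgt; apply/negP => /(H x Dx) [k Hk].
  have [i _ [_]] := Sx k I; rewrite /= in_itv /= andbT => fp.
  by have := Hk i; rewrite leNgt fp.
move=> x /= /not_implyP [Dx nk] k _; apply: contrapT => ni; apply: nk; exists k => i.
rewrite leNgt; apply/negP => fp; apply: ni; exists i => //; split => //.
by rewrite /= in_itv /= fp.
Qed.

End NotBad.

Lemma ae_forall_fin d (T : measurableType d) (R : realType) (mu : {measure set T -> \bar R})
    (J : finType) (Q : J -> T -> Prop) :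
  (forall i, {ae mu, forall x, Q i x}) -> {ae mu, forall x, forall i, Q i x}.
Proof. by move=> H; apply: filter_forall. Qed.

Section Tests.
Context {R : realType} {G : metric_graph R}.
Local Notation T := (measurableTypeR R).

Let mE (e : edge G) : measurable (edge_itv e : set T). Proof. exact: measurable_itv. Qed.

Definition node_ind (v w : node G) : R := (w == v)%:R.
Definition edge_fun (e : edge G) (f : R -> R) (e' : edge G) : R -> R := if e' == e then f else cst 0.

Lemma pairing_node (m : prob G) v : pairing (node_ind v) (fun=> cst 0) m = gam m v.
Proof.
rewrite /pairing [X in _ + X]big1 ?addr0; last first.
  by move=> e _; rewrite Rintegral_cst ?mul0r//; exact: mE.
rewrite (bigD1 v)//= /node_ind eqxx mul1r big1 ?addr0// => w /negbTE ->; exact: mul0r.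
Qed.

Lemma pairing_edge (m : prob G) e f :
  pairing (fun=> 0) (edge_fun e f) m = \int[rho m e]_(x in edge_itv e) f x.
Proof.
rewrite /pairing big1 ?add0r; last by move=> w _; rewrite mul0r.
rewrite (bigD1 e)//= /edge_fun eqxx big1 ?addr0// => e' /negbTE ->.
by rewrite Rintegral_cst ?mul0r//; exact: mE.
Qed.

End Tests.

Section TimeMeasurability.
Context {R : realType} {G : metric_graph R}.
Local Notation T := (measurableTypeR R).
Local Notation leb := (@lebesgue_measure R).
Variables (T1 : R) (mu : R -> prob G).
Hypothesis ncont : narrowly_continuous T1 mu.

Let mE (e : edge G) : measurable (edge_itv e : set T). Proof. exact: measurable_itv. Qed.
Let l0 (e : edge G) : 0 < len e := len_gt0 e.

(** Narrow continuity tested with the indicator of one node. *)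
Lemma gam_continuous v : {within `[0, T1], continuous (fun t => gam (mu t) v)}.
Proof.
have c0 (e : edge G) : {within edge_itv e, continuous (cst 0 : R -> R)} by move=> x; exact: cvg_cst.
have -> : (fun t => gam (mu t) v) = (fun t => pairing (node_ind v) (fun=> cst 0) (mu t)).
  by apply/funext => t; rewrite pairing_node.
exact: ncont.
Qed.

Lemma rho_continuous e (f : R -> R) : {within edge_itv e, continuous f} ->
  {within `[0, T1], continuous (fun t => \int[rho (mu t) e]_(x in edge_itv e) f x)}.
Proof.
move=> cf; have -> : (fun t => \int[rho (mu t) e]_(x in edge_itv e) f x) =
    (fun t => pairing (fun=> 0) (edge_fun e f) (mu t)).
  by apply/funext => t; rewrite pairing_edge.
by apply: ncont => e'; rewrite /edge_fun; case: eqP => [->//|_] x; exact: cvg_cst.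
Qed.

(** The mass of a cell is a limit of integrals of continuous functions. *)
Lemma cell_mass_measurable e N i : (i < 2 ^ N)%N ->
  measurable_fun `[0, T1] (fun t => cell_mass (len e) (rho (mu t) e) N i).
Proof.
move=> iN; apply: (@measurable_fun_cvg _ _ _ _
  (fun n t => \int[rho (mu t) e]_(x in edge_itv e) cell_hat (len e) N i n x)).
  move=> n; apply: within_measurable; apply: rho_continuous.
  by apply: continuous_subspaceT => x; exact: cell_hat_continuous.
move=> t _.
have mC : measurable (cell (len e) N i : set T) by exact: measurable_cell.
have -> : cell_mass (len e) (rho (mu t) e) N i = \int[rho (mu t) e]_(x in edge_itv e) (\1_(cell (len e) N i) x).
  rewrite /cell_mass /Rintegral integral_indic//.
  by rewrite (setIidl (@cell_sub _ _ N i)).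
have fin : (rho (mu t) e (edge_itv e) < +oo)%E by rewrite -ge0_fin_numE// fin_num_measure//; exact: mE.
apply: (Rintegral_dct (mu := rho (mu t) e) (g := cst 1) (mE e) _ _ _ _ _).2.
- by move=> n; apply: measurable_funTS; apply: continuous_measurable_fun; exact: cell_hat_continuous.
- by apply: measurable_funTS; exact: measurable_indic.
- apply: aeW => x; rewrite /edge_itv /= in_itv /= => xl; exact: cell_hat_cvg.
- apply: (bounded_integrable (mu := rho (mu t) e) (mE e) fin (K := 1)) => //.
  by move=> x _; rewrite /cst normr1.
- by apply: aeW => x _ n; exact: cell_hat_le1.
Qed.

End TimeMeasurability.

Section AlmostEveryTime.
Context {R : realType} {G : metric_graph R}.
Local Notation T := (measurableTypeR R).
Local Notation leb := (@lebesgue_measure R).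
Variables (ref : prob G) (P : edge G -> R -> R) (d : edge G -> R) (kappa : edge G -> node G -> R).
Hypothesis omega_gt0 : forall v, 0 < gam ref v.
Hypothesis P_lip : forall e, [lipschitz P e x | x in edge_itv e].
Hypothesis pi_density : forall e (A : set R), measurable A ->
  rho ref e A = (\int[leb]_(x in A `&` edge_itv e) (expR (- P e x))%:E)%E.
Hypothesis d_gt0 : forall e, 0 < d e.
Hypothesis kappa_gt0 : forall e v, v \in ends e -> 0 < kappa e v.
Variables (T1 : R) (mu : R -> prob G) (j : R -> flux G).
Hypothesis ncont : narrowly_continuous T1 mu.
Hypothesis mflux : measurable_flux T1 j.
Local Notation D := (`[0, T1]%classic : set T).
Let B t := (rate d kappa (mu t) (j t) + slope ref d kappa (mu t))%E.
Hypothesis iB : (\int[leb]_(t in D) B t < +oo)%E.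

Let mD : measurable D. Proof. exact: measurable_itv. Qed.
Let l0 (e : edge G) : 0 < len e := len_gt0 e.
Let wpi e := cell_mass_pi_gt0 (l0 e) (P_lip e) (@pi_density e).
Let B0 t : D t -> (0 <= B t)%E.
Proof. by move=> _; rewrite adde_ge0//; [exact: rate_ge0|exact: slope_ge0]. Qed.
Let Cgood m f (h : (rate d kappa m f + slope ref d kappa m < +oo)%E) :
  exists q p b, good ref m f q p b.
Proof.
have [C _ HC] := finite_good omega_gt0 P_lip pi_density d_gt0 kappa_gt0.
by have [q [p [b [g _]]]] := HC m f h; exists q, p, b.
Qed.
Let not_bad (J : countType) := ae_not_bad mD B0 iB (J := J).

Lemma measurable_inv_ge0 (f : T -> R) : (forall x, 0 <= f x) -> measurable_fun D f ->
  measurable_fun D (fun x => (f x)^-1).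
Proof.
move=> f0 mf; have -> : (fun x => (f x)^-1) = (fun x => \1_[set y | 0 < y] (f x) * expR (- ln (f x))).
  apply/funext => x; rewrite indicE; have := f0 x; rewrite le_eqVlt => /orP[/eqP <-|fx].
    by rewrite invr0 memNset ?mul0r//= ltxx.
  by rewrite mem_set// mul1r expRN lnK.
apply: measurable_funM; last first.
  apply: measurableT_comp => //; apply: measurableT_comp => //.
  exact: measurableT_comp mf.
apply: measurableT_comp mf; apply: measurable_indic.
rewrite (_ : [set y | 0 < y] = `]0, +oo[%classic); first exact: measurable_itv.
by apply/seteqP; split => y; rewrite /= in_itv /= andbT.
Qed.

Let mcell_mass e N i : measurable_fun D (fun t => (i < 2 ^ N)%N%:R * cell_mass (len e) (rho (mu t) e) N i).
Proof.
case: ltnP => iN; last by rewrite (_ : (fun t => _) = cst 0) ?measurable_cst//; apply/funext => t; rewrite mul0r.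
by rewrite (_ : (fun t => _) = (fun t => cell_mass (len e) (rho (mu t) e) N i)); [exact: cell_mass_measurable|apply/funext => t; rewrite mul1r].
Qed.

Let mcell_charge e N i : measurable_fun D (fun t => cell_charge (len e) (jint (j t) e) N i).
Proof.
apply: measurableT_comp => //.
by apply: mflux.2; exact: measurable_cell.
Qed.

Let msqrt (f : T -> R) : measurable_fun D f -> measurable_fun D (fun t => Num.sqrt (f t)).
Proof. by move=> mf; apply: measurableT_comp mf; apply: continuous_measurable_fun; exact: sqrt_continuous. Qed.

Let mcell_root e N i : (i < 2 ^ N)%N -> measurable_fun D (fun t => cell_root (len e) (rho (mu t) e) (rho ref e) N i).
Proof. by move=> iN; apply: msqrt; apply: measurable_funM; [exact: cell_mass_measurable|exact: measurable_cst]. Qed.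

Lemma ae_fisher e : {ae leb, forall t, D t -> exists k : nat, forall N : nat,
  fisher_sum (len e) (rho (mu t) e) (rho ref e) N - k%:R <= 0}.
Proof.
apply: not_bad.
  move=> k N; apply: measurable_funB; last exact: measurable_cst.
  apply: measurable_funM; first exact: measurable_cst.
  apply: measurable_sum => i; apply: measurable_funX.
  have iN : (i.+1 < 2 ^ N)%N by rewrite -ltn_predRL.
  by apply: measurable_funB; apply: mcell_root => //; exact: ltnW.
move=> t Dt /Cgood[q [p [b gd]]].
have [iq Lp q0 rE] := good_H1 gd e.
have q0' x : edge_itv e x -> 0 <= q e x by rewrite /edge_itv /= in_itv; exact: q0.
exists (Num.truncn (4 * len e * \int[leb]_(x in edge_itv e) (p e x ^+ 2))).+1 => N.
rewrite subr_le0; apply: le_trans (ltW (truncnS_gt _)).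
exact: (fisher_le (l0 e) (wpi e) iq Lp q0' rE N).
Qed.

Lemma ae_charge e : {ae leb, forall t, D t -> exists k : nat, forall N : nat,
  \sum_(i < (2 ^ N)%N) cell_charge (len e) (jint (j t) e) N i ^+ 2 / cell_mass (len e) (rho (mu t) e) N i - k%:R <= 0}.
Proof.
apply: not_bad.
  move=> k N; apply: measurable_funB; last exact: measurable_cst.
  apply: measurable_sum => i; apply: measurable_funM; first exact: measurable_funX.
  by apply: measurable_inv_ge0; [move=> x; exact: cell_mass_ge0|exact: cell_mass_measurable].
move=> t Dt /Cgood[q [p [b gd]]].
exists (Num.truncn (\int[rho (mu t) e]_(x in edge_itv e) (b e x ^+ 2))).+1 => N.
rewrite subr_le0; apply: le_trans (ltW (truncnS_gt _)).
exact: (cell_charge_le (l0 e) (good_density gd e) (good_L2 gd e) N).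
Qed.

(** The left-hand side is positive exactly if some cell has mass 0 and nonzero flux. *)
Lemma ae_charge0 e : {ae leb, forall t, D t -> exists k : nat, forall Ni : nat * nat,
  (Ni.2 < 2 ^ Ni.1)%N%:R * (cell_charge (len e) (jint (j t) e) Ni.1 Ni.2 ^+ 2 *
    \1_[set 0] ((Ni.2 < 2 ^ Ni.1)%N%:R * cell_mass (len e) (rho (mu t) e) Ni.1 Ni.2)) <= 0}.
Proof.
apply: not_bad.
  move=> _ [N i]; apply: measurable_funM; first exact: measurable_cst.
  apply: measurable_funM; first exact: measurable_funX.
  by apply: measurableT_comp (mcell_mass e N i); apply: measurable_indic; exact: measurable_set1.
move=> t Dt /Cgood[q [p [b gd]]]; exists 0%N => -[N i] /=.
case: ltnP => iN; last by rewrite mul0r.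
rewrite !mul1r indicE; case: (boolP (_ \in _)) => [|_]; last by rewrite mulr0.
rewrite inE /= => w0; rewrite mulr1.
suff -> : cell_charge (len e) (jint (j t) e) N i = 0 by rewrite expr0n.
have [ib jE] := good_density gd e.
have mC : measurable (cell (len e) N i : set T) by exact: measurable_cell.
rewrite /cell_charge jE// null_set_integral//.
  by apply/measurable_EFinP/measurable_funTS; exact: Rint_measurable ib.
by have := fineK (fin_num_measure (rho (mu t) e) _ mC); rewrite -[fine _]/(cell_mass (len e) (rho (mu t) e) N i) w0.
Qed.

Lemma ae_node0 e v : v \in ends e -> {ae leb, forall t, D t -> exists k : nat, forall _ : unit,
  \1_[set 0] (gam (mu t) v) * jbar (j t) e v ^+ 2 <= 0}.
Proof.
move=> ve; apply: not_bad.
  move=> _ _; apply: measurable_funM; last by apply: measurable_funX; exact: mflux.1.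
  apply: measurableT_comp (within_measurable (gam_continuous ncont (v:=v))).
  by apply: measurable_indic; exact: measurable_set1.
move=> t Dt /Cgood[q [p [b gd]]]; exists 0%N => _.
rewrite indicE; case: (boolP (_ \in _)) => [|_]; last by rewrite mul0r.
by rewrite inE /= => g0; rewrite (good_node gd ve) ?expr0n ?mulr0// g0 mul0r.
Qed.

(** Either the flux through the node is 0 or the cell roots at the end point stay above
some [k.+1%:R^-1] from level [k] on, that is, the trace is positive. *)
Lemma ae_trace0 e v : v \in ends e -> {ae leb, forall t, D t -> exists k : nat, forall N : nat,
  jbar (j t) e v ^+ 2 * Num.max 0 ((k <= N)%N%:R * (k.+1%:R^-1 -
    cell_root (len e) (rho (mu t) e) (rho ref e) N (cell_idx (len e) N (end_point e v)))) <= 0}.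
Proof.
move=> ve; apply: not_bad.
  move=> k N; apply: measurable_funM; first by apply: measurable_funX; exact: mflux.1.
  apply: measurable_maxr; first exact: measurable_cst.
  apply: measurable_funM; first exact: measurable_cst.
  apply: measurable_funB; first exact: measurable_cst.
  by apply: mcell_root; exact: cell_idx_lt.
move=> t Dt /Cgood[q [p [b gd]]].
have [iq Lp q0 rE] := good_H1 gd e.
have q0' x : edge_itv e x -> 0 <= q e x by rewrite /edge_itv /= in_itv; exact: q0.
have [->|J0] := eqVneq (jbar (j t) e v) 0; first by exists 0%N => N; rewrite expr0n mul0r.
have qp : 0 < q e (end_point e v).
  rewrite lt_neqAle q0 ?end_point_itv// andbT eq_sym; apply: contra J0 => /eqP h; apply/eqP.
  by apply: (good_node gd ve); rewrite h mulr0.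
have eD : edge_itv e (end_point e v) by rewrite /edge_itv /= in_itv; exact: end_point_itv.
have q2 : 0 < q e (end_point e v) / 2 by rewrite divr_gt0.
have /cvgrPdist_le/(_ _ q2)[M _ HM] := cell_root_cvg (l0 e) (wpi e) iq Lp q0' rE eD.
pose k := maxn M (Num.truncn (q e (end_point e v) / 2)^-1).
exists k => N; rewrite [X in _ * X]max_l ?mulr0//.
case: leqP => kN; last by rewrite mul0r.
rewrite mul1r subr_le0.
have := HM N (leq_trans (leq_maxl _ _) kN); rewrite /= ler_norml => /andP[_ h].
have kq : k.+1%:R^-1 <= q e (end_point e v) / 2.
  rewrite -[leRHS]invrK lef_pV2 ?posrE ?invr_gt0//; apply: (le_trans (ltW (truncnS_gt _))).
  by rewrite ler_nat ltnS; exact: leq_maxr.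
by apply: (le_trans kq); move: h; move: (cell_root _ _ _ _ _) (q e _) => u v'; lra.
Qed.

Lemma ae_good : {ae leb, forall t, D t -> exists q p b, good ref (mu t) (j t) q p b}.
Proof.
have h1 := ae_forall_fin ae_fisher.
have h2 := ae_forall_fin ae_charge.
have h3 := ae_forall_fin ae_charge0.
have h4 : {ae leb, forall t (ev : edge G * node G), D t -> ev.2 \in ends ev.1 ->
    \1_[set 0] (gam (mu t) ev.2) * jbar (j t) ev.1 ev.2 ^+ 2 <= 0}.
  apply: ae_forall_fin => -[e v].
  case: (boolP (v \in ends e)) => ve; last by apply: aeW => t _ /= h; case/negP: ve.
  by apply: ae_imply (ae_node0 ve) => t H Dt _; have [k] := H Dt; exact.
have h5 : {ae leb, forall t (ev : edge G * node G), D t -> ev.2 \in ends ev.1 ->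
    exists k : nat, forall N : nat, jbar (j t) ev.1 ev.2 ^+ 2 * Num.max 0 ((k <= N)%N%:R * (k.+1%:R^-1 -
    cell_root (len ev.1) (rho (mu t) ev.1) (rho ref ev.1) N (cell_idx (len ev.1) N (end_point ev.1 ev.2)))) <= 0}.
  apply: ae_forall_fin => -[e v].
  case: (boolP (v \in ends e)) => ve; last by apply: aeW => t _ /= h; case/negP: ve.
  by apply: ae_imply (ae_trace0 ve) => t H Dt _; exact: H.
apply: (ae_imply2 _ (ae_imply2 (fun x a b => conj a b) h1 h2) (ae_imply2 (fun x a b => conj a b) h3 (ae_imply2 (fun x a b => conj a b) h4 h5))).
move=> t [a1 a2] [a3 [a4 a5]] Dt.
have /choice[qp Hqp] : forall e, exists qp, H1_density (len e) (rho ref e) (rho (mu t) e) qp.1 qp.2.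
  move=> e; have [k Hk] := a1 e Dt.
  have FF N : fisher_sum (len e) (rho (mu t) e) (rho ref e) N <= k%:R by have := Hk N; rewrite subr_le0.
  have [q [p [iq Lp q0 rE]]] := fisher_rep (l0 e) (wpi e) FF.
  by exists (q, p); split => // x _; exact: q0.
have /choice[b Hb] : forall e, exists b, has_density (rho (mu t) e) (jint (j t) e) b /\ L2 (rho (mu t) e) (edge_itv e) b.
  move=> e; have [k Hk] := a2 e Dt; have [k' Hk'] := a3 e Dt.
  apply: (charge_rep (l0 e) (@jint_supp _ _ (j t) e) (F := k%:R)).
    move=> N i iN w0; have := Hk' (N, i); rewrite /= iN !mul1r w0 indicE mem_set//= mulr1 => h.
    by apply/eqP; rewrite -sqrf_eq0 eq_le h sqr_ge0.
  by move=> N; have := Hk N; rewrite subr_le0.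
exists (fun e => (qp e).1), (fun e => (qp e).2), b; split => //.
- by move=> e; case: (Hb e).
- by move=> e; case: (Hb e).
move=> e v ve /eqP; rewrite mulf_eq0 => /orP[/eqP g0|/eqP q0].
  have := a4 (e, v) Dt ve; rewrite /= g0 indicE mem_set//= mul1r => h.
  by apply/eqP; rewrite -sqrf_eq0 eq_le h sqr_ge0.
have [k Hk] := a5 (e, v) Dt ve.
apply: contrapT => /eqP J0.
have J2 : 0 < jbar (j t) e v ^+ 2 by rewrite lt_neqAle sqr_ge0 andbT eq_sym sqrf_eq0.
have [iq Lp q0' rE] := Hqp e.
have q0D x : edge_itv e x -> 0 <= (qp e).1 x by rewrite /edge_itv /= in_itv; exact: q0'.
have eD : edge_itv e (end_point e v) by rewrite /edge_itv /= in_itv; exact: end_point_itv.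
have := cell_root_cvg (l0 e) (wpi e) iq Lp q0D rE eD; rewrite q0 => cQ.
have kp : 0 < k.+1%:R^-1 :> R by rewrite invr_gt0.
have /cvgrPdist_lt/(_ _ kp)[M _ HM] := cQ.
have := HM (maxn M k) (leq_maxl _ _); rewrite /= sub0r normrN ltNge => /negP; apply.
have := Hk (maxn M k); rewrite leq_maxr mul1r /= pmulr_rle0// ge_max => /andP[_].
rewrite subr_le0 => h; apply: (le_trans h); exact: ler_norm.
Qed.
End AlmostEveryTime.

(** * Time derivative of the discrete energy *)

Section Calculus.
Context {R : realType}.
Local Notation T := (measurableTypeR R).

Lemma is_C1_derive (l : R) (f f' : R -> R) : (forall x : R, is_derive x 1 f (f' x)) -> continuous f' ->
  is_C1 l f f'.
Proof.
move=> df cf'; split; last exact: continuous_subspaceT.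
move=> x _; apply/cvgrPdist_le => e e0.
have [r r0 H] := (is_deriveP1 f x (f' x)).1 (df x) e e0.
rewrite near_withinE; exists r => // y /= xy yx _; move: yx => /= yx.
have n0 : y - x != 0 by rewrite subr_eq0.
have xy' : `|y - x| < r by rewrite distrC.
move: (H y xy'); rewrite -ler_pdivrMr ?normr_gt0// -normfV -normrM; apply: le_trans.
rewrite distrC le_eqVlt; apply/orP; left; apply/eqP; congr (`| _ |); field.
exact: n0.
Qed.

Lemma is_derive_fsum (I : Type) (s : seq I) (F : I -> R -> R) (dF : I -> R) (t : R) :
  (forall i, is_derive t 1 (F i) (dF i)) ->
  is_derive t 1 (fun t => \sum_(i <- s) F i t) (\sum_(i <- s) dF i).
Proof.
move=> H; elim: s => [|i s IH].
  rewrite big_nil; have -> : (fun t => \sum_(i <- [::]) F i t) = cst 0 by apply/funext => x; rewrite big_nil.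
  exact: is_derive_cst.
rewrite big_cons; have -> : (fun t => \sum_(i <- i :: s) F i t) = F i + (fun t => \sum_(i <- s) F i t).
  by apply/funext => x; rewrite big_cons.
exact: is_deriveD.
Qed.

Lemma ac_fsum a b (I : Type) (s : seq I) (F : I -> R -> R) :
  (forall i, absolutely_continuous_on a b (F i)) ->
  absolutely_continuous_on a b (fun t => \sum_(i <- s) F i t).
Proof.
move=> H; elim: s => [|i s IH].
  by apply: (ac_congr _ (ac_cst a b 0)) => x _; rewrite big_nil.
apply: (ac_congr _ (ac_lin 1 (H i) IH)) => x _; rewrite big_cons mul1r//.
Qed.

Variables (dl w : R).
Hypothesis d0 : 0 < dl.
Hypothesis d1 : dl <= 1.
Hypothesis w0 : 0 < w.

Lemma reg_eta_lip (r s : R) : 0 <= r -> 0 <= s ->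
  `|reg_eta dl r - reg_eta dl s| <= (- ln dl) * `|r - s|.
Proof.
wlog : r s / reg_eta dl s <= reg_eta dl r.
  move=> W r0 s0; have [h|/ltW h] := leP (reg_eta dl s) (reg_eta dl r); first exact: W.
  by rewrite distrC [`|r - s|]distrC; exact: W.
move=> h r0 s0; rewrite ger0_norm ?subr_ge0//.
have := reg_eta_tangent d0 d1 s0 r0 => h1.
apply: (@le_trans _ _ (reg_log dl r * (r - s))).
  by move: h1; move: (reg_log dl r) (reg_eta dl r) (reg_eta dl s) => a b c; lra.
by apply: (le_trans (ler_norm _)); rewrite normrM; apply: ler_wpM2r => //; exact: reg_log_bound.
Qed.

(** [reg_eta] is Lipschitz, unlike [eta]. *)
Lemma entropy_term_ac a b (M : R -> R) : (forall x, 0 <= M x) -> absolutely_continuous_on a b M ->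
  absolutely_continuous_on a b (fun x => w * reg_eta dl (M x / w)).
Proof.
move=> M0 acM; apply: (ac_lip (f := fun z => w * reg_eta dl (z / w)) (K := - ln dl)) acM => x y _ _.
rewrite -mulrBr normrM (gtr0_norm w0) -ler_pdivlMl//.
have h (z : R) : 0 <= z -> 0 <= z / w by move=> z0; rewrite divr_ge0// ltW.
apply: (le_trans (reg_eta_lip (h _ (M0 x)) (h _ (M0 y)))).
by rewrite -mulrBl normrM normfV (gtr0_norm w0) [w^-1 * _]mulrC mulrA.
Qed.

Lemma entropy_term_derive (M : R -> R) (m t : R) : 0 <= M t -> is_derive t 1 M m ->
  is_derive t 1 (fun x => w * reg_eta dl (M x / w)) (reg_log dl (M t / w) * m).
Proof.
move=> M0 dM.
have dMw : is_derive t 1 (fun x => M x / w) (m / w).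
  have -> : (fun x => M x / w) = w^-1 *: M by apply/funext => x; rewrite /GRing.scale /= mulrC.
  by rewrite mulrC; exact: is_deriveZ.
have r0 : 0 <= M t / w by rewrite divr_ge0// ltW.
have h := is_derive1_comp (f := reg_eta dl) (g := fun x => M x / w) (reg_eta_derive d0 r0) dMw.
have -> : reg_log dl (M t / w) * m = w * (reg_log dl (M t / w) * (m / w)).
  by move: (reg_log _ _) => a; field; rewrite gt_eqF.
exact: is_deriveZ.
Qed.

End Calculus.

Section ChargeLinear.
Context {R : realType}.
Local Notation T := (measurableTypeR R).
Variables (j : {charge set T -> \bar R}) (l : R).
Local Notation D := (`[0, l]%classic : set T).

Let mD : measurable D. Proof. exact: measurable_itv. Qed.

Lemma charge_integral_sum (n : nat) (c : nat -> R) (F : nat -> R -> R) : 0 <= l ->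
  (forall i, {within `[0, l], continuous (F i)}) ->
  fine (charge_integral j D (fun x => \sum_(i < n) c i * F i x)) =
  \sum_(i < n) c i * fine (charge_integral j D (F i)).
Proof.
move=> l0 cF; rewrite /charge_integral; set jp := jordan_pos _; set jn := jordan_neg _.
have ib (m : {finite_measure set T -> \bar R}) i : m.-integrable D (EFin \o F i).
  have [K K0 H] := within_bounded l0 (cF i).
  apply: (bounded_integrable (mu := m) mD _ (within_measurable (cF i)) (K := K)).
    by rewrite -ge0_fin_numE// fin_num_measure.
  by move=> x; rewrite /= in_itv; exact: H.
have ip i : jp.-integrable D (EFin \o F i) by exact: ib.
have iN i : jn.-integrable D (EFin \o F i) by exact: ib.
have E i : fine (\int[jp]_(x in D) (F i x)%:E - \int[jn]_(x in D) (F i x)%:E)%E =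
    \int[jp]_(x in D) F i x - \int[jn]_(x in D) F i x.
  by rewrite -!EFin_Rint.
have [isp sp] := Rint_sum (mu := jp) (index_enum _) mD (fun i : 'I_n => RintZ (c i) mD (ip i)).
have [isn sn] := Rint_sum (mu := jn) (index_enum _) mD (fun i : 'I_n => RintZ (c i) mD (iN i)).
rewrite -!EFin_Rint//= sp sn -sumrB; apply: eq_bigr => i _.
by rewrite E !RintegralZl// mulrBr.
Qed.

Lemma charge_integral0 : charge_integral j D (cst 0) = 0%E.
Proof. by rewrite /charge_integral !integral0 subee. Qed.

End ChargeLinear.

Section EnergyInTime.
Context {R : realType} {G : metric_graph R}.
Local Notation T := (measurableTypeR R).
Local Notation leb := (@lebesgue_measure R).
Variables (ref : prob G) (P : edge G -> R -> R).
Hypothesis omega_gt0 : forall v, 0 < gam ref v.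
Hypothesis P_lip : forall e, [lipschitz P e x | x in edge_itv e].
Hypothesis pi_density : forall e (A : set R), measurable A ->
  rho ref e A = (\int[leb]_(x in A `&` edge_itv e) (expR (- P e x))%:E)%E.
Variables (T1 : R) (mu : R -> prob G) (j : R -> flux G).
Hypothesis mu_j_CE : CE T1 mu j.

Let l0 (e : edge G) : 0 < len e := len_gt0 e.
Let wpi e := cell_mass_pi_gt0 (l0 e) (P_lip e) (@pi_density e).

Definition flux_node (f : flux G) v : R := \sum_(e in edges_at v) jbar f e v.
Definition flux_edge (f : flux G) e (g g' : R -> R) : R :=
  fine (charge_integral (jint f e) (edge_itv e) g')
  - \sum_(v | e \in edges_at v) g (end_point e v) * jbar f e v.

Lemma flux_pairing_node (f : flux G) v :
  flux_pairing (node_ind v) (fun=> cst 0) (fun=> cst 0) f = flux_node f v.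
Proof.
rewrite /flux_pairing [X in _ + X]big1 ?addr0; last by move=> e _; rewrite charge_integral0.
rewrite (bigD1 v)//= [X in _ + X]big1 ?addr0; last first.
  by move=> w /negbTE wv; apply: big1 => e _; rewrite /node_ind wv subrr mul0r.
by apply: eq_bigr => e _; rewrite /node_ind eqxx subr0 mul1r.
Qed.

Lemma flux_pairing_edge (f : flux G) e g g' :
  flux_pairing (fun=> 0) (edge_fun e g) (edge_fun e g') f = flux_edge f e g g'.
Proof.
rewrite /flux_pairing addrC /flux_edge; congr (_ + _).
  rewrite (bigD1 e)//= /edge_fun eqxx big1 ?addr0// => e' /negbTE ->.
  by rewrite charge_integral0.
rewrite (exchange_big_dep xpredT)//= (bigD1 e)//= [X in _ + X]big1 ?addr0; last first.
  by move=> e' /negbTE ee; apply: big1 => v _; rewrite /edge_fun ee subrr mul0r.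
by rewrite -sumrN; apply: eq_bigr => v _; rewrite /edge_fun eqxx sub0r mulNr.
Qed.

Lemma gam_ac v : absolutely_continuous_on 0 T1 (fun t => gam (mu t) v) /\
  {ae leb, forall t, t \in `]0, T1[ -> is_derive t 1 (fun t => gam (mu t) v) (flux_node (j t) v)}.
Proof.
have [_ _ _ test] := mu_j_CE.
have c1 (e : edge G) : is_C1 (len e) (cst 0) (cst 0).
  by apply: is_C1_derive => x; exact: cvg_cst.
have [h1 h2] := test (node_ind v) (fun=> cst 0) (fun=> cst 0) c1.
have E : (fun t => pairing (node_ind v) (fun=> cst 0) (mu t)) = (fun t => gam (mu t) v).
  by apply/funext => t; exact: pairing_node.
rewrite E in h1 h2; split => //.
by apply: ae_imply h2 => t H /H; rewrite flux_pairing_node.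
Qed.

Lemma rho_ac e (g g' : R -> R) : (forall x : R, is_derive x 1 g (g' x)) -> continuous g' ->
  absolutely_continuous_on 0 T1 (fun t => \int[rho (mu t) e]_(x in edge_itv e) g x) /\
  {ae leb, forall t, t \in `]0, T1[ ->
    is_derive t 1 (fun t => \int[rho (mu t) e]_(x in edge_itv e) g x) (flux_edge (j t) e g g')}.
Proof.
move=> dg cg'; have [_ _ _ test] := mu_j_CE.
have c1 (e' : edge G) : is_C1 (len e') (edge_fun e g e') (edge_fun e g' e').
  rewrite /edge_fun; case: eqP => [->|_]; first exact: is_C1_derive.
  by apply: is_C1_derive => x; exact: cvg_cst.
have [h1 h2] := test (fun=> 0) (edge_fun e g) (edge_fun e g') c1.
have E : (fun t => pairing (fun=> 0) (edge_fun e g) (mu t)) =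
    (fun t => \int[rho (mu t) e]_(x in edge_itv e) g x).
  by apply/funext => t; exact: pairing_edge.
rewrite E in h1 h2; split => //.
by apply: ae_imply h2 => t H /H; rewrite flux_pairing_edge.
Qed.

Section Regularised.
Variable dl : R.
Hypothesis d0 : 0 < dl.
Hypothesis d1 : dl <= 1.
Variable N : nat.

(** The flux pairing is linear in the test functions, so it splits into the rates of
change of the hat masses and of the node masses. *)
Lemma prod_discE (m : prob G) (f : flux G) : prod_disc ref dl N m f =
  \sum_e \sum_(i < (2 ^ N)%N.+1)
    reg_log dl (pou_mass (len e) (rho m e) N i / pou_mass (len e) (rho ref e) N i)
      * flux_edge f e (pou (len e) N i) (pou' (len e) N i)
  + \sum_v node_test ref dl m v * flux_node f v.
Proof.
rewrite /prod_disc /flux_pairing.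
pose c e i := reg_log dl (pou_mass (len e) (rho m e) N i / pou_mass (len e) (rho ref e) N i).
have cE e i : reg_log_sq dl (avg_sqrt (len e) (rho m e) (rho ref e) N i) = c e i.
  by rewrite /reg_log_sq /avg_sqrt sqr_sqrtr// divr_ge0// pou_mass_ge0.
have -> : \sum_e fine (charge_integral (jint f e) (edge_itv e) (edge_test' ref dl N m e)) =
    \sum_e \sum_(i < (2 ^ N)%N.+1) c e i * fine (charge_integral (jint f e) (edge_itv e) (pou' (len e) N i)).
  apply: eq_bigr => e _; rewrite -charge_integral_sum; last 2 first.
  - exact: ltW.
  - by move=> i; apply: continuous_subspaceT => x; exact: pou'_continuous.
  congr (fine (charge_integral _ _ _)); apply/funext => x.
  by apply: eq_bigr => i _; rewrite cE.
have -> : \sum_v \sum_(e in edges_at v) (node_test ref dl m v - edge_test ref dl N m e (end_point e v)) * jbar f e v =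
    \sum_v node_test ref dl m v * flux_node f v
    - \sum_e \sum_(v | e \in edges_at v) (\sum_(i < (2 ^ N)%N.+1) c e i * pou (len e) N i (end_point e v)) * jbar f e v.
  rewrite [X in _ - X](exchange_big_dep xpredT)//= -sumrB; apply: eq_bigr => v _.
  rewrite /flux_node mulr_sumr -sumrB; apply: eq_bigr => e _.
  rewrite mulrBl; congr (_ - _ * _).
  by apply: eq_bigr => i _; rewrite cE.
rewrite addrC addrA [in RHS]addrC -addrA addrC -addrA; congr (_ + _).
rewrite addrC -sumrB; apply: eq_bigr => e _.
under [in RHS]eq_bigr do rewrite /flux_edge mulrBr.
rewrite sumrB; congr (_ - _).
rewrite [RHS](eq_bigr (fun i : 'I__ => \sum_(v | e \in edges_at v) c e i * pou (len e) N i (end_point e v) * jbar f e v)); last first.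
  by move=> i _; rewrite mulr_sumr; apply: eq_bigr => v _; rewrite mulrA.
by rewrite exchange_big; apply: eq_bigr => v _; rewrite mulr_suml.
Qed.

Lemma energy_disc_ac : absolutely_continuous_on 0 T1 (fun t => energy_disc ref dl N (mu t)).
Proof.
rewrite /energy_disc.
have h1 : absolutely_continuous_on 0 T1 (fun t => \sum_e edge_energy_disc (len e) (rho (mu t) e) (rho ref e) dl N).
  apply: ac_fsum => e; apply: ac_fsum => i.
  have wp := pou_mass_gt0 (l0 e) (wpi e) (ltn_ord i : (i <= 2 ^ N)%N).
  apply: (entropy_term_ac d0 d1 wp (fun t => pou_mass_ge0 _ _ _ _)).
  exact: (rho_ac e (pou_derive (len e) N i) (@pou'_continuous _ (len e) N i)).1.
have h2 : absolutely_continuous_on 0 T1 (fun t => \sum_v gam ref v * reg_eta dl (gam (mu t) v / gam ref v)).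
  apply: ac_fsum => v; exact: (entropy_term_ac d0 d1 (omega_gt0 v) (fun t => gam_ge0 _ _) (gam_ac v).1).
by apply: (ac_congr _ (ac_lin 1 h1 h2)) => x _; rewrite mul1r.
Qed.

Lemma energy_disc_derive : {ae leb, forall t, t \in `]0, T1[ ->
  is_derive t 1 (fun t => energy_disc ref dl N (mu t)) (prod_disc ref dl N (mu t) (j t))}.
Proof.
have h1 := ae_forall_fin (fun v => (gam_ac v).2).
have h2 : {ae leb, forall t (ei : {e : edge G & 'I_(2 ^ N)%N.+1}), t \in `]0, T1[ ->
    is_derive t 1 (fun t => pou_mass (len (tag ei)) (rho (mu t) (tag ei)) N (tagged ei))
      (flux_edge (j t) (tag ei) (pou (len (tag ei)) N (tagged ei)) (pou' (len (tag ei)) N (tagged ei)))}.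
  apply: ae_forall_fin => -[e i] /=.
  exact: (rho_ac e (pou_derive (len e) N i) (@pou'_continuous _ (len e) N i)).2.
apply: (ae_imply2 _ h1 h2) => t a1 a2 tI; rewrite prod_discE.
apply: is_deriveD; [apply: is_derive_fsum => e; apply: is_derive_fsum => i|apply: is_derive_fsum => v].
  have wp := pou_mass_gt0 (l0 e) (wpi e) (ltn_ord i : (i <= 2 ^ N)%N).
  exact: (entropy_term_derive d0 wp (pou_mass_ge0 _ _ _ _) (a2 (existT _ e i) tI)).
exact: (entropy_term_derive d0 (omega_gt0 v) (gam_ge0 _ _) (a1 v tI)).
Qed.

End Regularised.
End EnergyInTime.

(** * Functions of time *)

Section RealLine.
Context {R : realType}.
Local Notation T := (measurableTypeR R).
Local Notation leb := (@lebesgue_measure R).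

Lemma cvg_ext (f g : nat -> R) (x : R) : (forall n, f n = g n) ->
  f n @[n --> \oo] --> x -> g n @[n --> \oo] --> x.
Proof. by move=> /funext ->. Qed.

Lemma ac_continuous a b (F : R -> R) : absolutely_continuous_on a b F -> {within `[a, b], continuous F}.
Proof.
move=> acF; rewrite continuous_subspace_in => x /set_mem Dx.
suff : F @ within `[a, b] (nbhs x) --> F x by rewrite nbhs_subspace_in.
apply/cvgrPdist_lt => e e0; have [r r0 H] := acF e e0.
rewrite near_withinE; exists r => // y /= xy Dy.
move: Dx Dy; rewrite /= !in_itv /= => /andP[ax xb] /andP[ay yb].
wlog xy' : x y ax xb ay yb xy / x <= y.
  move=> W; have [h|/ltW h] := leP x y; first exact: W.
  by rewrite distrC; apply: W => //; rewrite distrC.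
have := H 1%N (fun=> x) (fun=> y); rewrite !big_ord1 distrC; apply.
- by move=> _; split => //; split.
- by move=> i k _ _ _; rewrite !ord1.
- by move: xy; rewrite distrC ger0_norm// subr_ge0.
Qed.

Lemma ae_interior a b (Q : R -> Prop) : {ae leb, forall t, t \in `]a, b[ -> Q t} ->
  {ae leb, forall t, `[a, b]%classic t -> Q t}.
Proof.
move=> H; apply: (ae_imply2 _ H (ae_imply2 (fun x h1 h2 => conj h1 h2) (ae_neq a) (ae_neq b))) => t K [na nb].
rewrite /= in_itv /= => /andP[at_ tb]; apply: K; rewrite inE /= in_itv /= !lt_neqAle at_ tb !andbT.
by apply/andP; split; apply/eqP => // h; apply: na.
Qed.

(** The derivative is the almost everywhere limit of difference quotients of a
continuous function. *)
Lemma ac_derive_measurable a b (F A : R -> R) : absolutely_continuous_on a b F ->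
  {ae leb, forall t, t \in `]a, b[ -> is_derive t 1 F (A t)} ->
  exists2 g, measurable_fun (`[a, b] : set T) g & {ae leb, forall t, `[a, b]%classic t -> A t = g t}.
Proof.
move=> acF dF; have mD : measurable (`[a, b]%classic : set T) by exact: measurable_itv.
have mF := within_measurable (ac_continuous acF).
have mFD : measurable_fun setT (F \_ `[a, b]) by exact: (measurable_restrictT _ mD).1.
pose h n : R := n.+1%:R^-1; have h0 n : 0 < h n by rewrite invr_gt0.
have hc : h n @[n --> \oo] --> (0 : R) by exact: cvg_harmonic.
apply: (ae_measurable_rep (mu := leb) (D := `[a, b]) mD
  (f_ := fun n t => ((F \_ `[a, b]) (t + h n) - F t) / h n)).
  move=> n; apply: measurable_funM; last exact: measurable_cst.
  apply: measurable_funB => //; apply: measurableT_comp => //.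
  by apply: measurable_funD; [exact: measurable_id|exact: measurable_cst].
apply: ae_interior; apply: ae_imply dF => t H tI; have dt := H tI.
move: tI; rewrite inE /= in_itv /= => /andP[at_ tb].
apply/cvgrPdist_le => e e0.
have [r r0 K] := (is_deriveP1 F t (A t)).1 dt e e0.
have m0 : 0 < Num.min r (b - t) by rewrite lt_min r0 subr_gt0.
have /cvgrPdist_lt/(_ _ m0) := hc; apply: filterS => n.
rewrite sub0r normrN gtr0_norm// lt_min => /andP[hr hb].
have -> : (F \_ `[a, b]) (t + h n) = F (t + h n).
  rewrite patchE mem_set//= in_itv /=; apply/andP; split; last by lra.
  by apply: ltW; apply: (lt_le_trans at_); rewrite lerDl ltW.
have := K (t + h n); rewrite [t + h n - t]addrC addKr gtr0_norm// => /(_ hr).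
rewrite -ler_pdivrMr// -[X in _ / X](gtr0_norm (h0 n)) -normfV -normrM; apply: le_trans.
rewrite distrC le_eqVlt; apply/orP; left; apply/eqP; congr (`| _ |); field.
by rewrite gt_eqF.
Qed.

(** A set of full measure is dense. *)
Lemma continuous_ae_le a b (h : R -> R) (c : R) : a < b -> {within `[a, b], continuous h} ->
  {ae leb, forall t, `[a, b]%classic t -> h t <= c} -> forall t, a <= t <= b -> h t <= c.
Proof.
move=> ab ch [N [mN N0 sN]] t tab; rewrite leNgt; apply/negP => ht.
have Dt : `[a, b]%classic t by rewrite /= in_itv.
have : h @ within `[a, b] (nbhs t) --> h t.
  by have := ch t; rewrite /continuous_at nbhs_subspace_in.
have p : 0 < h t - c by rewrite subr_gt0.
move=> /cvgrPdist_lt/(_ _ p); rewrite near_withinE => -[r /= r0 H].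
case/andP: tab => at_ tb.
pose lo := Num.max a (t - r); pose hi := Num.min b (t + r).
have lohi : lo < hi by rewrite /lo /hi gt_max !lt_min; apply/andP; split; apply/andP; split; lra.
have : (leb `]lo, hi[ <= leb N)%E.
  apply: le_measure; rewrite ?inE//.
  move=> s; rewrite /= in_itv /= gt_max lt_min => /andP[/andP[as_ ts] /andP[sb st]].
  apply: sN => /= K.
  have Ds : `[a, b]%classic s by rewrite /= in_itv /= !ltW.
  have := H s _ Ds; rewrite /ball_ /=.
  have -> : `|t - s| < r by rewrite ltr_norml; apply/andP; split; lra.
  move=> /(_ isT); have := K Ds; rewrite ltr_norml => h1 /andP[h2 h3]; lra.
by rewrite leb_oo ?(ltW lohi)// N0 lee_fin subr_le0 leNgt lohi.
Qed.

Lemma sum_sup_le (I : finType) (A : I -> set R) (K : R) : (forall i, A i !=set0) ->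
  (forall i, has_ubound (A i)) ->
  (forall f : I -> R, (forall i, A i (f i)) -> \sum_i f i <= K) -> \sum_i sup (A i) <= K.
Proof.
move=> A0 Au H; apply/ler_addgt0Pl => e e0.
pose e1 := e / (#|I|.+1%:R); have e10 : 0 < e1 by rewrite divr_gt0.
have /choice[f Hf] : forall i, exists y, A i y /\ sup (A i) - e1 < y.
  move=> i; have [y Ay h] := sup_adherent e10 (conj (A0 i) (Au i)).
  by exists y.
apply: (@le_trans _ _ (\sum_i (e1 + f i))).
  by apply: ler_sum => i _; have [_ h] := Hf i; lra.
rewrite big_split /=; apply: lerD; last by apply: H => i; case: (Hf i).
rewrite sumr_const -[e1 *+ _]mulr_natr /e1 mulrAC ler_pdivrMr//.
by apply: ler_wpM2l; [exact: ltW|rewrite ler_nat; exact: leqW].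
Qed.

End RealLine.

(** * The chain rule *)

Section ChainRule.
Context {R : realType} {G : metric_graph R}.
Local Notation T := (measurableTypeR R).
Local Notation leb := (@lebesgue_measure R).
Variables (ref : prob G) (P : edge G -> R -> R) (d : edge G -> R) (kappa : edge G -> node G -> R).
Hypothesis omega_gt0 : forall v, 0 < gam ref v.
Hypothesis P_lip : forall e, [lipschitz P e x | x in edge_itv e].
Hypothesis pi_density : forall e (A : set R), measurable A ->
  rho ref e A = (\int[leb]_(x in A `&` edge_itv e) (expR (- P e x))%:E)%E.
Hypothesis d_gt0 : forall e, 0 < d e.
Hypothesis kappa_gt0 : forall e v, v \in ends e -> 0 < kappa e v.
Variables (T1 : R) (mu : R -> prob G) (j : R -> flux G).
Hypothesis T1_gt0 : 0 < T1.
Hypothesis mu_j_CE : CE T1 mu j.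
Local Notation D := (`[0, T1]%classic : set T).
Let B t := (rate d kappa (mu t) (j t) + slope ref d kappa (mu t))%E.
Hypothesis iB : (\int[leb]_(t in D) B t < +oo)%E.

Let mD : measurable D. Proof. exact: measurable_itv. Qed.
Let l0 (e : edge G) : 0 < len e := len_gt0 e.
Let ncont : narrowly_continuous T1 mu. Proof. by case: mu_j_CE. Qed.
Let mflux : measurable_flux T1 j. Proof. by case: mu_j_CE. Qed.
Let B0 t : D t -> (0 <= B t)%E.
Proof. by move=> _; rewrite adde_ge0//; [exact: rate_ge0|exact: slope_ge0]. Qed.

Let hs n : R := n.+1%:R^-1.
Let hs0 n : 0 < hs n. Proof. by rewrite invr_gt0. Qed.
Let hs1 n : hs n <= 1. Proof. by rewrite invf_le1// ler1n. Qed.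
Let hsc : hs n @[n --> \oo] --> (0 : R). Proof. exact: cvg_harmonic. Qed.

Lemma jbar_norm_integrable : leb.-integrable D (EFin \o (fun t => jbar_norm (j t))).
Proof.
have [_ _ iM _] := mu_j_CE.
have jE t : jbar_norm (j t) = \sum_e \sum_(v in ends e) `|jbar (j t) e v|.
  rewrite /jbar_norm (exchange_big_dep xpredT)//=; apply: eq_bigr => e _.
  by apply: eq_bigl => v; rewrite inE.
apply/integrableP; split.
  apply/measurable_EFinP; rewrite (funext jE).
  apply: measurable_sum => e.
  rewrite (_ : (fun t => _) = (fun t => \sum_v if v \in ends e then `|jbar (j t) e v| else 0)); last first.
    by apply/funext => t; rewrite big_mkcond.
  apply: measurable_sum => v; case: (boolP (v \in ends e)) => [ve|_]; last exact: measurable_cst.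
  by apply: measurableT_comp => //; exact: mflux.1.
apply: le_lt_trans iM; apply: ge0_le_lower_integral => t _; first exact: abse_ge0.
have n0 : 0 <= jbar_norm (j t) by apply: sumr_ge0 => v _; apply: sumr_ge0.
rewrite /comp gee0_abs ?lee_fin// /flux_mass jE -sumEFin.
under eq_bigr do rewrite -sumEFin.
by rewrite leeDl//; apply: sume_ge0 => e _; exact: charge_tv_ge0.
Qed.

(** The densities are chosen for each time separately; no measurability in time of the
choice is asserted, only the quantities derived from it are limits of measurable ones. *)
Lemma good_choice : exists C0 q p b, 0 < C0 /\ {ae leb, forall t, D t ->
  good ref (mu t) (j t) (q t) (p t) (b t) /\
  ((B t < +oo)%E -> budget ref (mu t) (j t) (q t) (p t) (b t) (C0 * fine (B t)))}.
Proof.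
have [C0 C00 HC] := finite_good omega_gt0 P_lip pi_density d_gt0 kappa_gt0.
have ag := ae_good omega_gt0 P_lip pi_density d_gt0 kappa_gt0 ncont mflux iB.
pose K t (w : (edge G -> R -> R) * (edge G -> R -> R) * (edge G -> R -> R)) :=
  good ref (mu t) (j t) w.1.1 w.1.2 w.2 /\
  ((B t < +oo)%E -> budget ref (mu t) (j t) w.1.1 w.1.2 w.2 (C0 * fine (B t))).
have /choice[w Hw] : forall t, exists w, (exists w', K t w') -> K t w.
  move=> t; have [[w Kw]|n] := pselect (exists w', K t w'); first by exists w.
  by exists (fun _ _ => 0, fun _ _ => 0, fun _ _ => 0).
exists C0, (fun t => (w t).1.1), (fun t => (w t).1.2), (fun t => (w t).2); split => //.
apply: ae_imply ag => t H Dt; apply: (Hw t).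
have [h|h] := ltP (B t) +oo%E.
  have [q [p [b [g bd]]]] := HC _ _ h.
  by exists (q, p, b).
have [q [p [b g]]] := H Dt; exists (q, p, b); split => // h'.
by move: h; rewrite leNgt h'.
Qed.

Section Chosen.
Variables (C0 : R) (q p b : R -> edge G -> R -> R).
Hypothesis C00 : 0 < C0.
Hypothesis gd : {ae leb, forall t, D t -> good ref (mu t) (j t) (q t) (p t) (b t) /\
  ((B t < +oo)%E -> budget ref (mu t) (j t) (q t) (p t) (b t) (C0 * fine (B t)))}.

Let le_dissipation (C x k : R) t : D t -> 0 < C ->
  ((B t < +oo)%E -> `|x| <= C * (C0 * fine (B t)) + k) ->
  (`|x|%:E <= (C * C0)%:E * B t + k%:E)%E.
Proof.
move=> Dt Cp; have := B0 Dt; case: (B t) => [r| |] // _ h.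
  by have := h (ltry _); rewrite -EFinM -EFinD lee_fin mulrA.
by rewrite gt0_muley ?lte_fin ?mulr_gt0// addye// leey.
Qed.

Let X0 t : D t -> 0 <= C0 * fine (B t).
Proof. by move=> Dt; rewrite mulr_ge0 ?(ltW C00)// fine_ge0// B0. Qed.

(** The limit [N] to infinity in the integrated identity for the discrete energy. *)
Lemma reg_identity dl : 0 < dl -> dl <= 1 -> exists a, [/\ leb.-integrable D (EFin \o a),
  {ae leb, forall t, D t -> prod_reg ref P dl (mu t) (j t) (q t) (p t) (b t) = a t} &
  forall x, 0 <= x <= T1 ->
    energy_disc ref dl N (mu x) - energy_disc ref dl N (mu 0) @[N --> \oo] -->
    \int[leb]_(t in `[0, x]) a t].
Proof.
move=> d0 d1.
have acF N := energy_disc_ac omega_gt0 P_lip pi_density mu_j_CE d0 d1 N.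
have dF N := energy_disc_derive omega_gt0 P_lip pi_density mu_j_CE d0 N.
(* Measurable representatives of [prod_disc] exist because it is a derivative in time. *)
have /choice[g Hg] : forall N, exists g, measurable_fun D g /\
    {ae leb, forall t, D t -> prod_disc ref dl N (mu t) (j t) = g t}.
  by move=> N; have [g mg gE] := ac_derive_measurable (acF N) (dF N); exists g.
have gE : {ae leb, forall t, D t -> forall N, prod_disc ref dl N (mu t) (j t) = g N t}.
  have := ae_foralln (fun N => (Hg N).2).
  by apply: ae_imply => t H Dt N; exact: H.
have [C C1 HC] := prod_disc_le P_lip pi_density d0 d1.
have L0 : 0 <= - ln dl by rewrite oppr_ge0 ln_le0.
have [||||H iH gH] := @lower_dominated _ _ _ leb D mD g
    (fun t => 2 * (- ln dl) * jbar_norm (j t)) (C * C0) B (fun N => (Hg N).1) _ _ _ B0 iB.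
- exact: RintZ jbar_norm_integrable.
- move=> t _; apply: mulr_ge0; first by apply: mulr_ge0.
  by apply: sumr_ge0 => v _; apply: sumr_ge0.
- exact: mulr_gt0.
- apply: (ae_imply2 _ gE gd) => t h1 h2 Dt N; rewrite -h1//; apply: le_dissipation => // hB.
  have [gt bt] := h2 Dt; exact: HC gt (bt hB) (X0 Dt).
have [a ma aE] : exists2 a, measurable_fun D a &
    {ae leb, forall t, D t -> prod_reg ref P dl (mu t) (j t) (q t) (p t) (b t) = a t}.
  apply: (ae_measurable_rep (mu := leb) mD (fun N => (Hg N).1)).
  apply: (ae_imply2 _ gE gd) => t h1 h2 Dt; have [gt _] := h2 Dt.
  exact: cvg_ext (h1 Dt) (prod_disc_cvg P_lip pi_density gt d0 d1).
have cg : {ae leb, forall t, D t -> g N t @[N --> \oo] --> a t}.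
  apply: (ae_imply2 _ (ae_imply2 (fun x u v => conj u v) gE gd) aE) => t [h1 h2] h3 Dt; have [gt _] := h2 Dt.
  rewrite -h3//; exact: cvg_ext (h1 Dt) (prod_disc_cvg P_lip pi_density gt d0 d1).
exists a; split => //; first by have [] := Rintegral_dct (mu := leb) mD (fun N => (Hg N).1) ma cg iH gH.
move=> x /andP[x0 xT].
have xD : `[0, x]%classic `<=` D by exact: itvcc_sub.
have mx : measurable (`[0, x]%classic : set T) by exact: measurable_itv.
have ig N : leb.-integrable `[0, x] (EFin \o g N).
  apply: (integrableS (mu := leb) mD mx xD).
  apply/integrableP; split; first by apply/measurable_EFinP; exact: (Hg N).1.
  case/integrableP: iH => _; apply: le_lt_trans; apply: ae_ge0_le_lower_integral => //.
  apply: ae_imply gH => t h Dt; rewrite lee_fin; apply: (le_trans (h Dt N)); exact: ler_norm.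
have -> : (fun N => energy_disc ref dl N (mu x) - energy_disc ref dl N (mu 0)) =
    (fun N => \int[leb]_(t in `[0, x]) g N t).
  apply/funext => N; apply: (ac_ftc (F := fun t => energy_disc ref dl N (mu t))) => //.
    exact: ac_sub (acF N).
  apply: (ae_imply2 _ (dF N) gE) => t h1 h2 tI.
  move: (tI); rewrite inE /= in_itv /= => /andP[t0 tx].
  rewrite -h2; last by rewrite /= in_itv /= (ltW t0) (le_trans (ltW tx)).
  by apply: h1; rewrite inE /= in_itv /= t0 (lt_le_trans tx).
apply: (Rintegral_dct (mu := leb) mx _ _ _ (integrableS (mu := leb) mD mx xD iH) _).2.
- by move=> N; apply: measurable_funS (Hg N).1.
- by apply: measurable_funS ma.
- by apply: ae_imply cg => t h /xD; exact: h.
- by apply: ae_imply gH => t h /xD; exact: h.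
Qed.

(** The limit [d] to 0. The discrete energies are kept on the left, since at
exceptional times they are not known to converge to a regularised energy. *)
Lemma limit_identity : exists (a_ : nat -> R -> R) (a : R -> R), [/\ leb.-integrable D (EFin \o a),
  {ae leb, forall t, D t -> prod_lim ref P (mu t) (j t) (q t) (p t) (b t) = a t},
  (forall n x, 0 <= x <= T1 ->
    energy_disc ref (hs n) N (mu x) - energy_disc ref (hs n) N (mu 0) @[N --> \oo] -->
    \int[leb]_(t in `[0, x]) a_ n t) &
  forall x, 0 <= x <= T1 ->
    \int[leb]_(t in `[0, x]) a_ n t @[n --> \oo] --> \int[leb]_(t in `[0, x]) a t].
Proof.
have /choice[a_ Ha] := fun n => reg_identity (hs0 n) (hs1 n).
have ia n : leb.-integrable D (EFin \o a_ n) by case: (Ha n).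
have ma n := Rint_measurable (ia n).
have aE : {ae leb, forall t, D t -> forall n, prod_reg ref P (hs n) (mu t) (j t) (q t) (p t) (b t) = a_ n t}.
  have aEn n : {ae leb, forall t, D t -> prod_reg ref P (hs n) (mu t) (j t) (q t) (p t) (b t) = a_ n t}.
    by case: (Ha n).
  by have := ae_foralln aEn; apply: ae_imply => t H Dt n; exact: H.
have [C C1 HC] := prod_reg_le P_lip pi_density.
have [||||H iH aH] := @lower_dominated _ _ _ leb D mD a_ (cst 0) (C * C0) B ma _ _ _ B0 iB.
- by have := RintZ 0 mD jbar_norm_integrable; congr (is_true (integrable _ _ _)); apply/funext => t; rewrite /= mul0r.
- by [].
- exact: mulr_gt0.
- apply: (ae_imply2 _ aE gd) => t k1 k2 Dt n; rewrite -k1//; apply: le_dissipation => // hB.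
  have [gt bt] := k2 Dt; rewrite addr0; exact: HC gt (bt hB) (X0 Dt) (hs0 n) (hs1 n).
have [a mea aEl] : exists2 a, measurable_fun D a &
    {ae leb, forall t, D t -> prod_lim ref P (mu t) (j t) (q t) (p t) (b t) = a t}.
  apply: (ae_measurable_rep (mu := leb) mD ma).
  apply: (ae_imply2 _ aE gd) => t k1 k2 Dt; have [gt _] := k2 Dt.
  exact: cvg_ext (k1 Dt) (prod_reg_cvg omega_gt0 P_lip pi_density gt hs0 hsc).
have ca : {ae leb, forall t, D t -> a_ n t @[n --> \oo] --> a t}.
  apply: (ae_imply2 _ (ae_imply2 (fun x u v => conj u v) aE gd) aEl) => t [k1 k2] k3 Dt; have [gt _] := k2 Dt.
  rewrite -k3//; exact: cvg_ext (k1 Dt) (prod_reg_cvg omega_gt0 P_lip pi_density gt hs0 hsc).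
exists a_, a; split => //.
- by have [] := Rintegral_dct (mu := leb) mD ma mea ca iH aH.
- by move=> n; case: (Ha n).
move=> x /andP[x0 xT].
have xD : `[0, x]%classic `<=` D by exact: itvcc_sub.
have mx : measurable (`[0, x]%classic : set T) by exact: measurable_itv.
apply: (Rintegral_dct (mu := leb) mx _ _ _ (integrableS (mu := leb) mD mx xD iH) _).2.
- by move=> n; apply: measurable_funS (ma n).
- by apply: measurable_funS mea.
- by apply: ae_imply ca => t k /xD; exact: k.
- by apply: ae_imply aH => t k /xD; exact: k.
Qed.

End Chosen.

Section Bounds.
Variables (I : R -> R) (c : R).
Hypothesis cI : {within `[0, T1], continuous I}.
Hypothesis EI : {ae leb, forall t, D t -> exists q p,
  (forall e, H1_density (len e) (rho ref e) (rho (mu t) e) (q e) (p e)) /\ energy_lim ref (mu t) q = c + I t}.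

Lemma dual_continuous e psi : continuous psi ->
  {within `[0, T1], continuous (fun t => dual_value (len e) (rho (mu t) e) (rho ref e) psi)}.
Proof.
move=> cpsi x; apply: cvgB; last exact: cvg_cst.
by apply: (rho_continuous ncont (e := e) (f := psi)); exact: continuous_subspaceT.
Qed.

Lemma reg_node_continuous dl v : 0 < dl ->
  {within `[0, T1], continuous (fun t => gam ref v * reg_eta dl (gam (mu t) v / gam ref v))}.
Proof.
move=> d0 x; apply: cvgM; first exact: cvg_cst.
have r0 : 0 <= gam (mu x) v / gam ref v by rewrite divr_ge0 ?gam_ge0// ltW.
apply: (@continuous_cvg _ _ _ _ _ _ (reg_eta dl)).
  apply: differentiable_continuous; apply/derivable1_diffP.
  by case: (reg_eta_derive d0 r0).
by apply: cvgM; [exact: gam_continuous|exact: cvg_cst].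
Qed.

(** The left-hand side is continuous in time and lies below the energy at almost every
time by the Fenchel-Young inequality. *)
Lemma dual_bound dl (psi : edge G -> R -> R) t : 0 < dl -> dl <= 1 ->
  (forall e, continuous (psi e)) -> 0 <= t <= T1 ->
  \sum_e dual_value (len e) (rho (mu t) e) (rho ref e) (psi e)
  + \sum_v gam ref v * reg_eta dl (gam (mu t) v / gam ref v) <= c + I t.
Proof.
move=> d0 d1 cpsi tT; rewrite -lerBlDr.
pose F t := \sum_e dual_value (len e) (rho (mu t) e) (rho ref e) (psi e)
  + \sum_v gam ref v * reg_eta dl (gam (mu t) v / gam ref v) - I t.
apply: (continuous_ae_le (h := F) T1_gt0 _ _ tT).
  move=> x; apply: cvgB; last exact: cI.
  apply: cvgD; [apply: cvg_sum_cond => e _|apply: cvg_sum_cond => v _].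
    by apply: dual_continuous; exact: cpsi.
  exact: reg_node_continuous.
apply: ae_imply EI => s H Ds; have [q [p [Hq E]]] := H Ds.
rewrite /F lerBlDr -E; apply: lerD; [apply: ler_sum => e _|apply: ler_sum => v _].
  have [iq _ _ rE] := Hq e.
  have cq := indef_continuous (ltW (l0 e)) iq.
  have [ie _] := edge_energy_reg_cvg (l0 e) (rho ref e) iq hs0 hs1 hsc.
  apply: (dual_value_le (l0 e) (@rho_supp _ _ (mu s) e) _ rE ie).
    by apply: measurable_funX; exact: within_measurable.
  by apply: continuous_subspaceT; exact: cpsi.
apply: ler_wpM2l; first exact: ltW.
by apply: reg_eta_le => //; rewrite divr_ge0 ?gam_ge0// ltW.
Qed.

(** [dual_bound] for independent choices of [psi] on the edges allows to take the
supremum edge by edge. *)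
Lemma energy_le_indef t : 0 <= t <= T1 -> (energy ref (mu t) <= (c + I t)%:E)%E.
Proof.
move=> tT; pose nodes := \sum_v gam ref v * eta (gam (mu t) v / gam ref v).
have gr0 v : 0 <= gam (mu t) v / gam ref v by rewrite divr_ge0 ?gam_ge0// ltW.
have HK psi : (forall e, continuous (psi e)) ->
    \sum_e dual_value (len e) (rho (mu t) e) (rho ref e) (psi e) <= c + I t - nodes.
  move=> cpsi; rewrite lerBrDr.
  have cv : \sum_e dual_value (len e) (rho (mu t) e) (rho ref e) (psi e) +
      \sum_v gam ref v * reg_eta (hs n) (gam (mu t) v / gam ref v) @[n --> \oo] -->
      \sum_e dual_value (len e) (rho (mu t) e) (rho ref e) (psi e) + nodes.
    apply: cvgD; first exact: cvg_cst.
    apply: cvg_sum_cond => v _; apply: cvgM; first exact: cvg_cst.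
    exact: (reg_eta_cvg hs0 hsc).
  by apply: (cvgr_to_le cv); apply: nearW => n; exact: dual_bound.
pose A e := [set y | exists2 psi, continuous psi & y = dual_value (len e) (rho (mu t) e) (rho ref e) psi].
have c0 : continuous (cst 0 : R -> R) by move=> x; exact: cvg_cst.
have dv0 e : dual_value (len e) (rho (mu t) e) (rho ref e) (cst 0) = 0 by exact: dual_value0.
have Au e : has_ubound (A e).
  exists (c + I t - nodes) => y [psi cpsi ->].
  have := HK (edge_fun e psi); rewrite (bigD1 e)//= /edge_fun eqxx big1 ?addr0; last first.
    by move=> e' /negbTE ->; exact: dv0.
  by apply => e'; case: eqP.
have A0 e : A e !=set0 by exists 0, (cst 0).
have : \sum_e sup (A e) <= c + I t - nodes.
  apply: sum_sup_le => // f Hf.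
  have /choice[psi Hpsi] : forall e, exists psi, continuous psi /\ f e = dual_value (len e) (rho (mu t) e) (rho ref e) psi.
    by move=> e; have [psi cpsi fE] := Hf e; exists psi.
  rewrite (eq_bigr (fun e => dual_value (len e) (rho (mu t) e) (rho ref e) (psi e))).
    by apply: HK => e; case: (Hpsi e).
  by move=> e _; case: (Hpsi e).
rewrite lerBrDr -lee_fin; apply: le_trans.
rewrite EFinD -!sumEFin; apply: leeD; [apply: lee_sum => e _|apply: lee_sum => v _].
  apply: (dual_relent (l0 e) _ (@rho_supp _ _ (mu t) e) (@rho_supp _ _ ref e)) => psi cpsi.
  by apply: ub_le_sup => //; exists psi.
by rewrite node_relentE.
Qed.

End Bounds.

(** The constant [c] is fixed at one good time [t0] rather than at time 0, where the
discrete energies are not known to converge to the energy. *)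
Lemma energy_identity : exists (a : R -> R) (c : R), [/\ leb.-integrable D (EFin \o a),
  {ae leb, forall t, D t -> energy_production ref (mu t) (j t) = (a t)%:E} &
  forall t, 0 <= t <= T1 -> energy ref (mu t) = (c + \int[leb]_(s in `[0, t]) a s)%:E].
Proof.
have [C0 [q [p [b [C00 gd]]]]] := good_choice.
have [a_ [a [ia aE Ha_ Ha]]] := limit_identity C00 gd.
pose I x := \int[leb]_(s in `[0, x]) a s.
pose I_ n x := \int[leb]_(s in `[0, x]) a_ n s.
have iI : indef 0 T1 I a by split => // x _; rewrite /I set_itv1 Rintegral_set1 add0r.
have cI := indef_continuous (ltW T1_gt0) iI.
have [t0 Dt0 [g0 _]] : exists2 t, D t & good ref (mu t) (j t) (q t) (p t) (b t) /\
    ((B t < +oo)%E -> budget ref (mu t) (j t) (q t) (p t) (b t) (C0 * fine (B t))).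
  apply: contrapT => no.
  have h1 : {ae leb, forall t, `[0, T1]%classic t -> (cst 1 : R -> R) t <= 0}.
    by apply: ae_imply gd => t H Dt; exfalso; apply: no; exists t => //; exact: H.
  have c1 : {within `[0, T1], continuous (cst 1 : R -> R)} by move=> x; exact: cvg_cst.
  have := continuous_ae_le T1_gt0 c1 h1 (t := 0); rewrite lexx (ltW T1_gt0) /= => /(_ isT).
  by rewrite ler10.
have t0T : 0 <= t0 <= T1 by move: Dt0; rewrite /= in_itv.
pose c := energy_lim ref (mu t0) (q t0) - I t0.
have discE n x : 0 <= x <= T1 -> energy_disc ref (hs n) N (mu x) @[N --> \oo] -->
    I_ n x - I_ n t0 + energy_reg ref (hs n) (mu t0) (q t0).
  move=> xT; have c1 := Ha_ n x xT; have c2 := Ha_ n t0 t0T.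
  have c3 := energy_disc_cvg P_lip pi_density (good_H1 g0) (hs0 n) (hs1 n).
  apply: cvg_ext (cvgD (cvgB c1 c2) c3) => N.
  (* The unknown energy at time 0 cancels in the difference of the identities at [x] and [t0]. *)
  have E (u u0 z : R) : u - z - (u0 - z) + u0 = u by ring.
  exact: E.
have regE x : 0 <= x <= T1 -> I_ n x - I_ n t0 + energy_reg ref (hs n) (mu t0) (q t0) @[n --> \oo] --> c + I x.
  move=> xT; have -> : c + I x = I x - I t0 + energy_lim ref (mu t0) (q t0) by rewrite /c; ring.
  apply: cvgD; first by apply: cvgB; exact: Ha.
  exact: (energy_reg_cvg (good_H1 g0) hs0 hs1 hsc).
have EI : {ae leb, forall t, D t -> exists q p,
    (forall e, H1_density (len e) (rho ref e) (rho (mu t) e) (q e) (p e)) /\ energy_lim ref (mu t) q = c + I t}.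
  apply: ae_imply gd => t H Dt; have [gt _] := H Dt; exists (q t), (p t); split; first exact: good_H1 gt.
  have tT : 0 <= t <= T1 by move: Dt; rewrite /= in_itv.
  have E n : energy_reg ref (hs n) (mu t) (q t) = I_ n t - I_ n t0 + energy_reg ref (hs n) (mu t0) (q t0).
    apply: (cvg_unique _ (energy_disc_cvg P_lip pi_density (good_H1 gt) (hs0 n) (hs1 n)) (discE n t tT)).
    exact: Rhausdorff.
  have := energy_reg_cvg (good_H1 gt) hs0 hs1 hsc; under eq_fun do rewrite E.
  by move=> cv; apply: (cvg_unique _ cv (regE t tT)); exact: Rhausdorff.
exists a, c; split => //.
  apply: (ae_imply2 _ gd aE) => t k1 k2 Dt; have [gt _] := k1 Dt.
  by rewrite (energy_productionE omega_gt0 P_lip pi_density gt) k2.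
move=> t tT; apply/eqP; rewrite eq_le (energy_le_indef cI EI tT) /=.
have := energy_ge0 omega_gt0 (mu t).
have dl n N := energy_disc_le omega_gt0 P_lip pi_density N (mu t) (hs0 n) (hs1 n).
case E : (energy ref (mu t)) => [r| |] // _; last by rewrite leey.
rewrite lee_fin; apply: (cvgr_to_le (regE t tT)); apply: nearW => n.
apply: (cvgr_to_le (discE n t tT)); apply: nearW => N.
by rewrite -lee_fin -E; exact: dl.
Qed.

End ChainRule.

Theorem proposition3p12 (R : realType) (G : metric_graph R)
  (ref : prob G) (P : edge G -> R -> R)
  (d : edge G -> R) (kappa : edge G -> node G -> R) (T : R)
  (omega_gt0 : forall v, 0 < gam ref v)
  (P_lip : forall e, [lipschitz P e x | x in edge_itv e])
  (pi_density : forall e (A : set R), measurable A ->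
     rho ref e A =
     (\int[@lebesgue_measure R]_(x in A `&` edge_itv e) (expR (- P e x))%:E)%E)
  (d_gt0 : forall e, 0 < d e)
  (kappa_gt0 : forall e v, v \in ends e -> 0 < kappa e v)
  (T_gt0 : 0 < T)
  (mu : R -> prob G) (j : R -> flux G)
  (mu_j_CE : CE T mu j)
  (energy0 : (energy ref (mu 0%R) < +oo)%E)
  (L_fin : (ed_functional ref d kappa T mu j < +oo)%E) :
  [/\ forall t, 0 <= t <= T -> energy ref (mu t) \is a fin_num,
      absolutely_continuous_on 0 T (fun t => fine (energy ref (mu t))) &
      forall s t, 0 <= s -> s <= t -> t <= T ->
        (energy ref (mu t) - energy ref (mu s) =
         \int[@lebesgue_measure R]_(tau in `[s, t])
           energy_production ref (mu tau) (j tau))%E].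
Proof.
have iB : (dissipation ref d kappa T mu j < +oo)%E.
  have e0 := energy_ge0 omega_gt0 (mu 0); have eT := energy_ge0 omega_gt0 (mu T).
  rewrite ltNge leye_eq; apply/negP => /eqP dE; move: L_fin; rewrite /ed_functional dE.
  case: (energy ref (mu 0)) energy0 e0 => [r0| |]// _ _.
  by case: (energy ref (mu T)) eT => [r1| |]//.
have [a [c [ia aE E]]] := energy_identity omega_gt0 P_lip pi_density d_gt0 kappa_gt0 T_gt0 mu_j_CE iB.
pose I x := \int[@lebesgue_measure R]_(s in `[0, x]) a s.
have iI : indef 0 T I a by split => // x _; rewrite /I set_itv1 Rintegral_set1 add0r.
split.
- by move=> t tT; rewrite E.
- have ac0 := ac_lin 1 (ac_cst 0 T c) (indef_ac iI).
  by apply: (ac_congr _ ac0) => x xT; rewrite mul1r E.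
- move=> s t s0 st tT.
  have sT : 0 <= s <= T by rewrite s0 (le_trans st).
  have tT' : 0 <= t <= T by rewrite tT (le_trans s0).
  have mst : measurable (`[s, t]%classic : set (measurableTypeR R)) by exact: measurable_itv.
  have stT : `[s, t]%classic `<=` `[0, T]%classic by exact: itvcc_sub.
  rewrite !E// -EFinB (_ : c + _ - _ = I t - I s); last by rewrite /I; ring.
  rewrite (indef_incr iI s0 st tT) EFin_Rint//; last exact: integrable_cc_sub ia.
  apply: ae_eq_lower_integral; apply: ae_imply aE => x H /stT Dx.
  by rewrite H.
Qed.
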